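(* For $\alpha \in \mathbb{R}_+ = (0,\infty)$, let $\mathbb{T}_\alpha = \mathbb{C}/(\alpha^{-1/2}\mathbb{Z} \times i\,\alpha^{1/2}\mathbb{Z})$ be the rectangular torus of unit area (with the flat metric) and let $\Delta_\alpha$ be its Laplace--Beltrami operator. Then $$\det{}' \Delta_\alpha = \alpha\,|\eta(\alpha i)|^4 \leq |\eta(i)|^4 \approx 0.34830\dots,$$ with equality in the inequality if and only if $\alpha = 1$. Here $\det{}'$ denotes the zeta-regularized determinant and $\eta$ the Dedekind eta function.
   Context: Here $\alpha^{-1/2}\mathbb{Z} \times i\,\alpha^{1/2}\mathbb{Z}$ denotes the lattice $\{m\alpha^{-1/2} + i\,n\,\alpha^{1/2} : m,n\in\mathbb{Z}\} \subset \mathbb{C}$. Dedekind eta function: for $\tau$ in the upper half plane $\mathbb{H}$, $\eta(\tau) = e^{\pi i \tau/12}\prod_{k=1}^\infty (1-e^{2\pi i k\tau})$. Zeta-regularized determinant: for a lattice $\Lambda\subset\mathbb{C}$ of unit area, the eigenvalues of the Laplace--Beltrami operator $\Delta_\Lambda$ on $\mathbb{C}/\Lambda$ (with the sign convention that they are non-negative, and counted with multiplicity) are $(2\pi|w|)^2$, where $w$ ranges over the dual lattice of $\Lambda$; since $\Lambda$ has unit area, the dual lattice is $i\Lambda$, so the eigenvalues are equally $(2\pi|w|)^2$ with $w$ ranging over $\Lambda$. The associated zeta function is $$Z_\Lambda(s) = \sum_{w\in\Lambda\setminus\{0\}} (2\pi|w|)^{-2s}, \qquad \mathrm{Re}(s)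 > 1,$$ which continues analytically to $\mathbb{C}\setminus\{1\}$, and $$\det{}'\Delta_\Lambda = \exp\left(-\left.\tfrac{d}{ds}Z_\Lambda(s)\right|_{s=0}\right).$$ The operator $\Delta_\alpha$ is $\Delta_\Lambda$ for $\Lambda = \alpha^{-1/2}\mathbb{Z} \times i\,\alpha^{1/2}\mathbb{Z}$. *)

(* Defs.v *)
From Stdlib Require Export Reals ZArith List ClassicalEpsilon.
From Coquelicot Require Export Coquelicot.
Export ListNotations.

Open Scope R_scope.

Definition Cexp (z : C) : C := (exp (Re z) * cos (Im z), exp (Re z) * sin (Im z)).

(** [x ^ s] for a real base [x > 0] and a complex exponent [s]. *)
Definition Rcpow (x : R) (s : C) : C := Cexp (s * RtoC (ln x))%C.

(** Limits are taken componentwise; the value is meaningful only when the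
    sequences of real and imaginary parts both converge to finite limits. *)
Definition Clim_seq (u : nat -> C) : C :=
  (real (Lim_seq (fun n => Re (u n))), real (Lim_seq (fun n => Im (u n)))).

Fixpoint Cprod (u : nat -> C) (n : nat) : C :=
  match n with
  | O => RtoC 1
  | S m => (Cprod u m * u m)%C
  end.

(** The factor of index [k] is the one of index [k + 1] in the usual product
    over [k >= 1]. Only used for [0 < Im tau]. *)
Definition eta (tau : C) : C :=
  (Cexp (RtoC PI * Ci * tau / RtoC 12) *
   Clim_seq (Cprod (fun k : nat =>
     RtoC 1 - Cexp (RtoC 2 * RtoC PI * Ci * RtoC (INR (S k)) * tau))))%C.

Definition Csum_list (f : C -> C) (l : list C) : C :=
  fold_right (fun w acc => (f w + acc)%C) (RtoC 0) l.

(** Unconditional summation of [f] over the set [A]: convergence along the net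
    of finite subsets of [A], a finite subset being a duplicate-free list. *)
Definition has_sum (A : C -> Prop) (f : C -> C) (S : C) : Prop :=
  forall eps : R, 0 < eps ->
  exists l0 : list C, NoDup l0 /\ (forall w, In w l0 -> A w) /\
  forall l : list C, NoDup l -> (forall w, In w l -> A w) -> incl l0 l ->
    Cmod (Csum_list f l - S)%C < eps.

Definition analytic_at (f : C -> C) (s0 : C) : Prop :=
  exists (a : nat -> C) (r : R), 0 < r /\
  forall s : C, Cmod (s - s0)%C < r ->
    is_pseries (K := C_AbsRing) (V := C_NormedModule) a (s - s0)%C (f s).

(** A lattice is given as a subset of [C]. The lattices considered have unit
    area, so that the dual lattice of [L] is [i L] and the nonzero eigenvalues
    of the Laplacian of [C / L], with multiplicity, are the [(2 PI |w|)^2] for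
    [w] in [L] nonzero. *)
Definition zeta_term (s w : C) : C :=
  Rcpow (2 * PI * Cmod w) (- (RtoC 2 * s))%C.

Definition is_spectral_zeta (L : C -> Prop) (Z : C -> C) : Prop :=
  (forall s : C, 1 < Re s ->
     has_sum (fun w => L w /\ w <> RtoC 0) (zeta_term s) (Z s)) /\
  (forall s : C, s <> RtoC 1 -> analytic_at Z s).

(** The analytic continuation is unique on [C] minus [1] by the identity
    theorem; the value selected at [1] is arbitrary. *)
Definition spectral_zeta (L : C -> Prop) : C -> C :=
  epsilon (inhabits (fun _ : C => RtoC 0)) (is_spectral_zeta L).

Definition det_laplacian (L : C -> Prop) : C :=
  Cexp (- C_derive (spectral_zeta L) (RtoC 0))%C.

Definition rect_lattice (alpha : R) (w : C) : Prop :=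
  exists m n : Z, w = (IZR m * / sqrt alpha, IZR n * sqrt alpha).

(* Main.v *)
Require Import Defs.
From Stdlib Require Import Reals.
From Coquelicot Require Import Coquelicot.
From Stdlib Require Import Lra Lia Classical ZArith List FunctionalExtensionality Permutation.

(** Write w for the lattice points and G(u) for the sum of (u + |w|^2)^(-2) over
    w <> 0.  From the Beta integral,
      A^(-s) = sin(pi s) / (pi (1 - s)) * int_0^oo u^(1-s) (u + A)^(-2) du,
    the zeta function is a Mellin transform of G.  Up to a super-polynomially small
    error, G(u) is pi / u - 1 / u^2 at infinity (row sums are hyperbolic cotangents),
    so splitting the integral at u = 1 continues the zeta function to s <> 1, and the
    identity theorem makes the continuation unique near 0.

    There sin(pi s) vanishes, so the derivative at 0 only involves the
    regularised integral of u G(u).  Integrating row by row gives the terms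
    2 ln sinh(pi sqrt(U + a^2 n^2)); at the upper end the trapezoidal rule yields the
    exponent -pi a / 3 and at the lower end there remain the logarithms of the eta
    product.

    For the maximum, G is invariant under a -> 1/a, hence so is the determinant, and
    the product of its formulas at a and 1/a is compared factor by factor with the
    square of the formula at 1. *)

(** * Power series expansions and the identity theorem *)

(** The classical route through theta functions rests on the Gamma function and Poisson summation.
    The squared resolvent stands in for both: the square makes the sum over a two-dimensional
    lattice converge, its row sums are elementary, and the one special value is a Beta integral,
    which like the cotangent comes from a Fourier series at a single point. The two terms of G at
    infinity have a meaning: pi / u is the integral of (u + |w|^2)^(-2) over the plane, and -1 / u^2
    is the missing origin. An error below every power of 1 / u, and not just one, is what carries
    the continuation arbitrarily far to the left; hence the exponent [k] in the estimates. With u =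
    e^x and u = e^(-x), the two halves of the Mellin integral become Laplace integrals over x >= 0.
    These and the lattice sums are instances of one abstract functional, so that analyticity in s is
    proved once, from explicit Taylor remainders and without contour integrals. The invariance of G
    takes the place of the modular transformation of eta. *)

Fixpoint cpoly (a : nat -> C) (z : C) (n : nat) : C :=
  match n with
  | O => RtoC 0
  | S m => (cpoly a z m + a m * z ^ m)%C
  end.

(** A Taylor expansion with geometric remainder; unlike the bare convergence of
    the series, this form is stable under products by a finite computation. *)
Definition taylor (f : C -> C) (s0 : C) (a : nat -> C) (r M : R) : Prop :=
  forall z : C, Cmod z < r ->
  forall n, Cmod (f (s0 + z) - cpoly a z n)%C <= M * (Cmod z / r) ^ n.

Definition expandable (f : C -> C) (s0 : C) : Prop :=
  exists a r M, 0 < r /\ 0 <= M /\ taylor f s0 a r M.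

(** [sum_n] includes its last index while [cpoly] excludes it, hence the shift by one. *)
Lemma cpoly_sum_n (a : nat -> C) (z : C) (n : nat) :
  sum_n (G := C_AbelianMonoid)
    (fun k => scal (K := C_AbsRing) (V := C_NormedModule) (pow_n z k) (a k)) n
  = cpoly a z (S n).
Proof.
  assert (hp : forall k, @pow_n C_Ring z k = (z ^ k)%C).
  { induction k as [|k IH]; [reflexivity|]. simpl. now rewrite <- IH. }
  induction n as [|n IH].
  - rewrite sum_O.
    change ((RtoC 1 * a 0%nat)%C = (0 + a 0%nat * 1)%C). ring.
  - rewrite sum_Sn, IH.
    change ((cpoly a z (S n) + @pow_n C_Ring z (S n) * a (S n))%C = cpoly a z (S (S n))).
    rewrite hp. simpl. ring.
Qed.

Lemma is_pseries_cpoly (a : nat -> C) (z l : C) :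
  is_pseries (K := C_AbsRing) (V := C_NormedModule) a z l <->
  is_lim_seq (fun n => Cmod (cpoly a z n - l)%C) 0.
Proof.
  unfold is_pseries, is_series.
  split; intros H.
  - apply is_lim_seq_incr_1. intros P [eps HP].
    assert (hloc : @locally C_UniformSpace l (fun y => Cmod (y - l)%C < eps)).
    { apply (@locally_le_locally_norm C_AbsRing C_NormedModule).
      exists eps. intros y Hy. exact Hy. }
    specialize (H _ hloc). revert H. unfold filtermap.
    apply filter_imp. intros n Hn. apply HP.
    change (Rabs (Cmod (cpoly a z (S n) - l)%C - 0) < eps).
    rewrite Rminus_0_r, Rabs_pos_eq by apply Cmod_ge_0.
    rewrite <- cpoly_sum_n. exact Hn.
  - apply is_lim_seq_incr_1 in H.
    intros P HP.
    apply (@locally_norm_le_locally C_AbsRing C_NormedModule) in HP.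
    destruct HP as [eps HP].
    assert (hloc : locally 0 (fun y => Rabs y < eps)).
    { exists eps. intros y Hy. change (Rabs (y - 0) < eps) in Hy.
      now rewrite Rminus_0_r in Hy. }
    specialize (H _ hloc). revert H. unfold filtermap.
    apply filter_imp. intros n Hn. apply HP.
    rewrite Rabs_pos_eq in Hn by apply Cmod_ge_0.
    rewrite <- cpoly_sum_n in Hn. exact Hn.
Qed.

Lemma is_lim_seq_geom_scal (M q : R) : 0 <= q < 1 -> is_lim_seq (fun n => M * q ^ n) 0.
Proof.
  intros hq.
  replace (Finite 0) with (Rbar_mult M 0) by (simpl; f_equal; ring).
  apply is_lim_seq_scal_l. apply is_lim_seq_geom. rewrite Rabs_pos_eq; lra.
Qed.

Lemma pow_div_l (x y : R) n : y <> 0 -> (x / y) ^ n = x ^ n / y ^ n.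
Proof. intros hy. unfold Rdiv. now rewrite Rpow_mult_distr, pow_inv. Qed.

Lemma div_lt_1 (x r : R) : 0 < r -> x < r -> x / r < 1.
Proof. intros hr hx. apply Rmult_lt_reg_r with r; [lra|]. field_simplify; lra. Qed.

Lemma expandable_analytic (f : C -> C) (s0 : C) : expandable f s0 -> analytic_at f s0.
Proof.
  intros (a & r & M & hr & hM & ht). exists a, r. split; [assumption|].
  intros s hs. apply is_pseries_cpoly.
  specialize (ht _ hs).
  replace (s0 + (s - s0))%C with s in ht by ring.
  apply is_lim_seq_le_le with (u := fun _ => 0)
    (w := fun n => M * (Cmod (s - s0)%C / r) ^ n).
  - intros n. split; [apply Cmod_ge_0|].
    replace (cpoly a (s - s0) n - f s)%C with (- (f s - cpoly a (s - s0) n))%C by ring.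
    rewrite Cmod_opp. apply ht.
  - apply is_lim_seq_const.
  - apply is_lim_seq_geom_scal. split.
    + apply Rdiv_le_0_compat; [apply Cmod_ge_0|lra].
    + now apply div_lt_1.
Qed.

(** The bound telescopes: for [q <= 1/2] one has [B q^k <= 2 B q^k - 2 B q^(k+1)]. *)
Lemma cpoly_diff_bound (a : nat -> C) (z : C) (B q : R) (n m : nat) :
  0 <= q -> q <= / 2 -> (forall k, Cmod (a k * z ^ k)%C <= B * q ^ k) ->
  Cmod (cpoly a z (n + m) - cpoly a z n)%C <= 2 * B * q ^ n - 2 * B * q ^ (n + m).
Proof.
  intros hq0 hq hB.
  assert (hB0 : 0 <= B).
  { specialize (hB 0%nat). simpl in hB. pose proof (Cmod_ge_0 (a 0%nat * 1)%C). lra. }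
  induction m as [|m IH].
  - rewrite Nat.add_0_r. replace (cpoly a z n - cpoly a z n)%C with (RtoC 0) by ring.
    rewrite Cmod_0. nra.
  - rewrite Nat.add_succ_r. simpl.
    replace (cpoly a z (n + m) + a (n + m)%nat * z ^ (n + m) - cpoly a z n)%C with
      ((cpoly a z (n + m) - cpoly a z n) + a (n + m)%nat * z ^ (n + m))%C by ring.
    eapply Rle_trans; [apply Cmod_triangle|].
    specialize (hB (n + m)%nat). pose proof (pow_le q (n + m) hq0).
    assert (q * q ^ (n + m) <= / 2 * q ^ (n + m)) by (apply Rmult_le_compat_r; lra).
    nra.
Qed.

(** Each term is the difference of two consecutive errors, and the errors are bounded because they
    tend to 0. *)
Lemma pseries_terms_bounded (a : nat -> C) (z l : C) :
  is_lim_seq (fun n => Cmod (cpoly a z n - l)%C) 0 ->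
  exists B, forall k, Cmod (a k * z ^ k)%C <= B.
Proof.
  intros H.
  destruct (ex_finite_lim_seq_correct (fun n => Cmod (cpoly a z n - l)%C)) as [hc _].
  assert (hb : exists B, forall n, Cmod (cpoly a z n - l)%C <= B).
  { apply is_lim_seq_spec in H.
    destruct (H (mkposreal 1 Rlt_0_1)) as [N HN]. simpl in HN.
    assert (hfin : forall m, exists B, forall n, (n < m)%nat -> Cmod (cpoly a z n - l)%C <= B).
    { induction m as [|m [B IH]].
      - exists 0. intros n hn. lia.
      - exists (Rmax B (Cmod (cpoly a z m - l)%C)). intros n hn.
        destruct (Nat.eq_dec n m) as [->|hne].
        + apply Rmax_r.
        + eapply Rle_trans; [apply IH; lia|apply Rmax_l]. }
    destruct (hfin N) as [B hB]. exists (Rmax B 1). intros n.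
    destruct (le_lt_dec N n) as [h|h].
    - specialize (HN n h). rewrite Rminus_0_r in HN.
      apply Rabs_lt_between in HN. eapply Rle_trans; [|apply Rmax_r]. lra.
    - eapply Rle_trans; [now apply hB|apply Rmax_l]. }
  destruct hb as [B hB]. exists (B + B). intros k.
  replace (a k * z ^ k)%C with ((cpoly a z (S k) - l) - (cpoly a z k - l))%C by (simpl; ring).
  eapply Rle_trans; [apply Cmod_triangle|]. rewrite Cmod_opp.
  apply Rplus_le_compat; apply hB.
Qed.

(** Abel's argument: convergence at the single point [r/2] bounds the terms there, and on the disc
    of radius [r/4] the ratio to that point is at most 1/2, which makes the remainder geometric. *)
Lemma analytic_expandable (f : C -> C) (s0 : C) : analytic_at f s0 -> expandable f s0.
Proof.
  intros (a & r & hr & H).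
  assert (hpt : Cmod (RtoC (r / 2)) = r / 2) by (rewrite Cmod_R, Rabs_pos_eq; lra).
  assert (hb : exists B, forall k, Cmod (a k * RtoC (r / 2) ^ k)%C <= B).
  { apply pseries_terms_bounded with (f (s0 + RtoC (r / 2))%C).
    assert (hh : Cmod (s0 + RtoC (r / 2) - s0)%C < r).
    { replace (s0 + RtoC (r / 2) - s0)%C with (RtoC (r / 2)) by ring. rewrite hpt. lra. }
    specialize (H _ hh). apply is_pseries_cpoly in H.
    replace (s0 + RtoC (r / 2) - s0)%C with (RtoC (r / 2)) in H by ring. exact H. }
  destruct hb as [B hB].
  assert (hB0 : 0 <= B) by (eapply Rle_trans; [apply Cmod_ge_0|apply (hB 0%nat)]).
  exists a, (r / 4), (2 * B). split; [lra|]. split; [lra|].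
  intros z hz n.
  assert (hz0 := Cmod_ge_0 z).
  set (q := Cmod z / (r / 2)).
  assert (hq0 : 0 <= q) by (apply Rdiv_le_0_compat; lra).
  assert (hq : q <= / 2).
  { unfold q. apply Rmult_le_reg_r with (r / 2); [lra|]. field_simplify; lra. }
  assert (hterm : forall k, Cmod (a k * z ^ k)%C <= B * q ^ k).
  { intros k. specialize (hB k). rewrite Cmod_mult, Cmod_pow in hB |- *.
    rewrite hpt in hB. unfold q.
    rewrite pow_div_l by lra.
    apply Rmult_le_reg_r with ((r / 2) ^ k); [apply pow_lt; lra|].
    replace (B * (Cmod z ^ k / (r / 2) ^ k) * (r / 2) ^ k) with (B * Cmod z ^ k)
      by (field; apply pow_nonzero; lra).
    pose proof (pow_le (Cmod z) k hz0). nra. }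
  assert (hlim : is_lim_seq (fun m => Cmod (cpoly a z m - f (s0 + z))%C) 0).
  { assert (hh : Cmod (s0 + z - s0)%C < r) by (replace (s0 + z - s0)%C with z by ring; lra).
    specialize (H _ hh). apply is_pseries_cpoly in H.
    now replace (s0 + z - s0)%C with z in H by ring. }
  assert (hmain : Cmod (f (s0 + z) - cpoly a z n)%C <= 2 * B * q ^ n).
  { apply (is_lim_seq_incr_n _ n) in hlim.
    assert (hl2 : is_lim_seq (fun m => Cmod (cpoly a z (m + n) - f (s0 + z))%C + 2 * B * q ^ n)
      (0 + 2 * B * q ^ n)).
    { apply is_lim_seq_plus'; [exact hlim|apply is_lim_seq_const]. }
    rewrite Rplus_0_l in hl2.
    refine (is_lim_seq_le (fun _ => Cmod (f (s0 + z) - cpoly a z n)%C) _ _ _ _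
      (is_lim_seq_const _) hl2).
    intros m.
    replace (f (s0 + z) - cpoly a z n)%C with
      (- (cpoly a z (m + n) - f (s0 + z)) + (cpoly a z (n + m) - cpoly a z n))%C
      by (rewrite (Nat.add_comm n m); ring).
    eapply Rle_trans; [apply Cmod_triangle|]. rewrite Cmod_opp.
    apply Rplus_le_compat_l.
    eapply Rle_trans; [apply cpoly_diff_bound with (B := B) (q := q); assumption|].
    pose proof (pow_le q (n + m) hq0). nra. }
  eapply Rle_trans; [exact hmain|].
  apply Rmult_le_compat_l; [lra|]. apply pow_incr. split; [assumption|].
  unfold q, Rdiv. apply Rmult_le_compat_l; [assumption|].
  apply Rinv_le_contravar; lra.
Qed.

Lemma taylor_shrink (f : C -> C) s0 a r r' M :
  0 < r' <= r -> 0 <= M -> taylor f s0 a r M -> taylor f s0 a r' M.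
Proof.
  intros hr hM ht z hz n.
  eapply Rle_trans; [apply ht; lra|].
  apply Rmult_le_compat_l; [assumption|]. apply pow_incr.
  pose proof (Cmod_ge_0 z). split.
  - apply Rdiv_le_0_compat; lra.
  - apply Rmult_le_compat_l; [assumption|]. apply Rinv_le_contravar; lra.
Qed.

(** A Cauchy estimate without contour integrals: at the point [r/2] the term of order [k] is the
    difference of two consecutive remainders. *)
Lemma taylor_coeff (f : C -> C) s0 a r M k :
  0 < r -> taylor f s0 a r M -> Cmod (a k) * r ^ k <= 2 * M.
Proof.
  intros hr ht.
  assert (hpt : Cmod (RtoC (r / 2)) = r / 2) by (rewrite Cmod_R, Rabs_pos_eq; lra).
  assert (hlt : Cmod (RtoC (r / 2)) < r) by lra.
  pose proof (ht _ hlt k) as h1. pose proof (ht _ hlt (S k)) as h2.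
  pose proof (ht _ hlt 0%nat) as h0.
  rewrite hpt in h0, h1, h2. replace (r / 2 / r) with (/ 2) in h0, h1, h2 by (field; lra).
  assert (hM : 0 <= M).
  { simpl in h0. eapply Rle_trans in h0; [|apply Cmod_ge_0]. lra. }
  assert (h3 : Cmod (a k) * (r / 2) ^ k <= 2 * M * (/ 2) ^ k).
  { replace (Cmod (a k) * (r / 2) ^ k) with (Cmod (a k * RtoC (r / 2) ^ k)%C)
      by (rewrite Cmod_mult, Cmod_pow, hpt; ring).
    replace (a k * RtoC (r / 2) ^ k)%C with
      ((f (s0 + RtoC (r / 2)) - cpoly a (RtoC (r / 2)) k) -
       (f (s0 + RtoC (r / 2)) - cpoly a (RtoC (r / 2)) (S k)))%C by (simpl; ring).
    eapply Rle_trans; [apply Cmod_triangle|]. rewrite Cmod_opp.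
    pose proof (pow_lt (/ 2) k ltac:(lra)).
    simpl in h2 |- *. nra. }
  replace (r / 2) with (r * / 2) in h3 by field.
  rewrite Rpow_mult_distr in h3.
  pose proof (pow_lt (/ 2) k ltac:(lra)). nra.
Qed.

Lemma cpoly_plus a b z n : cpoly (fun k => a k + b k)%C z n = (cpoly a z n + cpoly b z n)%C.
Proof. induction n as [|n IH]; simpl; [ring|]. rewrite IH. ring. Qed.

Lemma expandable_plus (f g : C -> C) s0 :
  expandable f s0 -> expandable g s0 -> expandable (fun s => f s + g s)%C s0.
Proof.
  intros (a & r & M & hr & hM & ht) (b & r' & M' & hr' & hM' & ht').
  exists (fun k => a k + b k)%C, (Rmin r r'), (M + M').
  assert (hm : 0 < Rmin r r') by (apply Rmin_glb_lt; lra).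
  split; [exact hm|]. split; [lra|].
  intros z hz n.
  rewrite cpoly_plus.
  replace (f (s0 + z) + g (s0 + z) - (cpoly a z n + cpoly b z n))%C with
    ((f (s0 + z) - cpoly a z n) + (g (s0 + z) - cpoly b z n))%C by ring.
  eapply Rle_trans; [apply Cmod_triangle|].
  rewrite Rmult_plus_distr_r. apply Rplus_le_compat.
  - apply (taylor_shrink f s0 a r); auto. split; [lra|apply Rmin_l].
  - apply (taylor_shrink g s0 b r'); auto. split; [lra|apply Rmin_r].
Qed.

(** The degree [n] and the number [m] of summands are separate so that inductions can run on [m]
    with [n] fixed; the coefficient of degree [n] in the product is the value at [m = S n]. *)
Fixpoint cauchy_coeff (a b : nat -> C) (n : nat) (m : nat) : C :=
  match m with
  | O => RtoC 0
  | S k => (cauchy_coeff a b n k + a k * b (n - k)%nat)%C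
  end.

(** A triangular convolution used in two ways: with [F] the partial sums of the second factor it is
    the partial sum of the product series, and with [F] the remainders of the second factor it is
    the truncation error. *)
Fixpoint mixed_rest (F : nat -> C) (a : nat -> C) (z : C) (n m : nat) : C :=
  match m with
  | O => RtoC 0
  | S k => (mixed_rest F a z n k + a k * z ^ k * F (n - k)%nat)%C
  end.

Lemma mixed_rest_succ (b a : nat -> C) (z : C) (n m : nat) : (m <= S n)%nat ->
  mixed_rest (cpoly b z) a z (S n) m =
  (mixed_rest (cpoly b z) a z n m + cauchy_coeff a b n m * z ^ n)%C.
Proof.
  induction m as [|m IH]; intros hm; cbn [mixed_rest cauchy_coeff]; [ring|].
  rewrite IH by lia. rewrite Nat.sub_succ_l by lia. cbn [cpoly].
  replace (z ^ n)%C with (z ^ m * z ^ (n - m))%C by (rewrite <- Cpow_add_r; f_equal; lia).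
  ring.
Qed.

Lemma cpoly_cauchy (a b : nat -> C) (z : C) (n : nat) :
  cpoly (fun k => cauchy_coeff a b k (S k)) z n = mixed_rest (cpoly b z) a z n n.
Proof.
  induction n as [|n IH]; [reflexivity|].
  change (cpoly (fun k => cauchy_coeff a b k (S k)) z (S n)) with
    (cpoly (fun k => cauchy_coeff a b k (S k)) z n + cauchy_coeff a b n (S n) * z ^ n)%C.
  rewrite IH, mixed_rest_succ by lia.
  simpl. rewrite Nat.sub_diag. simpl. ring.
Qed.

Lemma mixed_rest_const (G : C) (F a : nat -> C) z n m :
  (G * cpoly a z m - mixed_rest F a z n m)%C = mixed_rest (fun k => G - F k)%C a z n m.
Proof.
  induction m as [|m IH]; simpl; [ring|]. rewrite <- IH. ring.
Qed.

Lemma mixed_rest_bound (F a : nat -> C) z (A B q : R) n m : (m <= n)%nat -> 0 <= q ->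
  (forall k, Cmod (a k * z ^ k)%C <= A * q ^ k) ->
  (forall k, Cmod (F k) <= B * q ^ k) ->
  Cmod (mixed_rest F a z n m) <= INR m * (A * B * q ^ n).
Proof.
  intros hm hq hA hB.
  induction m as [|m IH].
  - simpl mixed_rest. rewrite Cmod_0. simpl. lra.
  - rewrite S_INR. simpl mixed_rest.
    eapply Rle_trans; [apply Cmod_triangle|].
    rewrite Rmult_plus_distr_r. apply Rplus_le_compat; [apply IH; lia|].
    rewrite Cmod_mult, Rmult_1_l.
    replace (q ^ n) with (q ^ m * q ^ (n - m)) by (rewrite <- pow_add; f_equal; lia).
    replace (A * B * (q ^ m * q ^ (n - m))) with ((A * q ^ m) * (B * q ^ (n - m))) by ring.
    apply Rmult_le_compat; auto using Cmod_ge_0.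
Qed.

Lemma INR_le_pow2 n : INR n <= 2 ^ n.
Proof.
  induction n as [|n IH]; [simpl; lra|]. rewrite S_INR. simpl.
  assert (1 <= 2 ^ n) by (apply pow_R1_Rle; lra). lra.
Qed.

(** With P and Q_j the partial sums of the two factors, the error is [(f - P) g] plus the sum of
    [a_k z^k (g - Q_(n-k))] over [k < n]. Each cross term is O(q^n) and there are [n] of them;
    halving the radius replaces [q] by [2 q], and [2^n] absorbs the factor [n]. *)
Lemma expandable_mult (f g : C -> C) s0 :
  expandable f s0 -> expandable g s0 -> expandable (fun s => f s * g s)%C s0.
Proof.
  intros (a & r1 & M & hr1 & hM & ht1) (b & r2 & M' & hr2 & hM' & ht2).
  set (r := Rmin r1 r2).
  assert (hr : 0 < r) by (apply Rmin_glb_lt; lra).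
  assert (ht : taylor f s0 a r M).
  { apply (taylor_shrink f s0 a r1); auto. split; [lra|apply Rmin_l]. }
  assert (ht' : taylor g s0 b r M').
  { apply (taylor_shrink g s0 b r2); auto. split; [lra|apply Rmin_r]. }
  exists (fun k => cauchy_coeff a b k (S k)), (r / 2), (3 * M * M').
  split; [lra|]. split; [nra|].
  intros z hz n. pose proof (Cmod_ge_0 z) as hz0.
  assert (hzr : Cmod z < r) by lra.
  set (q := Cmod z / r).
  assert (hq : 0 <= q) by (apply Rdiv_le_0_compat; lra).
  assert (hqn := pow_le q n hq).
  rewrite cpoly_cauchy.
  replace (f (s0 + z) * g (s0 + z) - mixed_rest (cpoly b z) a z n n)%C with
    ((f (s0 + z) - cpoly a z n) * g (s0 + z) +
     (g (s0 + z) * cpoly a z n - mixed_rest (cpoly b z) a z n n))%C by ring.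
  rewrite mixed_rest_const.
  eapply Rle_trans; [apply Cmod_triangle|]. rewrite Cmod_mult.
  assert (h2 : Cmod (g (s0 + z)%C) <= M').
  { pose proof (ht' z hzr 0%nat) as h. simpl in h.
    replace (g (s0 + z) - 0)%C with (g (s0 + z)%C) in h by ring. lra. }
  assert (h3 : Cmod (mixed_rest (fun k => g (s0 + z) - cpoly b z k)%C a z n n)
    <= INR n * (2 * M * M' * q ^ n)).
  { apply mixed_rest_bound; [lia|assumption| |intros k; now apply ht'].
    intros k. rewrite Cmod_mult, Cmod_pow.
    pose proof (taylor_coeff f s0 a r M k hr ht) as hk.
    unfold q. rewrite pow_div_l by lra.
    apply Rmult_le_reg_r with (r ^ k); [apply pow_lt; lra|].
    replace (2 * M * (Cmod z ^ k / r ^ k) * r ^ k) with (2 * M * Cmod z ^ k)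
      by (field; apply pow_nonzero; lra).
    pose proof (pow_le (Cmod z) k hz0). nra. }
  replace (Cmod z / (r / 2)) with (2 * q) by (unfold q; field; lra).
  rewrite Rpow_mult_distr.
  pose proof (INR_le_pow2 n) as hn.
  assert (h4 : Cmod (f (s0 + z) - cpoly a z n)%C * Cmod (g (s0 + z)%C) <= M * q ^ n * M').
  { apply Rmult_le_compat; auto using Cmod_ge_0. }
  assert (h5 : 1 <= 2 ^ n) by (apply pow_R1_Rle; lra).
  assert (h6 : 0 <= M * M' * q ^ n) by (apply Rmult_le_pos; nra).
  assert (INR n * (2 * M * M' * q ^ n) <= 2 ^ n * (2 * M * M' * q ^ n)).
  { apply Rmult_le_compat_r; lra. }
  nra.
Qed.

Lemma expandable_const (c s0 : C) : expandable (fun _ => c) s0.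
Proof.
  exists (fun k => match k with O => c | _ => RtoC 0 end), 1, (Cmod c).
  split; [lra|]. split; [apply Cmod_ge_0|].
  intros z hz n. pose proof (Cmod_ge_0 z).
  assert (hc : forall m, cpoly (fun k => match k with O => c | _ => RtoC 0 end) z (S m) = c).
  { induction m as [|m IH]; [simpl; ring|]. 
    change (cpoly (fun k : nat => match k with
             | O => c | S _ => RtoC 0 end) z (S m) + RtoC 0 * z ^ (S m) = c)%C.
    rewrite IH. ring. }
  destruct n as [|n].
  - simpl. replace (c - 0)%C with c by ring. lra.
  - rewrite hc. replace (c - c)%C with (RtoC 0) by ring. rewrite Cmod_0.
    apply Rmult_le_pos; [apply Cmod_ge_0|]. apply pow_le. apply Rdiv_le_0_compat; lra.
Qed.

Lemma expandable_ext (f g : C -> C) s0 (d : R) : 0 < d ->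
  (forall s, Cmod (s - s0)%C < d -> f s = g s) -> expandable f s0 -> expandable g s0.
Proof.
  intros hd hfg (a & r & M & hr & hM & ht).
  assert (hm : 0 < Rmin r d) by (apply Rmin_glb_lt; lra).
  exists a, (Rmin r d), M. split; [exact hm|]. split; [exact hM|].
  intros z hz n.
  rewrite <- hfg.
  - apply (taylor_shrink f s0 a r); auto. split; [lra|apply Rmin_l].
  - replace (s0 + z - s0)%C with z by ring. eapply Rlt_le_trans; [exact hz|apply Rmin_r].
Qed.

Lemma expandable_id (s0 : C) : expandable (fun s => s) s0.
Proof.
  exists (fun k => match k with O => s0 | S O => RtoC 1 | _ => RtoC 0 end), 1, (Cmod s0 + 1).
  pose proof (Cmod_ge_0 s0).
  split; [lra|]. split; [lra|].
  intros z hz n. pose proof (Cmod_ge_0 z).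
  assert (hc : forall m, cpoly (fun k => match k with O => s0 | S O => RtoC 1 | _ => RtoC 0 end) z (S (S m))
    = (s0 + z)%C).
  { induction m as [|m IH]; [simpl; ring|].
    change (cpoly (fun k => match k with O => s0 | S O => RtoC 1 | _ => RtoC 0 end) z (S (S m))
      + RtoC 0 * z ^ (S (S m)) = s0 + z)%C.
    rewrite IH. ring. }
  assert (hle : Cmod (s0 + z)%C <= Cmod s0 + Cmod z) by apply Cmod_triangle.
  destruct n as [|[|n]].
  - simpl. replace (s0 + z - 0)%C with (s0 + z)%C by ring. lra.
  - simpl. replace (s0 + z - (0 + s0 * 1))%C with z by ring. field_simplify. nra.
  - rewrite hc. replace (s0 + z - (s0 + z))%C with (RtoC 0) by ring. rewrite Cmod_0.
    apply Rmult_le_pos; [lra|]. apply pow_le. apply Rdiv_le_0_compat; lra.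
Qed.

(** The geometric series with its exact remainder [(- z / d)^n / (d + z)]; on the disc of radius
    [|d| / 2] the denominator stays away from 0. *)
Lemma expandable_inv_linear (c s0 : C) : s0 <> c -> expandable (fun s => / (s - c))%C s0.
Proof.
  intros hc. set (d := (s0 - c)%C).
  assert (hd : d <> RtoC 0).
  { unfold d. intros h. apply hc. replace s0 with (s0 - c + c)%C by ring. rewrite h. ring. }
  assert (hd0 : 0 < Cmod d) by now apply Cmod_gt_0.
  exists (fun k => (- / d) ^ k * / d)%C, (Cmod d / 2), (2 / Cmod d).
  split; [lra|]. split; [apply Rdiv_le_0_compat; lra|].
  intros z hz n. pose proof (Cmod_ge_0 z).
  assert (hdz : Cmod d / 2 <= Cmod (d + z)%C).
  { assert (h : Cmod d <= Cmod (d + z)%C + Cmod (- z)%C).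
    { replace d with ((d + z) + - z)%C at 1 by ring. apply Cmod_triangle. }
    rewrite Cmod_opp in h. lra. }
  assert (hdz0 : (d + z)%C <> RtoC 0) by (apply Cmod_gt_0; lra).
  assert (he : (s0 + z - c)%C = (d + z)%C) by (unfold d; ring).
  rewrite he.
  assert (hr : (/ (d + z) - cpoly (fun k => (- / d) ^ k * / d) z n)%C
    = ((- / d * z) ^ n * / (d + z))%C).
  { induction n as [|n IH].
    - simpl. ring.
    - simpl. replace (/ (d + z) - (cpoly (fun k => (- / d) ^ k * / d) z n + (- / d) ^ n * / d * z ^ n))%C
        with ((/ (d + z) - cpoly (fun k => (- / d) ^ k * / d) z n) - (- / d) ^ n * / d * z ^ n)%C by ring.
      rewrite IH, Cpow_mult_l. field. now split. }
  rewrite hr, Cmod_mult, Cmod_pow, Cmod_mult, Cmod_opp, !Cmod_inv by assumption.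
  rewrite Rmult_comm. apply Rmult_le_compat.
  - left. apply Rinv_0_lt_compat. lra.
  - apply pow_le. apply Rmult_le_pos; [|assumption]. left. now apply Rinv_0_lt_compat.
  - replace (2 / Cmod d) with (/ (Cmod d / 2)) by (field; lra).
    apply Rinv_le_contravar; lra.
  - apply pow_incr. split.
    + apply Rmult_le_pos; [|assumption]. left. now apply Rinv_0_lt_compat.
    + replace (Cmod z / (Cmod d / 2)) with (2 * (/ Cmod d * Cmod z)) by (field; lra).
      assert (0 <= / Cmod d * Cmod z).
      { apply Rmult_le_pos; [|assumption]. left. now apply Rinv_0_lt_compat. }
      lra.
Qed.

(** * Complex derivatives, removable singularities and isolated zeros *)

Lemma cpoly_shift (a : nat -> C) z n :
  cpoly a z (S n) = (a 0%nat + z * cpoly (fun k => a (S k)) z n)%C.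
Proof.
  induction n as [|n IH]; [simpl; ring|].
  change (cpoly a z (S (S n))) with (cpoly a z (S n) + a (S n) * z ^ (S n))%C.
  rewrite IH. simpl. ring.
Qed.

Lemma is_derive_of_quadratic (f : C -> C) (s0 l : C) (r M : R) : 0 < r -> 0 <= M ->
  (forall z, Cmod z < r -> Cmod (f (s0 + z) - f s0 - l * z)%C <= M * Cmod z ^ 2) ->
  is_derive (K := C_AbsRing) (V := C_NormedModule) f s0 l.
Proof.
  intros hr hM H. split.
  - apply (is_linear_scal_l (K := C_AbsRing) (V := C_NormedModule)).
  - intros x hx.
    apply (@is_filter_lim_locally_unique C_AbsRing (AbsRing_NormedModule C_AbsRing)) in hx. subst x.
    intros eps.
    set (d := Rmin r (eps / (M + 1))).
    assert (hd : 0 < d).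
    { apply Rmin_glb_lt; [assumption|]. apply Rdiv_lt_0_compat; [apply cond_pos|lra]. }
    apply (@locally_le_locally_norm C_AbsRing (AbsRing_NormedModule C_AbsRing)).
    exists (mkposreal d hd).
    cut (forall s : C, Cmod (s - s0)%C < d ->
      Cmod ((f s - f s0) - (s - s0) * l)%C <= eps * Cmod (s - s0)%C).
    { intros key s hs. exact (key s hs). }
    intros s hs.
    assert (h1 : Cmod (s - s0)%C < r) by (eapply Rlt_le_trans; [exact hs|apply Rmin_l]).
    assert (h2 : Cmod (s - s0)%C < eps / (M + 1)) by (eapply Rlt_le_trans; [exact hs|apply Rmin_r]).
    specialize (H _ h1). replace (s0 + (s - s0))%C with s in H by ring.
    replace ((f s - f s0) - (s - s0) * l)%C with (f s - f s0 - l * (s - s0))%C by ring.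
    eapply Rle_trans; [exact H|].
    pose proof (Cmod_ge_0 (s - s0)%C).
    assert (M * Cmod (s - s0)%C <= eps).
    { apply Rle_trans with ((M + 1) * Cmod (s - s0)%C); [nra|].
      apply Rmult_le_reg_r with (/ (M + 1)); [apply Rinv_0_lt_compat; lra|].
      replace ((M + 1) * Cmod (s - s0)%C * / (M + 1)) with (Cmod (s - s0)%C) by (field; lra).
      left. exact h2. }
    simpl. nra.
Qed.

Lemma taylor_derive (f : C -> C) s0 a r M : 0 < r -> 0 <= M -> taylor f s0 a r M ->
  is_derive (K := C_AbsRing) (V := C_NormedModule) f s0 (a 1%nat).
Proof.
  intros hr hM ht.
  apply is_derive_of_quadratic with r (M / r ^ 2); [assumption| |].
  - apply Rdiv_le_0_compat; [assumption|]. apply pow_lt. lra.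
  - intros z hz.
    assert (h0 : Cmod (RtoC 0) < r) by (rewrite Cmod_0; lra).
    pose proof (ht _ h0 1%nat) as h. rewrite Cmod_0 in h.
    replace (s0 + 0)%C with s0 in h by ring. simpl in h.
    replace (f s0 - (0 + a 0%nat * 1))%C with (f s0 - a 0%nat)%C in h by ring.
    assert (ha0 : (f s0 - a 0%nat)%C = RtoC 0).
    { apply Cmod_eq_0. pose proof (Cmod_ge_0 (f s0 - a 0%nat)%C). unfold Rdiv in h. lra. }
    specialize (ht _ hz 2%nat). simpl in ht.
    replace (f (s0 + z) - f s0 - a 1%nat * z)%C with
      (f (s0 + z) - (0 + a 0%nat * 1 + a 1%nat * (z * 1)) - (f s0 - a 0%nat))%C by ring.
    rewrite ha0.
    replace (f (s0 + z) - (0 + a 0%nat * 1 + a 1%nat * (z * 1)) - 0)%C with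
      (f (s0 + z) - (0 + a 0%nat * 1 + a 1%nat * (z * 1)))%C by ring.
    replace (M / r ^ 2 * Cmod z ^ 2) with (M * (Cmod z / r * (Cmod z / r * 1))); [exact ht|].
    field. lra.
Qed.

Lemma expandable_ex_derive (f : C -> C) s0 : expandable f s0 ->
  ex_derive (K := C_AbsRing) (V := C_NormedModule) f s0.
Proof. intros (a & r & M & hr & hM & ht). exists (a 1%nat). now apply taylor_derive with r M. Qed.

(** Division by [s - s0] shifts the coefficients by one, so the value of the quotient at [s0] has to
    be the derivative of [f]. The quotient is any [g] with the right values, which suits functions
    defined by cases at the singularity. *)
Lemma expandable_divide (f : C -> C) s0 : expandable f s0 -> f s0 = RtoC 0 ->
  exists v, is_derive (K := C_AbsRing) (V := C_NormedModule) f s0 v /\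
    forall g : C -> C, g s0 = v ->
    (forall s, s <> s0 -> g s = (f s / (s - s0))%C) -> expandable g s0.
Proof.
  intros (a & r & M & hr & hM & ht) hf0.
  assert (ha0 : a 0%nat = RtoC 0).
  { assert (h0 : Cmod (RtoC 0) < r) by (rewrite Cmod_0; lra).
    pose proof (ht _ h0 1%nat) as h. rewrite Cmod_0 in h.
    replace (s0 + 0)%C with s0 in h by ring. rewrite hf0 in h. simpl in h.
    replace (0 - (0 + a 0%nat * 1))%C with (- a 0%nat)%C in h by ring.
    rewrite Cmod_opp in h. apply Cmod_eq_0.
    pose proof (Cmod_ge_0 (a 0%nat)). unfold Rdiv in h. lra. }
  exists (a 1%nat). split; [now apply taylor_derive with r M|]. intros g hg0 hg.
  assert (hM2 : 0 <= 2 * M / r) by (apply Rdiv_le_0_compat; lra).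
  exists (fun k => a (S k)), r, (2 * M / r). split; [lra|]. split; [exact hM2|].
  intros z hz n. 
  destruct (Ceq_dec z (RtoC 0)) as [->|hz0].
  - replace (s0 + 0)%C with s0 by ring. rewrite hg0, Cmod_0.
    assert (hc : forall m, cpoly (fun k => a (S k)) (RtoC 0) (S m) = a 1%nat).
    { intros m. rewrite cpoly_shift. ring. }
    destruct n as [|n].
    + simpl. replace (a 1%nat - 0)%C with (a 1%nat) by ring.
      pose proof (taylor_coeff f s0 a r M 1 hr ht) as h. simpl in h.
      apply Rmult_le_reg_r with r; [lra|]. field_simplify; lra.
    + rewrite hc. replace (a 1%nat - a 1%nat)%C with (RtoC 0) by ring. rewrite Cmod_0.
      apply Rmult_le_pos; [assumption|]. apply pow_le. unfold Rdiv. lra.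
  - assert (hne : (s0 + z)%C <> s0).
    { intros h. apply hz0. replace z with (s0 + z - s0)%C by ring. rewrite h. ring. }
    rewrite hg by assumption.
    replace (s0 + z - s0)%C with z by ring.
    pose proof (ht _ hz (S n)) as h. rewrite cpoly_shift, ha0 in h.
    assert (hzp : 0 < Cmod z) by now apply Cmod_gt_0.
    replace (f (s0 + z) / z - cpoly (fun k => a (S k)) z n)%C with
      ((f (s0 + z) - (0 + z * cpoly (fun k => a (S k)) z n)) / z)%C by (field; assumption).
    rewrite Cmod_div by assumption.
    apply Rmult_le_reg_r with (Cmod z); [assumption|].
    replace (Cmod (f (s0 + z) - (0 + z * cpoly (fun k : nat => a (S k)) z n))%C / Cmod z * Cmod z)
      with (Cmod (f (s0 + z) - (0 + z * cpoly (fun k : nat => a (S k)) z n))%C) by (field; lra).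
    eapply Rle_trans; [exact h|]. simpl.
    assert (0 <= (Cmod z / r) ^ n) by (apply pow_le; apply Rdiv_le_0_compat; lra).
    replace (M * (Cmod z / r * (Cmod z / r) ^ n)) with ((M / r) * (Cmod z / r) ^ n * Cmod z)
      by (field; lra).
    apply Rmult_le_compat_r; [lra|]. apply Rmult_le_compat_r; [assumption|].
    unfold Rdiv. apply Rmult_le_compat_r; [left; now apply Rinv_0_lt_compat|lra].
Qed.

(** At a zero close to [s0] the lowest nonvanishing term would have to be cancelled by a remainder
    of higher order. So zeros that accumulate at [s0] force all coefficients to vanish, one after
    the other. *)
Lemma expandable_zero_locally (f : C -> C) s0 : expandable f s0 ->
  (forall d, 0 < d -> exists z, z <> RtoC 0 /\ Cmod z < d /\ f (s0 + z)%C = RtoC 0) ->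
  exists d, 0 < d /\ forall s, Cmod (s - s0)%C < d -> f s = RtoC 0.
Proof.
  intros (a & r & M & hr & hM & ht) hz.
  assert (ha : forall n k, (k < n)%nat -> a k = RtoC 0).
  { induction n as [|n IH]; intros k hk; [lia|].
    destruct (Nat.eq_dec k n) as [->|hne]; [|apply IH; lia].
    assert (hc : forall z m, (m <= n)%nat -> cpoly a z m = RtoC 0).
    { intros z. induction m as [|m IHm]; intros hm; [reflexivity|].
      simpl. rewrite IHm, IH by lia. ring. }
    apply Cmod_eq_0. apply Rle_antisym; [|apply Cmod_ge_0].
    apply Rnot_lt_le. intros hlt.
    (* At a zero closer than [e] the term of order [n] exceeds the bound on the remainder of order
       [n + 1]. *)
    set (e := Cmod (a n) * r ^ S n / (M + 1)).
    assert (hrn : 0 < r ^ S n) by (apply pow_lt; lra).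
    assert (he : 0 < e) by (apply Rdiv_lt_0_compat; [nra|lra]).
    destruct (hz (Rmin r e)) as (z & hz0 & hzd & hfz); [now apply Rmin_glb_lt|].
    assert (hzr : Cmod z < r) by (eapply Rlt_le_trans; [exact hzd|apply Rmin_l]).
    assert (hze : Cmod z < e) by (eapply Rlt_le_trans; [exact hzd|apply Rmin_r]).
    assert (hzp : 0 < Cmod z) by now apply Cmod_gt_0.
    specialize (ht _ hzr (S n)). rewrite hfz in ht. simpl cpoly in ht.
    rewrite hc in ht by lia.
    replace (0 - (0 + a n * z ^ n))%C with (- (a n * z ^ n))%C in ht by ring.
    rewrite Cmod_opp, Cmod_mult, Cmod_pow in ht.
    rewrite pow_div_l in ht by lra.
    assert (hzn : 0 < Cmod z ^ n) by (apply pow_lt; lra).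
    assert (h1 : Cmod (a n) * r ^ S n <= M * Cmod z).
    { apply Rmult_le_reg_r with (Cmod z ^ n); [assumption|].
      apply Rmult_le_reg_r with (/ r ^ S n); [now apply Rinv_0_lt_compat|].
      replace (Cmod (a n) * r ^ S n * Cmod z ^ n * / r ^ S n) with (Cmod (a n) * Cmod z ^ n)
        by (field; apply pow_nonzero; lra).
      eapply Rle_trans; [exact ht|]. simpl. right. field. split; [|lra]. apply pow_nonzero. lra. }
    assert (h2 : (M + 1) * Cmod z < Cmod (a n) * r ^ S n).
    { apply Rmult_lt_reg_r with (/ (M + 1)); [apply Rinv_0_lt_compat; lra|].
      replace ((M + 1) * Cmod z * / (M + 1)) with (Cmod z) by (field; lra). exact hze. }
    nra. }
  exists r. split; [assumption|]. intros s hs.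
  assert (hc : forall z m, cpoly a z m = RtoC 0).
  { intros z. induction m as [|m IHm]; [reflexivity|].
    simpl. rewrite IHm, (ha (S m)) by lia. ring. }
  apply Cmod_eq_0. apply Rle_antisym; [|apply Cmod_ge_0].
  assert (hl : is_lim_seq (fun n => M * (Cmod (s - s0)%C / r) ^ n) 0).
  { apply is_lim_seq_geom_scal. split.
    - apply Rdiv_le_0_compat; [apply Cmod_ge_0|lra].
    - now apply div_lt_1. }
  refine (is_lim_seq_le (fun _ => Cmod (f s)) _ _ _ _ (is_lim_seq_const _) hl).
  intros n. specialize (ht _ hs n). rewrite hc in ht.
  replace (s0 + (s - s0))%C with s in ht by ring.
  now replace (f s - 0)%C with (f s) in ht by ring.
Qed.

(** The set of parameters whose final segment consists of zeros of [f] is both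
    open and closed in [0, 1]. *)
Lemma identity_on_segment (f : C -> C) (p q : C) : p <> q ->
  (forall t, 0 <= t <= 1 -> expandable f (q + RtoC t * (p - q))%C) ->
  (exists d, 0 < d /\ forall s, Cmod (s - p)%C < d -> f s = RtoC 0) ->
  exists d, 0 < d /\ forall s, Cmod (s - q)%C < d -> f s = RtoC 0.
Proof.
  intros hpq hf (d0 & hd0 & hp).
  set (g := fun t : R => (q + RtoC t * (p - q))%C).
  assert (hL : 0 < Cmod (p - q)%C).
  { apply Cmod_gt_0. intros h. apply hpq. replace p with (p - q + q)%C by ring. rewrite h. ring. }
  assert (hdist : forall t t', Cmod (g t - g t')%C = Rabs (t - t') * Cmod (p - q)%C).
  { intros t t'. replace (g t - g t')%C with (RtoC (t - t') * (p - q))%C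
      by (unfold g; rewrite RtoC_minus; ring).
    now rewrite Cmod_mult, Cmod_R. }
  set (E := fun x => 0 <= x <= 1 /\ forall t, 1 - x <= t <= 1 -> f (g t) = RtoC 0).
  assert (hE0 : E 0).
  { split; [lra|]. intros t ht. replace t with 1 by lra. apply hp.
    replace (g 1 - p)%C with (RtoC 0) by (unfold g; ring). rewrite Cmod_0. lra. }
  destruct (completeness E) as [x [hub hlub]].
  { exists 1. intros y [hy _]. lra. }
  { now exists 0. }
  assert (hx : 0 <= x <= 1).
  { split; [now apply hub|]. apply hlub. intros y [hy _]. lra. }
  assert (hlt : forall t, 1 - x < t <= 1 -> f (g t) = RtoC 0).
  { intros t ht.
    assert (hy : exists y, E y /\ 1 - t <= y).
    { apply NNPP. intros hn. assert (hb : is_upper_bound E (1 - t)).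
      { intros y hy. apply Rnot_lt_le. intros h. apply hn. exists y. split; [assumption|lra]. }
      specialize (hlub _ hb). lra. }
    destruct hy as (y & [_ hEy] & hy). apply hEy. lra. }
  assert (hxp : 0 < x).
  { apply Rlt_le_trans with (Rmin 1 (d0 / Cmod (p - q)%C / 2)).
    - apply Rmin_glb_lt; [lra|]. apply Rdiv_lt_0_compat; [|lra]. now apply Rdiv_lt_0_compat.
    - apply hub. 
      assert (h1 := Rmin_l 1 (d0 / Cmod (p - q)%C / 2)).
      assert (h2 := Rmin_r 1 (d0 / Cmod (p - q)%C / 2)).
      assert (h3 : 0 < Rmin 1 (d0 / Cmod (p - q)%C / 2)).
      { apply Rmin_glb_lt; [lra|]. apply Rdiv_lt_0_compat; [|lra]. now apply Rdiv_lt_0_compat. }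
      split; [lra|]. intros t ht. apply hp.
      replace (g t - p)%C with (g t - g 1)%C by (unfold g; ring).
      rewrite hdist.
      apply Rlt_le_trans with (d0 / Cmod (p - q)%C * Cmod (p - q)%C); [|right; field; lra].
      apply Rmult_lt_compat_r; [assumption|].
      apply Rabs_def1; lra. }
  (* The zeros with parameters slightly above [1 - x] accumulate at [g (1 - x)], so [f] vanishes on
     a whole disc there; this makes the set open. *)
  destruct (expandable_zero_locally f (g (1 - x))) as (d & hd & hzero).
  { apply hf. lra. }
  { intros d hd. set (h := Rmin x (d / Cmod (p - q)%C / 2)).
    assert (hh : 0 < h).
    { apply Rmin_glb_lt; [lra|]. apply Rdiv_lt_0_compat; [|lra]. now apply Rdiv_lt_0_compat. }
    exists (RtoC h * (p - q))%C. split; [|split].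
    - apply Cmod_gt_0. rewrite Cmod_mult, Cmod_R, Rabs_pos_eq by lra. nra.
    - rewrite Cmod_mult, Cmod_R, Rabs_pos_eq by lra.
      apply Rlt_le_trans with (d / Cmod (p - q)%C * Cmod (p - q)%C); [|right; field; lra].
      apply Rmult_lt_compat_r; [assumption|].
      assert (h2 := Rmin_r x (d / Cmod (p - q)%C / 2)). fold h in h2. lra.
    - replace (g (1 - x)%R + RtoC h * (p - q))%C with (g (1 - x + h))
        by (unfold g; rewrite RtoC_plus; ring).
      apply hlt. assert (h1 := Rmin_l x (d / Cmod (p - q)%C / 2)). fold h in h1. lra. }
  assert (hx1 : x = 1).
  { apply Rle_antisym; [lra|]. apply Rnot_lt_le. intros hx1.
    set (h := Rmin (1 - x) (d / Cmod (p - q)%C / 2)).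
    assert (hdL : 0 < d / Cmod (p - q)%C) by now apply Rdiv_lt_0_compat.
    assert (hh : 0 < h) by (apply Rmin_glb_lt; lra).
    assert (h1 := Rmin_l (1 - x) (d / Cmod (p - q)%C / 2)). fold h in h1.
    assert (h2 := Rmin_r (1 - x) (d / Cmod (p - q)%C / 2)). fold h in h2.
    assert (hE : E (x + h)).
    { split; [lra|]. intros t ht.
      destruct (Rlt_le_dec (1 - x) t) as [h3|h3]; [apply hlt; lra|].
      apply hzero. rewrite hdist.
      apply Rlt_le_trans with (d / Cmod (p - q)%C * Cmod (p - q)%C); [|right; field; lra].
      apply Rmult_lt_compat_r; [assumption|]. apply Rabs_def1; lra. }
    specialize (hub _ hE). lra. }
  exists d. split; [assumption|]. intros s hs. apply hzero.
  replace (g (1 - x)) with q; [assumption|]. rewrite hx1. unfold g.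
  replace (1 - 1) with 0 by ring. ring.
Qed.

(** * The complex exponential *)

Lemma exp_le_compat (x y : R) : x <= y -> exp x <= exp y.
Proof. intros [h| ->]; [left; now apply exp_increasing|lra]. Qed.

Lemma Cexp_plus (z w : C) : Cexp (z + w)%C = (Cexp z * Cexp w)%C.
Proof.
  destruct z as [a b], w as [c d]. unfold Cexp, Cmult, Cplus; simpl.
  rewrite exp_plus, cos_plus, sin_plus. f_equal; ring.
Qed.

Lemma Cmod_Cexp (z : C) : Cmod (Cexp z) = exp (Re z).
Proof.
  unfold Cmod, Cexp; simpl.
  replace (exp (Re z) * cos (Im z) * (exp (Re z) * cos (Im z) * 1) +
    exp (Re z) * sin (Im z) * (exp (Re z) * sin (Im z) * 1)) with
    (Rsqr (exp (Re z)) * (Rsqr (sin (Im z)) + Rsqr (cos (Im z)))) by (unfold Rsqr; ring).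
  rewrite sin2_cos2, Rmult_1_r, sqrt_Rsqr; [reflexivity|]. left. apply exp_pos.
Qed.

Lemma Cexp_R (x : R) : Cexp (RtoC x) = RtoC (exp x).
Proof.
  unfold Cexp, RtoC; simpl. rewrite cos_0, sin_0. f_equal; ring.
Qed.

Lemma is_derive_Rmul (f g : R -> R) (x l m : R) : is_derive f x l -> is_derive g x m ->
  is_derive (fun y => f y * g y) x (l * g x + f x * m).
Proof.
  intros hf hg. apply (is_derive_mult f g x l m hf hg). intros a b. apply Rmult_comm.
Qed.

Lemma mean_value (f df : R -> R) (a b : R) : a < b ->
  (forall x, a <= x <= b -> is_derive f x (df x)) ->
  exists c, a < c < b /\ f b - f a = df c * (b - a).
Proof.
  intros hab h. destruct (MVT_cor2 f df a b hab) as (c & h1 & h2).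
  - intros c hc. apply is_derive_Reals. now apply h.
  - exists c. now split.
Qed.

Lemma derive_nonneg_le (f df : R -> R) (a b : R) : a <= b ->
  (forall x, a <= x <= b -> is_derive f x (df x)) ->
  (forall x, a <= x <= b -> 0 <= df x) -> f a <= f b.
Proof.
  intros [hab|<-] h hp; [|lra].
  destruct (mean_value f df a b hab h) as (c & hc & he).
  assert (0 <= df c) by (apply hp; lra). nra.
Qed.

Definition Cderiv (f : R -> C) (t : R) (l : C) : Prop :=
  is_derive (fun x => Re (f x)) t (Re l) /\ is_derive (fun x => Im (f x)) t (Im l).

Lemma Cderiv_plus f g t l m : Cderiv f t l -> Cderiv g t m ->
  Cderiv (fun x => f x + g x)%C t (l + m)%C.
Proof.
  intros [h1 h2] [h3 h4]. split; simpl.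
  - apply (is_derive_plus (fun x => Re (f x)) (fun x => Re (g x))); assumption.
  - apply (is_derive_plus (fun x => Im (f x)) (fun x => Im (g x))); assumption.
Qed.

Lemma Cderiv_mult f g t l m : Cderiv f t l -> Cderiv g t m ->
  Cderiv (fun x => f x * g x)%C t (l * g t + f t * m)%C.
Proof.
  intros [h1 h2] [h3 h4]. split; simpl.
  - evar_last.
    + apply (is_derive_minus (fun x => Re (f x) * Re (g x)) (fun x => Im (f x) * Im (g x))).
      * apply is_derive_Rmul; eassumption.
      * apply is_derive_Rmul; eassumption.
    + unfold minus, plus, opp, Re, Im; simpl. ring.
  - evar_last.
    + apply (is_derive_plus (fun x => Re (f x) * Im (g x)) (fun x => Im (f x) * Re (g x))).
      * apply is_derive_Rmul; eassumption.
      * apply is_derive_Rmul; eassumption.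
    + unfold minus, plus, opp, Re, Im; simpl. ring.
Qed.

Lemma Cderiv_const (c : C) t : Cderiv (fun _ => c) t (RtoC 0).
Proof.
  split; simpl.
  - exact (is_derive_const (K := R_AbsRing) (V := R_NormedModule) (Re c) t).
  - exact (is_derive_const (K := R_AbsRing) (V := R_NormedModule) (Im c) t).
Qed.

Lemma Cderiv_ext (f g : R -> C) t l : (forall x, f x = g x) -> Cderiv f t l -> Cderiv g t l.
Proof.
  intros h [h1 h2]. split.
  - apply is_derive_ext with (2 := h1). intros x. now rewrite h.
  - apply is_derive_ext with (2 := h2). intros x. now rewrite h.
Qed.

Lemma Cderiv_scal (c : C) f t l : Cderiv f t l -> Cderiv (fun x => c * f x)%C t (c * l)%C.
Proof.
  intros h. replace (c * l)%C with (0 * f t + c * l)%C by ring.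
  apply (Cderiv_mult (fun _ => c) f); [apply Cderiv_const|exact h].
Qed.

Lemma Cderiv_linear (w : C) t : Cderiv (fun x => RtoC x * w)%C t w.
Proof.
  destruct w as [a b]. split; simpl.
  - auto_derive; [auto|ring].
  - auto_derive; [auto|ring].
Qed.

Lemma Cderiv_Cexp (w : C) t :
  Cderiv (fun x => Cexp (RtoC x * w)%C) t (w * Cexp (RtoC t * w))%C.
Proof.
  destruct w as [a b]. unfold Cexp, Cmult. split; simpl.
  - auto_derive; [auto|].
    replace (t * a + - (0 * b)) with (t * a - 0 * b) by ring. ring.
  - auto_derive; [auto|].
    replace (t * a + - (0 * b)) with (t * a - 0 * b) by ring. ring.
Qed.

Definition exp_coeff (k : nat) : C := RtoC (/ INR (fact k)).

Lemma Cderiv_pow_over_fact (w : C) t k :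
  Cderiv (fun x => exp_coeff (S k) * (RtoC x * w) ^ (S k))%C t
    (w * (exp_coeff k * (RtoC t * w) ^ k))%C.
Proof.
  assert (h : forall k, Cderiv (fun x => (RtoC x * w) ^ S k)%C t
    (RtoC (INR (S k)) * (w * (RtoC t * w) ^ k))%C).
  { clear k. induction k as [|k IH].
    - pose proof (Cderiv_linear w t) as h. simpl.
      replace (1 * (w * 1))%C with w by ring.
      apply Cderiv_ext with (2 := h). intros x. ring.
    - rewrite S_INR, RtoC_plus.
      replace ((RtoC (INR (S k)) + 1) * (w * (RtoC t * w) ^ S k))%C with
        (w * (RtoC t * w) ^ S k + (RtoC t * w) * (RtoC (INR (S k)) * (w * (RtoC t * w) ^ k)))%C
        by (simpl; ring).
      apply (Cderiv_mult (fun x => RtoC x * w)%C (fun x => (RtoC x * w) ^ S k)%C);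
        [apply Cderiv_linear|exact IH]. }
  replace (w * (exp_coeff k * (RtoC t * w) ^ k))%C with
    (exp_coeff (S k) * (RtoC (INR (S k)) * (w * (RtoC t * w) ^ k)))%C.
  - apply Cderiv_scal. apply h.
  - unfold exp_coeff. rewrite fact_simpl, mult_INR.
    replace (/ (INR (S k) * INR (fact k))) with (/ INR (S k) * / INR (fact k))
      by (field; split; [apply INR_fact_neq_0|now apply not_0_INR]).
    rewrite RtoC_mult.
    assert (he : (RtoC (/ INR (S k)) * RtoC (INR (S k)) = 1)%C).
    { rewrite <- RtoC_mult. f_equal. field. now apply not_0_INR. }
    transitivity ((RtoC (/ INR (S k)) * RtoC (INR (S k))) *
      (w * (RtoC (/ INR (fact k)) * (RtoC t * w) ^ k)))%C; [ring|].
    rewrite he. ring.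
Qed.

Lemma Cderiv_cpoly_exp (w : C) t n :
  Cderiv (fun x => cpoly exp_coeff (RtoC x * w)%C (S n)) t
    (w * cpoly exp_coeff (RtoC t * w)%C n)%C.
Proof.
  induction n as [|n IH].
  - simpl. replace (w * 0)%C with (RtoC 0) by ring.
    apply Cderiv_ext with (2 := Cderiv_const (exp_coeff 0) t). intros x. ring.
  - change (fun x => cpoly exp_coeff (RtoC x * w)%C (S (S n))) with
      (fun x => cpoly exp_coeff (RtoC x * w)%C (S n) + exp_coeff (S n) * (RtoC x * w) ^ (S n))%C.
    simpl cpoly at 2.
    replace (w * (cpoly exp_coeff (RtoC t * w) n + exp_coeff n * (RtoC t * w) ^ n))%C with
      (w * cpoly exp_coeff (RtoC t * w) n + w * (exp_coeff n * (RtoC t * w) ^ n))%C by ring.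
    apply Cderiv_plus; [exact IH|]. apply Cderiv_pow_over_fact.
Qed.

(** Integration of a bound by monotonicity: both [A x^(n+1) / (n+1) - f] and [A x^(n+1) / (n+1) + f]
    start at 0 and have nonnegative derivative. *)
Lemma bound_from_derivative (f df : R -> R) (A : R) (n : nat) : f 0 = 0 ->
  (forall x, 0 <= x <= 1 -> is_derive f x (df x)) ->
  (forall x, 0 <= x <= 1 -> Rabs (df x) <= A * x ^ n) ->
  forall x, 0 <= x <= 1 -> Rabs (f x) <= A * (x ^ S n / INR (S n)).
Proof.
  intros h0 hd hb x hx.
  assert (hS : INR (S n) <> 0) by now apply not_0_INR.
  assert (hp : forall y, is_derive (fun y => A * (y ^ S n / INR (S n))) y (A * y ^ n)).
  { intros y. auto_derive; [auto|]. simpl Nat.pred. field. exact hS. }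
  apply Rabs_le. split.
  - assert (h : 0 + A * (0 ^ S n / INR (S n)) <= f x + A * (x ^ S n / INR (S n))).
    { rewrite <- h0 at 1.
      apply (derive_nonneg_le (fun y => f y + A * (y ^ S n / INR (S n)))
        (fun y => df y + A * y ^ n)); [lra| |].
      - intros y hy. apply (is_derive_plus f (fun y => A * (y ^ S n / INR (S n)))); [apply hd; lra|apply hp].
      - intros y hy. specialize (hb y ltac:(lra)). 
        pose proof (Rle_abs (- df y)) as h1. rewrite Rabs_Ropp in h1. lra. }
    rewrite pow_i in h by lia. unfold Rdiv in h. lra.
  - assert (h : A * (0 ^ S n / INR (S n)) - 0 <= A * (x ^ S n / INR (S n)) - f x).
    { rewrite <- h0 at 2.
      apply (derive_nonneg_le (fun y => A * (y ^ S n / INR (S n)) - f y)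
        (fun y => A * y ^ n - df y)); [lra| |].
      - intros y hy. apply (is_derive_minus (fun y => A * (y ^ S n / INR (S n))) f); [apply hp|apply hd; lra].
      - intros y hy. specialize (hb y ltac:(lra)).
        pose proof (Rle_abs (df y)) as h1. lra. }
    rewrite pow_i in h by lia. unfold Rdiv in h. lra.
Qed.

Lemma Re_mult_bound (w z : C) (B : R) : Rabs (Re z) <= B -> Rabs (Im z) <= B ->
  Rabs (Re (w * z)%C) <= 2 * Cmod w * B /\ Rabs (Im (w * z)%C) <= 2 * Cmod w * B.
Proof.
  intros h1 h2.
  pose proof (re_le_Cmod w) as h3. pose proof (Rmax_Cmod w) as h4.
  assert (h5 : Rabs (Im w) <= Cmod w) by (eapply Rle_trans; [apply Rmax_r|exact h4]).
  pose proof (Rabs_pos (Im z)).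
  pose proof (Rabs_pos (Re w)). pose proof (Rabs_pos (Im w)).
  split; simpl.
  - eapply Rle_trans; [apply Rabs_triang|]. rewrite Rabs_Ropp, !Rabs_mult.
    change (fst w) with (Re w). change (snd w) with (Im w).
    change (fst z) with (Re z). change (snd z) with (Im z). nra.
  - eapply Rle_trans; [apply Rabs_triang|]. rewrite !Rabs_mult.
    change (fst w) with (Re w). change (snd w) with (Im w).
    change (fst z) with (Re z). change (snd z) with (Im z). nra.
Qed.

Lemma Cmod_le_2 (z : C) (B : R) : Rabs (Re z) <= B -> Rabs (Im z) <= B -> Cmod z <= 2 * B.
Proof.
  intros h1 h2. replace z with (RtoC (Re z) + Ci * RtoC (Im z))%C.
  - eapply Rle_trans; [apply Cmod_triangle|]. rewrite Cmod_mult, Cmod_Ci, !Cmod_R. lra.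
  - destruct z as [a b]. unfold Cplus, Cmult, Ci, RtoC. simpl. f_equal; ring.
Qed.

Lemma exp_ge_term (x : R) n : 0 <= x -> x ^ n / INR (fact n) <= exp x.
Proof.
  revert x. induction n as [|n IH]; intros x hx.
  - simpl. replace (1 / 1) with 1 by field. pose proof (exp_ineq1_le x). lra.
  - assert (h : exp 0 - 0 ^ S n / INR (fact (S n)) <= exp x - x ^ S n / INR (fact (S n))).
    { apply (derive_nonneg_le (fun y => exp y - y ^ S n / INR (fact (S n)))
        (fun y => exp y - y ^ n / INR (fact n))); [lra| |].
      - intros y hy.
        assert (hc : / INR (fact n) = INR (S n) * / INR (fact (S n))).
        { rewrite fact_simpl, mult_INR. field.
          split; [apply INR_fact_neq_0|now apply not_0_INR]. }
        unfold Rdiv. rewrite hc. generalize (/ INR (fact (S n))). intros c.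
        auto_derive; [auto|].
        change (match n with O => 1 | S _ => INR n + 1 end) with (INR (S n)). ring.
      - intros y hy. specialize (IH y ltac:(lra)). lra. }
    rewrite exp_0, pow_i in h by lia. unfold Rdiv in h at 1. lra.
Qed.

(** Along the ray [t w] the derivative of the remainder of order [n + 1] is [w] times the remainder
    of order [n], and integration from 0 to [t] produces the factorial. Real and imaginary parts are
    bounded separately, which costs a factor 2 in each multiplication by [w], hence [(2 |w|)^n], and
    one more 2 for the final modulus. *)
Lemma Cexp_taylor (w : C) n :
  Cmod (Cexp w - cpoly exp_coeff w n)%C <=
  2 * (exp (Cmod w) * ((2 * Cmod w) ^ n / INR (fact n))).
Proof.
  assert (key : forall n t, 0 <= t <= 1 ->
    let r := (Cexp (RtoC t * w) - cpoly exp_coeff (RtoC t * w) n)%C in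
    Rabs (Re r) <= exp (Cmod w) * ((2 * Cmod w) ^ n / INR (fact n)) * t ^ n /\
    Rabs (Im r) <= exp (Cmod w) * ((2 * Cmod w) ^ n / INR (fact n)) * t ^ n).
  { clear n. induction n as [|n IH]; intros t ht; cbv zeta.
    - cbn [cpoly]. simpl INR.
      replace (Cexp (RtoC t * w) - 0)%C with (Cexp (RtoC t * w)) by ring.
      simpl pow. rewrite Rdiv_1_r, !Rmult_1_r.
      assert (h : Cmod (Cexp (RtoC t * w)) <= exp (Cmod w)).
      { rewrite Cmod_Cexp. apply exp_le_compat.
        eapply Rle_trans; [apply Rle_abs|]. eapply Rle_trans; [apply re_le_Cmod|].
        rewrite Cmod_mult, Cmod_R, Rabs_pos_eq by lra. pose proof (Cmod_ge_0 w). nra. }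
      split; (eapply Rle_trans; [|exact h]).
      + apply re_le_Cmod.
      + eapply Rle_trans; [|apply Rmax_Cmod]. apply Rmax_r.
    - set (r := fun m x => (Cexp (RtoC x * w) - cpoly exp_coeff (RtoC x * w) m)%C).
      set (A := exp (Cmod w) * ((2 * Cmod w) ^ n / INR (fact n))).
      assert (hd : forall x, Cderiv (r (S n)) x (w * r n x)%C).
      { intros x. replace (w * r n x)%C with
          (w * Cexp (RtoC x * w) + (- 1) * (w * cpoly exp_coeff (RtoC x * w) n))%C
          by (unfold r; ring).
        assert (h := Cderiv_plus _ _ _ _ _ (Cderiv_Cexp w x)
          (Cderiv_scal (- 1)%C _ _ _ (Cderiv_cpoly_exp w x n))).
        apply Cderiv_ext with (2 := h). intros y. unfold r. ring. }
      assert (hr0 : r (S n) 0 = RtoC 0).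
      { unfold r. replace (RtoC 0 * w)%C with (RtoC 0) by ring. rewrite Cexp_R, exp_0.
        rewrite cpoly_shift. unfold exp_coeff at 1. simpl INR. rewrite Rinv_1. ring. }
      assert (hb : forall x, 0 <= x <= 1 ->
        Rabs (Re (w * r n x)%C) <= 2 * Cmod w * A * x ^ n /\
        Rabs (Im (w * r n x)%C) <= 2 * Cmod w * A * x ^ n).
      { intros x hx. destruct (IH x hx) as [h1 h2].
        destruct (Re_mult_bound w (r n x) (A * x ^ n) h1 h2) as [h3 h4].
        split; lra. }
      assert (he : exp (Cmod w) * ((2 * Cmod w) ^ S n / INR (fact (S n))) * t ^ S n =
        2 * Cmod w * A * (t ^ S n / INR (S n))).
      { unfold A. rewrite fact_simpl, mult_INR. 
        change ((2 * Cmod w) ^ S n) with (2 * Cmod w * (2 * Cmod w) ^ n). field.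
        split; [now apply not_0_INR|apply INR_fact_neq_0]. }
      rewrite he. split.
      + apply (bound_from_derivative (fun x => Re (r (S n) x)) (fun x => Re (w * r n x)%C)); auto.
        * now rewrite hr0.
        * intros x _. apply hd.
        * intros x hx. now apply hb.
      + apply (bound_from_derivative (fun x => Im (r (S n) x)) (fun x => Im (w * r n x)%C)); auto.
        * now rewrite hr0.
        * intros x _. apply hd.
        * intros x hx. now apply hb. }
  destruct (key n 1 ltac:(lra)) as [h1 h2].
  replace (RtoC 1 * w)%C with w in h1, h2 by ring.
  rewrite pow1, Rmult_1_r in h1, h2.
  now apply Cmod_le_2.
Qed.

(** Of the exponent [3 r |m|], one part bounds [exp (|z| |m|)] and two parts bound
    [(2 r |m|)^n / n!]. The result separates the geometric factor in [z] from a weight in [m] that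
    can be summed or integrated. *)
Lemma Cexp_taylor_geom (m r : R) (z : C) n : 0 < r -> Cmod z < r ->
  Cmod (Cexp (z * RtoC m) - cpoly exp_coeff (z * RtoC m) n)%C <=
  2 * (Cmod z / r) ^ n * exp (3 * r * Rabs m).
Proof.
  intros hr hz. pose proof (Cmod_ge_0 z). pose proof (Rabs_pos m).
  eapply Rle_trans; [apply Cexp_taylor|].
  rewrite Cmod_mult, Cmod_R.
  replace (2 * (Cmod z * Rabs m)) with (Cmod z / r * (2 * r * Rabs m)) by (field; lra).
  rewrite Rpow_mult_distr.
  assert (h1 : exp (Cmod z * Rabs m) <= exp (r * Rabs m)) by (apply exp_le_compat; nra).
  assert (h2 : (2 * r * Rabs m) ^ n / INR (fact n) <= exp (2 * r * Rabs m))
    by (apply exp_ge_term; nra).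
  replace (3 * r * Rabs m) with (r * Rabs m + 2 * r * Rabs m) by ring.
  rewrite exp_plus.
  assert (h3 : 0 <= (Cmod z / r) ^ n) by (apply pow_le; apply Rdiv_le_0_compat; lra).
  assert (h4 : 0 <= (2 * r * Rabs m) ^ n / INR (fact n)).
  { apply Rdiv_le_0_compat; [apply pow_le; nra|apply INR_fact_lt_0]. }
  assert (h5 : exp (Cmod z * Rabs m) * ((2 * r * Rabs m) ^ n / INR (fact n)) <=
    exp (r * Rabs m) * exp (2 * r * Rabs m)).
  { apply Rmult_le_compat; auto. left. apply exp_pos. }
  replace (2 * (exp (Cmod z * Rabs m) * ((Cmod z / r) ^ n * (2 * r * Rabs m) ^ n / INR (fact n))))
    with (2 * (Cmod z / r) ^ n * (exp (Cmod z * Rabs m) * ((2 * r * Rabs m) ^ n / INR (fact n))))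
    by (unfold Rdiv; ring).
  apply Rmult_le_compat_l; [lra|]. exact h5.
Qed.

(** * Superpositions of exponentials *)

(** Common to the sum over the lattice and the integral over a half-line: linearity on a class
    [dom], and domination by a weight [W] of total mass at most [K], checked on [supp] only. *)
Record bounded_functional {X : Type} (dom : (X -> R) -> Prop) (I : (X -> R) -> R)
  (supp : X -> Prop) (W : X -> R) (K : R) : Prop := {
  bf_lin : forall f g a b, dom f -> dom g ->
    dom (fun x => a * f x + b * g x) /\ I (fun x => a * f x + b * g x) = a * I f + b * I g;
  bf_bound : forall f B, dom f -> 0 <= B -> (forall x, supp x -> Rabs (f x) <= B * W x) ->
    Rabs (I f) <= B * K }.

Definition cfun {X : Type} (I : (X -> R) -> R) (h : X -> C) : C :=
  (I (fun x => Re (h x)), I (fun x => Im (h x))).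

Definition cdom {X : Type} (dom : (X -> R) -> Prop) (h : X -> C) : Prop :=
  dom (fun x => Re (h x)) /\ dom (fun x => Im (h x)).

Lemma cfun_lin {X : Type} dom (I : (X -> R) -> R) supp W K (h1 h2 : X -> C) (c d : C) :
  bounded_functional dom I supp W K -> cdom dom h1 -> cdom dom h2 ->
  cdom dom (fun x => c * h1 x + d * h2 x)%C /\
  cfun I (fun x => c * h1 x + d * h2 x)%C = (c * cfun I h1 + d * cfun I h2)%C.
Proof.
  intros [hl _] [d1 d2] [d3 d4].
  destruct (hl _ _ (Re c) (- Im c) d1 d2) as [e1 e2].
  destruct (hl _ _ (Im c) (Re c) d1 d2) as [e3 e4].
  destruct (hl _ _ (Re d) (- Im d) d3 d4) as [e5 e6].
  destruct (hl _ _ (Im d) (Re d) d3 d4) as [e7 e8].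
  destruct (hl _ _ 1 1 e1 e5) as [e9 e10].
  destruct (hl _ _ 1 1 e3 e7) as [e11 e12].
  assert (hre : (fun x => Re (c * h1 x + d * h2 x)%C) =
    (fun x => 1 * (Re c * Re (h1 x) + - Im c * Im (h1 x)) + 1 * (Re d * Re (h2 x) + - Im d * Im (h2 x)))).
  { apply functional_extensionality. intros x. unfold Re, Im. simpl. ring. }
  assert (him : (fun x => Im (c * h1 x + d * h2 x)%C) =
    (fun x => 1 * (Im c * Re (h1 x) + Re c * Im (h1 x)) + 1 * (Im d * Re (h2 x) + Re d * Im (h2 x)))).
  { apply functional_extensionality. intros x. unfold Re, Im. simpl. ring. }
  split.
  - split; [rewrite hre|rewrite him]; assumption.
  - unfold cfun. rewrite hre, him, e10, e12, e2, e4, e6, e8.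
    unfold Cmult, Cplus, Re, Im. simpl. f_equal; ring.
Qed.

Lemma cfun_bound {X : Type} dom (I : (X -> R) -> R) supp W K (h : X -> C) (B : R) :
  bounded_functional dom I supp W K -> cdom dom h -> 0 <= B ->
  (forall x, supp x -> Cmod (h x) <= B * W x) -> Cmod (cfun I h) <= 2 * (B * K).
Proof.
  intros [_ hb] [d1 d2] hB h1. apply Cmod_le_2; unfold cfun; simpl.
  - apply hb; auto. intros x hx. eapply Rle_trans; [apply re_le_Cmod|now apply h1].
  - apply hb; auto. intros x hx. eapply Rle_trans; [|now apply h1].
    eapply Rle_trans; [|apply Rmax_Cmod]. apply Rmax_r.
Qed.

(** A Dirichlet series when [I] is a sum and [mu] runs through minus the logarithms of the
    eigenvalues, a Laplace transform when [I] is an integral and [mu x] is [x] or [- x]. *)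
Definition superposition {X : Type} (I : (X -> R) -> R) (phi mu : X -> R) (s : C) : C :=
  cfun I (fun x => RtoC (phi x) * Cexp (s * RtoC (mu x)))%C.

(** The Taylor coefficients are the moments of [phi mu^k e^(s0 mu)] divided by [k!]. For each [n]
    only a finite linear combination passes through [I]; the remainder is bounded pointwise by a
    geometric factor times [W], so no differentiation under the sum or integral occurs. *)
Lemma expandable_superposition {X : Type} dom (I : (X -> R) -> R) supp W K
  (phi mu : X -> R) (s0 : C) (r : R) :
  bounded_functional dom I supp W K -> 0 < r -> 0 <= K ->
  (forall x, supp x -> Rabs (phi x) * exp (Re s0 * mu x) * exp (3 * r * Rabs (mu x)) <= W x) ->
  (forall s k, Cmod (s - s0)%C < r ->
    cdom dom (fun x => RtoC (phi x * mu x ^ k) * Cexp (s * RtoC (mu x)))%C) ->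
  expandable (superposition I phi mu) s0.
Proof.
  intros hI hr hK hW hdom.
  set (h := fun (k : nat) x => (RtoC (phi x * mu x ^ k) * Cexp (s0 * RtoC (mu x)))%C).
  assert (hself : forall k, cdom dom (h k)).
  { intros k. apply hdom. replace (s0 - s0)%C with (RtoC 0) by ring. rewrite Cmod_0. lra. }
  exists (fun k => exp_coeff k * cfun I (h k))%C, r, (2 * (2 * K)).
  split; [assumption|]. split; [lra|].
  intros z hz n.
  set (p := fun n x => (RtoC (phi x) * Cexp (s0 * RtoC (mu x)) *
    cpoly exp_coeff (z * RtoC (mu x)) n)%C).
  assert (hp : forall n, cdom dom (p n) /\
    cpoly (fun k => exp_coeff k * cfun I (h k))%C z n = cfun I (p n)).
  { clear n. induction n as [|n [IH1 IH2]].
    - destruct (cfun_lin _ _ _ _ _ (h 0%nat) (h 0%nat) 0 0 hI (hself _) (hself _)) as [e1 e2].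
      assert (he : (fun x => 0 * h 0%nat x + 0 * h 0%nat x)%C = p 0%nat).
      { apply functional_extensionality. intros x. unfold p. simpl. ring. }
      rewrite he in e1, e2. split; [exact e1|]. rewrite e2. simpl. ring.
    - destruct (cfun_lin _ _ _ _ _ (p n) (h n) 1 (exp_coeff n * z ^ n)%C hI IH1 (hself _))
        as [e1 e2].
      assert (he : (fun x => 1 * p n x + exp_coeff n * z ^ n * h n x)%C = p (S n)).
      { apply functional_extensionality. intros x. unfold p, h. cbn [cpoly].
        rewrite Cpow_mult_l, RtoC_mult, RtoC_pow. ring. }
      rewrite he in e1, e2. split; [exact e1|]. rewrite e2. cbn [cpoly]. rewrite IH2. ring. }
  destruct (hp n) as [d1 e1]. rewrite e1.
  set (k := fun x => (RtoC (phi x) * Cexp ((s0 + z) * RtoC (mu x)))%C).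
  assert (hk : cdom dom k).
  { assert (hs : Cmod (s0 + z - s0)%C < r) by (replace (s0 + z - s0)%C with z by ring; lra).
    specialize (hdom _ 0%nat hs).
    replace k with (fun x : X => (RtoC (phi x * mu x ^ 0) * Cexp ((s0 + z) * RtoC (mu x)))%C);
      [exact hdom|].
    apply functional_extensionality. intros x. unfold k. simpl pow. now rewrite Rmult_1_r. }
  change (superposition I phi mu (s0 + z)%C) with (cfun I k).
  destruct (cfun_lin _ _ _ _ _ k (p n) 1 (Copp 1) hI hk d1) as [e2 e3].
  replace (cfun I k - cfun I (p n))%C with (1 * cfun I k + Copp 1 * cfun I (p n))%C by ring.
  rewrite <- e3.
  assert (hq : 0 <= (Cmod z / r) ^ n).
  { apply pow_le. apply Rdiv_le_0_compat; [apply Cmod_ge_0|lra]. }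
  replace (2 * (2 * K) * (Cmod z / r) ^ n) with (2 * ((2 * (Cmod z / r) ^ n) * K)) by ring.
  apply (cfun_bound dom I supp W); [assumption|exact e2|lra|].
  intros x hx. unfold k, p.
  replace (1 * (phi x * Cexp ((s0 + z) * mu x)) +
    Copp 1 * (phi x * Cexp (s0 * mu x) * cpoly exp_coeff (z * mu x) n))%C with
    (phi x * Cexp (s0 * mu x) * (Cexp (z * mu x) - cpoly exp_coeff (z * mu x) n))%C.
  2:{ replace ((s0 + z) * mu x)%C with (s0 * mu x + z * mu x)%C by ring.
      rewrite Cexp_plus. ring. }
  rewrite !Cmod_mult, Cmod_R, Cmod_Cexp.
  pose proof (Cexp_taylor_geom (mu x) r z n hr hz) as ht.
  replace (Re (s0 * mu x)%C) with (Re s0 * mu x) by (unfold Re; simpl; ring).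
  specialize (hW x hx).
  assert (h0 : 0 <= Rabs (phi x) * exp (Re s0 * mu x)).
  { apply Rmult_le_pos; [apply Rabs_pos|left; apply exp_pos]. }
  apply Rle_trans with (Rabs (phi x) * exp (Re s0 * mu x) *
    (2 * (Cmod z / r) ^ n * exp (3 * r * Rabs (mu x)))).
  - apply Rmult_le_compat_l; assumption.
  - replace (Rabs (phi x) * exp (Re s0 * mu x) * (2 * (Cmod z / r) ^ n * exp (3 * r * Rabs (mu x))))
      with (2 * (Cmod z / r) ^ n * (Rabs (phi x) * exp (Re s0 * mu x) * exp (3 * r * Rabs (mu x))))
      by ring.
    apply Rmult_le_compat_l; lra.
Qed.

Lemma expandable_Cexp (l s0 : C) : expandable (fun s => Cexp (l * s))%C s0.
Proof.
  set (L := Cmod l).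
  exists (fun k => Cexp (l * s0) * (exp_coeff k * l ^ k))%C, 1,
    (Cmod (Cexp (l * s0)) * (2 * exp (3 * L))).
  pose proof (Cmod_ge_0 (Cexp (l * s0))) as h0. pose proof (exp_pos (3 * L)) as h1.
  split; [lra|]. split; [nra|].
  intros z hz n.
  assert (hc : cpoly (fun k => Cexp (l * s0) * (exp_coeff k * l ^ k))%C z n =
    (Cexp (l * s0) * cpoly exp_coeff (l * z) n)%C).
  { induction n as [|n IH]; cbn [cpoly]; [ring|]. rewrite IH, Cpow_mult_l. ring. }
  rewrite hc. replace (l * (s0 + z))%C with (l * s0 + l * z)%C by ring.
  rewrite Cexp_plus.
  replace (Cexp (l * s0) * Cexp (l * z) - Cexp (l * s0) * cpoly exp_coeff (l * z) n)%C with
    (Cexp (l * s0) * (Cexp (l * z) - cpoly exp_coeff (l * z) n))%C by ring.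
  rewrite Cmod_mult, Rmult_assoc. apply Rmult_le_compat_l; [assumption|].
  eapply Rle_trans; [apply Cexp_taylor|]. rewrite Cmod_mult. fold L.
  pose proof (Cmod_ge_0 l) as hL. fold L in hL. pose proof (Cmod_ge_0 z) as hz0.
  replace (2 * (L * Cmod z)) with (Cmod z * (2 * L)) by ring.
  rewrite Rpow_mult_distr, Rdiv_1_r.
  assert (h2 : (2 * L) ^ n / INR (fact n) <= exp (2 * L)) by (apply exp_ge_term; lra).
  assert (h3 : exp (L * Cmod z) <= exp L) by (apply exp_le_compat; nra).
  assert (h4 : 0 <= (2 * L) ^ n / INR (fact n)).
  { apply Rdiv_le_0_compat; [apply pow_le; lra|apply INR_fact_lt_0]. }
  pose proof (pow_le (Cmod z) n hz0) as h5.
  replace (3 * L) with (L + 2 * L) by ring. rewrite exp_plus.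
  replace (exp (L * Cmod z) * (Cmod z ^ n * (2 * L) ^ n / INR (fact n))) with
    ((exp (L * Cmod z) * ((2 * L) ^ n / INR (fact n))) * Cmod z ^ n) by (unfold Rdiv; ring).
  apply Rle_trans with (2 * ((exp L * exp (2 * L)) * Cmod z ^ n)); [|right; ring].
  apply Rmult_le_compat_l; [lra|].
  apply Rmult_le_compat_r; [assumption|].
  apply Rmult_le_compat; auto. left. apply exp_pos.
Qed.

(** Coquelicot states equalities of integrals in the carrier of a normed module,
    which [ring] and [field] do not recognise as [R]. *)
Ltac real_eq := match goal with |- @eq _ ?a ?b => change (@eq R a b) end.

(** * Integrals over a half-line *)

Lemma ex_RInt_cont (f : R -> R) a b : (forall x, continuous f x) -> ex_RInt f a b.
Proof. intros h. apply (ex_RInt_continuous (V := R_CompleteNormedModule)). intros x _. apply h. Qed.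

Lemma is_derive_continuous (f : R -> R) x l : is_derive f x l -> continuous f x.
Proof. intros h. apply (ex_derive_continuous (V := R_NormedModule)). now exists l. Qed.

Lemma RInt_FTC (f df : R -> R) a b : (forall x, is_derive f x (df x)) ->
  (forall x, continuous df x) -> RInt df a b = f b - f a :> R.
Proof.
  intros h1 h2. apply is_RInt_unique.
  apply (is_RInt_derive (V := R_CompleteNormedModule) f df); auto.
Qed.

Lemma RInt_exp_opp (c a b : R) : c <> 0 ->
  RInt (fun x => exp (- c * x)) a b = (exp (- c * a) - exp (- c * b)) / c :> R.
Proof.
  intros hc. rewrite (RInt_FTC (fun x => - exp (- c * x) / c) (fun x => exp (- c * x))).
  - field. exact hc.
  - intros x. auto_derive; [auto|]. field. exact hc.
  - intros x. apply is_derive_continuous with (- c * exp (- c * x)). auto_derive; [auto|ring].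
Qed.

Lemma continuous_exp_opp c x : continuous (fun x => exp (- c * x)) x.
Proof. apply is_derive_continuous with (- c * exp (- c * x)). auto_derive; [auto|ring]. Qed.

(** The limit runs along integer cutoffs only; for an exponentially dominated integrand it is the
    improper integral, with the rate given by [LInt_tail]. *)
Definition LInt (f : R -> R) : R := real (Lim_seq (fun n => RInt f 0 (INR n))).

Definition exp_dominated (c : R) (f : R -> R) (C : R) : Prop :=
  forall x, 0 <= x -> Rabs (f x) <= C * exp (- c * x).

(** Continuity is asked on the whole line although decay is asked on the half-line, so that
    integrability over any interval is immediate and translates stay continuous. *)
Definition exp_dom (c : R) (f : R -> R) : Prop :=
  (forall x, continuous f x) /\ exists C, exp_dominated c f C.

Lemma exp_dominated_pos c f C : exp_dominated c f C -> 0 <= C.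
Proof.
  intros h. specialize (h 0 ltac:(lra)). rewrite Rmult_0_r, exp_0 in h.
  pose proof (Rabs_pos (f 0)). lra.
Qed.

Lemma RInt_exp_dominated c f C a b : 0 < c -> (forall x, continuous f x) ->
  exp_dominated c f C -> 0 <= a <= b ->
  Rabs (RInt f a b) <= C / c * exp (- c * a).
Proof.
  intros hc hf hC hab.
  assert (hC0 := exp_dominated_pos _ _ _ hC).
  eapply Rle_trans; [apply abs_RInt_le; [lra|now apply ex_RInt_cont]|].
  apply Rle_trans with (RInt (fun x => C * exp (- c * x)) a b).
  - apply RInt_le; [lra| | |].
    + apply ex_RInt_cont. intros x. apply continuous_comp; [apply hf|apply continuous_Rabs].
    + apply ex_RInt_cont. intros x.
      apply (continuous_scal_r (K := R_AbsRing) C (fun x => exp (- c * x))).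
      apply continuous_exp_opp.
    + intros x hx. apply hC. lra.
  - rewrite (RInt_scal (V := R_CompleteNormedModule)) by (apply ex_RInt_cont, continuous_exp_opp).
    change (scal C (RInt (fun x => exp (- c * x)) a b)) with (C * RInt (fun x => exp (- c * x)) a b).
    rewrite RInt_exp_opp by lra.
    pose proof (exp_pos (- c * b)).
    unfold Rdiv. rewrite Rmult_assoc. apply Rmult_le_compat_l; [assumption|].
    rewrite Rmult_comm. apply Rmult_le_compat_l; [left; now apply Rinv_0_lt_compat|lra].
Qed.

Lemma is_lim_seq_exp_opp c : 0 < c -> is_lim_seq (fun n => exp (- c * INR n)) 0.
Proof.
  intros hc.
  apply is_lim_seq_ext with (fun n => exp (- c) ^ n).
  - intros n. induction n as [|n IH].
    + simpl. now rewrite Rmult_0_r, exp_0.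
    + rewrite S_INR, Rmult_plus_distr_l, Rmult_1_r, exp_plus. simpl. rewrite IH. ring.
  - apply is_lim_seq_geom. rewrite Rabs_pos_eq by (left; apply exp_pos).
    rewrite <- exp_0. apply exp_increasing. lra.
Qed.

Lemma RInt_split (f : R -> R) a b c : (forall x, continuous f x) ->
  RInt f a c = RInt f a b + RInt f b c :> R.
Proof.
  intros hf. symmetry.
  apply (RInt_Chasles (V := R_CompleteNormedModule) f a b c); now apply ex_RInt_cont.
Qed.

Lemma LInt_correct c f : 0 < c -> exp_dom c f ->
  is_lim_seq (fun n => RInt f 0 (INR n)) (LInt f).
Proof.
  intros hc [hf [C hC]].
  apply Lim_seq_correct'. apply ex_lim_seq_cauchy_corr.
  assert (hC0 := exp_dominated_pos _ _ _ hC).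
  intros eps.
  assert (hl : is_lim_seq (fun n => C / c * exp (- c * INR n)) 0).
  { replace (Finite 0) with (Rbar_mult (C / c) 0) by (simpl; f_equal; ring).
    apply is_lim_seq_scal_l. now apply is_lim_seq_exp_opp. }
  apply is_lim_seq_spec in hl. destruct (hl eps) as [N HN].
  exists N.
  assert (key : forall n m, (N <= n)%nat -> (n <= m)%nat ->
    Rabs (RInt f 0 (INR m) - RInt f 0 (INR n)) < eps).
  { intros n m hn hm. rewrite (RInt_split f 0 (INR n) (INR m)) by assumption.
    rewrite Rplus_minus_l.
    eapply Rle_lt_trans.
    - apply (RInt_exp_dominated c f C); auto. split; [apply pos_INR|now apply le_INR].
    - specialize (HN n hn). rewrite Rminus_0_r in HN. apply Rabs_def2 in HN. lra. }
  intros n m hn hm. destruct (Nat.le_ge_cases n m) as [h|h].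
  - rewrite Rabs_minus_sym. now apply key.
  - now apply key.
Qed.

Lemma LInt_tail c f C X : 0 < c -> (forall x, continuous f x) -> exp_dominated c f C ->
  0 <= X -> Rabs (LInt f - RInt f 0 X) <= C / c * exp (- c * X).
Proof.
  intros hc hf hC hX.
  assert (hd : exp_dom c f) by (split; [exact hf|now exists C]).
  pose proof (LInt_correct c f hc hd) as hl.
  assert (hl2 : is_lim_seq (fun n => Rabs (RInt f 0 (INR n) - RInt f 0 X)) (Rabs (LInt f - RInt f 0 X))).
  { apply (is_lim_seq_abs (fun n => RInt f 0 (INR n) - RInt f 0 X) (LInt f - RInt f 0 X)).
    apply is_lim_seq_minus'; [exact hl|apply is_lim_seq_const]. }
  destruct (nfloor_ex X hX) as [N HN].
  apply (is_lim_seq_incr_n _ (S N)) in hl2.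
  refine (is_lim_seq_le _ (fun _ => C / c * exp (- c * X)) _ _ _ hl2 (is_lim_seq_const _)).
  intros n. rewrite (RInt_split f 0 X) by assumption.
  rewrite Rplus_minus_l.
  apply RInt_exp_dominated; auto. split; [assumption|].
  rewrite plus_INR, S_INR. pose proof (pos_INR n). lra.
Qed.

Lemma LInt_bound c f C : 0 < c -> (forall x, continuous f x) -> exp_dominated c f C ->
  Rabs (LInt f) <= C / c.
Proof.
  intros hc hf hC. pose proof (LInt_tail c f C 0 hc hf hC ltac:(lra)) as h.
  rewrite RInt_point in h. change (@zero R_CompleteNormedModule) with 0 in h.
  rewrite Rminus_0_r, Rmult_0_r, exp_0, Rmult_1_r in h. exact h.
Qed.

Lemma exp_dom_lin c f g a b : exp_dom c f -> exp_dom c g -> exp_dom c (fun x => a * f x + b * g x).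
Proof.
  intros [hf [C hC]] [hg [D hD]]. split.
  - intros x. apply (continuous_plus (fun x => a * f x) (fun x => b * g x)).
    + apply (continuous_scal_r (K := R_AbsRing) a f), hf.
    + apply (continuous_scal_r (K := R_AbsRing) b g), hg.
  - exists (Rabs a * C + Rabs b * D). intros x hx.
    eapply Rle_trans; [apply Rabs_triang|]. rewrite !Rabs_mult, Rmult_plus_distr_r, !Rmult_assoc.
    apply Rplus_le_compat; (apply Rmult_le_compat_l; [apply Rabs_pos|]); auto.
Qed.

Lemma LInt_lin c f g a b : 0 < c -> exp_dom c f -> exp_dom c g ->
  LInt (fun x => a * f x + b * g x) = a * LInt f + b * LInt g.
Proof.
  intros hc hf hg. unfold LInt at 1.
  rewrite (is_lim_seq_unique _ (a * LInt f + b * LInt g)); [reflexivity|].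
  apply is_lim_seq_ext with (fun n => a * RInt f 0 (INR n) + b * RInt g 0 (INR n)).
  - intros n. symmetry. apply is_RInt_unique.
    apply (is_RInt_plus (V := R_NormedModule) (fun x => a * f x) (fun x => b * g x)).
    + apply (is_RInt_scal (V := R_NormedModule) f).
      apply (RInt_correct (V := R_CompleteNormedModule)), ex_RInt_cont, hf.
    + apply (is_RInt_scal (V := R_NormedModule) g).
      apply (RInt_correct (V := R_CompleteNormedModule)), ex_RInt_cont, hg.
  - apply is_lim_seq_plus'.
    + apply (is_lim_seq_scal_l _ a (LInt f)). now apply LInt_correct with c.
    + apply (is_lim_seq_scal_l _ b (LInt g)). now apply LInt_correct with c.
Qed.

Lemma LInt_bounded_functional c : 0 < c ->
  bounded_functional (exp_dom c) LInt (fun x => 0 <= x) (fun x => exp (- c * x)) (/ c).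
Proof.
  intros hc. split.
  - intros f g a b hf hg. split; [now apply exp_dom_lin|now apply LInt_lin with c].
  - intros f B [hf _] hB h. now apply LInt_bound.
Qed.

Lemma exp_dominated_weaken c c' f C : c' <= c -> exp_dominated c f C -> exp_dominated c' f C.
Proof.
  intros hc h x hx. eapply Rle_trans; [now apply h|].
  apply Rmult_le_compat_l; [now apply exp_dominated_pos in h|]. apply exp_le_compat. nra.
Qed.

Lemma LInt_is_lim c f (l : R) (F : R -> R) : 0 < c -> exp_dom c f ->
  (forall X, 0 <= X -> RInt f 0 X = F X) -> is_lim_seq (fun n => F (INR n)) l -> LInt f = l.
Proof.
  intros hc hf hF hl.
  pose proof (LInt_correct c f hc hf) as h.
  apply (is_lim_seq_ext _ (fun n => F (INR n))) in h.
  - apply is_lim_seq_unique in h. apply is_lim_seq_unique in hl.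
    rewrite h in hl. exact (f_equal real hl).
  - intros n. apply hF, pos_INR.
Qed.

Lemma exp_dom_exp c : exp_dom c (fun x => exp (- c * x)).
Proof.
  split; [intros x; apply continuous_exp_opp|].
  exists 1. intros x hx. rewrite Rabs_pos_eq; [lra|left; apply exp_pos].
Qed.

Lemma LInt_exp c : 0 < c -> LInt (fun x => exp (- c * x)) = / c.
Proof.
  intros hc. apply LInt_is_lim with c (fun X => (exp (- c * 0) - exp (- c * X)) / c).
  - assumption.
  - apply exp_dom_exp.
  - intros X hX. apply RInt_exp_opp. lra.
  - replace (/ c) with ((1 - 0) * / c) by ring. 
    apply (is_lim_seq_scal_r _ (/ c) (Finite (1 - 0))). apply is_lim_seq_minus'.
    + rewrite Rmult_0_r, exp_0. apply is_lim_seq_const.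
    + now apply is_lim_seq_exp_opp.
Qed.

(** With [t = e^(-x)], the integrals of [logistic l] and [logistic2 l] over the half-line are those
    of [t^(l-1) / (1 + t)] and [t^(l-1) / (1 + t)^2] over (0, 1): halves of Beta integrals. *)
Definition logistic (l x : R) : R := exp (- l * x) / (1 + exp (- x)).
Definition logistic2 (l x : R) : R := exp (- l * x) / (1 + exp (- x)) ^ 2.

Lemma logistic_exp_dom l : 0 < l -> exp_dom l (logistic l) /\ exp_dominated l (logistic l) 1.
Proof.
  intros hl.
  assert (hd : exp_dominated l (logistic l) 1).
  { intros x hx. unfold logistic. pose proof (exp_pos (- l * x)). pose proof (exp_pos (- x)).
    rewrite Rabs_pos_eq by (apply Rdiv_le_0_compat; lra).
    apply Rmult_le_reg_r with (1 + exp (- x)); [lra|]. field_simplify; nra. }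
  split; [|exact hd]. split; [|now exists 1].
  intros x. apply (ex_derive_continuous (V := R_NormedModule)). unfold logistic.
  auto_derive. pose proof (exp_pos (- x)). lra.
Qed.

Lemma logistic2_exp_dom l : 0 < l -> exp_dom l (logistic2 l).
Proof.
  intros hl. split.
  - intros x. apply (ex_derive_continuous (V := R_NormedModule)). unfold logistic2.
    auto_derive. pose proof (exp_pos (- x)).
    enough (0 < (1 + exp (- x)) * ((1 + exp (- x)) * 1)) by lra. nra.
  - exists 1. intros x hx. unfold logistic2. pose proof (exp_pos (- l * x)). pose proof (exp_pos (- x)).
    assert (1 <= (1 + exp (- x)) ^ 2) by nra.
    rewrite Rabs_pos_eq by (apply Rdiv_le_0_compat; lra).
    apply Rmult_le_reg_r with ((1 + exp (- x)) ^ 2); [lra|]. field_simplify; nra.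
Qed.

(** Integration by parts, through the derivative of [logistic l]; the constant 1/2 is the boundary
    value [logistic l 0]. *)
Lemma LInt_logistic2 l : 0 < l -> LInt (logistic2 l) = / 2 + (1 - l) * LInt (logistic l).
Proof.
  intros hl. destruct (logistic_exp_dom l hl) as [hd hb].
  assert (hdf : forall x, is_derive (logistic l) x ((1 - l) * logistic l x + - (1) * logistic2 l x)).
  { intros x. unfold logistic, logistic2. pose proof (exp_pos (- x)).
    auto_derive; [lra|]. field. lra. }
  assert (hdom := exp_dom_lin l _ _ (1 - l) (- (1)) hd (logistic2_exp_dom l hl)).
  assert (h : LInt (fun x => (1 - l) * logistic l x + - (1) * logistic2 l x) = - / 2).
  { apply LInt_is_lim with l (fun X => logistic l X - logistic l 0).
    - assumption.
    - exact hdom.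
    - intros X hX. apply RInt_FTC; [exact hdf|apply hdom].
    - replace (- / 2) with (0 - logistic l 0).
      + apply is_lim_seq_minus'; [|apply is_lim_seq_const].
        apply is_lim_seq_abs_0.
        apply is_lim_seq_le_le with (fun _ => 0) (fun n => 1 * exp (- l * INR n)).
        * intros n. split; [apply Rabs_pos|apply hb, pos_INR].
        * apply is_lim_seq_const.
        * apply is_lim_seq_ext with (fun n => exp (- l * INR n)); [intros; ring|].
          now apply is_lim_seq_exp_opp.
      + unfold logistic. rewrite Rmult_0_r, Ropp_0, exp_0. field. }
  rewrite (LInt_lin l) in h by (auto using logistic2_exp_dom). lra.
Qed.

Fixpoint alt_sum (u : nat -> R) (n : nat) : R :=
  match n with
  | O => 0
  | S m => alt_sum u m + (- 1) ^ m * u m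
  end.

(** The finite geometric series in [- e^(-x)] with exact remainder: [logistic l x = e^(-l x) -
    logistic (l + 1) x], iterated [n] times. *)
Lemma LInt_logistic_partial l n : 0 < l ->
  Rabs (LInt (logistic l) - alt_sum (fun j => / (l + INR j)) n) <= / (l + INR n).
Proof.
  intros hl. pose proof (pos_INR n) as hn.
  assert (h : LInt (logistic l) = alt_sum (fun j => / (l + INR j)) n +
    (- 1) ^ n * LInt (logistic (l + INR n))).
  { clear hn. induction n as [|n IH].
    - simpl. rewrite Rplus_0_r. ring.
    - rewrite IH. simpl alt_sum. rewrite Rplus_assoc. f_equal. pose proof (pos_INR n) as hn.
      assert (he : logistic (l + INR n) =
        (fun x => 1 * exp (- (l + INR n) * x) + - (1) * logistic (l + INR (S n)) x)).
      { apply functional_extensionality. intros x. unfold logistic. rewrite S_INR.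
        replace (- (l + (INR n + 1)) * x) with (- (l + INR n) * x + - x) by ring.
        rewrite exp_plus. pose proof (exp_pos (- x)). field. lra. }
      rewrite he, (LInt_lin (l + INR n)), LInt_exp; try lra.
      + simpl. ring.
      + apply exp_dom_exp.
      + destruct (logistic_exp_dom (l + INR (S n))) as [[h1 _] h2]; [rewrite S_INR; lra|].
        split; [exact h1|]. exists 1.
        apply exp_dominated_weaken with (2 := h2). rewrite S_INR. lra. }
  rewrite h. replace (alt_sum (fun j => / (l + INR j)) n + (- 1) ^ n * LInt (logistic (l + INR n)) -
    alt_sum (fun j => / (l + INR j)) n) with ((- 1) ^ n * LInt (logistic (l + INR n))) by ring.
  rewrite Rabs_mult, pow_1_abs, Rmult_1_l.
  destruct (logistic_exp_dom (l + INR n)) as [[h1 _] h2]; [lra|].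
  pose proof (LInt_bound (l + INR n) _ 1 ltac:(lra) h1 h2). unfold Rdiv in *. lra.
Qed.

(** * Reflection and translation of integrals over the line *)

Lemma RInt_reflect (f : R -> R) X : (forall x, continuous f x) ->
  RInt (fun x => f (- x)) 0 X = RInt f (- X) 0 :> R.
Proof.
  intros hf.
  assert (h := RInt_comp_lin (V := R_CompleteNormedModule) f (- 1) 0 0 X).
  rewrite <- (opp_RInt_swap (V := R_CompleteNormedModule) f 0 (- X)) by now apply ex_RInt_cont.
  replace (- 1 * 0 + 0) with 0 in h by ring. replace (- 1 * X + 0) with (- X) in h by ring.
  rewrite <- h by now apply ex_RInt_cont.
  rewrite <- (RInt_opp (V := R_CompleteNormedModule)).
  - apply RInt_ext. intros x _.
    change (f (- x) = - (- 1 * f (- 1 * x + 0))). 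
    replace (- 1 * x + 0) with (- x) by ring. ring.
  - apply ex_RInt_cont. intros x.
    apply (continuous_scal_r (K := R_AbsRing) (- 1) (fun y => f (- 1 * y + 0))).
    apply (continuous_comp (fun y => - 1 * y + 0) f); [|apply hf].
    apply (ex_derive_continuous (V := R_NormedModule)). auto_derive. auto.
Qed.

Lemma RInt_translate (f : R -> R) t a b : (forall x, continuous f x) ->
  RInt (fun x => f (x + t)) a b = RInt f (a + t) (b + t) :> R.
Proof.
  intros hf.
  assert (h := RInt_comp_lin (V := R_CompleteNormedModule) f 1 t a b).
  rewrite !Rmult_1_l in h. rewrite <- h by now apply ex_RInt_cont.
  apply RInt_ext. intros x _. change (f (x + t) = 1 * f (1 * x + t)). now rewrite !Rmult_1_l.
Qed.

Lemma exp_dom_comp (c : R) f t : 0 < c -> (forall x, continuous f x) ->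
  (exists C, forall x, Rabs (f x) <= C * exp (- c * Rabs x)) ->
  exp_dom c (fun x => f (x + t)) /\ exp_dom c (fun x => f (- x + t)).
Proof.
  intros hc hf [C hC].
  assert (hC0 : 0 <= C).
  { specialize (hC 0). rewrite Rabs_R0, Rmult_0_r, exp_0 in hC. pose proof (Rabs_pos (f 0)). lra. }
  assert (hb : forall x y, Rabs x <= Rabs y + Rabs t ->
    C * exp (- c * Rabs y) <= C * exp (c * Rabs t) * exp (- c * Rabs x)).
  { intros x y hxy. rewrite Rmult_assoc, <- exp_plus. apply Rmult_le_compat_l; [assumption|].
    apply exp_le_compat. nra. }
  split; split.
  - intros x. apply (continuous_comp (fun y => y + t) f); [|apply hf].
    apply (ex_derive_continuous (V := R_NormedModule)). auto_derive. auto.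
  - exists (C * exp (c * Rabs t)). intros x hx. eapply Rle_trans; [apply hC|].
    rewrite <- (Rabs_pos_eq x hx) at 2. apply hb.
    replace x with ((x + t) + - t) at 1 by ring. eapply Rle_trans; [apply Rabs_triang|].
    rewrite Rabs_Ropp. lra.
  - intros x. apply (continuous_comp (fun y => - y + t) f); [|apply hf].
    apply (ex_derive_continuous (V := R_NormedModule)). auto_derive. auto.
  - exists (C * exp (c * Rabs t)). intros x hx. eapply Rle_trans; [apply hC|].
    rewrite <- (Rabs_pos_eq x hx) at 2. apply hb.
    replace x with (- (- x + t) + t) at 1 by ring. eapply Rle_trans; [apply Rabs_triang|].
    rewrite Rabs_Ropp. lra.
Qed.

(** An integral over the line is written as two half-line integrals. At the cutoff [n] the two sides
    differ by the integrals over two intervals of length [|t|] adjacent to [n] and [- n], which are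
    exponentially small. *)
Lemma line_integral_translate (c : R) f t : 0 < c -> (forall x, continuous f x) ->
  (exists C, forall x, Rabs (f x) <= C * exp (- c * Rabs x)) ->
  LInt (fun x => f (x + t)) + LInt (fun x => f (- x + t)) = LInt f + LInt (fun x => f (- x)).
Proof.
  intros hc hf hC.
  destruct (exp_dom_comp c f t hc hf hC) as [h1 h2].
  destruct (exp_dom_comp c f 0 hc hf hC) as [h3 h4].
  replace (fun x => f (x + 0)) with f in h3
    by (apply functional_extensionality; intros x; now rewrite Rplus_0_r).
  replace (fun x => f (- x + 0)) with (fun x => f (- x)) in h4
    by (apply functional_extensionality; intros x; now rewrite Rplus_0_r).
  assert (hl : is_lim_seq (fun n => RInt (fun x => f (x + t)) 0 (INR n) + RInt (fun x => f (- x + t)) 0 (INR n)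
     - (RInt f 0 (INR n) + RInt (fun x => f (- x)) 0 (INR n)))
     (LInt (fun x => f (x + t)) + LInt (fun x => f (- x + t)) - (LInt f + LInt (fun x => f (- x))))).
  { apply is_lim_seq_minus'; apply is_lim_seq_plus'; now apply LInt_correct with c. }
  assert (h0 : is_lim_seq (fun n => RInt (fun x => f (x + t)) 0 (INR n) + RInt (fun x => f (- x + t)) 0 (INR n)
     - (RInt f 0 (INR n) + RInt (fun x => f (- x)) 0 (INR n))) 0).
  { apply is_lim_seq_ext with (fun n => RInt f (INR n) (INR n + t) - RInt f (- INR n) (- INR n + t)).
    - intros n. rewrite (RInt_translate f t) by assumption.
      rewrite (RInt_reflect (fun y => f (y + t))).
      + rewrite (RInt_translate f t) by assumption. rewrite (RInt_reflect f) by assumption.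
        rewrite (RInt_split f (- INR n) (- INR n + t) 0) by assumption.
        rewrite (RInt_split f (- INR n + t) (0 + t) 0) by assumption.
        rewrite (RInt_split f (0 + t) (INR n) (INR n + t)) by assumption.
        rewrite (RInt_split f 0 (0 + t) (INR n)) by assumption.
        rewrite <- (opp_RInt_swap (V := R_CompleteNormedModule) f (0 + t) 0) by now apply ex_RInt_cont.
        change (opp (RInt f (0 + t) 0)) with (- RInt f (0 + t) 0). ring.
      + intros x. apply h1.
    - destruct hC as [C hC].
      assert (hC0 : 0 <= C).
      { specialize (hC 0). rewrite Rabs_R0, Rmult_0_r, exp_0 in hC. pose proof (Rabs_pos (f 0)). lra. }
      assert (hs : forall y, Rabs (RInt f y (y + t)) <= Rabs t * (C * exp (c * Rabs t) * exp (- c * Rabs y))).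
      { intros y.
        replace (Rabs t) with (Rabs (y + t - y)) at 1 by (f_equal; ring).
        rewrite (Rabs_minus_sym (y + t) y).
        destruct (Rle_lt_dec y (y + t)) as [h|h].
        - rewrite Rabs_minus_sym, (Rabs_pos_eq (y + t - y)) by lra.
          apply (abs_RInt_le_const f); [assumption|now apply ex_RInt_cont|].
          intros x hx. eapply Rle_trans; [apply hC|]. rewrite Rmult_assoc, <- exp_plus.
          apply Rmult_le_compat_l; [assumption|]. apply exp_le_compat.
          assert (Rabs y <= Rabs x + Rabs t).
          { replace y with (x + (y - x)) by ring. eapply Rle_trans; [apply Rabs_triang|].
            rewrite (Rabs_minus_sym y x), (Rabs_pos_eq (x - y)), (Rabs_pos_eq t) by lra. 
            replace (x + (y - x)) with y by ring. lra. }
          nra.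
        - rewrite <- (opp_RInt_swap (V := R_CompleteNormedModule) f (y + t) y) by now apply ex_RInt_cont.
          change (opp (RInt f (y + t) y)) with (- RInt f (y + t) y). rewrite Rabs_Ropp.
          rewrite (Rabs_pos_eq (y - (y + t))) by lra.
          apply (abs_RInt_le_const f); [lra|now apply ex_RInt_cont|].
          intros x hx. eapply Rle_trans; [apply hC|]. rewrite Rmult_assoc, <- exp_plus.
          apply Rmult_le_compat_l; [assumption|]. apply exp_le_compat.
          assert (Rabs y <= Rabs x + Rabs t).
          { replace y with (x + (y - x)) by ring. eapply Rle_trans; [apply Rabs_triang|].
            rewrite (Rabs_pos_eq (y - x)), (Rabs_left t) by lra. 
            replace (x + (y - x)) with y by ring. lra. }
          nra. }
      apply is_lim_seq_abs_0.
      apply is_lim_seq_le_le with (fun _ => 0) (fun n => 2 * (Rabs t * (C * exp (c * Rabs t))) * exp (- c * INR n)).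
      + intros n. split; [apply Rabs_pos|].
        unfold Rminus at 1. eapply Rle_trans; [apply Rabs_triang|]. rewrite Rabs_Ropp.
        pose proof (hs (INR n)) as e1. pose proof (hs (- INR n)) as e2.
        rewrite Rabs_Ropp in e2. rewrite (Rabs_pos_eq (INR n)) in e1, e2 by apply pos_INR. lra.
      + apply is_lim_seq_const.
      + replace (Finite 0) with (Rbar_mult (2 * (Rabs t * (C * exp (c * Rabs t)))) 0)
          by (simpl; f_equal; ring).
        apply is_lim_seq_scal_l. now apply is_lim_seq_exp_opp. }
  apply is_lim_seq_unique in hl. apply is_lim_seq_unique in h0.
  rewrite hl in h0. apply (f_equal real) in h0. simpl in h0. lra.
Qed.

(** * Fourier series and partial fractions *)

(** The truncation is symmetric, so that sums of cosines become Dirichlet kernels. *)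
Fixpoint zsum (N : nat) (f : Z -> R) : R :=
  match N with
  | O => f 0%Z
  | S n => zsum n f + (f (Z.of_nat (S n)) + f (- Z.of_nat (S n))%Z)
  end.

Lemma zsum_ext N f g : (forall m, f m = g m) -> zsum N f = zsum N g.
Proof. intros h. induction N as [|N IH]; cbn [zsum]; now rewrite ?IH, ?h. Qed.

Lemma zsum_lin N f g a b : zsum N (fun m => a * f m + b * g m) = a * zsum N f + b * zsum N g.
Proof. induction N as [|N IH]; cbn [zsum]; [ring|rewrite IH; ring]. Qed.

Lemma zsum_scal N f a : zsum N (fun m => a * f m) = a * zsum N f.
Proof. induction N as [|N IH]; cbn [zsum]; [ring|rewrite IH; ring]. Qed.

Lemma zsum_le N f g : (forall m, f m <= g m) -> zsum N f <= zsum N g.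
Proof.
  intros h. induction N as [|N IH]; cbn [zsum]; [apply h|].
  pose proof (h (Z.of_nat (S N))). pose proof (h (- Z.of_nat (S N))%Z). lra.
Qed.

Lemma RInt_Rplus (f g : R -> R) a b : (forall x, continuous f x) -> (forall x, continuous g x) ->
  RInt (fun x => f x + g x) a b = RInt f a b + RInt g a b :> R.
Proof.
  intros hf hg. exact (RInt_plus (V := R_CompleteNormedModule) f g a b
    (ex_RInt_cont _ _ _ hf) (ex_RInt_cont _ _ _ hg)).
Qed.

Lemma RInt_Rscal (f : R -> R) c a b : (forall x, continuous f x) ->
  RInt (fun x => c * f x) a b = c * RInt f a b :> R.
Proof.
  intros hf. exact (RInt_scal (V := R_CompleteNormedModule) f a b c (ex_RInt_cont _ _ _ hf)).
Qed.

Lemma continuous_Rmult (f g : R -> R) x : continuous f x -> continuous g x ->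
  continuous (fun y => f y * g y) x.
Proof. intros hf hg. exact (continuous_mult (K := R_AbsRing) f g x hf hg). Qed.

Lemma continuous_Rplus (f g : R -> R) x : continuous f x -> continuous g x ->
  continuous (fun y => f y + g y) x.
Proof. intros hf hg. exact (continuous_plus (V := R_NormedModule) f g x hf hg). Qed.

Lemma continuous_ex_derive (f : R -> R) x : ex_derive f x -> continuous f x.
Proof. intros h. now apply (ex_derive_continuous (V := R_NormedModule)). Qed.

Lemma zsum_continuous N (f : Z -> R -> R) x : (forall m, continuous (f m) x) ->
  continuous (fun y => zsum N (fun m => f m y)) x.
Proof.
  intros h. induction N as [|N IH]; cbn [zsum]; [apply h|].
  apply (continuous_Rplus (fun y => zsum N (fun m => f m y))); [exact IH|].
  apply (continuous_Rplus (f (Z.of_nat (S N)))); apply h.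
Qed.

Lemma zsum_RInt N (f : Z -> R -> R) a b : (forall m x, continuous (f m) x) ->
  zsum N (fun m => RInt (f m) a b) = RInt (fun x => zsum N (fun m => f m x)) a b.
Proof.
  intros h. induction N as [|N IH]; cbn [zsum]; [reflexivity|].
  rewrite (RInt_Rplus (fun x => zsum N (fun m => f m x))), RInt_Rplus, IH; auto.
  - intros x. apply zsum_continuous. intros m. apply h.
  - intros x. apply (continuous_Rplus (f (Z.of_nat (S N)))); apply h.
Qed.

(** Shifting the integrand by half a period of the sine changes the sign of the
    integral, so uniform continuity alone forces it to vanish in the limit. *)
Lemma riemann_lebesgue (q : R -> R) (b : R) : 0 < b -> (forall x, continuous q x) ->
  is_lim_seq (fun N => RInt (fun y => q y * sin ((2 * INR N + 1) * y)) 0 b) 0.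
Proof.
  intros hb hq.
  destruct (bounded_continuity (K := R_AbsRing) (V := R_NormedModule) q 0 (b + 4)) as [M hM].
  { intros x _. apply hq. }
  assert (hM0 : 0 < M).
  { eapply Rle_lt_trans; [|apply (hM 0); lra]. apply norm_ge_0. }
  apply is_lim_seq_spec. intros eps.
  assert (he : 0 < eps / (b + 1)) by (apply Rdiv_lt_0_compat; [apply cond_pos|lra]).
  destruct (unifcont_1d (V := R_UniformSpace) q 0 (b + 4) (fun x _ => hq x) (mkposreal _ he)) as [d hd].
  (* The shift [h] stays below [D] for three reasons: below [d] for uniform continuity, below 1 so
     that shifted points remain where [q] is controlled, and below [eps / (8 M)] so that the end
     pieces are negligible. *)
  set (D := Rmin d (Rmin 1 (eps / (8 * M)))).
  assert (hD : 0 < D).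
  { apply Rmin_glb_lt; [apply cond_pos|]. apply Rmin_glb_lt; [lra|].
    apply Rdiv_lt_0_compat; [apply cond_pos|lra]. }
  destruct (nfloor_ex (PI / D)) as [N0 HN0].
  { apply Rdiv_le_0_compat; [left; apply PI_RGT_0|assumption]. }
  exists (S N0). intros N HN. rewrite Rminus_0_r.
  set (l := 2 * INR N + 1).
  assert (hl : PI / D < l).
  { apply le_INR in HN. rewrite S_INR in HN. unfold l. pose proof (pos_INR N0). lra. }
  assert (hpid : 0 < PI / D) by (apply Rdiv_lt_0_compat; [apply PI_RGT_0|assumption]).
  set (h := PI / l).
  assert (hh : 0 < h) by (apply Rdiv_lt_0_compat; [apply PI_RGT_0|lra]).
  assert (hhD : h < D).
  { unfold h. apply Rmult_lt_reg_r with l; [lra|]. apply Rmult_lt_reg_r with (/ D);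
    [now apply Rinv_0_lt_compat|]. field_simplify; [|lra|lra]. unfold Rdiv in *. lra. }
  assert (h1 : h < d) by (eapply Rlt_le_trans; [exact hhD|apply Rmin_l]).
  assert (h2 : h < 1).
  { eapply Rlt_le_trans; [exact hhD|]. eapply Rle_trans; [apply Rmin_r|apply Rmin_l]. }
  assert (h3 : h < eps / (8 * M)).
  { eapply Rlt_le_trans; [exact hhD|]. eapply Rle_trans; [apply Rmin_r|apply Rmin_r]. }
  set (g := fun y => q y * sin (l * y)).
  assert (hsin : forall x, continuous (fun y => sin (l * y)) x).
  { intros x. apply continuous_ex_derive. auto_derive. auto. }
  assert (hqh : forall x, continuous (fun y => q (y + h)) x).
  { intros x. apply (continuous_comp (fun y => y + h) q); [|apply hq].
    apply continuous_ex_derive. auto_derive. auto. }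
  assert (hg : forall x, continuous g x) by (intros x; now apply continuous_Rmult).
  set (k := fun y => q (y + h) * sin (l * y)).
  assert (hk : forall x, continuous k x) by (intros x; now apply continuous_Rmult).
  assert (e1 : RInt g 0 b = - RInt k (- h) (b - h) :> R).
  { pose proof (RInt_translate g h (- h) (b - h) hg) as et.
    rewrite Rplus_opp_l in et. replace (b - h + h) with b in et by ring. rewrite <- et.
    assert (e : RInt (fun x => g (x + h)) (- h) (b - h) = RInt (fun x => - 1 * k x) (- h) (b - h) :> R).
    { apply (RInt_ext (V := R_CompleteNormedModule)). intros x _. unfold g, k.
      replace (l * (x + h)) with (l * x + PI) by (unfold h; field; lra).
      rewrite neg_sin. real_eq. ring. }
    rewrite e, RInt_Rscal by assumption. real_eq. ring. }
  assert (e2 : RInt k (- h) (b - h) = RInt k (- h) 0 + RInt k 0 b - RInt k (b - h) b :> R).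
  { rewrite (RInt_split k (- h) 0 (b - h)) by assumption.
    rewrite (RInt_split k 0 (b - h) b) by assumption. lra. }
  assert (e3 : Rabs (RInt k (- h) 0) <= (0 - - h) * M).
  { apply abs_RInt_le_const; [lra|now apply ex_RInt_cont|]. intros t ht. unfold k.
    rewrite Rabs_mult. rewrite <- (Rmult_1_r M). apply Rmult_le_compat; try apply Rabs_pos.
    - left. apply (hM (t + h)). lra.
    - apply Rabs_le. apply SIN_bound. }
  assert (e4 : Rabs (RInt k (b - h) b) <= (b - (b - h)) * M).
  { apply abs_RInt_le_const; [lra|now apply ex_RInt_cont|]. intros t ht. unfold k.
    rewrite Rabs_mult. rewrite <- (Rmult_1_r M). apply Rmult_le_compat; try apply Rabs_pos.
    - left. apply (hM (t + h)). lra.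
    - apply Rabs_le. apply SIN_bound. }
  assert (e5 : Rabs (RInt (fun y => g y + - 1 * k y) 0 b) <= (b - 0) * (eps / (b + 1))).
  { apply abs_RInt_le_const; [lra| |].
    - apply ex_RInt_cont. intros x. apply continuous_Rplus; [apply hg|].
      apply continuous_Rmult; [apply continuous_const|apply hk].
    - intros t ht. unfold g, k.
      replace (q t * sin (l * t) + -1 * (q (t + h) * sin (l * t))) with
        ((q t - q (t + h)) * sin (l * t)) by ring.
      rewrite Rabs_mult. rewrite <- (Rmult_1_r (eps / (b + 1))).
      apply Rmult_le_compat; try apply Rabs_pos.
      + apply Rnot_lt_le. intros hlt. apply (hd t (t + h)); [lra|lra| |].
        * change (Rabs (t + h - t) < d). replace (t + h - t) with h by ring.
          rewrite Rabs_pos_eq; lra.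
        * intros hball. change (Rabs (q (t + h) - q t) < eps / (b + 1)) in hball.
          rewrite Rabs_minus_sym in hball. lra.
      + apply Rabs_le. apply SIN_bound. }
  rewrite (RInt_Rplus g), RInt_Rscal in e5; auto.
  2:{ intros x. apply continuous_Rmult; [apply continuous_const|apply hk]. }
  assert (e6 : (b - 0) * (eps / (b + 1)) < eps).
  { apply Rmult_lt_reg_r with (b + 1); [lra|]. field_simplify; [|lra]. 
    pose proof (cond_pos eps). lra. }
  assert (e7 : h * M * 8 < eps).
  { apply Rmult_lt_compat_r with (r := 8 * M) in h3; [|lra].
    replace (eps / (8 * M) * (8 * M)) with (pos eps) in h3 by (field; lra). lra. }
  change (Rabs (RInt g 0 b) < eps).

  set (A := RInt g 0 b : R) in *. set (B := RInt k 0 b : R) in *.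
  set (B1 := RInt k (- h) 0 : R) in *. set (B2 := RInt k (b - h) b : R) in *.
  (* Averaging the integral with its shifted form leaves the integral of [g - k], small by uniform
     continuity, and two end pieces of length [h]. *)
  assert (e8 : 2 * A = (A + - 1 * B) - B1 + B2) by lra.
  assert (e9 : Rabs (2 * A) < 2 * eps).
  { rewrite e8. eapply Rle_lt_trans; [apply Rabs_triang|].
    eapply Rle_lt_trans; [apply Rplus_le_compat_r, Rabs_triang|]. rewrite Rabs_Ropp. nra. }
  rewrite Rabs_mult, (Rabs_pos_eq 2) in e9 by lra. lra.
Qed.

Lemma sin_Zpi m : sin (IZR m * PI) = 0.
Proof. apply sin_eq_0_1. now exists m. Qed.

Lemma dirichlet_kernel N y :
  zsum N (fun m => cos (2 * IZR m * y)) * sin y = sin ((2 * INR N + 1) * y).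
Proof.
  induction N as [|N IH]; cbn [zsum].
  - simpl INR. replace (2 * 0 * y) with 0 by ring. rewrite cos_0, Rmult_1_l. f_equal. ring.
  - rewrite Rmult_plus_distr_r, IH, opp_IZR, <- INR_IZR_INZ.
    replace (2 * - INR (S N) * y) with (- (2 * INR (S N) * y)) by ring.
    rewrite cos_neg.
    replace ((2 * INR (S N) + 1) * y) with (2 * INR (S N) * y + y) by ring.
    replace ((2 * INR N + 1) * y) with (2 * INR (S N) * y - y) by (rewrite S_INR; ring).
    rewrite sin_minus, sin_plus. ring.
Qed.

Lemma RInt_cos_even m :
  RInt (fun y => cos (2 * IZR m * y)) 0 (PI / 2) = (if Z.eq_dec m 0 then PI / 2 else 0) :> R.
Proof.
  destruct (Z.eq_dec m 0) as [->|hm].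
  - rewrite (RInt_FTC (fun y => y)).
    + field.
    + intros x. auto_derive; [auto|]. replace (2 * 0 * x) with 0 by ring. now rewrite cos_0.
    + intros x. apply continuous_ex_derive. auto_derive. auto.
  - assert (hm' : IZR m <> 0) by now apply not_0_IZR.
    rewrite (RInt_FTC (fun y => sin (2 * IZR m * y) / (2 * IZR m)) (fun y => cos (2 * IZR m * y))).
    + replace (2 * IZR m * (PI / 2)) with (IZR m * PI) by field. rewrite sin_Zpi, Rmult_0_r, sin_0.
      field. exact hm'.
    + intros x. auto_derive; [auto|]. field. exact hm'.
    + intros x. apply continuous_ex_derive. auto_derive. auto.
Qed.

Lemma zsum_delta N a f : (forall m, m <> 0%Z -> f m = 0) -> f 0%Z = a -> zsum N f = a.
Proof.
  intros h h0. induction N as [|N IH]; cbn [zsum]; [assumption|].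
  rewrite IH, !h by lia. ring.
Qed.

(** The amplitude that remains when [f - f 0] is integrated against the Dirichlet kernel
    [sin ((2 N + 1) y) / sin y]; the value [d] at 0 is meant to be the derivative of [f] there. *)
Definition sinc_quotient (f : R -> R) (d : R) (y : R) : R :=
  if Req_EM_T y 0 then d else (f y - f 0) / sin y.

Lemma sinc_quotient_continuous (f : R -> R) (d x : R) : 0 <= x <= PI / 2 ->
  (forall y, continuous f y) -> is_derive f 0 d -> continuous (sinc_quotient f d) x.
Proof.
  intros hx hf hd. 
  destruct (Req_EM_T x 0) as [->|hx0].
  - assert (h1 : is_lim (fun y => (f y - f 0) / y) 0 d).
    { apply is_derive_Reals in hd. apply is_lim_spec. intros eps.
      destruct (hd eps (cond_pos eps)) as [del hdel].
      exists del. intros y hy hy0. change (Rabs (y - 0) < del) in hy. rewrite Rminus_0_r in hy.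
      specialize (hdel y hy0 hy). now rewrite Rplus_0_l in hdel. }
    assert (h2 : is_lim (fun y => sin y / y) 0 1).
    { assert (hs : is_derive sin 0 1) by (auto_derive; [auto|rewrite cos_0; ring]).
      apply is_derive_Reals in hs. apply is_lim_spec. intros eps.
      destruct (hs eps (cond_pos eps)) as [del hdel].
      exists del. intros y hy hy0. change (Rabs (y - 0) < del) in hy. rewrite Rminus_0_r in hy.
      specialize (hdel y hy0 hy). now rewrite Rplus_0_l, sin_0, Rminus_0_r in hdel. }
    assert (h3 : is_lim (fun y => ((f y - f 0) / y) / (sin y / y)) 0 d).
    { replace (Finite d) with (Rbar_div d 1) by (simpl; f_equal; field).
      apply is_lim_div; auto; [|reflexivity]. intros h. injection h. lra. }
    apply is_lim_spec in h3.
    apply filterlim_locally. intros eps. destruct (h3 eps) as [del hdel].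
    assert (hm : 0 < Rmin del 1) by (apply Rmin_glb_lt; [apply cond_pos|lra]).
    exists (mkposreal _ hm). intros y hy. change (Rabs (y - 0) < Rmin del 1) in hy.
    change (Rabs (sinc_quotient f d y - sinc_quotient f d 0) < eps).
    unfold sinc_quotient. destruct (Req_EM_T 0 0) as [_|]; [|easy].
    destruct (Req_EM_T y 0) as [->|hy0].
    + replace (d - d) with 0 by ring. rewrite Rabs_R0. apply cond_pos.
    + assert (hb : ball 0 del y).
      { change (Rabs (y - 0) < del). eapply Rlt_le_trans; [exact hy|apply Rmin_l]. }
      specialize (hdel y hb hy0).
      assert (hy1 : Rabs y < 1).
      { rewrite Rminus_0_r in hy. eapply Rlt_le_trans; [exact hy|apply Rmin_r]. }
      assert (hsy : sin y <> 0).
      { apply Rabs_def2 in hy1. pose proof PI2_1. destruct (Rlt_le_dec 0 y) as [hp|hp].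
        - apply Rgt_not_eq, sin_gt_0; lra.
        - apply Rlt_not_eq, sin_lt_0_var; lra. }
      now replace ((f y - f 0) / sin y) with ((f y - f 0) / y / (sin y / y)) by (field; auto).
  - assert (hsx : sin x <> 0) by (apply Rgt_not_eq, sin_gt_0; lra).
    apply continuous_ext_loc with (fun y => (f y - f 0) * / sin y).
    + assert (hxp : 0 < x) by lra. exists (mkposreal x hxp). intros y hy.
      change (Rabs (y - x) < x) in hy. apply Rabs_def2 in hy.
      unfold sinc_quotient. destruct (Req_EM_T y 0); [lra|reflexivity].
    + apply continuous_Rmult.
      * apply (continuous_Rplus f (fun _ => - f 0)); [apply hf|apply continuous_const].
      * apply continuous_ex_derive. auto_derive. exact hsx.
Qed.

Lemma clamp_continuous a b x : continuous (fun y => Rmax a (Rmin y b)) x.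
Proof.
  apply filterlim_locally. intros eps. exists eps. intros y hy.
  change (Rabs (y - x) < eps) in hy. change (Rabs (Rmax a (Rmin y b) - Rmax a (Rmin x b)) < eps).
  apply Rabs_def2 in hy. apply Rabs_def1; unfold Rmax, Rmin;
    repeat destruct Rle_dec; lra.
Qed.

(** The cosine series of the even, pi-periodic extension of [f] from [0, pi/2], evaluated at 0.
    Summing the cosines gives the Dirichlet kernel; the constant [f 0] is reproduced exactly and the
    rest is a Riemann-Lebesgue integral. *)
Lemma fourier_half_period (f : R -> R) (d : R) :
  (forall x, continuous f x) -> is_derive f 0 d ->
  is_lim_seq (fun N => zsum N (fun m =>
    2 / PI * RInt (fun y => f y * cos (2 * IZR m * y)) 0 (PI / 2))) (f 0).
Proof.
  intros hf hd. pose proof PI_RGT_0 as hpi.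
  (* Clamping the argument to [0, pi/2] gives a function continuous on the whole line, away from the
     further zeros of the sine. *)
  set (q := fun y => sinc_quotient f d (Rmax 0 (Rmin y (PI / 2)))).
  assert (hq : forall x, continuous q x).
  { intros x. apply (continuous_comp (fun y => Rmax 0 (Rmin y (PI / 2))) (sinc_quotient f d)).
    - apply clamp_continuous.
    - apply sinc_quotient_continuous; auto. unfold Rmax, Rmin. repeat destruct Rle_dec; lra. }
  assert (hc : forall m x, continuous (fun y => cos (2 * IZR m * y)) x).
  { intros m x. apply continuous_ex_derive. auto_derive. auto. }
  assert (hK : forall N x, continuous (fun y => zsum N (fun m => cos (2 * IZR m * y))) x).
  { intros N x. apply (zsum_continuous N (fun m y => cos (2 * IZR m * y))). intros m. apply hc. }
  assert (hs : forall N x, continuous (fun y => sin ((2 * INR N + 1) * y)) x).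
  { intros N x. apply continuous_ex_derive. auto_derive. auto. }
  apply is_lim_seq_ext with (fun N =>
    2 / PI * RInt (fun y => q y * sin ((2 * INR N + 1) * y)) 0 (PI / 2) + f 0).
  - intros N. rewrite zsum_scal, zsum_RInt by (intros m x; now apply continuous_Rmult).
    assert (e1 : RInt (fun x => zsum N (fun m => f x * cos (2 * IZR m * x))) 0 (PI / 2) =
      RInt (fun y => q y * sin ((2 * INR N + 1) * y) +
         f 0 * zsum N (fun m => cos (2 * IZR m * y))) 0 (PI / 2) :> R).
    { apply (RInt_ext (V := R_CompleteNormedModule)). intros x hx.
      rewrite Rmin_left, Rmax_right in hx by lra.
      rewrite zsum_scal, <- dirichlet_kernel. unfold q.
      rewrite Rmin_left, Rmax_right by lra. unfold sinc_quotient.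
      destruct (Req_EM_T x 0); [lra|].
      assert (hsx : sin x <> 0) by (apply Rgt_not_eq, sin_gt_0; lra).
      change (f x * zsum N (fun m => cos (2 * IZR m * x)) =
       (f x - f 0) / sin x * (zsum N (fun m => cos (2 * IZR m * x)) * sin x) +
        f 0 * zsum N (fun m => cos (2 * IZR m * x))). field. exact hsx. }
    rewrite e1, (RInt_Rplus (fun y => q y * sin ((2 * INR N + 1) * y))).
    + rewrite RInt_Rscal by apply hK.
      rewrite <- (zsum_RInt N (fun m y => cos (2 * IZR m * y))) by (intros; apply hc).
      rewrite (zsum_delta N (PI / 2)).
      * field. lra.
      * intros m hm. rewrite RInt_cos_even. now destruct (Z.eq_dec m 0).
      * rewrite RInt_cos_even. reflexivity.
    + intros x. now apply continuous_Rmult.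
    + intros x. apply continuous_Rmult; [apply continuous_const|apply hK].
  - replace (Finite (f 0)) with (Finite (2 / PI * 0 + f 0)) by (f_equal; ring).
    apply is_lim_seq_plus'; [|apply is_lim_seq_const].
    apply (is_lim_seq_scal_l _ (2 / PI) (Finite 0)). apply riemann_lebesgue; [lra|exact hq].
Qed.

(** The function [cosh (2 v (pi/2 - y))] has cosine coefficients proportional to [1 / (m^2 + v^2)]:
    its derivative vanishes at [pi/2], so only the endpoint 0 contributes to two integrations by
    parts. *)
Lemma coth_partial_fractions v : 0 < v ->
  is_lim_seq (fun N => zsum N (fun m => / (IZR m ^ 2 + v ^ 2)))
    (PI * cosh (PI * v) / (v * sinh (PI * v))).
Proof.
  intros hv. pose proof PI_RGT_0 as hpi.
  assert (hsh : 0 < sinh (PI * v)) by (rewrite <- sinh_0; apply sinh_lt; nra).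
  set (f := fun y => cosh (2 * v * (PI / 2 - y))).
  assert (hf : forall x, is_derive f x (- 2 * v * sinh (2 * v * (PI / 2 - x)))).
  { intros x. unfold f. auto_derive; [auto|]. unfold Rminus. ring. }
  assert (h := fourier_half_period f _ (fun x => is_derive_continuous _ _ _ (hf x)) (hf 0)).
  apply (is_lim_seq_scal_l _ (PI / (v * sinh (PI * v)))) in h.
  replace (Finite (PI * cosh (PI * v) / (v * sinh (PI * v)))) with
    (Rbar_mult (PI / (v * sinh (PI * v))) (f 0)).
  2:{ simpl. f_equal. unfold f. replace (2 * v * (PI / 2 - 0)) with (PI * v) by field. field. lra. }
  revert h. apply is_lim_seq_ext. intros N.
  rewrite <- zsum_scal. apply zsum_ext. intros m.
  assert (hden : 0 < IZR m ^ 2 + v ^ 2) by (pose proof (pow2_ge_0 (IZR m)); nra).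
  rewrite (RInt_FTC (fun y => (- 2 * v * sinh (2 * v * (PI / 2 - y)) * cos (2 * IZR m * y) +
    2 * IZR m * cosh (2 * v * (PI / 2 - y)) * sin (2 * IZR m * y)) / (4 * (IZR m ^ 2 + v ^ 2)))).
  - replace (2 * v * (PI / 2 - PI / 2)) with 0 by ring.
    replace (2 * IZR m * (PI / 2)) with (IZR m * PI) by field.
    replace (2 * v * (PI / 2 - 0)) with (PI * v) by field.
    rewrite Rmult_0_r, sin_0, cos_0, sinh_0, sin_Zpi. field. lra.
  - intros x. unfold f. auto_derive; [auto|].
    replace (PI / 2 + - x) with (PI / 2 - x) by ring. field. lra.
  - intros x. apply continuous_ex_derive. unfold f. auto_derive. auto.
Qed.

(** The same method with [cos (2 z y)]. Here the endpoint [pi/2] contributes, which produces the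
    alternating sign [cos (m pi)]. *)
Lemma sin_partial_fractions z : 0 < z < 1 ->
  is_lim_seq (fun N => zsum N (fun m => cos (IZR m * PI) * (z ^ 2 / (z ^ 2 - IZR m ^ 2))))
    (PI * z / sin (PI * z)).
Proof.
  intros hz. pose proof PI_RGT_0 as hpi.
  assert (hsh : 0 < sin (PI * z)) by (apply sin_gt_0; nra).
  set (f := fun y => cos (2 * z * y)).
  assert (hf : forall x, is_derive f x (- 2 * z * sin (2 * z * x))).
  { intros x. unfold f. auto_derive; [auto|]. ring. }
  assert (h := fourier_half_period f _ (fun x => is_derive_continuous _ _ _ (hf x)) (hf 0)).
  apply (is_lim_seq_scal_l _ (PI * z / sin (PI * z))) in h.
  replace (Finite (PI * z / sin (PI * z))) with (Rbar_mult (PI * z / sin (PI * z)) (f 0)).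
  2:{ simpl. f_equal. unfold f. rewrite Rmult_0_r, cos_0. ring. }
  revert h. apply is_lim_seq_ext. intros N.
  rewrite <- zsum_scal. apply zsum_ext. intros m.
  assert (hden : z ^ 2 - IZR m ^ 2 <> 0).
  { intros he. destruct (Z.eq_dec m 0) as [->|hm]; [nra|].
    assert (1 <= IZR m ^ 2).
    { replace (IZR m ^ 2) with (IZR (m * m)) by (rewrite mult_IZR; ring). apply IZR_le. nia. }
    nra. }
  rewrite (RInt_FTC (fun y => (2 * z * sin (2 * z * y) * cos (2 * IZR m * y) -
    2 * IZR m * cos (2 * z * y) * sin (2 * IZR m * y)) / (4 * (z ^ 2 - IZR m ^ 2)))).
  - replace (2 * z * (PI / 2)) with (PI * z) by field.
    replace (2 * IZR m * (PI / 2)) with (IZR m * PI) by field.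
    rewrite !Rmult_0_r, sin_0, cos_0, sin_Zpi. field. lra.
  - intros x. unfold f. auto_derive; [auto|]. field. lra.
  - intros x. apply continuous_ex_derive. unfold f. auto_derive. auto.
Qed.

Lemma cos_Zpi_nat n : cos (IZR (Z.of_nat n) * PI) = (- 1) ^ n.
Proof.
  induction n as [|n IH].
  - simpl. now rewrite Rmult_0_l, cos_0.
  - rewrite Nat2Z.inj_succ, succ_IZR, Rmult_plus_distr_r, Rmult_1_l, neg_cos, IH. simpl. ring.
Qed.

Lemma cos_Zpi_opp m : cos (IZR (- m) * PI) = cos (IZR m * PI).
Proof. rewrite opp_IZR, Ropp_mult_distr_l_reverse. apply cos_neg. Qed.

(** The terms at [m] and [- m] together split as [2 z^2 / (z^2 - m^2) = z (1 / (m + z) - 1 / (m -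
    z))], with [m = j + 1]. *)
Lemma sin_fractions_alt_sum z N : 0 < z < 1 ->
  zsum N (fun m => cos (IZR m * PI) * (z ^ 2 / (z ^ 2 - IZR m ^ 2))) =
  1 + z * (alt_sum (fun j => / (1 - z + INR j)) N - alt_sum (fun j => / (1 + z + INR j)) N).
Proof.
  intros hz. induction N as [|N IH]; cbn [zsum alt_sum].
  - rewrite Rmult_0_l, cos_0. field. nra.
  - rewrite IH, cos_Zpi_opp, cos_Zpi_nat, opp_IZR, <- INR_IZR_INZ, S_INR.
    pose proof (pos_INR N) as hN. simpl pow. field.
    repeat split; nra.
Qed.

Lemma is_lim_seq_inv_shift l : 0 < l -> is_lim_seq (fun n => / (l + INR n)) 0.
Proof.
  intros hl. apply (is_lim_seq_inv _ p_infty); [|easy].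
  apply (is_lim_seq_plus (fun _ => l) INR l p_infty); [apply is_lim_seq_const|apply is_lim_seq_INR|easy].
Qed.

Lemma is_lim_seq_unique_R (u : nat -> R) (a b : R) : is_lim_seq u a -> is_lim_seq u b -> a = b.
Proof.
  intros h1 h2. apply is_lim_seq_unique in h1. apply is_lim_seq_unique in h2.
  rewrite h1 in h2. exact (f_equal real h2).
Qed.

(** This is B(1 - z, 1 + z) = pi z / sin (pi z). The integral of [t^(-z) / (1 + t)^2] over (0, oo)
    is cut at 1 and its outer part inverted by [t -> 1/t]; both halves expand into the alternating
    sums of the partial fractions of the sine. *)
Lemma beta_reflection z : 0 < z < 1 ->
  LInt (logistic2 (1 - z)) + LInt (logistic2 (1 + z)) = PI * z / sin (PI * z).
Proof.
  intros hz. rewrite !LInt_logistic2 by lra.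
  apply is_lim_seq_unique_R with (fun N => 1 + z *
    (alt_sum (fun j => / (1 - z + INR j)) N - alt_sum (fun j => / (1 + z + INR j)) N)).
  - replace (/ 2 + (1 - (1 - z)) * LInt (logistic (1 - z)) + (/ 2 + (1 - (1 + z)) * LInt (logistic (1 + z))))
      with (1 + z * (LInt (logistic (1 - z)) - LInt (logistic (1 + z)))) by field.
    apply is_lim_seq_plus'; [apply is_lim_seq_const|].
    apply (is_lim_seq_scal_l _ z (Finite _)).
    assert (h : forall l, 0 < l ->
      is_lim_seq (fun N => alt_sum (fun j => / (l + INR j)) N) (LInt (logistic l))).
    { intros l hl.
      apply is_lim_seq_ext with (fun N => LInt (logistic l) -
        (LInt (logistic l) - alt_sum (fun j => / (l + INR j)) N)); [intros; ring|].
      replace (Finite (LInt (logistic l))) with (Finite (LInt (logistic l) - 0)) by (f_equal; ring).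
      apply is_lim_seq_minus'; [apply is_lim_seq_const|].
      apply is_lim_seq_abs_0. apply is_lim_seq_le_le with (fun _ => 0) (fun N => / (l + INR N)).
      - intros n. split; [apply Rabs_pos|now apply LInt_logistic_partial].
      - apply is_lim_seq_const.
      - now apply is_lim_seq_inv_shift. }
    apply is_lim_seq_minus'; apply h; lra.
  - apply is_lim_seq_ext with (2 := sin_partial_fractions z hz).
    intros N. now apply sin_fractions_alt_sum.
Qed.

(** * The resolvent representation of powers *)

(** The integrand [u^(1-s) (u + a)^(-2) du] at [u = e^x]; the exponent [2 - s] includes the factor
    [u] from [du = u dx]. *)
Definition resolvent_kernel (s a x : R) : R := exp ((2 - s) * x) / (exp x + a) ^ 2.

Lemma resolvent_kernel_continuous s a x : 0 < a -> continuous (resolvent_kernel s a) x.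
Proof.
  intros ha. apply continuous_ex_derive. unfold resolvent_kernel. auto_derive.
  pose proof (exp_pos x). apply Rgt_not_eq. nra.
Qed.

Lemma resolvent_kernel_one_bound s x : 1 < s < 2 ->
  Rabs (resolvent_kernel s 1 x) <= 1 * exp (- (2 - s) * Rabs x).
Proof.
  intros hs. unfold resolvent_kernel. pose proof (exp_pos x) as h1.
  pose proof (exp_pos ((2 - s) * x)) as h2.
  rewrite Rabs_pos_eq by (apply Rdiv_le_0_compat; [lra|apply pow_lt; lra]).
  rewrite Rmult_1_l.
  apply Rmult_le_reg_r with ((exp x + 1) ^ 2); [apply pow_lt; lra|].
  replace (exp ((2 - s) * x) / (exp x + 1) ^ 2 * (exp x + 1) ^ 2) with (exp ((2 - s) * x)) by (field; lra).
  destruct (Rle_lt_dec 0 x) as [hx|hx].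
  - rewrite Rabs_pos_eq by assumption.
    replace ((2 - s) * x) with (- (2 - s) * x + 2 * ((2 - s) * x)) by ring.
    rewrite exp_plus. apply Rmult_le_compat_l; [left; apply exp_pos|].
    apply Rle_trans with (exp (x + x)); [apply exp_le_compat; nra|].
    rewrite exp_plus. nra.
  - rewrite Rabs_left by assumption. replace (- (2 - s) * - x) with ((2 - s) * x) by ring.
    rewrite <- (Rmult_1_r (exp ((2 - s) * x))) at 1. apply Rmult_le_compat_l; [lra|]. nra.
Qed.

Lemma resolvent_kernel_scale s a x : 0 < a ->
  resolvent_kernel s a x = Rpower a (- s) * resolvent_kernel s 1 (x + - ln a).
Proof.
  intros ha. unfold resolvent_kernel, Rpower.
  pose proof (exp_pos x). 
  rewrite exp_plus, exp_Ropp, exp_ln by assumption.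
  replace ((2 - s) * (x + - ln a)) with ((2 - s) * x + (s * ln a + (- ln a + - ln a))) by ring.
  rewrite !exp_plus. rewrite exp_Ropp, exp_ln by assumption.
  replace (- s * ln a) with (- (s * ln a)) by ring. rewrite exp_Ropp.
  pose proof (exp_pos (s * ln a)).
  field. split; [lra|]. split; [lra|]. lra.
Qed.

(** By homogeneity, [a] enters as the factor [a^(-s)] and a translation by [ln a], to which the
    integral over the line is insensitive. The case [a = 1] is the reflection formula at
    [z = s - 1]. *)
Lemma resolvent_mellin s a : 1 < s < 2 -> 0 < a ->
  LInt (resolvent_kernel s a) + LInt (fun x => resolvent_kernel s a (- x)) =
  Rpower a (- s) * (PI * (s - 1) / sin (PI * (s - 1))).
Proof.
  intros hs ha.
  assert (hc : 0 < 2 - s) by lra.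
  assert (hcont : forall x, continuous (resolvent_kernel s 1) x)
    by (intros x; apply resolvent_kernel_continuous; lra).
  assert (hb : exists C, forall x, Rabs (resolvent_kernel s 1 x) <= C * exp (- (2 - s) * Rabs x))
    by (exists 1; intros x; now apply resolvent_kernel_one_bound).
  destruct (exp_dom_comp (2 - s) _ (- ln a) hc hcont hb) as [h1 h2].
  assert (e1 : resolvent_kernel s a =
    (fun x => Rpower a (- s) * resolvent_kernel s 1 (x + - ln a) + 0 * resolvent_kernel s 1 (x + - ln a))).
  { apply functional_extensionality. intros x. rewrite resolvent_kernel_scale by assumption. ring. }
  assert (e2 : (fun x => resolvent_kernel s a (- x)) =
    (fun x => Rpower a (- s) * resolvent_kernel s 1 (- x + - ln a) + 0 * resolvent_kernel s 1 (- x + - ln a))).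
  { apply functional_extensionality. intros x. rewrite resolvent_kernel_scale by assumption. ring. }
  rewrite e2. rewrite e1 at 1.
  rewrite !(LInt_lin (2 - s)) by assumption.
  rewrite <- beta_reflection by lra.
  transitivity (Rpower a (- s) * (LInt (fun x => resolvent_kernel s 1 (x + - ln a)) +
    LInt (fun x => resolvent_kernel s 1 (- x + - ln a)))); [ring|].
  f_equal. rewrite (line_integral_translate (2 - s)) by assumption.
  rewrite Rplus_comm. f_equal; f_equal; apply functional_extensionality; intros x;
    unfold resolvent_kernel, logistic2.
  - replace ((2 - s) * - x) with (- (1 - (s - 1)) * x) by ring.
    now rewrite (Rplus_comm (exp (- x))).
  - replace (- (1 + (s - 1)) * x) with ((2 - s) * x + (- x + - x)) by ring.
    rewrite !exp_plus, exp_Ropp. pose proof (exp_pos x). field. lra.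
Qed.

(** * Sums over lattices *)

Definition ZS (f : Z -> R) : R := real (Lim_seq (fun N => zsum N f)).

Definition summable (w : Z -> R) : Prop :=
  (forall m, 0 <= w m) /\ exists B, forall N, zsum N w <= B.

Lemma zsum_diff_dominated f h N M : (forall m, Rabs (f m) <= h m) -> (N <= M)%nat ->
  Rabs (zsum M f - zsum N f) <= zsum M h - zsum N h.
Proof.
  intros hfh hNM. induction hNM as [|M hNM IH].
  - rewrite !Rminus_diag_eq by reflexivity. rewrite Rabs_R0. lra.
  - cbn [zsum].
    replace (zsum M f + (f (Z.of_nat (S M)) + f (- Z.of_nat (S M))%Z) - zsum N f) with
      ((zsum M f - zsum N f) + (f (Z.of_nat (S M)) + f (- Z.of_nat (S M))%Z)) by ring.
    eapply Rle_trans; [apply Rabs_triang|].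
    pose proof (Rabs_triang (f (Z.of_nat (S M))) (f (- Z.of_nat (S M))%Z)).
    pose proof (hfh (Z.of_nat (S M))). pose proof (hfh (- Z.of_nat (S M))%Z). lra.
Qed.

Lemma zsum_abs_le f h N : (forall m, Rabs (f m) <= h m) -> Rabs (zsum N f) <= zsum N h.
Proof.
  intros hfh. induction N as [|N IH]; cbn [zsum]; [apply hfh|].
  eapply Rle_trans; [apply Rabs_triang|].
  pose proof (Rabs_triang (f (Z.of_nat (S N))) (f (- Z.of_nat (S N))%Z)).
  pose proof (hfh (Z.of_nat (S N))). pose proof (hfh (- Z.of_nat (S N))%Z). lra.
Qed.

Lemma zsum_incr w N M : (forall m, 0 <= w m) -> (N <= M)%nat -> zsum N w <= zsum M w.
Proof.
  intros hw h. pose proof (zsum_diff_dominated w w N M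
    ltac:(intros m; rewrite Rabs_pos_eq; [lra|apply hw]) h) as h1.
  pose proof (Rabs_pos (zsum M w - zsum N w)). lra.
Qed.

Lemma zsum_nonneg w N : (forall m, 0 <= w m) -> 0 <= zsum N w.
Proof.
  intros hw. eapply Rle_trans; [apply (hw 0%Z)|]. change (w 0%Z) with (zsum 0 w).
  apply zsum_incr; [assumption|lia].
Qed.

(** Besides convergence, domination of the increments gives an explicit tail bound, which later
    makes truncation errors uniform in parameters. *)
Lemma ex_lim_of_increments (u v : nat -> R) (l : R) : is_lim_seq v l ->
  (forall N M, (N <= M)%nat -> Rabs (u M - u N) <= v M - v N) ->
  is_lim_seq u (real (Lim_seq u)) /\ forall N, Rabs (real (Lim_seq u) - u N) <= l - v N.
Proof.
  intros hv h.
  assert (hu : is_lim_seq u (real (Lim_seq u))).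
  { apply Lim_seq_correct'. apply ex_lim_seq_cauchy_corr.
    assert (hc : ex_lim_seq_cauchy v) by (apply ex_lim_seq_cauchy_corr; now exists l).
    intros eps. destruct (hc eps) as [N0 HN]. exists N0. intros n m hn hm.
    destruct (Nat.le_ge_cases n m) as [hle|hle].
    - rewrite Rabs_minus_sym. eapply Rle_lt_trans; [now apply h|].
      eapply Rle_lt_trans; [apply Rle_abs|]. now apply HN.
    - eapply Rle_lt_trans; [now apply h|].
      eapply Rle_lt_trans; [apply Rle_abs|]. now apply HN. }
  split; [exact hu|]. intros N.
  apply (is_lim_seq_incr_n _ N) in hu. apply (is_lim_seq_incr_n _ N) in hv.
  assert (h1 : is_lim_seq (fun n => Rabs (u (n + N)%nat - u N)) (Rabs (real (Lim_seq u) - u N))).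
  { apply (is_lim_seq_abs (fun n => u (n + N)%nat - u N) (real (Lim_seq u) - u N)).
    apply is_lim_seq_minus'; [exact hu|apply is_lim_seq_const]. }
  assert (h2 : is_lim_seq (fun n => v (n + N)%nat - v N) (l - v N)).
  { apply is_lim_seq_minus'; [exact hv|apply is_lim_seq_const]. }
  refine (is_lim_seq_le _ _ _ _ _ h1 h2). intros n. apply h. lia.
Qed.

Lemma ZS_summable w : summable w -> is_lim_seq (fun N => zsum N w) (ZS w).
Proof.
  intros [hw [B hB]]. apply Lim_seq_correct'.
  apply ex_finite_lim_seq_incr with B; [|assumption].
  intros n. apply zsum_incr; [assumption|lia].
Qed.

Lemma ZS_dominated f w K : summable w -> (forall m, Rabs (f m) <= K * w m) ->
  is_lim_seq (fun N => zsum N f) (ZS f) /\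
  forall N, Rabs (ZS f - zsum N f) <= K * (ZS w - zsum N w).
Proof.
  intros hw hf.
  destruct (ex_lim_of_increments (fun N => zsum N f) (fun N => K * zsum N w) (K * ZS w)) as [h1 h2].
  - apply (is_lim_seq_scal_l _ K (ZS w)). now apply ZS_summable.
  - intros N M hNM. rewrite <- !zsum_scal. now apply zsum_diff_dominated.
  - split; [exact h1|]. intros N. specialize (h2 N).
    rewrite Rmult_minus_distr_l. exact h2.
Qed.

Lemma ZS_unique f (l : R) : is_lim_seq (fun N => zsum N f) l -> ZS f = l.
Proof. intros h. apply is_lim_seq_unique in h. unfold ZS. now rewrite h. Qed.

Lemma ZS_ext f g : (forall m, f m = g m) -> ZS f = ZS g.
Proof. intros h. f_equal. apply functional_extensionality. exact h. Qed.

Lemma ZS_lin f g w K L a b : summable w -> (forall m, Rabs (f m) <= K * w m) ->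
  (forall m, Rabs (g m) <= L * w m) ->
  ZS (fun m => a * f m + b * g m) = a * ZS f + b * ZS g.
Proof.
  intros hw hf hg. apply ZS_unique.
  apply is_lim_seq_ext with (fun N => a * zsum N f + b * zsum N g).
  - intros N. now rewrite zsum_lin.
  - apply is_lim_seq_plus'.
    + apply (is_lim_seq_scal_l _ a (ZS f)). now apply ZS_dominated with w K.
    + apply (is_lim_seq_scal_l _ b (ZS g)). now apply ZS_dominated with w L.
Qed.

Lemma ZS_partial_le w N : summable w -> zsum N w <= ZS w.
Proof.
  intros hw. pose proof (ZS_summable w hw) as h. destruct hw as [hw _].
  apply (is_lim_seq_incr_compare (fun N => zsum N w) (ZS w)); [exact h|].
  intros n. apply zsum_incr; [assumption|lia].
Qed.

Lemma ZS_nonneg w : summable w -> 0 <= ZS w.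
Proof.
  intros hw. eapply Rle_trans; [|apply (ZS_partial_le w 0 hw)].
  apply zsum_nonneg, hw.
Qed.

Lemma ZS_abs_le f w K : summable w -> (forall m, Rabs (f m) <= K * w m) ->
  Rabs (ZS f) <= K * ZS w.
Proof.
  intros hw hf. destruct (ZS_dominated f w K hw hf) as [h1 _].
  apply is_lim_seq_abs in h1.
  assert (h2 : is_lim_seq (fun N => K * zsum N w) (K * ZS w)).
  { apply (is_lim_seq_scal_l _ K (ZS w)). now apply ZS_summable. }
  refine (is_lim_seq_le _ _ _ _ _ h1 h2). intros N.
  rewrite <- zsum_scal. now apply zsum_abs_le.
Qed.

Lemma summable_le f w K : summable w -> (forall m, 0 <= f m <= K * w m) -> summable f.
Proof.
  intros hw hf. split; [intros m; apply hf|].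
  exists (K * ZS w). intros N.
  assert (hK : forall m, Rabs (f m) <= K * w m).
  { intros m. rewrite Rabs_pos_eq; apply hf. }
  apply Rle_trans with (K * zsum N w).
  - rewrite <- zsum_scal. apply zsum_le. intros m. apply hf.
  - destruct (ZS_dominated f w K hw hK) as [_ h]. specialize (h N).
    pose proof (Rabs_pos (ZS f - zsum N f)). lra.
Qed.

(** * Sums over pairs of integers by square truncation *)

Definition box (N : nat) (F : Z * Z -> R) : R := zsum N (fun n => zsum N (fun m => F (n, m))).
Definition LS (F : Z * Z -> R) : R := real (Lim_seq (fun N => box N F)).
(** The box sums of a product weight are squares of one-dimensional sums, so domination by such
    weights reduces summability over pairs to dimension one. *)
Definition tensor (w : Z -> R) (p : Z * Z) : R := w (fst p) * w (snd p).

Lemma box_tensor N w : box N (tensor w) = zsum N w ^ 2.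
Proof.
  unfold box, tensor. simpl. rewrite Rmult_1_r, <- zsum_scal.
  apply zsum_ext. intros n. rewrite zsum_scal. apply Rmult_comm.
Qed.

Lemma box_scal N a F : box N (fun p => a * F p) = a * box N F.
Proof.
  unfold box. rewrite <- zsum_scal. apply zsum_ext. intros n. apply zsum_scal.
Qed.

Lemma box_lin N a b F G : box N (fun p => a * F p + b * G p) = a * box N F + b * box N G.
Proof.
  unfold box. rewrite <- zsum_lin. apply zsum_ext. intros n.
  exact (zsum_lin N (fun m => F (n, m)) (fun m => G (n, m)) a b).
Qed.

Lemma box_diff_dominated F H N M : (forall p, Rabs (F p) <= H p) -> (N <= M)%nat ->
  Rabs (box M F - box N F) <= box M H - box N H.
Proof.
  intros hFH hNM. unfold box.
  set (f := fun n => zsum M (fun m => F (n, m))). set (h := fun n => zsum M (fun m => H (n, m))).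
  replace (zsum M f - zsum N (fun n => zsum N (fun m => F (n, m)))) with
    ((zsum M f - zsum N f) + (1 * zsum N f + - (1) * zsum N (fun n => zsum N (fun m => F (n, m))))) by ring.
  replace (zsum M h - zsum N (fun n => zsum N (fun m => H (n, m)))) with
    ((zsum M h - zsum N h) + (1 * zsum N h + - (1) * zsum N (fun n => zsum N (fun m => H (n, m))))) by ring.
  eapply Rle_trans; [apply Rabs_triang|]. rewrite <- !zsum_lin.
  apply Rplus_le_compat.
  - apply zsum_diff_dominated; [|assumption]. intros n. now apply zsum_abs_le.
  - apply zsum_abs_le. intros n.
    replace (1 * f n + - (1) * zsum N (fun m => F (n, m))) with
      (f n - zsum N (fun m => F (n, m))) by ring.
    replace (1 * h n + - (1) * zsum N (fun m => H (n, m))) with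
      (h n - zsum N (fun m => H (n, m))) by ring.
    now apply zsum_diff_dominated.
Qed.

Definition lat_dominated (w : Z -> R) (K : R) (F : Z * Z -> R) : Prop :=
  forall p, Rabs (F p) <= K * tensor w p.

Lemma LS_dominated F w K : summable w -> lat_dominated w K F ->
  is_lim_seq (fun N => box N F) (LS F) /\
  forall N, Rabs (LS F - box N F) <= K * (ZS w ^ 2 - zsum N w ^ 2).
Proof.
  intros hw hF.
  destruct (ex_lim_of_increments (fun N => box N F) (fun N => K * zsum N w ^ 2) (K * ZS w ^ 2)) as [h1 h2].
  - apply (is_lim_seq_scal_l _ K (ZS w ^ 2)). simpl.
    apply (is_lim_seq_mult' _ _ (ZS w) (ZS w * 1)); [now apply ZS_summable|].
    apply is_lim_seq_mult'; [now apply ZS_summable|apply is_lim_seq_const].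
  - intros N M hNM. rewrite <- !box_tensor, <- !box_scal. now apply box_diff_dominated.
  - split; [exact h1|]. intros N. specialize (h2 N).
    rewrite Rmult_minus_distr_l. exact h2.
Qed.

Lemma LS_abs_le F w K : summable w -> lat_dominated w K F -> Rabs (LS F) <= K * ZS w ^ 2.
Proof.
  intros hw hF. destruct (LS_dominated F w K hw hF) as [_ h]. specialize (h 0%nat).
  assert (hb : Rabs (box 0 F) <= K * zsum 0 w ^ 2).
  { specialize (hF (0, 0)%Z). unfold tensor in hF. unfold box. cbn [zsum fst snd] in *. lra. }
  replace (LS F) with ((LS F - box 0 F) + box 0 F) by ring.
  eapply Rle_trans; [apply Rabs_triang|]. lra.
Qed.

Lemma LS_unique F (l : R) : is_lim_seq (fun N => box N F) l -> LS F = l.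
Proof. intros h. apply is_lim_seq_unique in h. unfold LS. now rewrite h. Qed.

Lemma LS_bounded_functional w : summable w ->
  bounded_functional (fun F => exists K, lat_dominated w K F) LS (fun _ => True)
    (tensor w) (ZS w ^ 2).
Proof.
  intros hw. split.
  - intros F G a b [K hK] [L hL]. split.
    + exists (Rabs a * K + Rabs b * L). intros p. specialize (hK p). specialize (hL p).
      eapply Rle_trans; [apply Rabs_triang|]. rewrite !Rabs_mult.
      pose proof (Rabs_pos a). pose proof (Rabs_pos b). nra.
    + apply LS_unique. apply is_lim_seq_ext with (fun N => a * box N F + b * box N G).
      * intros N. now rewrite box_lin.
      * apply is_lim_seq_plus'.
        -- apply (is_lim_seq_scal_l _ a (LS F)). now apply LS_dominated with w K.
        -- apply (is_lim_seq_scal_l _ b (LS G)). now apply LS_dominated with w L.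
  - intros F B _ hB h. apply LS_abs_le; [assumption|]. intros p. now apply h.
Qed.

Lemma ZS_tail_lim w : summable w -> is_lim_seq (fun N => ZS w - zsum N w) 0.
Proof.
  intros hw. replace (Finite 0) with (Finite (ZS w - ZS w)) by (f_equal; ring).
  apply is_lim_seq_minus'; [apply is_lim_seq_const|now apply ZS_summable].
Qed.

Lemma ZS2_tail_lim w : summable w -> is_lim_seq (fun N => ZS w ^ 2 - zsum N w ^ 2) 0.
Proof.
  intros hw. replace (Finite 0) with (Finite (ZS w ^ 2 - ZS w ^ 2)) by (f_equal; ring).
  apply is_lim_seq_minus'; [apply is_lim_seq_const|]. simpl.
  apply (is_lim_seq_mult' _ _ (ZS w) (ZS w * 1)); [now apply ZS_summable|].
  apply is_lim_seq_mult'; [now apply ZS_summable|apply is_lim_seq_const].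
Qed.

Lemma row_dominated F w K : summable w -> lat_dominated w K F ->
  forall n, (forall m, Rabs (F (n, m)) <= (K * w n) * w m).
Proof. intros hw hF n m. specialize (hF (n, m)). unfold tensor in hF. simpl in hF. lra. Qed.

(** Truncating row [n] costs at most [|K| w n] times the common tail of [w], and the factors [w n]
    are summable, so square truncation and iterated summation have the same limit. *)
Lemma LS_iterated F w K : summable w -> lat_dominated w K F ->
  LS F = ZS (fun n => ZS (fun m => F (n, m))).
Proof.
  intros hw hF. symmetry. apply ZS_unique.
  destruct (LS_dominated F w K hw hF) as [h1 _].
  apply is_lim_seq_ext with (fun N => box N F +
    (zsum N (fun n => ZS (fun m => F (n, m))) - box N F)); [intros; ring|].
  replace (Finite (LS F)) with (Finite (LS F + 0)) by (f_equal; ring).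
  apply is_lim_seq_plus'; [exact h1|].
  apply is_lim_seq_abs_0.
  apply is_lim_seq_le_le with (fun _ => 0) (fun N => (Rabs K * ZS w) * (ZS w - zsum N w)).
  - intros N. split; [apply Rabs_pos|]. unfold box.
    replace (zsum N (fun n => ZS (fun m => F (n, m))) - zsum N (fun n => zsum N (fun m => F (n, m)))) with
      (zsum N (fun n => 1 * ZS (fun m => F (n, m)) + - (1) * zsum N (fun m => F (n, m))))
      by (rewrite zsum_lin; ring).
    apply Rle_trans with (zsum N (fun n => (Rabs K * (ZS w - zsum N w)) * w n)).
    + apply zsum_abs_le. intros n.
      replace (1 * ZS (fun m => F (n, m)) + - (1) * zsum N (fun m => F (n, m))) with
        (ZS (fun m => F (n, m)) - zsum N (fun m => F (n, m))) by ring.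
      destruct (ZS_dominated (fun m => F (n, m)) w (K * w n) hw) as [_ h2].
      { now apply row_dominated. }
      eapply Rle_trans; [apply h2|].
      assert (0 <= w n) by apply hw. pose proof (Rle_abs K).
      pose proof (ZS_partial_le w N hw).
      replace (Rabs K * (ZS w - zsum N w) * w n) with (Rabs K * (w n * (ZS w - zsum N w))) by ring.
      rewrite Rmult_assoc. apply Rmult_le_compat_r; [apply Rmult_le_pos; lra|assumption].
    + rewrite zsum_scal. pose proof (ZS_partial_le w N hw). pose proof (Rabs_pos K).
      replace (Rabs K * ZS w * (ZS w - zsum N w)) with (Rabs K * (ZS w - zsum N w) * ZS w) by ring.
      apply Rmult_le_compat_l; [apply Rmult_le_pos; lra|assumption].
  - apply is_lim_seq_const.
  - replace (Finite 0) with (Rbar_mult (Rabs K * ZS w) 0) by (simpl; f_equal; ring).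
    apply is_lim_seq_scal_l. now apply ZS_tail_lim.
Qed.

Lemma zsum_comm N M (F : Z -> Z -> R) :
  zsum N (fun n => zsum M (fun m => F n m)) = zsum M (fun m => zsum N (fun n => F n m)).
Proof.
  induction N as [|N IH]; cbn [zsum]; [reflexivity|]. rewrite IH.
  assert (h : forall f g h, zsum M (fun m => f m + (g m + h m)) = zsum M f + (zsum M g + zsum M h)).
  { intros f g h. clear IH. induction M as [|M IHM]; cbn [zsum]; [ring|]. rewrite IHM. ring. }
  now rewrite h.
Qed.

Definition swap (p : Z * Z) : Z * Z := (snd p, fst p).

Lemma LS_swap F : LS (fun p => F (swap p)) = LS F.
Proof.
  unfold LS. f_equal. f_equal. apply functional_extensionality. intros N.
  unfold box, swap. simpl. apply (zsum_comm N N (fun n m => F (m, n))).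
Qed.

(** * Unordered summation over the punctured lattice *)

Fixpoint zlist (N : nat) : list Z :=
  match N with
  | O => [0%Z]
  | S n => zlist n ++ [Z.of_nat (S n); (- Z.of_nat (S n))%Z]
  end.

Lemma in_zlist N m : In m (zlist N) <-> (Z.abs m <= Z.of_nat N)%Z.
Proof.
  induction N as [|N IH]; cbn [zlist].
  - simpl. lia.
  - rewrite in_app_iff, IH. cbn [In]. lia.
Qed.

Lemma NoDup_zlist N : NoDup (zlist N).
Proof.
  induction N as [|N IH]; cbn [zlist].
  - repeat constructor. simpl. tauto.
  - apply NoDup_app; [assumption| |].
    + repeat constructor; cbn [In]; lia.
    + intros m hm. apply in_zlist in hm. cbn [In]. lia.
Qed.

Definition lsum {X : Type} (f : X -> R) (l : list X) : R := fold_right (fun x acc => f x + acc) 0 l.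

Lemma lsum_app {X : Type} (f : X -> R) l l' : lsum f (l ++ l') = lsum f l + lsum f l'.
Proof. induction l as [|x l IH]; simpl; [ring|]. unfold lsum in *. rewrite IH. ring. Qed.

Lemma lsum_map {X Y : Type} (f : Y -> R) (g : X -> Y) l : lsum f (map g l) = lsum (fun x => f (g x)) l.
Proof. induction l as [|x l IH]; simpl; [reflexivity|]. unfold lsum in *. now rewrite IH. Qed.

Lemma lsum_zlist f N : lsum f (zlist N) = zsum N f.
Proof.
  induction N as [|N IH]; cbn [zlist zsum]; [unfold lsum; simpl; ring|].
  rewrite lsum_app, IH. unfold lsum. simpl. ring.
Qed.

Definition boxlist (N : nat) : list (Z * Z) := list_prod (zlist N) (zlist N).

Lemma lsum_list_prod (F : Z * Z -> R) l l' :
  lsum F (list_prod l l') = lsum (fun n => lsum (fun m => F (n, m)) l') l.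
Proof.
  induction l as [|x l IH]; simpl; [reflexivity|].
  rewrite lsum_app, IH, lsum_map. reflexivity.
Qed.

Lemma lsum_boxlist F N : lsum F (boxlist N) = box N F.
Proof.
  unfold boxlist. rewrite lsum_list_prod, lsum_zlist. unfold box.
  apply zsum_ext. intros n. apply lsum_zlist.
Qed.

Lemma NoDup_product {X Y : Type} (l : list X) (l' : list Y) : NoDup l -> NoDup l' ->
  NoDup (list_prod l l').
Proof.
  intros hl hl'.
  induction hl as [|x l hx hl IH]; simpl; [constructor|].
  apply NoDup_app; [| assumption |].
  - apply FinFun.Injective_map_NoDup; [|assumption]. intros a b h. now injection h.
  - intros [a b] h1 h2. apply in_map_iff in h1. destruct h1 as (c & h1 & _). injection h1 as <- <-.
    apply in_prod_iff in h2. tauto.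
Qed.

Lemma NoDup_boxlist N : NoDup (boxlist N).
Proof. apply NoDup_product; apply NoDup_zlist. Qed.

Lemma in_boxlist N n m : In (n, m) (boxlist N) <-> (Z.abs n <= Z.of_nat N)%Z /\ (Z.abs m <= Z.of_nat N)%Z.
Proof. unfold boxlist. rewrite in_prod_iff, !in_zlist. tauto. Qed.

Lemma in_some_boxlist (l : list (Z * Z)) : exists N, incl l (boxlist N).
Proof.
  induction l as [|[n m] l [N IH]].
  - exists 0%nat. intros p [].
  - exists (Nat.max N (Z.to_nat (Z.max (Z.abs n) (Z.abs m)))).
    intros [a b] [h|h].
    + injection h as <- <-. apply in_boxlist. lia.
    + specialize (IH _ h). apply in_boxlist in IH. apply in_boxlist. lia.
Qed.

Lemma lsum_perm {X : Type} (f : X -> R) l l' : Permutation l l' -> lsum f l = lsum f l'.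
Proof.
  intros h. induction h; unfold lsum in *; simpl; try lra.
Qed.

Lemma lsum_abs_le {X : Type} (f h : X -> R) l : (forall x, In x l -> Rabs (f x) <= h x) ->
  Rabs (lsum f l) <= lsum h l.
Proof.
  induction l as [|x l IH]; intros hl; unfold lsum in *; simpl.
  - rewrite Rabs_R0. lra.
  - eapply Rle_trans; [apply Rabs_triang|]. apply Rplus_le_compat.
    + apply hl. now left.
    + apply IH. intros y hy. apply hl. now right.
Qed.

Lemma lsum_nonneg {X : Type} (f : X -> R) l : (forall x, 0 <= f x) -> 0 <= lsum f l.
Proof.
  intros h. induction l as [|x l IH]; unfold lsum in *; simpl; [lra|]. pose proof (h x). lra.
Qed.

Lemma lsum_incl {X : Type} (f : X -> R) l l' : (forall x, 0 <= f x) -> NoDup l -> incl l l' ->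
  lsum f l <= lsum f l'.
Proof.
  intros hf hl. revert l'. induction hl as [|x l hx hl IH]; intros l' hi.
  - now apply lsum_nonneg.
  - destruct (in_split x l') as (l1 & l2 & ->); [apply hi; now left|].
    rewrite lsum_app. change (f x + lsum f l <= lsum f l1 + (f x + lsum f l2)).
    assert (h : lsum f l <= lsum f (l1 ++ l2)).
    { apply IH. intros y hy.
      assert (hy2 : In y (l1 ++ x :: l2)) by (apply hi; now right).
      apply in_app_iff in hy2. apply in_app_iff. destruct hy2 as [h|[h|h]]; auto.
      subst y. contradiction. }
    rewrite lsum_app in h. lra.
Qed.

Lemma incl_permutation {X : Type} (l0 l : list X) : NoDup l0 -> incl l0 l ->
  exists r, Permutation l (l0 ++ r).
Proof.
  intros h0. revert l. induction h0 as [|x l0 hx h0 IH]; intros l hi.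
  - exists l. reflexivity.
  - destruct (in_split x l) as (l1 & l2 & ->); [apply hi; now left|].
    destruct (IH (l1 ++ l2)) as [r hr].
    { intros y hy. assert (hy2 : In y (l1 ++ x :: l2)) by (apply hi; now right).
      apply in_app_iff in hy2. apply in_app_iff. destruct hy2 as [h|[h|h]]; auto.
      subst y. contradiction. }
    exists r. transitivity (x :: l1 ++ l2); [symmetry; apply Permutation_middle|].
    simpl. now constructor.
Qed.

Definition punctured (N : nat) : list (Z * Z) :=
  filter (fun p => negb (Z.eqb (fst p) 0 && Z.eqb (snd p) 0)) (boxlist N).

Lemma in_punctured N p : In p (punctured N) <-> In p (boxlist N) /\ p <> (0, 0)%Z.
Proof.
  unfold punctured. rewrite filter_In. destruct p as [n m]. simpl.
  destruct (Z.eqb_spec n 0) as [->|hn]; destruct (Z.eqb_spec m 0) as [->|hm]; simpl;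
    intuition congruence.
Qed.

Lemma lsum_punctured F N : F (0, 0)%Z = 0 -> lsum F (punctured N) = box N F.
Proof.
  intros h0. rewrite <- lsum_boxlist. unfold punctured. generalize (boxlist N). intros l.
  induction l as [|[n m] l IH]; simpl; [reflexivity|].
  destruct (Z.eqb_spec n 0) as [->|hn]; [destruct (Z.eqb_spec m 0) as [->|hm]|];
    unfold lsum in *; simpl; rewrite IH; try reflexivity.
  rewrite h0. ring.
Qed.

(** The points of [l] outside the punctured box are distinct, lie outside the box [N] and inside
    some larger box [M], so their contribution is at most the mass of [H] between the two boxes. *)
Lemma lsum_remainder_bound F H N l : (forall p, Rabs (F p) <= H p) -> F (0, 0)%Z = 0 ->
  NoDup l -> (forall p, In p l -> p <> (0, 0)%Z) -> incl (punctured N) l ->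
  exists M, (N <= M)%nat /\ Rabs (lsum F l - box N F) <= box M H - box N H.
Proof.
  intros hFH h0 hl hl0 hi.
  assert (hH : forall p, 0 <= H p) by (intros p; eapply Rle_trans; [apply Rabs_pos|apply hFH]).
  assert (hp : NoDup (punctured N)) by (apply NoDup_filter, NoDup_boxlist).
  destruct (incl_permutation _ _ hp hi) as [r hr].
  assert (hpr : NoDup (punctured N ++ r)) by now apply (Permutation_NoDup hr).
  assert (hr0 : forall p, In p r -> ~ In p (boxlist N)).
  { intros p hpr0 hpb.
    assert (hpl : In p l).
    { apply (Permutation_in p (Permutation_sym hr)). apply in_app_iff. now right. }
    assert (hpp : In p (punctured N)) by (apply in_punctured; auto).
    apply NoDup_app_remove_l in hpr as hnr.
    clear - hpp hpr0 hpr. induction (punctured N) as [|x q IH]; [contradiction|].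
    simpl in hpr. inversion hpr as [|? ? hx hq]; subst. destruct hpp as [->|hpp].
    - apply hx. apply in_app_iff. now right.
    - now apply IH. }
  destruct (in_some_boxlist r) as [M0 hM0].
  set (M := Nat.max N M0).
  exists M. split; [lia|].
  rewrite (lsum_perm F _ _ hr), lsum_app, lsum_punctured by assumption.
  rewrite Rplus_minus_l.
  apply Rle_trans with (lsum H r); [now apply lsum_abs_le|].
  assert (hb : lsum H (boxlist N ++ r) <= lsum H (boxlist M)).
  { apply lsum_incl; [assumption| |].
    - apply NoDup_app; [apply NoDup_boxlist|now apply NoDup_app_remove_l in hpr|].
      intros p h1 h2. now apply (hr0 p).
    - intros [a b] h. apply in_app_iff in h. destruct h as [h|h].
      + apply in_boxlist in h. apply in_boxlist. lia.
      + apply hM0 in h. apply in_boxlist in h. apply in_boxlist. lia. }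
  rewrite lsum_app, !lsum_boxlist in hb. lra.
Qed.

Lemma Csum_list_lsum (f : C -> C) l :
  Csum_list f l = (lsum (fun w => Re (f w)) l, lsum (fun w => Im (f w)) l).
Proof.
  induction l as [|w l IH]; [reflexivity|].
  unfold Csum_list, lsum in *. simpl. rewrite IH. reflexivity.
Qed.

(** The origin is removed by its value and not from the index set, so that all lattice sums run over
    the same pairs. It also masks the default values of logarithms and inverses at the origin. *)
Definition lat_restrict (F : Z * Z -> R) (p : Z * Z) : R :=
  if (Z.eqb (fst p) 0 && Z.eqb (snd p) 0)%bool then 0 else F p.

Lemma lat_restrict_neq F p : p <> (0, 0)%Z -> lat_restrict F p = F p.
Proof.
  destruct p as [n m]. unfold lat_restrict. simpl. intros h.
  destruct (Z.eqb_spec n 0) as [->|hn]; destruct (Z.eqb_spec m 0) as [->|hm]; simpl;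
    congruence.
Qed.

Lemma has_sum_lattice (phi : Z * Z -> C) (A : C -> Prop) (f : C -> C) w K :
  summable w -> 0 <= K ->
  (forall p q, phi p = phi q -> p = q) ->
  (forall z, A z <-> exists p, p <> (0, 0)%Z /\ z = phi p) ->
  (forall p, p <> (0, 0)%Z -> Cmod (f (phi p)) <= K * tensor w p) ->
  has_sum A f (LS (lat_restrict (fun p => Re (f (phi p)))), LS (lat_restrict (fun p => Im (f (phi p))))).
Proof.
  intros hw hK hphi hA hf.
  set (F := lat_restrict (fun p => Re (f (phi p)))).
  set (G := lat_restrict (fun p => Im (f (phi p)))).
  assert (ht : forall p, 0 <= tensor w p) by (intros p; apply Rmult_le_pos; apply hw).
  assert (hF : lat_dominated w K F).
  { intros p. unfold F. destruct (classic (p = (0, 0)%Z)) as [->|hp].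
    - unfold lat_restrict. simpl. rewrite Rabs_R0. apply Rmult_le_pos; auto.
    - rewrite lat_restrict_neq by assumption.
      eapply Rle_trans; [apply re_le_Cmod|now apply hf]. }
  assert (hG : lat_dominated w K G).
  { intros p. unfold G. destruct (classic (p = (0, 0)%Z)) as [->|hp].
    - unfold lat_restrict. simpl. rewrite Rabs_R0. apply Rmult_le_pos; auto.
    - rewrite lat_restrict_neq by assumption.
      eapply Rle_trans; [|now apply hf]. eapply Rle_trans; [|apply Rmax_Cmod]. apply Rmax_r. }
  intros eps heps.
  assert (hl : is_lim_seq (fun N => K * (ZS w ^ 2 - zsum N w ^ 2)) 0).
  { replace (Finite 0) with (Rbar_mult K 0) by (simpl; f_equal; ring).
    apply is_lim_seq_scal_l. now apply ZS2_tail_lim. }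
  (* Each of the real and imaginary parts costs two errors, and passing to the modulus costs a
     factor 2: four fifths of [eps] in all. *)
  assert (he : 0 < eps / 5) by lra.
  apply is_lim_seq_spec in hl. destruct (hl (mkposreal _ he)) as [N HN].
  specialize (HN N ltac:(lia)). simpl in HN. rewrite Rminus_0_r in HN. apply Rabs_def2 in HN.
  exists (map phi (punctured N)). split; [|split].
  - apply FinFun.Injective_map_NoDup; [exact hphi|apply NoDup_filter, NoDup_boxlist].
  - intros z hz. apply in_map_iff in hz. destruct hz as (p & <- & hp).
    apply hA. exists p. split; [|reflexivity]. now apply in_punctured in hp.
  - intros l hl0 hlA hi.
    assert (hex : exists P, l = map phi P /\ forall p, In p P -> p <> (0, 0)%Z).
    { clear hl0 hi. induction l as [|z l IH].
      - exists nil. split; [reflexivity|]. intros p [].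
      - destruct IH as (P & hP & hP0); [intros y hy; apply hlA; now right|].
        destruct (proj1 (hA z) (hlA z ltac:(now left))) as (p & hp & hz).
        exists (p :: P). split; [simpl; now rewrite hP, hz|].
        intros q [<-|hq]; auto. }
    destruct hex as (P & -> & hP0).
    assert (hP : NoDup P) by now apply NoDup_map_inv in hl0.
    assert (hiP : incl (punctured N) P).
    { intros p hp. assert (h : In (phi p) (map phi P)) by (apply hi, in_map, hp).
      apply in_map_iff in h. destruct h as (q & hq & hqP). now rewrite <- (hphi _ _ hq). }
    assert (key : forall H, lat_dominated w K H -> H (0, 0)%Z = 0 ->
      Rabs (lsum H P - LS H) < 2 * (eps / 5)).
    { intros H hH hH0.
      destruct (lsum_remainder_bound H (fun p => K * tensor w p) N P hH hH0 hP hP0 hiP) as (M & hM & hb).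
      rewrite !box_scal, !box_tensor in hb.
      destruct (LS_dominated H w K hw hH) as [_ hb2]. specialize (hb2 N).
      replace (lsum H P - LS H) with ((lsum H P - box N H) - (LS H - box N H)) by ring.
      unfold Rminus at 1. eapply Rle_lt_trans; [apply Rabs_triang|]. rewrite Rabs_Ropp.
      assert (hMle : K * zsum M w ^ 2 <= K * ZS w ^ 2).
      { apply Rmult_le_compat_l; [assumption|]. apply pow_incr. split.
        - apply zsum_nonneg, hw.
        - now apply ZS_partial_le. }
      lra. }
    assert (hF1 : lsum (fun z => Re (f z)) (map phi P) = lsum F P).
    { rewrite lsum_map. clear - hP0. subst F. induction P as [|p P IH]; [reflexivity|].
      unfold lsum in *. simpl. rewrite IH by (intros q hq; apply hP0; now right).
      rewrite lat_restrict_neq; [reflexivity|]. apply hP0. now left. }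
    assert (hG1 : lsum (fun z => Im (f z)) (map phi P) = lsum G P).
    { rewrite lsum_map. clear - hP0. subst G. induction P as [|p P IH]; [reflexivity|].
      unfold lsum in *. simpl. rewrite IH by (intros q hq; apply hP0; now right).
      rewrite lat_restrict_neq; [reflexivity|]. apply hP0. now left. }
    rewrite Csum_list_lsum, hF1, hG1.
    pose proof (key F hF eq_refl) as k1. pose proof (key G hG eq_refl) as k2.
    eapply Rle_lt_trans; [apply (Cmod_le_2 _ (2 * (eps / 5)))|lra].
    + simpl. left. exact k1.
    + simpl. left. exact k2.
Qed.

(** * Power weights *)

Lemma Rpower_anti x y p : 0 < x <= y -> 0 <= p -> Rpower y (- p) <= Rpower x (- p).
Proof.
  intros hxy hp. unfold Rpower. apply exp_le_compat.
  assert (ln x <= ln y) by (destruct (proj2 hxy) as [h|<-]; [left; apply ln_increasing; lra|lra]).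
  nra.
Qed.

Lemma Rpower_pos x y : 0 < Rpower x y.
Proof. apply exp_pos. Qed.

(** A version of [|m|^(-p)] that is finite at [m = 0]. *)
Definition pw (p : R) (m : Z) : R := Rpower (1 + IZR m ^ 2) (- (p / 2)).

Lemma Rpower_diff_bound p k : 1 < p -> 1 <= k ->
  (p - 1) * Rpower (k + 1) (- p) <= Rpower k (- (p - 1)) - Rpower (k + 1) (- (p - 1)).
Proof.
  intros hp hk.
  destruct (mean_value (fun x => Rpower x (- (p - 1))) (fun x => - (p - 1) * Rpower x (- p)) k (k + 1))
    as (c & hc & he); [lra| |].
  - intros x hx. unfold Rpower. auto_derive; [lra|].
    replace (- p * ln x) with (- (p - 1) * ln x + - ln x) by ring.
    rewrite exp_plus, exp_Ropp, exp_ln by lra. replace (- (p + - (1))) with (- (p - 1)) by ring. field. lra.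
  - replace (k + 1 - k) with 1 in he by ring.
    assert (h : Rpower (k + 1) (- p) <= Rpower c (- p)) by (apply Rpower_anti; lra).
    nra.
Qed.

Lemma pw_summable p : 1 < p -> summable (pw p).
Proof.
  intros hp. split; [intros m; left; apply Rpower_pos|].
  (* The indices -1, 0 and 1 contribute at most 3; the others are compared with the integral of
     [x^(-p)] and telescope, the factor 2 counting both signs. *)
  exists (3 + 2 / (p - 1)). intros N.
  assert (hpw : forall k, pw p (Z.of_nat (S k)) <= Rpower (INR k + 1) (- p) /\
    pw p (- Z.of_nat (S k)) <= Rpower (INR k + 1) (- p)).
  { intros k. unfold pw. rewrite opp_IZR, <- INR_IZR_INZ, S_INR.
    pose proof (pos_INR k) as hk.
    replace ((- (INR k + 1)) ^ 2) with ((INR k + 1) ^ 2) by ring.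
    enough (Rpower (1 + (INR k + 1) ^ 2) (- (p / 2)) <= Rpower (INR k + 1) (- p)) by tauto.
    replace (Rpower (INR k + 1) (- p)) with (Rpower ((INR k + 1) ^ 2) (- (p / 2))).
    - apply Rpower_anti; [split; nra|lra].
    - rewrite <- (Rpower_pow 2) by lra. rewrite Rpower_mult. f_equal. simpl. field. }
  assert (h : forall n, zsum (S n) (pw p) <= 3 + 2 / (p - 1) * (1 - Rpower (INR n + 1) (- (p - 1)))).
  { induction n as [|n IH].
    - cbn [zsum]. destruct (hpw 0%nat) as [h1 h2]. simpl INR in *.
      replace (0 + 1) with 1 in * by ring.
      unfold Rpower in *. rewrite ln_1, Rmult_0_r, exp_0 in *.
      assert (h0 : pw p 0 = 1).
      { unfold pw, Rpower. replace (1 + 0 ^ 2) with 1 by ring. now rewrite ln_1, Rmult_0_r, exp_0. }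
      rewrite h0. lra.
    - change (zsum (S (S n)) (pw p)) with (zsum (S n) (pw p) +
        (pw p (Z.of_nat (S (S n))) + pw p (- Z.of_nat (S (S n)))%Z)).
      destruct (hpw (S n)) as [h1 h2]. rewrite S_INR in *.
      pose proof (pos_INR n) as hn.
      pose proof (Rpower_diff_bound p (INR n + 1) hp ltac:(lra)) as h3.
      assert (h4 : Rpower (INR n + 1 + 1) (- p) <=
        1 / (p - 1) * (Rpower (INR n + 1) (- (p - 1)) - Rpower (INR n + 1 + 1) (- (p - 1)))).
      { apply Rmult_le_reg_l with (p - 1); [lra|]. eapply Rle_trans; [exact h3|]. right. field. lra. }
      unfold Rdiv in *. nra. }
  assert (hq : 0 <= 2 / (p - 1)) by (apply Rdiv_le_0_compat; lra).
  destruct N as [|n].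
  - cbn [zsum]. specialize (h 0%nat). cbn [zsum] in h. simpl INR in h. 
    destruct (hpw 0%nat) as [h1 h2].
    assert (0 < pw p (Z.of_nat 1)) by apply Rpower_pos.
    assert (0 < pw p (- Z.of_nat 1)) by apply Rpower_pos.
    pose proof (Rpower_pos (0 + 1) (- (p - 1))). nra.
  - eapply Rle_trans; [apply h|]. pose proof (Rpower_pos (INR n + 1) (- (p - 1))). nra.
Qed.

(** * The spectral Dirichlet series *)

(** The squared length of a lattice vector. A pair lists the vertical index first, so that the inner
    sums of a double sum run along the horizontal rows. *)
Definition quad (a : R) (p : Z * Z) : R := IZR (snd p) ^ 2 / a + IZR (fst p) ^ 2 * a.

Lemma IZR_sqr_ge_1 m : m <> 0%Z -> 1 <= IZR m ^ 2.
Proof.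
  intros hm. replace (IZR m ^ 2) with (IZR (m * m)) by (rewrite mult_IZR; ring).
  apply IZR_le. nia.
Qed.

(** The factor 1/2 comes from [1 + n^2 + m^2 <= 2 (n^2 + m^2)] away from the origin. *)
Definition quad_const (a : R) : R := Rmin a (/ a) / 2.

Lemma quad_const_pos a : 0 < a -> 0 < quad_const a.
Proof.
  intros ha. unfold quad_const. apply Rdiv_lt_0_compat; [|lra].
  apply Rmin_glb_lt; [assumption|now apply Rinv_0_lt_compat].
Qed.

Lemma quad_lower a p : 0 < a -> p <> (0, 0)%Z ->
  quad_const a * (1 + IZR (fst p) ^ 2 + IZR (snd p) ^ 2) <= quad a p.
Proof.
  intros ha hp. destruct p as [n m]. unfold quad, quad_const. simpl fst. simpl snd.
  pose proof (Rmin_l a (/ a)) as h1. pose proof (Rmin_r a (/ a)) as h2.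
  pose proof (quad_const_pos a ha) as h0. unfold quad_const in h0.
  assert (h3 : 1 <= IZR n ^ 2 + IZR m ^ 2).
  { pose proof (pow2_ge_0 (IZR m)).
    destruct (Z.eq_dec n 0) as [->|hn].
    - assert (hm : m <> 0%Z) by congruence. pose proof (IZR_sqr_ge_1 m hm). lra.
    - pose proof (IZR_sqr_ge_1 n hn). lra. }
  pose proof (pow2_ge_0 (IZR n)). pose proof (pow2_ge_0 (IZR m)).
  unfold Rdiv. set (k := Rmin a (/ a)) in *.
  nra.
Qed.

Lemma quad_pos a p : 0 < a -> p <> (0, 0)%Z -> 0 < quad a p.
Proof.
  intros ha hp. eapply Rlt_le_trans; [|now apply quad_lower].
  apply Rmult_lt_0_compat; [now apply quad_const_pos|].
  pose proof (pow2_ge_0 (IZR (fst p))). pose proof (pow2_ge_0 (IZR (snd p))). lra.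
Qed.

(** Since [(1 + n^2) (1 + m^2) <= (1 + n^2 + m^2)^2], the power is dominated by a product weight of
    the same exponent [p]. This weight is summable for [p > 1], so the whole half-plane of
    convergence is reached. *)
Lemma quad_power_bound a p q : 0 < a -> 0 <= p -> q <> (0, 0)%Z ->
  Rpower (quad a q) (- p) <= Rpower (quad_const a) (- p) * tensor (pw p) q.
Proof.
  intros ha hp hq. pose proof (quad_const_pos a ha) as hc.
  set (X := 1 + IZR (fst q) ^ 2 + IZR (snd q) ^ 2).
  assert (h1 := pow2_ge_0 (IZR (fst q))). assert (h2 := pow2_ge_0 (IZR (snd q))).
  assert (hX : 0 < X) by (unfold X; lra).
  apply Rle_trans with (Rpower (quad_const a * X) (- p)).
  - apply Rpower_anti; [|assumption]. split; [now apply Rmult_lt_0_compat|now apply quad_lower].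
  - rewrite <- Rpower_mult_distr by assumption. apply Rmult_le_compat_l; [left; apply Rpower_pos|].
    unfold tensor, pw. rewrite Rpower_mult_distr by lra.
    replace (Rpower X (- p)) with (Rpower (X ^ 2) (- (p / 2))).
    + apply Rpower_anti; [|lra]. split; [nra|]. unfold X. nra.
    + rewrite <- (Rpower_pow 2) by lra. rewrite Rpower_mult. f_equal. simpl. field.
Qed.

Definition lat (a : R) (p : Z * Z) : C := (IZR (snd p) * / sqrt a, IZR (fst p) * sqrt a).

Lemma lat_inj a p q : 0 < a -> lat a p = lat a q -> p = q.
Proof.
  intros ha h. destruct p as [n m], q as [n' m']. unfold lat in h. simpl in h.
  injection h as h1 h2. pose proof (sqrt_lt_R0 a ha) as hs.
  apply Rmult_eq_reg_r in h1; [|apply Rinv_neq_0_compat; lra].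
  apply Rmult_eq_reg_r in h2; [|lra].
  apply eq_IZR in h1. apply eq_IZR in h2. now subst.
Qed.

Lemma Cmod_lat a p : 0 < a -> Cmod (lat a p) = sqrt (quad a p).
Proof.
  intros ha. unfold Cmod, lat, quad. simpl fst. simpl snd. f_equal.
  rewrite !Rpow_mult_distr, pow_inv. rewrite pow2_sqrt by lra. reflexivity.
Qed.

(** Minus the logarithm of the eigenvalue, so that a term of the zeta function is the exponential of
    [s] times it. *)
Definition log_eigen (a : R) (p : Z * Z) : R := - 2 * ln (2 * PI * Cmod (lat a p)).

Lemma log_eigen_quad a p : 0 < a -> p <> (0, 0)%Z ->
  log_eigen a p = - (2 * ln (2 * PI) + ln (quad a p)).
Proof.
  intros ha hp. unfold log_eigen. pose proof (quad_pos a p ha hp) as hq.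
  rewrite Cmod_lat by assumption. pose proof PI_RGT_0.
  rewrite ln_mult by (try apply sqrt_lt_R0; lra).
  rewrite <- Rpower_sqrt by assumption. unfold Rpower. rewrite ln_exp. field.
Qed.

Definition dirichlet (a : R) : C -> C :=
  superposition LS (lat_restrict (fun _ => 1)) (log_eigen a).

Lemma zeta_term_lat a s p :
  zeta_term s (lat a p) = Cexp (s * RtoC (log_eigen a p)).
Proof.
  unfold zeta_term, Rcpow, log_eigen. f_equal. rewrite RtoC_mult. ring.
Qed.

Lemma dirichlet_terms a s : dirichlet a s =
  (LS (lat_restrict (fun p => Re (zeta_term s (lat a p)))),
   LS (lat_restrict (fun p => Im (zeta_term s (lat a p))))).
Proof.
  unfold dirichlet, superposition, cfun.
  f_equal; f_equal; apply functional_extensionality; intros p; unfold lat_restrict;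
    destruct (Z.eqb (fst p) 0 && Z.eqb (snd p) 0)%bool; rewrite ?zeta_term_lat;
    unfold Re, Im; simpl; ring.
Qed.

Lemma exp_log_eigen_bound a t p : 0 < a -> 0 <= t -> p <> (0, 0)%Z ->
  exp (t * log_eigen a p) <=
  Rpower (2 * PI) (- (2 * t)) * Rpower (quad_const a) (- t) * tensor (pw t) p.
Proof.
  intros ha ht hp. rewrite log_eigen_quad by assumption.
  replace (t * - (2 * ln (2 * PI) + ln (quad a p))) with (- (2 * t) * ln (2 * PI) + - t * ln (quad a p)) by ring.
  rewrite exp_plus, Rmult_assoc. apply Rmult_le_compat_l; [left; apply exp_pos|].
  now apply quad_power_bound.
Qed.

Lemma zeta_has_sum a s : 0 < a -> 1 < Re s ->
  has_sum (fun w => rect_lattice a w /\ w <> RtoC 0) (zeta_term s) (dirichlet a s).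
Proof.
  intros ha hs. rewrite dirichlet_terms.
  apply has_sum_lattice with (pw (Re s)) (Rpower (2 * PI) (- (2 * Re s)) * Rpower (quad_const a) (- Re s)).
  - now apply pw_summable.
  - apply Rmult_le_pos; left; apply Rpower_pos.
  - intros p q. now apply lat_inj.
  - intros z. split.
    + intros [(m & n & ->) hz]. exists (n, m). split; [|reflexivity].
      intros h. injection h as -> ->. apply hz. rewrite !Rmult_0_l. reflexivity.
    + intros ([n m] & hp & ->). split; [now exists m, n|].
      intros h. apply hp. apply (lat_inj a); [assumption|].
      transitivity (RtoC 0); [exact h|]. unfold lat. simpl. rewrite !Rmult_0_l. reflexivity.
  - intros p hp. rewrite zeta_term_lat, Cmod_Cexp.
    replace (Re (s * RtoC (log_eigen a p))%C) with (Re s * log_eigen a p) by (unfold Re; simpl; ring).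
    apply exp_log_eigen_bound; auto. lra.
Qed.

Lemma bounded_functional_scale {X : Type} dom (I : (X -> R) -> R) supp W K c : 0 <= c ->
  bounded_functional dom I supp W K ->
  bounded_functional dom I supp (fun x => c * W x) (c * K).
Proof.
  intros hc [h1 h2]. split; [exact h1|]. intros f B hf hB h.
  rewrite <- Rmult_assoc. apply h2; [assumption|now apply Rmult_le_pos|].
  intros x hx. rewrite Rmult_assoc. now apply h.
Qed.

(** The power [m^k] costs one factor [exp (r |m|)] and the change of exponent is covered by two
    more. The total is the weight [exp (3 r |m|)] of the Taylor remainder, so a single domination
    serves both purposes. *)
Lemma moment_bound (m t r sig : R) k : 0 < r -> Rabs (t - sig) <= r ->
  Rabs (m ^ k) * exp (t * m) <= INR (fact k) / r ^ k * (exp (sig * m) * exp (3 * r * Rabs m)).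
Proof.
  intros hr ht. pose proof (Rabs_pos m) as hm.
  assert (hrk : 0 < r ^ k) by now apply pow_lt.
  assert (h1 : Rabs (m ^ k) <= INR (fact k) / r ^ k * exp (r * Rabs m)).
  { pose proof (exp_ge_term (r * Rabs m) k ltac:(nra)) as h.
    rewrite Rpow_mult_distr in h. rewrite <- RPow_abs.
    pose proof (INR_fact_lt_0 k) as hf.
    apply Rmult_le_reg_l with (r ^ k / INR (fact k)); [now apply Rdiv_lt_0_compat|].
    replace (r ^ k / INR (fact k) * (INR (fact k) / r ^ k * exp (r * Rabs m))) with (exp (r * Rabs m))
      by (field; split; lra).
    eapply Rle_trans; [|exact h]. right. field. lra. }
  assert (h2 : exp (t * m) <= exp (sig * m) * exp (2 * r * Rabs m)).
  { rewrite <- exp_plus. apply exp_le_compat.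
    assert (h : (t - sig) * m <= Rabs (t - sig) * Rabs m) by (rewrite <- Rabs_mult; apply Rle_abs).
    nra. }
  replace (3 * r * Rabs m) with (r * Rabs m + 2 * r * Rabs m) by ring. rewrite exp_plus.
  replace (INR (fact k) / r ^ k * (exp (sig * m) * (exp (r * Rabs m) * exp (2 * r * Rabs m)))) with
    ((INR (fact k) / r ^ k * exp (r * Rabs m)) * (exp (sig * m) * exp (2 * r * Rabs m))) by ring.
  apply Rmult_le_compat; auto using Rabs_pos. left. apply exp_pos.
Qed.

Lemma Re_Im_scaled_Cexp_bound (c m : R) (s : C) :
  Rabs (Re (RtoC c * Cexp (s * RtoC m))%C) <= Rabs c * exp (Re s * m) /\
  Rabs (Im (RtoC c * Cexp (s * RtoC m))%C) <= Rabs c * exp (Re s * m).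
Proof.
  assert (h : Cmod (RtoC c * Cexp (s * RtoC m))%C = Rabs c * exp (Re s * m)).
  { rewrite Cmod_mult, Cmod_R, Cmod_Cexp. do 2 f_equal. unfold Re. simpl. ring. }
  rewrite <- h. split; [apply re_le_Cmod|]. eapply Rle_trans; [|apply Rmax_Cmod]. apply Rmax_r.
Qed.

Lemma Rabs_re_sub_le (s s0 : C) r : Cmod (s - s0)%C < r -> Rabs (Re s - Re s0) <= r.
Proof.
  intros h. left. eapply Rle_lt_trans; [|exact h].
  replace (Re s - Re s0) with (Re (s - s0)%C) by (unfold Re; simpl; ring). apply re_le_Cmod.
Qed.

(** The weight [exp (3 r |mu|)] amounts, up to a constant, to lowering the exponent from [Re s0] to
    [t], which is still above 1. *)
Lemma dirichlet_expandable a s0 : 0 < a -> 1 < Re s0 -> expandable (dirichlet a) s0.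
Proof.
  intros ha hs.
  (* Then [3 r] is half the distance from [Re s0] to 1, and [t] below is the midpoint of 1 and
     [Re s0]. *)
  set (r := (Re s0 - 1) / 6). assert (hr : 0 < r) by (unfold r; lra).
  set (t := Re s0 - 3 * r). assert (ht : 1 < t) by (unfold t, r; lra).
  set (L := 2 * ln (2 * PI) + ln (quad_const a)).
  (* Eigenvalues below 1 have positive [log_eigen], at most [|L|], so that [|mu| <= - mu + 2 |L|];
     the factor [exp (6 r |L|)] pays for the correction. *)
  set (K := exp (6 * r * Rabs L) * (Rpower (2 * PI) (- (2 * t)) * Rpower (quad_const a) (- t))).
  assert (hK : 0 <= K).
  { left. apply Rmult_lt_0_compat; [apply exp_pos|]. apply Rmult_lt_0_compat; apply Rpower_pos. }
  pose proof (pw_summable t ht) as hw.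
  assert (hb : forall p, p <> (0, 0)%Z ->
    exp (Re s0 * log_eigen a p) * exp (3 * r * Rabs (log_eigen a p)) <= K * tensor (pw t) p).
  { intros p hp. unfold K. rewrite (Rmult_assoc (exp (6 * r * Rabs L))).
    apply Rle_trans with (exp (6 * r * Rabs L) * exp (t * log_eigen a p)).
    - rewrite <- !exp_plus. apply exp_le_compat. unfold t.
      assert (h1 : log_eigen a p <= Rabs L).
      { rewrite log_eigen_quad by assumption.
        assert (ln (quad_const a) <= ln (quad a p)).
        { assert (hq : quad_const a <= quad a p).
          { eapply Rle_trans; [|now apply quad_lower].
            pose proof (quad_const_pos a ha). 
            nra. }
          destruct hq as [hq|<-]; [left; apply ln_increasing; [now apply quad_const_pos|assumption]|lra]. }
        pose proof (Rle_abs (- L)) as h. rewrite Rabs_Ropp in h. unfold L in *. lra. }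
      assert (h2 : Rabs (log_eigen a p) <= - log_eigen a p + 2 * Rabs L).
      { unfold Rabs at 1. pose proof (Rabs_pos L). destruct Rcase_abs; lra. }
      nra.
    - apply Rmult_le_compat_l; [left; apply exp_pos|]. apply exp_log_eigen_bound; auto. lra. }
  assert (hT : forall p, 0 <= tensor (pw t) p) by (intros p; apply Rmult_le_pos; apply hw).
  apply (expandable_superposition (fun F => exists K, lat_dominated (pw t) K F) LS (fun _ => True)
    (fun p => K * tensor (pw t) p) (K * ZS (pw t) ^ 2)) with r.
  - apply bounded_functional_scale; [assumption|]. now apply LS_bounded_functional.
  - assumption.
  - apply Rmult_le_pos; [assumption|apply pow2_ge_0].
  - intros p _. destruct (classic (p = (0, 0)%Z)) as [->|hp].
    + unfold lat_restrict at 1. simpl. rewrite Rabs_R0, !Rmult_0_l. now apply Rmult_le_pos.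
    + rewrite lat_restrict_neq, Rabs_R1, Rmult_1_l by assumption. now apply hb.
  - intros s k hsr. apply Rabs_re_sub_le in hsr.
    assert (key : forall p, Rabs (lat_restrict (fun _ => 1) p * log_eigen a p ^ k) * exp (Re s * log_eigen a p) <=
      INR (fact k) / r ^ k * K * tensor (pw t) p).
    { intros p. assert (hfk : 0 <= INR (fact k) / r ^ k).
      { apply Rdiv_le_0_compat; [left; apply INR_fact_lt_0|now apply pow_lt]. }
      destruct (classic (p = (0, 0)%Z)) as [->|hp].
      - unfold lat_restrict at 1. simpl (Z.eqb _ _). simpl andb. cbv iota. rewrite Rmult_0_l, Rabs_R0, Rmult_0_l.
        apply Rmult_le_pos; [now apply Rmult_le_pos|apply hT].
      - rewrite lat_restrict_neq, Rmult_1_l by assumption.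
        eapply Rle_trans; [apply (moment_bound _ _ r (Re s0)); assumption|].
        rewrite (Rmult_assoc _ K). apply Rmult_le_compat_l; [assumption|]. now apply hb. }
    split; exists (INR (fact k) / r ^ k * K); intros p;
      (eapply Rle_trans; [apply Re_Im_scaled_Cexp_bound|apply key]).
Qed.

Lemma LS_zero : LS (fun _ => 0) = 0.
Proof.
  apply LS_unique. apply is_lim_seq_ext with (fun _ => 0); [|apply is_lim_seq_const].
  intros N. unfold box. symmetry.
  assert (h : forall M, zsum M (fun _ => 0) = 0) by (induction M as [|M IH]; cbn [zsum]; lra).
  rewrite (zsum_ext N _ (fun _ => 0)) by (intros; apply h). apply h.
Qed.

Lemma LS_scal F w K c : summable w -> lat_dominated w K F -> LS (fun p => c * F p) = c * LS F.
Proof.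
  intros hw hF. destruct (LS_bounded_functional w hw) as [h _].
  destruct (h F F c 0 (ex_intro _ K hF) (ex_intro _ K hF)) as [_ e].
  replace (fun p => c * F p) with (fun p => c * F p + 0 * F p)
    by (apply functional_extensionality; intros p; ring).
  rewrite e. ring.
Qed.

Lemma quad_power_dominated a s t : 0 < a -> 0 <= t -> 
  (forall p, p <> (0, 0)%Z -> Rabs (s p) <= Rpower (quad a p) (- t)) ->
  lat_dominated (pw t) (Rpower (quad_const a) (- t)) (lat_restrict s).
Proof.
  intros ha ht hs p. destruct (classic (p = (0, 0)%Z)) as [->|hp].
  - unfold lat_restrict. simpl. rewrite Rabs_R0.
    apply Rmult_le_pos; [left; apply Rpower_pos|]. apply Rmult_le_pos; left; apply Rpower_pos.
  - rewrite lat_restrict_neq by assumption. eapply Rle_trans; [now apply hs|].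
    now apply quad_power_bound.
Qed.

Lemma dirichlet_real a s : 0 < a -> 1 < s ->
  dirichlet a (RtoC s) =
  RtoC (Rpower (2 * PI) (- (2 * s)) * LS (lat_restrict (fun p => Rpower (quad a p) (- s)))).
Proof.
  intros ha hs. unfold dirichlet, superposition, cfun.
  assert (e1 : (fun p => Re (RtoC (lat_restrict (fun _ => 1) p) * Cexp (RtoC s * RtoC (log_eigen a p)))%C) =
    (fun p => Rpower (2 * PI) (- (2 * s)) * lat_restrict (fun p => Rpower (quad a p) (- s)) p)).
  { apply functional_extensionality. intros p.
    rewrite <- RtoC_mult, Cexp_R, <- RtoC_mult. unfold Re; simpl fst.
    destruct (classic (p = (0, 0)%Z)) as [->|hp].
    - unfold lat_restrict. simpl. ring.
    - rewrite !lat_restrict_neq, log_eigen_quad by assumption. unfold Rpower.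
      rewrite Rmult_1_l, <- exp_plus. f_equal. ring. }
  assert (e2 : (fun p => Im (RtoC (lat_restrict (fun _ => 1) p) * Cexp (RtoC s * RtoC (log_eigen a p)))%C) =
    (fun _ => 0)).
  { apply functional_extensionality. intros p.
    rewrite <- RtoC_mult, Cexp_R, <- RtoC_mult. reflexivity. }
  rewrite e1, e2, LS_zero, (LS_scal _ (pw s) (Rpower (quad_const a) (- s))).
  - reflexivity.
  - now apply pw_summable.
  - apply quad_power_dominated; [assumption|lra|].
    intros p hp. rewrite Rabs_pos_eq; [lra|left; apply Rpower_pos].
Qed.

(** * Interchange of lattice sums with limits and integrals *)

Lemma box_continuous N (F : R -> Z * Z -> R) x : (forall p, continuous (fun y => F y p) x) ->
  continuous (fun y => box N (F y)) x.
Proof.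
  intros h. apply (zsum_continuous N (fun n y => zsum N (fun m => F y (n, m)))). intros n.
  apply (zsum_continuous N (fun m y => F y (n, m))). intros m. apply h.
Qed.

Lemma LS_continuous (F : R -> Z * Z -> R) w (x d B : R) : summable w -> 0 < d ->
  (forall p, continuous (fun y => F y p) x) ->
  (forall y, Rabs (y - x) < d -> lat_dominated w B (F y)) ->
  continuous (fun y => LS (F y)) x.
Proof.
  intros hw hd hF hB. apply filterlim_locally. intros eps.
  assert (hl : is_lim_seq (fun N => B * (ZS w ^ 2 - zsum N w ^ 2)) 0).
  { replace (Finite 0) with (Rbar_mult B 0) by (simpl; f_equal; ring).
    apply is_lim_seq_scal_l. now apply ZS2_tail_lim. }
  assert (he : 0 < eps / 4) by (apply Rdiv_lt_0_compat; [apply cond_pos|lra]).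
  apply is_lim_seq_spec in hl. destruct (hl (mkposreal _ he)) as [N HN].
  specialize (HN N ltac:(lia)). simpl in HN. rewrite Rminus_0_r in HN. apply Rabs_def2 in HN.
  assert (hc := box_continuous N F x hF).
  destruct (proj1 (filterlim_locally _ _) hc (mkposreal _ he)) as [del hdel].
  assert (hm : 0 < Rmin d del) by (apply Rmin_glb_lt; [assumption|apply cond_pos]).
  exists (mkposreal _ hm). intros y hy. change (Rabs (y - x) < Rmin d del) in hy.
  change (Rabs (LS (F y) - LS (F x)) < eps).
  assert (h1 : Rabs (y - x) < d) by (eapply Rlt_le_trans; [exact hy|apply Rmin_l]).
  assert (h2 : Rabs (box N (F y) - box N (F x)) < eps / 4).
  { apply (hdel y). change (Rabs (y - x) < del). eapply Rlt_le_trans; [exact hy|apply Rmin_r]. }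
  assert (h0 : Rabs (x - x) < d) by (replace (x - x) with 0 by ring; rewrite Rabs_R0; lra).
  destruct (LS_dominated (F y) w B hw (hB y h1)) as [_ e1]. specialize (e1 N).
  destruct (LS_dominated (F x) w B hw (hB x h0)) as [_ e2]. specialize (e2 N).
  replace (LS (F y) - LS (F x)) with
    ((LS (F y) - box N (F y)) + (box N (F y) - box N (F x)) + - (LS (F x) - box N (F x))) by ring.
  eapply Rle_lt_trans; [apply Rabs_triang|]. rewrite Rabs_Ropp.
  eapply Rle_lt_trans; [apply Rplus_le_compat_r, Rabs_triang|]. simpl in *. lra.
Qed.

Lemma LInt_zsum c N (f : Z -> R -> R) : 0 < c -> (forall m, exp_dom c (f m)) ->
  exp_dom c (fun x => zsum N (fun m => f m x)) /\
  LInt (fun x => zsum N (fun m => f m x)) = zsum N (fun m => LInt (f m)).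
Proof.
  intros hc hf. induction N as [|N [h1 h2]]; cbn [zsum]; [now split|].
  set (a := f (Z.of_nat (S N))). set (b := f (- Z.of_nat (S N))%Z).
  assert (ha : exp_dom c a) by apply hf. assert (hb : exp_dom c b) by apply hf.
  assert (hab := exp_dom_lin c a b 1 1 ha hb).
  assert (e : (fun x => zsum N (fun m => f m x) + (a x + b x)) =
    (fun x => 1 * zsum N (fun m => f m x) + 1 * (1 * a x + 1 * b x))).
  { apply functional_extensionality. intros x. ring. }
  rewrite e. split.
  - exact (exp_dom_lin c _ _ 1 1 h1 hab).
  - rewrite (LInt_lin c _ _ 1 1 hc h1 hab), (LInt_lin c a b 1 1 hc ha hb), h2. ring.
Qed.

Lemma LInt_box c N (F : R -> Z * Z -> R) : 0 < c -> (forall p, exp_dom c (fun x => F x p)) ->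
  exp_dom c (fun x => box N (F x)) /\
  LInt (fun x => box N (F x)) = box N (fun p => LInt (fun x => F x p)).
Proof.
  intros hc hF.
  destruct (LInt_zsum c N (fun n x => zsum N (fun m => F x (n, m))) hc) as [h1 h2].
  { intros n. now apply (LInt_zsum c N (fun m x => F x (n, m))). }
  split; [exact h1|]. unfold box. rewrite h2. apply zsum_ext. intros n.
  now apply (LInt_zsum c N (fun m x => F x (n, m))).
Qed.

(** The domination is a weight on the lattice times an exponential in [x]. So the truncation error
    at [N] is exponentially dominated, with a coefficient that tends to 0, and its integral tends to
    0 as well. *)
Lemma LInt_LS (F : R -> Z * Z -> R) w K c : summable w -> 0 < c ->
  (forall p x, continuous (fun y => F y p) x) ->
  (forall x p, Rabs (F x p) <= K * tensor w p * exp (- c * x)) ->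
  exp_dom c (fun x => LS (F x)) /\
  LInt (fun x => LS (F x)) = LS (fun p => LInt (fun x => F x p)).
Proof.
  intros hw hc hcont hF.
  assert (hdom : forall x, lat_dominated w (K * exp (- c * x)) (F x)).
  { intros x p. specialize (hF x p). lra. }
  assert (hK : 0 <= K * ZS w ^ 2).
  { pose proof (LS_abs_le (F 0) w _ hw (hdom 0)) as h.
    rewrite Rmult_0_r, exp_0, Rmult_1_r in h. eapply Rle_trans; [apply Rabs_pos|exact h]. }
  assert (hc2 : forall x, continuous (fun y => LS (F y)) x).
  { intros x. apply LS_continuous with w 1 (Rabs K * exp (- c * (x - 1))); auto; [lra|].
    intros y hy p. eapply Rle_trans; [apply hF|]. apply Rabs_def2 in hy.
    assert (ht : 0 <= tensor w p) by (apply Rmult_le_pos; apply hw).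
    assert (exp (- c * y) <= exp (- c * (x - 1))) by (apply exp_le_compat; nra).
    pose proof (exp_pos (- c * y)). pose proof (Rle_abs K). pose proof (Rabs_pos K).
    apply Rle_trans with (Rabs K * tensor w p * exp (- c * y)).
    - apply Rmult_le_compat_r; [lra|]. now apply Rmult_le_compat_r.
    - replace (Rabs K * exp (- c * (x - 1)) * tensor w p) with (Rabs K * tensor w p * exp (- c * (x - 1))) by ring.
      apply Rmult_le_compat_l; [now apply Rmult_le_pos|assumption]. }
  assert (hd : exp_dom c (fun x => LS (F x))).
  { split; [exact hc2|]. exists (K * ZS w ^ 2). intros x hx.
    pose proof (LS_abs_le (F x) w _ hw (hdom x)). lra. }
  split; [exact hd|].
  assert (hFd : forall p, exp_dom c (fun x => F x p)).
  { intros p. split; [apply hcont|]. exists (K * tensor w p). intros x hx. apply hF. }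
  symmetry. apply LS_unique.
  apply is_lim_seq_ext with (fun N => LInt (fun x => LS (F x)) -
     (LInt (fun x => LS (F x)) - box N (fun p => LInt (fun x => F x p)))); [intros; ring|].
  replace (Finite (LInt (fun x => LS (F x)))) with (Finite (LInt (fun x => LS (F x)) - 0))
    by (f_equal; ring).
  apply is_lim_seq_minus'; [apply is_lim_seq_const|].
  apply is_lim_seq_abs_0.
  apply is_lim_seq_le_le with (fun _ => 0) (fun N => K / c * (ZS w ^ 2 - zsum N w ^ 2)).
  - intros N. split; [apply Rabs_pos|].
    destruct (LInt_box c N F hc hFd) as [h1 h2]. rewrite <- h2.
    assert (e : LInt (fun x => LS (F x)) - LInt (fun x => box N (F x)) =
      LInt (fun x => 1 * LS (F x) + - (1) * box N (F x))).
    { rewrite (LInt_lin c _ _ _ _ hc hd h1). ring. }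
    rewrite e. replace (K / c * (ZS w ^ 2 - zsum N w ^ 2)) with
      (K * (ZS w ^ 2 - zsum N w ^ 2) / c) by (unfold Rdiv; ring).
    apply LInt_bound; [assumption|apply (exp_dom_lin c _ _ 1 (- (1)) hd h1)|].
    intros x hx. replace (1 * LS (F x) + - (1) * box N (F x)) with (LS (F x) - box N (F x)) by ring.
    destruct (LS_dominated (F x) w _ hw (hdom x)) as [_ h]. specialize (h N). lra.
  - apply is_lim_seq_const.
  - replace (Finite 0) with (Rbar_mult (K / c) 0) by (simpl; f_equal; ring).
    apply is_lim_seq_scal_l. now apply ZS2_tail_lim.
Qed.

(** * The Mellin transform of the resolvent sum *)

(** The trace of [(u + Delta / (4 pi^2))^(-2)] on the complement of the constants; the first power
    would not be of trace class in dimension two. *)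
Definition green (a u : R) : R := LS (lat_restrict (fun p => / (u + quad a p) ^ 2)).

(** For [x >= 0] the denominator is at least [A^t e^((2-t) x)], by interpolation, and for [x < 0] at
    least [A^2]. Decay in [x] is thereby separated from decay in [A]. *)
Lemma resolvent_kernel_bound s t A x : 1 <= t -> t < s -> s < 2 -> 0 < A ->
  0 <= resolvent_kernel s A x <=
  (Rpower A (- t) + Rpower A (- (2))) * exp (- Rmin (s - t) (2 - s) * Rabs x).
Proof.
  intros h1 hs h2 hA. unfold resolvent_kernel. pose proof (exp_pos x) as hx.
  pose proof (exp_pos ((2 - s) * x)) as hn.
  assert (hd : 0 < (exp x + A) ^ 2) by (apply pow_lt; lra).
  split; [apply Rdiv_le_0_compat; lra|].
  assert (e : exp ((2 - s) * x) / (exp x + A) ^ 2 = exp ((2 - s) * x + - (2 * ln (exp x + A)))).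
  { rewrite exp_plus, exp_Ropp. replace (2 * ln (exp x + A)) with (ln (exp x + A) + ln (exp x + A)) by ring.
    rewrite exp_plus, exp_ln by lra. simpl. field. lra. }
  rewrite e.
  assert (hl1 : x <= ln (exp x + A)).
  { rewrite <- (ln_exp x) at 1. left. apply ln_increasing; lra. }
  assert (hl2 : ln A <= ln (exp x + A)) by (left; apply ln_increasing; lra).
  pose proof (Rmin_l (s - t) (2 - s)) as m1. pose proof (Rmin_r (s - t) (2 - s)) as m2.
  rewrite Rmult_plus_distr_r. unfold Rpower. rewrite <- !exp_plus.
  destruct (Rle_lt_dec 0 x) as [hx0|hx0].
  - rewrite Rabs_pos_eq by assumption.
    apply Rle_trans with (exp (- t * ln A + - Rmin (s - t) (2 - s) * x)).
    + apply exp_le_compat. nra.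
    + pose proof (exp_pos (- (2) * ln A + - Rmin (s - t) (2 - s) * x)). lra.
  - rewrite Rabs_left by assumption.
    apply Rle_trans with (exp (- (2) * ln A + - Rmin (s - t) (2 - s) * - x)).
    + apply exp_le_compat. nra.
    + pose proof (exp_pos (- t * ln A + - Rmin (s - t) (2 - s) * - x)). lra.
Qed.

Lemma pw_le p q m : p <= q -> pw q m <= pw p m.
Proof.
  intros h. unfold pw, Rpower. apply exp_le_compat.
  assert (h1 : 0 <= ln (1 + IZR m ^ 2)).
  { rewrite <- ln_1. pose proof (pow2_ge_0 (IZR m)) as h2.
    destruct (Req_dec (IZR m ^ 2) 0) as [->|h3]; [rewrite Rplus_0_r; lra|].
    left. apply ln_increasing; lra. }
  nra.
Qed.

Lemma tensor_le w v p : (forall m, 0 <= w m <= v m) -> tensor w p <= tensor v p.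
Proof. intros h. unfold tensor. apply Rmult_le_compat; apply h. Qed.

(** The Mellin integral is stated as its halves over [u > 1] and [u < 1], the cut at which the
    continuation treats them differently. *)
Lemma green_mellin a s : 0 < a -> 1 < s < 2 ->
  let c := (Rmin (s - (1 + s) / 2) (2 - s)) in
  0 < c /\
  exp_dom c (fun x => exp ((2 - s) * x) * green a (exp x)) /\
  exp_dom c (fun x => exp ((2 - s) * - x) * green a (exp (- x))) /\
  LInt (fun x => exp ((2 - s) * x) * green a (exp x)) +
  LInt (fun x => exp ((2 - s) * - x) * green a (exp (- x))) =
  LS (lat_restrict (fun p => Rpower (quad a p) (- s))) * (PI * (s - 1) / sin (PI * (s - 1))).
Proof.
  (* An exponent strictly between 1 and [s]: above 1 for summability over the lattice, below [s] for
     exponential decay at large [x]. *)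
  intros ha hs c. set (t := (1 + s) / 2) in *.
  assert (hc : 0 < c) by (apply Rmin_glb_lt; unfold t; lra).
  set (F := fun x => lat_restrict (fun p => resolvent_kernel s (quad a p) x)).
  set (K := Rpower (quad_const a) (- t) + Rpower (quad_const a) (- (2))).
  assert (ht : 1 < t < 2) by (unfold t; lra).
  pose proof (pw_summable t ltac:(lra)) as hw.
  assert (hT : forall p, 0 <= tensor (pw t) p) by (intros p; apply Rmult_le_pos; apply hw).
  assert (hK : 0 < K).
  { pose proof (Rpower_pos (quad_const a) (- t)). pose proof (Rpower_pos (quad_const a) (- (2))). unfold K. lra. }
  assert (hF : forall x p, Rabs (F x p) <= K * tensor (pw t) p * exp (- c * Rabs x)).
  { intros x p. pose proof (exp_pos (- c * Rabs x)) as he. unfold F.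
    destruct (classic (p = (0, 0)%Z)) as [->|hp].
    - unfold lat_restrict. simpl (Z.eqb _ _). simpl andb. cbv iota. rewrite Rabs_R0.
      apply Rmult_le_pos; [|lra]. apply Rmult_le_pos; [lra|apply hT].
    - rewrite lat_restrict_neq by assumption.
      pose proof (quad_pos a p ha hp) as hq.
      destruct (resolvent_kernel_bound s t (quad a p) x ltac:(lra) ltac:(unfold t; lra) ltac:(lra) hq) as [h1 h2].
      rewrite Rabs_pos_eq by assumption. eapply Rle_trans; [exact h2|].
      apply Rmult_le_compat_r; [lra|]. unfold K. rewrite Rmult_plus_distr_r.
      apply Rplus_le_compat; [apply quad_power_bound; auto; lra|].
      eapply Rle_trans; [apply quad_power_bound; auto; lra|].
      apply Rmult_le_compat_l; [left; apply Rpower_pos|]. apply tensor_le.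
      intros m. split; [left; apply Rpower_pos|apply pw_le; lra]. }
  assert (hFc : forall p x, continuous (fun y => F y p) x).
  { intros p x. unfold F. destruct (classic (p = (0, 0)%Z)) as [->|hp].
    - apply continuous_const.
    - apply continuous_ext with (fun y => resolvent_kernel s (quad a p) y).
      + intros y. now rewrite lat_restrict_neq.
      + apply resolvent_kernel_continuous. now apply quad_pos. }
  assert (hle : forall x p y, - c * Rabs y <= - c * x ->
    Rabs (F y p) <= K * tensor (pw t) p * exp (- c * x)).
  { intros x p y h. eapply Rle_trans; [apply hF|]. apply Rmult_le_compat_l.
    - apply Rmult_le_pos; [lra|apply hT].
    - now apply exp_le_compat. }
  destruct (LInt_LS F (pw t) K c hw hc hFc) as [d1 e1].
  { intros x p. apply hle. pose proof (Rle_abs x). nra. }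
  destruct (LInt_LS (fun x => F (- x)) (pw t) K c hw hc) as [d2 e2].
  { intros p x. apply (continuous_comp (fun y => - y) (fun y => F y p)); [|apply hFc].
    apply continuous_ex_derive. auto_derive. auto. }
  { intros x p. apply hle. rewrite Rabs_Ropp. pose proof (Rle_abs x). nra. }
  assert (hG : forall y, 0 < exp y -> exp ((2 - s) * y) * green a (exp y) = LS (F y)).
  { intros y hy. unfold green.
    rewrite <- (LS_scal _ (pw 2) (Rpower (quad_const a) (- (2)))).
    - f_equal. apply functional_extensionality. intros p. unfold F.
      destruct (classic (p = (0, 0)%Z)) as [->|hp]; [unfold lat_restrict; simpl; ring|].
      now rewrite !lat_restrict_neq by assumption.
    - apply pw_summable. lra.
    - apply quad_power_dominated; [assumption|lra|]. intros p hp.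
      pose proof (quad_pos a p ha hp) as hq.
      rewrite Rpower_Ropp. replace (Rpower (quad a p) 2) with (quad a p ^ 2)
        by (rewrite <- Rpower_pow by assumption; reflexivity).
      rewrite Rabs_pos_eq by (left; apply Rinv_0_lt_compat, pow_lt; lra).
      apply Rinv_le_contravar; [now apply pow_lt|]. apply pow_incr. lra. }
  assert (hG1 : (fun x => exp ((2 - s) * x) * green a (exp x)) = (fun x => LS (F x))).
  { apply functional_extensionality. intros x. apply hG, exp_pos. }
  assert (hG2 : (fun x => exp ((2 - s) * - x) * green a (exp (- x))) = (fun x => LS (F (- x)))).
  { apply functional_extensionality. intros x. apply hG, exp_pos. }
  rewrite hG1, hG2. split; [exact hc|]. split; [exact d1|]. split; [exact d2|].
  rewrite e1, e2.
  assert (hLI : forall f, (forall x p, continuous (fun y => f y p) x) ->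
    (forall x p, Rabs (f x p) <= K * tensor (pw t) p * exp (- c * x)) ->
    lat_dominated (pw t) (K / c) (fun p => LInt (fun x => f x p))).
  { intros f hf hb p. replace (K / c * tensor (pw t) p) with (K * tensor (pw t) p / c) by (unfold Rdiv; ring).
    apply LInt_bound; [assumption|intros x; apply hf|]. intros x _. apply hb. }
  assert (b1 : lat_dominated (pw t) (K / c) (fun p => LInt (fun x => F x p))).
  { apply hLI; [intros; apply hFc|]. intros x p. apply hle. pose proof (Rle_abs x). nra. }
  assert (b2 : lat_dominated (pw t) (K / c) (fun p => LInt (fun x => F (- x) p))).
  { apply (hLI (fun x p => F (- x) p)).
    - intros x p. apply (continuous_comp (fun y => - y) (fun y => F y p)); [|apply hFc].
      apply continuous_ex_derive. auto_derive. auto.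
    - intros x p. apply hle. rewrite Rabs_Ropp. pose proof (Rle_abs x). nra. }
  destruct (LS_bounded_functional (pw t) hw) as [hlin _].
  destruct (hlin _ _ 1 1 (ex_intro _ (K / c) b1) (ex_intro _ (K / c) b2)) as [_ e3].
  rewrite !Rmult_1_l in e3. rewrite <- e3, Rmult_comm.
  rewrite <- (LS_scal _ (pw s) (Rpower (quad_const a) (- s))).
  - f_equal. apply functional_extensionality. intros p. rewrite !Rmult_1_l. unfold F.
    destruct (classic (p = (0, 0)%Z)) as [->|hp].
    + unfold lat_restrict. simpl.
      assert (h0 : LInt (fun _ => 0) = 0).
      { unfold LInt. rewrite (Lim_seq_ext _ (fun _ => 0)).
        - now rewrite Lim_seq_const.
        - intros n. rewrite RInt_const. unfold scal; simpl; unfold mult; simpl. ring. }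
      rewrite h0. ring.
    + rewrite lat_restrict_neq by assumption.
      rewrite (Rmult_comm (PI * (s - 1) / sin (PI * (s - 1)))).
      rewrite <- resolvent_mellin by (auto using quad_pos).
      f_equal; f_equal; apply functional_extensionality; intros x; now rewrite lat_restrict_neq.
  - apply pw_summable. lra.
  - apply quad_power_dominated; [assumption|lra|].
    intros p hp. rewrite Rabs_pos_eq; [lra|left; apply Rpower_pos].
Qed.

Lemma pw2_eq m : pw 2 m = / (1 + IZR m ^ 2).
Proof.
  unfold pw. pose proof (pow2_ge_0 (IZR m)). replace (2 / 2) with 1 by field.
  rewrite Rpower_Ropp, Rpower_1 by lra. reflexivity.
Qed.

Lemma pw2_summable : summable (pw 2).
Proof. apply pw_summable. lra. Qed.

Lemma shifted_square_inv_bound x m : 0 < x -> 0 < / (IZR m ^ 2 + x) <= (1 + / x) * pw 2 m.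
Proof.
  intros hx. rewrite pw2_eq. pose proof (pow2_ge_0 (IZR m)) as hm.
  split; [apply Rinv_0_lt_compat; lra|].
  apply Rmult_le_reg_r with (IZR m ^ 2 + x); [lra|].
  apply Rmult_le_reg_r with (1 + IZR m ^ 2); [lra|].
  pose proof (Rinv_0_lt_compat x hx).
  rewrite Rinv_l by lra.
  replace ((1 + / x) * / (1 + IZR m ^ 2) * (IZR m ^ 2 + x) * (1 + IZR m ^ 2)) with
    ((IZR m ^ 2 + x) + (IZR m ^ 2 * / x + x * / x)) by (field; lra).
  rewrite Rinv_r by lra. nra.
Qed.

(** * Asymptotics of the resolvent sum *)

Definition rsum (k : nat) (x : R) : R := ZS (fun m => / (IZR m ^ 2 + x) ^ k).

Lemma rsum1_eq x : rsum 1 x = ZS (fun m => / (IZR m ^ 2 + x)).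
Proof. apply ZS_ext. intros m. now rewrite pow_1. Qed.

Lemma rsum1_summable x : 0 < x -> summable (fun m => / (IZR m ^ 2 + x)).
Proof.
  intros hx. apply summable_le with (pw 2) (1 + / x); [apply pw2_summable|].
  intros m. pose proof (shifted_square_inv_bound x m hx). lra.
Qed.

Lemma ZS_scal f w K c : summable w -> (forall m, Rabs (f m) <= K * w m) ->
  ZS (fun m => c * f m) = c * ZS f.
Proof.
  intros hw hf. replace (fun m => c * f m) with (fun m => c * f m + 0 * f m)
    by (apply functional_extensionality; intros m; ring).
  rewrite (ZS_lin f f w K K) by assumption. ring.
Qed.

Lemma inv_pow_le x m k : 0 < x -> / (IZR m ^ 2 + x) ^ (S k) <= / x ^ k * / (IZR m ^ 2 + x).
Proof.
  intros hx. pose proof (pow2_ge_0 (IZR m)) as hm.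
  rewrite <- Rinv_mult. apply Rinv_le_contravar.
  - apply Rmult_lt_0_compat; [now apply pow_lt|lra].
  - simpl. rewrite Rmult_comm. apply Rmult_le_compat_l; [lra|]. apply pow_incr. lra.
Qed.

Lemma rsum_dominated x k m : 0 < x ->
  Rabs (/ (IZR m ^ 2 + x) ^ S k) <= / x ^ k * / (IZR m ^ 2 + x).
Proof.
  intros hx. pose proof (pow2_ge_0 (IZR m)) as hm.
  rewrite Rabs_pos_eq by (left; apply Rinv_0_lt_compat, pow_lt; lra). now apply inv_pow_le.
Qed.

Lemma is_derive_of_quadratic_R (f : R -> R) (x l d M : R) : 0 < d -> 0 <= M ->
  (forall y, Rabs (y - x) < d -> Rabs (f y - f x - l * (y - x)) <= M * (y - x) ^ 2) ->
  is_derive f x l.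
Proof.
  intros hd hM h. apply is_derive_Reals. intros eps heps.
  set (e := Rmin d (eps / (M + 1))).
  assert (he : 0 < e) by (apply Rmin_glb_lt; [assumption|apply Rdiv_lt_0_compat; lra]).
  exists (mkposreal e he). intros t ht0 ht. simpl in ht.
  assert (h1 : Rabs t < d) by (eapply Rlt_le_trans; [exact ht|apply Rmin_l]).
  assert (h2 : Rabs t < eps / (M + 1)) by (eapply Rlt_le_trans; [exact ht|apply Rmin_r]).
  specialize (h (x + t)). replace (x + t - x) with t in h by ring. specialize (h h1).
  assert (hp : 0 < Rabs t) by now apply Rabs_pos_lt.
  replace ((f (x + t) - f x) / t - l) with ((f (x + t) - f x - l * t) / t) by (field; assumption).
  rewrite Rabs_div by assumption.
  apply Rmult_lt_reg_r with (Rabs t); [assumption|].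
  replace (Rabs (f (x + t) - f x - l * t) / Rabs t * Rabs t) with (Rabs (f (x + t) - f x - l * t))
    by (field; lra).
  eapply Rle_lt_trans; [exact h|].
  replace (t ^ 2) with (Rabs t * Rabs t) by (rewrite <- Rabs_mult, Rabs_pos_eq; nra).
  assert ((M + 1) * Rabs t < eps).
  { apply Rmult_lt_reg_r with (/ (M + 1)); [apply Rinv_0_lt_compat; lra|].
    replace ((M + 1) * Rabs t * / (M + 1)) with (Rabs t) by (field; lra). exact h2. }
  nra.
Qed.

(** Termwise differentiation with an exact second-order remainder: with [A = m^2], [1/(A+y) -
    1/(A+x) + (y-x)/(A+x)^2 = (y-x)^2 / ((A+x)^2 (A+y))], whose sum over [m] is O((y-x)^2) for [y]
    within [x/2] of [x]. *)
Lemma rsum1_derive x : 0 < x -> is_derive (rsum 1) x (- rsum 2 x).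
Proof.
  intros hx. set (S1 := rsum 1 x).
  assert (hS1 : 0 <= S1).
  { unfold S1. rewrite rsum1_eq. apply ZS_nonneg. now apply rsum1_summable. }
  apply is_derive_of_quadratic_R with (x / 2) (2 / x ^ 2 * S1); [lra| |].
  - apply Rmult_le_pos; [|assumption]. apply Rdiv_le_0_compat; [lra|now apply pow_lt].
  - intros y hy. apply Rabs_def2 in hy. 
    pose proof (rsum1_summable x hx) as hw.
    assert (hfy : forall m, Rabs (/ (IZR m ^ 2 + y)) <= 2 * / (IZR m ^ 2 + x)).
    { intros m. pose proof (pow2_ge_0 (IZR m)).
      rewrite Rabs_pos_eq by (left; apply Rinv_0_lt_compat; lra).
      replace (2 * / (IZR m ^ 2 + x)) with (/ ((IZR m ^ 2 + x) / 2)) by (field; lra).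
      apply Rinv_le_contravar; lra. }
    assert (hfx : forall m, Rabs (/ (IZR m ^ 2 + x)) <= 1 * / (IZR m ^ 2 + x)).
    { intros m. pose proof (pow2_ge_0 (IZR m)).
      rewrite Rabs_pos_eq by (left; apply Rinv_0_lt_compat; lra). lra. }
    assert (hfx2 : forall m, Rabs (/ (IZR m ^ 2 + x) ^ 2) <= / x * / (IZR m ^ 2 + x)).
    { intros m. pose proof (rsum_dominated x 1 m hx) as h. now rewrite pow_1 in h. }
    assert (e : rsum 1 y - S1 - - rsum 2 x * (y - x) =
      (y - x) ^ 2 * ZS (fun m => / ((IZR m ^ 2 + x) ^ 2 * (IZR m ^ 2 + y)))).
    { unfold S1. rewrite !rsum1_eq. unfold rsum.
      assert (hd1 : forall m, Rabs (1 * / (IZR m ^ 2 + y) + - (1) * / (IZR m ^ 2 + x)) <= 3 * / (IZR m ^ 2 + x)).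
      { intros m. eapply Rle_trans; [apply Rabs_triang|]. rewrite !Rabs_mult, Rabs_Ropp, Rabs_R1.
        specialize (hfy m). specialize (hfx m). lra. }
      transitivity (1 * ZS (fun m => 1 * / (IZR m ^ 2 + y) + - (1) * / (IZR m ^ 2 + x)) +
        (y - x) * ZS (fun m => / (IZR m ^ 2 + x) ^ 2)).
      - rewrite (ZS_lin (fun m => / (IZR m ^ 2 + y)) (fun m => / (IZR m ^ 2 + x)) _ _ _ 1 (- (1)) hw hfy hfx). ring.
      - rewrite <- (ZS_lin _ _ _ _ _ 1 (y - x) hw hd1 hfx2).
        rewrite <- (ZS_scal _ (fun m => / (IZR m ^ 2 + x)) (2 / x ^ 2)).
        + apply ZS_ext. intros m. pose proof (pow2_ge_0 (IZR m)). field. lra.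
        + assumption.
        + intros m. pose proof (pow2_ge_0 (IZR m)).
          assert (0 < (IZR m ^ 2 + x) ^ 2) by (apply pow_lt; lra).
          rewrite Rabs_pos_eq by (left; apply Rinv_0_lt_compat, Rmult_lt_0_compat; lra).
          rewrite Rinv_mult. specialize (hfy m). specialize (hfx2 m).
          rewrite Rabs_pos_eq in hfy, hfx2 by (left; apply Rinv_0_lt_compat; lra).
          assert (hy1 : / (IZR m ^ 2 + y) <= 2 / x).
          { replace (2 / x) with (/ (x / 2)) by (field; lra). apply Rinv_le_contravar; lra. }
          assert (hpx : 0 < / (IZR m ^ 2 + x)) by (apply Rinv_0_lt_compat; lra).
          replace (2 / x ^ 2 * / (IZR m ^ 2 + x)) with ((/ x * / (IZR m ^ 2 + x)) * (2 / x)) by (field; lra).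
          apply Rmult_le_compat; try lra; left; apply Rinv_0_lt_compat; lra. }
    fold S1. rewrite e, Rabs_mult, (Rabs_pos_eq ((y - x) ^ 2)), Rmult_comm by apply pow2_ge_0.
    apply Rmult_le_compat_r; [apply pow2_ge_0|].
    unfold S1. rewrite rsum1_eq.
    apply ZS_abs_le; [assumption|].
    intros m. pose proof (pow2_ge_0 (IZR m)).
    assert (0 < (IZR m ^ 2 + x) ^ 2) by (apply pow_lt; lra).
    rewrite Rabs_pos_eq by (left; apply Rinv_0_lt_compat, Rmult_lt_0_compat; lra).
    rewrite Rinv_mult. specialize (hfx2 m).
    rewrite Rabs_pos_eq in hfx2 by (left; apply Rinv_0_lt_compat; lra).
    assert (hy1 : / (IZR m ^ 2 + y) <= 2 / x).
    { replace (2 / x) with (/ (x / 2)) by (field; lra). apply Rinv_le_contravar; lra. }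
    replace (2 / x ^ 2 * / (IZR m ^ 2 + x)) with ((/ x * / (IZR m ^ 2 + x)) * (2 / x)) by (field; lra).
    apply Rmult_le_compat; try lra; left; apply Rinv_0_lt_compat; lra.
Qed.

(** * Row sums in closed form and their exponentially small errors *)

Definition coth (y : R) : R := cosh y / sinh y.

Lemma sinh_pos y : 0 < y -> 0 < sinh y.
Proof. intros hy. rewrite <- sinh_0. now apply sinh_lt. Qed.

Lemma rsum1_coth x : 0 < x -> rsum 1 x = PI * coth (PI * sqrt x) / sqrt x.
Proof.
  intros hx. rewrite rsum1_eq. pose proof (sqrt_lt_R0 x hx) as hs. apply ZS_unique.
  pose proof PI_RGT_0. assert (0 < sinh (PI * sqrt x)) by (apply sinh_pos; nra).
  replace (PI * coth (PI * sqrt x) / sqrt x) with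
    (PI * cosh (PI * sqrt x) / (sqrt x * sinh (PI * sqrt x))) by (unfold coth; field; lra).
  apply is_lim_seq_ext with (2 := coth_partial_fractions (sqrt x) hs).
  intros N. apply zsum_ext. intros m. now rewrite pow2_sqrt by lra.
Qed.

(** Both sides are minus the derivative of [rsum 1], once termwise and once from its closed form. *)
Lemma rsum2_coth x : 0 < x ->
  rsum 2 x = PI * coth (PI * sqrt x) / (2 * x * sqrt x) + PI ^ 2 / (2 * x * sinh (PI * sqrt x) ^ 2).
Proof.
  intros hx. pose proof PI_RGT_0 as hpi. pose proof (sqrt_lt_R0 x hx) as hs.
  assert (hsh : 0 < sinh (PI * sqrt x)) by (apply sinh_pos; nra).
  assert (h1 := rsum1_derive x hx).
  assert (h2 : is_derive (rsum 1) x
    (- (PI * coth (PI * sqrt x) / (2 * x * sqrt x) + PI ^ 2 / (2 * x * sinh (PI * sqrt x) ^ 2)))).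
  { apply is_derive_ext_loc with (fun y => PI * (cosh (PI * sqrt y) / sinh (PI * sqrt y)) / sqrt y).
    - exists (mkposreal x hx). intros y hy. change (Rabs (y - x) < x) in hy.
      apply Rabs_def2 in hy. symmetry. apply rsum1_coth. lra.
    - auto_derive; [repeat split; lra|].
      unfold coth. set (v := sqrt x) in *.
      replace x with (v ^ 2) by (unfold v; apply pow2_sqrt; lra).
      assert (hch : cosh (PI * v) ^ 2 = 1 + sinh (PI * v) ^ 2).
      { unfold cosh, sinh. pose proof (exp_plus (PI * v) (- (PI * v))) as he.
        rewrite Rplus_opp_r, exp_0 in he. nra. }
      transitivity (PI * (PI * (sinh (PI * v) ^ 2 - cosh (PI * v) ^ 2)) / (2 * v ^ 2 * sinh (PI * v) ^ 2)
         - PI * cosh (PI * v) / (2 * v ^ 3 * sinh (PI * v))).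
      + field. lra.
      + rewrite hch. field. lra. }
  apply is_derive_unique in h1. apply is_derive_unique in h2. lra.
Qed.

(** The constant term is kept because it has to offset [exp (- y) <= 1] in the hyperbolic sine and
    the -1 in [exp z - 1]. *)
Lemma exp_ge_one_term (x : R) n : 0 <= x -> 1 + x ^ S n / INR (fact (S n)) <= exp x.
Proof.
  intros hx.
  assert (h : exp 0 - 0 ^ S n / INR (fact (S n)) <= exp x - x ^ S n / INR (fact (S n))).
  { apply (derive_nonneg_le (fun y => exp y - y ^ S n / INR (fact (S n)))
      (fun y => exp y - y ^ n / INR (fact n))); [lra| |].
    - intros y hy.
      assert (hc : / INR (fact n) = INR (S n) * / INR (fact (S n))).
      { rewrite fact_simpl, mult_INR. field.
        split; [apply INR_fact_neq_0|now apply not_0_INR]. }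
      unfold Rdiv. rewrite hc. generalize (/ INR (fact (S n))). intros c.
      auto_derive; [auto|].
      change (match n with O => 1 | S _ => INR n + 1 end) with (INR (S n)). ring.
    - intros y hy. pose proof (exp_ge_term y n ltac:(lra)). lra. }
  rewrite exp_0, pow_i in h by lia. unfold Rdiv in h at 1. lra.
Qed.

Lemma sinh_ge_term (y : R) n : 0 <= y -> y ^ S n / (2 * INR (fact (S n))) <= sinh y.
Proof.
  intros hy. pose proof (exp_ge_one_term y n hy) as h. unfold sinh.
  assert (exp (- y) <= 1) by (rewrite <- exp_0; apply exp_le_compat; lra).
  replace (y ^ S n / (2 * INR (fact (S n)))) with (y ^ S n / INR (fact (S n)) / 2)
    by (field; apply INR_fact_neq_0). lra.
Qed.

Lemma coth_minus_1 y : 0 < y -> 0 < coth y - 1 <= / sinh y.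
Proof.
  intros hy. pose proof (sinh_pos y hy) as hs.
  assert (e : coth y - 1 = exp (- y) * / sinh y).
  { unfold coth. replace (exp (- y)) with (cosh y - sinh y) by (unfold cosh, sinh; field).
    field. lra. }
  rewrite e. pose proof (exp_pos (- y)). pose proof (Rinv_0_lt_compat _ hs).
  assert (exp (- y) <= 1) by (rewrite <- exp_0; apply exp_le_compat; lra).
  split; nra.
Qed.

Lemma coth_upper y : 0 < y -> coth y <= 1 + 2 / y.
Proof.
  intros hy. destruct (coth_minus_1 y hy) as [_ h].
  pose proof (sinh_ge_term y 0 ltac:(lra)) as h1. simpl in h1.
  assert (/ sinh y <= / (y / 2)) by (apply Rinv_le_contravar; lra).
  replace (2 / y) with (/ (y / 2)) by (field; lra). lra.
Qed.

(** The subtracted term is the integral of [(t^2 + x)^(-2)] over the line, which is also what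
    remains when the hyperbolic cotangent is replaced by 1. *)
Definition rsum2_error (x : R) : R := rsum 2 x - PI / 2 * / (x * sqrt x).

Lemma rsum2_error_bound k : exists C, 0 <= C /\ forall x, 0 < x ->
  0 <= rsum2_error x <= C * / x ^ (S (S k)).
Proof.
  (* The orders [2 k + 1] and [k + 1] at which the hyperbolic sine is bounded below are chosen so
     that both parts of the error become [v^(-(2 k + 4)) = x^(-(k + 2))], where [v = sqrt x]. *)
  set (f1 := INR (fact (S (2 * k)))). set (f2 := INR (fact (S k))).
  exists (PI / 2 * (2 * f1 / PI ^ S (2 * k)) + PI ^ 2 / 2 * (2 * f2 / PI ^ S k) ^ 2).
  pose proof PI_RGT_0 as hpi.
  assert (hf1 : 0 < f1) by apply INR_fact_lt_0. 
  assert (hp1 : 0 < PI ^ S (2 * k)) by now apply pow_lt. 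
  assert (hA : 0 <= 2 * f1 / PI ^ S (2 * k)) by (apply Rdiv_le_0_compat; lra).
  split.
  { apply Rplus_le_le_0_compat; apply Rmult_le_pos; try lra; try assumption.
    - pose proof (pow2_ge_0 PI). lra.
    - apply pow2_ge_0. }
  intros x hx. pose proof (sqrt_lt_R0 x hx) as hs.
  set (v := sqrt x) in *. assert (hxv : x = v ^ 2) by (unfold v; rewrite pow2_sqrt; lra).
  assert (hy : 0 < PI * v) by nra.
  pose proof (sinh_pos _ hy) as hsh.
  unfold rsum2_error. rewrite rsum2_coth by assumption. fold v.
  replace (PI * coth (PI * v) / (2 * x * v) + PI ^ 2 / (2 * x * sinh (PI * v) ^ 2) - PI / 2 * / (x * v)) with
    (PI / 2 * (/ v ^ 3 * (coth (PI * v) - 1)) + PI ^ 2 / 2 * (/ v ^ 2 * (/ sinh (PI * v)) ^ 2))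
    by (rewrite hxv; field; lra).
  destruct (coth_minus_1 _ hy) as [hc1 hc2].
  assert (hinv : forall j, / sinh (PI * v) <= 2 * INR (fact (S j)) / PI ^ S j * / v ^ S j).
  { intros j. pose proof (sinh_ge_term (PI * v) j ltac:(lra)) as h.
    rewrite Rpow_mult_distr in h. pose proof (INR_fact_lt_0 (S j)) as hf.
    assert (hpj : 0 < PI ^ S j) by now apply pow_lt. assert (hvj : 0 < v ^ S j) by now apply pow_lt.
    replace (2 * INR (fact (S j)) / PI ^ S j * / v ^ S j) with (/ (PI ^ S j * v ^ S j / (2 * INR (fact (S j)))))
      by (field; repeat split; lra).
    apply Rinv_le_contravar; [|exact h]. apply Rdiv_lt_0_compat; nra. }
  assert (hv3 : 0 < / v ^ 3) by (apply Rinv_0_lt_compat, pow_lt; lra).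
  assert (hv2 : 0 < / v ^ 2) by (apply Rinv_0_lt_compat, pow_lt; lra).
  assert (hpi2 : 0 < PI ^ 2) by now apply pow_lt.
  split.
  - apply Rplus_le_le_0_compat; apply Rmult_le_pos; try lra.
    + apply Rmult_le_pos; lra.
    + apply Rmult_le_pos; [lra|apply pow2_ge_0].
  - rewrite Rmult_plus_distr_r. apply Rplus_le_compat.
    + rewrite Rmult_assoc. apply Rmult_le_compat_l; [lra|].
      replace (2 * f1 / PI ^ S (2 * k) * / x ^ S (S k)) with
        (/ v ^ 3 * (2 * f1 / PI ^ S (2 * k) * / v ^ S (2 * k))).
      * apply Rmult_le_compat_l; [lra|]. eapply Rle_trans; [exact hc2|apply hinv].
      * rewrite hxv, <- pow_mult. replace (2 * S (S k))%nat with (3 + S (2 * k))%nat by lia.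
        rewrite (pow_add v 3). field. repeat split; try lra; apply pow_nonzero; lra.
    + rewrite Rmult_assoc. apply Rmult_le_compat_l; [lra|].
      replace ((2 * f2 / PI ^ S k) ^ 2 * / x ^ S (S k)) with
        (/ v ^ 2 * (2 * f2 / PI ^ S k * / v ^ S k) ^ 2).
      * apply Rmult_le_compat_l; [lra|]. apply pow_incr. split; [lra|apply hinv].
      * rewrite hxv, <- pow_mult. replace (2 * S (S k))%nat with (2 + (S k + S k))%nat by lia.
        rewrite (pow_add v 2), (pow_add v (S k)). field. repeat split; try lra; apply pow_nonzero; lra.
Qed.

(** The two directions have independent coefficients so that they can be exchanged, and so that one
    of them can be refined to mesh [h]. *)
Definition lat_term (V A B : R) (p : Z * Z) : R := / (V + A * IZR (fst p) ^ 2 + B * IZR (snd p) ^ 2) ^ 2.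

Lemma lat_term_dominated V A B : 0 < V -> 0 < A -> 0 < B ->
  lat_dominated (pw 2) (/ Rmin V (Rmin A B) ^ 2) (lat_term V A B).
Proof.
  intros hV hA hB [n m]. unfold lat_term, tensor. simpl fst. simpl snd. rewrite !pw2_eq.
  set (k := Rmin V (Rmin A B)).
  assert (hk : 0 < k) by (repeat apply Rmin_glb_lt; assumption).
  assert (h1 : k <= V) by apply Rmin_l.
  assert (h2 : k <= A) by (eapply Rle_trans; [apply Rmin_r|apply Rmin_l]).
  assert (h3 : k <= B) by (eapply Rle_trans; [apply Rmin_r|apply Rmin_r]).
  pose proof (pow2_ge_0 (IZR n)) as hn. pose proof (pow2_ge_0 (IZR m)) as hm.
  set (x := IZR n ^ 2) in *. set (y := IZR m ^ 2) in *.
  assert (h4 : k * (1 + x + y) <= V + A * x + B * y) by nra.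
  assert (h5 : 0 < k * (1 + x + y)) by nra.
  rewrite Rabs_pos_eq by (left; apply Rinv_0_lt_compat, pow_lt; lra).
  rewrite <- !Rinv_mult. apply Rinv_le_contravar.
  - apply Rmult_lt_0_compat; [now apply pow_lt|nra].
  - apply Rle_trans with ((k * (1 + x + y)) ^ 2); [|apply pow_incr; lra].
    rewrite Rpow_mult_distr. apply Rmult_le_compat_l; [apply pow2_ge_0|nra].
Qed.

Lemma LS_remove_origin F w K : summable w -> lat_dominated w K F ->
  LS F = LS (lat_restrict F) + F (0, 0)%Z.
Proof.
  intros hw hF.
  assert (hK : lat_dominated w (Rabs K) (lat_restrict F)).
  { intros p. assert (ht : 0 <= tensor w p) by (apply Rmult_le_pos; apply hw).
    destruct (classic (p = (0, 0)%Z)) as [->|hp].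
    - unfold lat_restrict. simpl. rewrite Rabs_R0. apply Rmult_le_pos; [apply Rabs_pos|assumption].
    - rewrite lat_restrict_neq by assumption. eapply Rle_trans; [apply hF|].
      apply Rmult_le_compat_r; [assumption|apply Rle_abs]. }
  apply LS_unique.
  apply is_lim_seq_ext with (fun N => box N (lat_restrict F) + F (0, 0)%Z).
  - intros N. enough (h : box N (fun p => 1 * F p + - (1) * lat_restrict F p) = F (0, 0)%Z).
    { rewrite box_lin in h. lra. }
    unfold box. apply zsum_delta.
    + intros n hn. apply zsum_delta; [intros m _|];
        (rewrite lat_restrict_neq; [ring|congruence]).
    + apply zsum_delta.
      * intros m hm. rewrite lat_restrict_neq; [ring|congruence].
      * unfold lat_restrict. simpl. ring.
  - apply is_lim_seq_plus'; [|apply is_lim_seq_const]. now apply LS_dominated with w (Rabs K).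
Qed.

Lemma row_sum_scaled x c : 0 < x -> 0 < c ->
  ZS (fun m => / (x + c * IZR m ^ 2) ^ 2) = / c ^ 2 * rsum 2 (x / c).
Proof.
  intros hx hc. assert (hxc : 0 < x / c) by now apply Rdiv_lt_0_compat.
  unfold rsum. rewrite <- (ZS_scal _ _ (/ (x / c) ^ 1) (/ c ^ 2) (rsum1_summable _ hxc)).
  - apply ZS_ext. intros m. field.
    repeat split; try lra; nra.
  - intros m. now apply rsum_dominated.
Qed.

Lemma lat_term_rows V A B : 0 < V -> 0 < A -> 0 < B ->
  LS (lat_term V A B) = ZS (fun n => / B ^ 2 * rsum 2 ((V + A * IZR n ^ 2) / B)).
Proof.
  intros hV hA hB.
  rewrite (LS_iterated _ _ _ pw2_summable (lat_term_dominated V A B hV hA hB)).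
  apply ZS_ext. intros n. unfold lat_term. simpl fst. simpl snd.
  apply row_sum_scaled; [|assumption]. nra.
Qed.

Lemma lat_term_swap V A B : LS (lat_term V A B) = LS (lat_term V B A).
Proof.
  rewrite <- LS_swap. f_equal. apply functional_extensionality. intros [n m].
  unfold lat_term, swap. simpl. f_equal. ring.
Qed.

(** The term [1 / u^2] restores the origin, after which every row is a complete sum over the
    integers. *)
Lemma green_rows a u : 0 < a -> 0 < u ->
  green a u + / u ^ 2 = ZS (fun n => a ^ 2 * rsum 2 (a * u + a ^ 2 * IZR n ^ 2)).
Proof.
  intros ha hu. pose proof (Rinv_0_lt_compat a ha) as hia.
  assert (h := lat_term_rows u a (/ a) hu ha hia).
  rewrite (LS_remove_origin _ _ _ pw2_summable (lat_term_dominated u a (/ a) hu ha hia)) in h.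
  assert (e1 : lat_term u a (/ a) (0, 0)%Z = / u ^ 2).
  { unfold lat_term. simpl fst. simpl snd. f_equal. f_equal. ring. }
  assert (e2 : lat_restrict (lat_term u a (/ a)) = lat_restrict (fun p => / (u + quad a p) ^ 2)).
  { apply functional_extensionality. intros p. unfold lat_restrict.
    destruct (Z.eqb (fst p) 0 && Z.eqb (snd p) 0)%bool; [reflexivity|].
    unfold lat_term, quad. do 2 f_equal. field. lra. }
  unfold green. rewrite e1, e2 in h. rewrite h. apply ZS_ext. intros n.
  rewrite pow_inv, Rinv_inv. do 2 f_equal. field. lra.
Qed.

(** * Riemann sums of the main term *)

Definition inv32 (x : R) : R := / (x * sqrt x).

Lemma inv32_pos x : 0 < x -> 0 < inv32 x.
Proof. intros hx. apply Rinv_0_lt_compat. pose proof (sqrt_lt_R0 x hx). nra. Qed.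

Lemma inv32_scale x c : 0 < x -> 0 < c -> inv32 (c ^ 2 * x) = / c ^ 3 * inv32 x.
Proof.
  intros hx hc. unfold inv32. rewrite sqrt_mult_alt by apply pow2_ge_0.
  rewrite sqrt_pow2 by lra. pose proof (sqrt_lt_R0 x hx). field. lra.
Qed.

Definition inv32_primitive (V y : R) : R := y / (V * sqrt (V + y ^ 2)).

Lemma inv32_primitive_derive V y : 0 < V ->
  is_derive (inv32_primitive V) y (inv32 (V + y ^ 2)).
Proof.
  intros hV. pose proof (pow2_ge_0 y) as hy. pose proof (sqrt_lt_R0 (V + y ^ 2) ltac:(lra)) as hs.
  unfold inv32_primitive, inv32. auto_derive.
  - replace (y * (y * 1)) with (y ^ 2) by ring. repeat split; try lra. nra.
  - replace (y * (y * 1)) with (y ^ 2) by ring.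
    set (s := sqrt (V + y ^ 2)) in *.
    assert (e : V + y ^ 2 = s ^ 2) by (unfold s; rewrite pow2_sqrt; lra).
    rewrite e. transitivity ((s ^ 2 - y ^ 2) / (V * s ^ 3)).
    + field. lra.
    + replace (s ^ 2 - y ^ 2) with V by lra. field. lra.
Qed.

Lemma inv32_anti x y : 0 < x <= y -> inv32 y <= inv32 x.
Proof.
  intros [hx hxy]. unfold inv32. apply Rinv_le_contravar.
  - pose proof (sqrt_lt_R0 x hx). nra.
  - apply Rmult_le_compat; try lra; [apply sqrt_pos|now apply sqrt_le_1_alt].
Qed.

(** The summand decreases on both sides of 0, so the sum and the integral over [-h N, h N] differ by
    at most the central term. *)
Lemma inv32_riemann_sum V h N : 0 < V -> 0 < h ->
  2 * inv32_primitive V (h * INR N) - h * inv32 V <=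
  h * zsum N (fun m => inv32 (V + h ^ 2 * IZR m ^ 2)) <=
  2 * inv32_primitive V (h * INR N) + h * inv32 V.
Proof.
  intros hV hh.
  assert (hstep : forall n, h * inv32 (V + h ^ 2 * INR (S n) ^ 2) <=
    inv32_primitive V (h * INR (S n)) - inv32_primitive V (h * INR n) <=
    h * inv32 (V + h ^ 2 * INR n ^ 2)).
  { intros n. pose proof (pos_INR n) as hn. rewrite S_INR.
    destruct (mean_value (inv32_primitive V) (fun y => inv32 (V + y ^ 2)) (h * INR n) (h * (INR n + 1)))
      as (c & hc & he).
    - nra.
    - intros y _. now apply inv32_primitive_derive.
    - rewrite he. replace (h * (INR n + 1) - h * INR n) with h by ring.
      rewrite (Rmult_comm _ h). rewrite <- !Rpow_mult_distr.
      assert (h0 : 0 <= h * INR n) by nra.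
      split; (apply Rmult_le_compat_l; [lra|]); apply inv32_anti.
      + pose proof (pow2_ge_0 c). split; [lra|]. apply Rplus_le_compat_l, pow_incr. lra.
      + pose proof (pow2_ge_0 (h * INR n)). split; [lra|]. apply Rplus_le_compat_l, pow_incr. lra. }
  assert (h0 : inv32_primitive V (h * INR 0) = 0).
  { unfold inv32_primitive. simpl INR. rewrite Rmult_0_r. unfold Rdiv. ring. }
  split.
  - apply Rle_trans with (2 * inv32_primitive V (h * INR N) + 2 * (h * inv32 (V + h ^ 2 * INR N ^ 2)) - h * inv32 V).
    + assert (0 < inv32 (V + h ^ 2 * INR N ^ 2)).
      { apply inv32_pos. pose proof (pow2_ge_0 (h * INR N)) as e. rewrite Rpow_mult_distr in e. lra. }
      nra.
    + induction N as [|N IH].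
      * cbn [zsum]. rewrite h0. simpl INR. replace (h ^ 2 * 0 ^ 2) with 0 by ring.
        rewrite Rplus_0_r. lra.
      * cbn [zsum]. rewrite opp_IZR, <- INR_IZR_INZ.
        replace ((- INR (S N)) ^ 2) with (INR (S N) ^ 2) by ring.
        destruct (hstep N). lra.
  - induction N as [|N IH].
    + cbn [zsum]. rewrite h0. replace (h ^ 2 * 0 ^ 2) with 0 by ring. rewrite Rplus_0_r. lra.
    + cbn [zsum]. rewrite opp_IZR, <- INR_IZR_INZ.
      replace ((- INR (S N)) ^ 2) with (INR (S N) ^ 2) by ring.
      destruct (hstep N). lra.
Qed.

Lemma inv32_primitive_bound V y : 0 < V -> 0 <= y ->
  / V - / (V + y ^ 2) <= inv32_primitive V y <= / V.
Proof.
  intros hV hy. unfold inv32_primitive. pose proof (pow2_ge_0 y) as hy2.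
  pose proof (sqrt_lt_R0 (V + y ^ 2) ltac:(lra)) as hs.
  set (s := sqrt (V + y ^ 2)) in *.
  assert (e : s ^ 2 = V + y ^ 2) by (unfold s; rewrite pow2_sqrt; lra).
  assert (hys : y <= s) by nra.
  rewrite <- e. split.
  - assert (h : / V - y / (V * s) = / (s * (s + y))).
    { replace V with (s ^ 2 - y ^ 2) by lra. field. repeat split; try lra; nra. }
    assert (h1 : / (s * (s + y)) <= / s ^ 2) by (apply Rinv_le_contravar; nra). lra.
  - apply Rmult_le_reg_r with (V * s); [nra|]. field_simplify; lra.
Qed.

Lemma inv32_dominated V c m : 0 < V -> 0 < c ->
  Rabs (inv32 (V + c * IZR m ^ 2)) <= / sqrt V * / c * (1 + / (V / c)) * pw 2 m.
Proof.
  intros hV hc. pose proof (pow2_ge_0 (IZR m)) as hm.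
  assert (hx : 0 < V + c * IZR m ^ 2) by nra.
  rewrite Rabs_pos_eq by (left; now apply inv32_pos). unfold inv32.
  pose proof (sqrt_lt_R0 V hV) as hs.
  assert (hs2 : sqrt V <= sqrt (V + c * IZR m ^ 2)) by (apply sqrt_le_1_alt; nra).
  assert (hVc : 0 < V / c) by now apply Rdiv_lt_0_compat.
  pose proof (shifted_square_inv_bound (V / c) m hVc) as [_ h].
  apply Rle_trans with (/ sqrt V * / c * / (IZR m ^ 2 + V / c)).
  - rewrite <- !Rinv_mult. apply Rinv_le_contravar.
    + repeat apply Rmult_lt_0_compat; lra.
    + replace (sqrt V * c * (IZR m ^ 2 + V / c)) with (sqrt V * (V + c * IZR m ^ 2)) by (field; lra).
      rewrite Rmult_comm. apply Rmult_le_compat_l; lra.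
  - rewrite !Rmult_assoc. apply Rmult_le_compat_l; [left; now apply Rinv_0_lt_compat|].
    apply Rmult_le_compat_l; [left; now apply Rinv_0_lt_compat|]. lra.
Qed.

(** The number [2 / V] is the integral of [(V + y^2)^(-3/2)] over the line. *)
Lemma inv32_mesh_sum V h : 0 < V -> 0 < h ->
  Rabs (h * ZS (fun m => inv32 (V + h ^ 2 * IZR m ^ 2)) - 2 / V) <= h * inv32 V.
Proof.
  intros hV hh. assert (hh2 : 0 < h ^ 2) by now apply pow_lt.
  destruct (ZS_dominated _ _ _ pw2_summable (fun m => inv32_dominated V (h ^ 2) m hV hh2)) as [hl _].
  apply (is_lim_seq_scal_l _ h) in hl.
  change (Rbar_mult h (ZS (fun m => inv32 (V + h ^ 2 * IZR m ^ 2)))) with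
    (Finite (h * ZS (fun m => inv32 (V + h ^ 2 * IZR m ^ 2)))) in hl.
  assert (up : h * ZS (fun m => inv32 (V + h ^ 2 * IZR m ^ 2)) <= 2 / V + h * inv32 V).
  { refine (is_lim_seq_le _ (fun _ => 2 / V + h * inv32 V) _ _ _ hl (is_lim_seq_const _)).
    intros N. destruct (inv32_riemann_sum V h N hV hh) as [_ e].
    pose proof (pos_INR N) as hN.
    destruct (inv32_primitive_bound V (h * INR N) hV ltac:(nra)) as [_ e2]. unfold Rdiv. lra. }
  assert (lo : 2 / V - h * inv32 V <= h * ZS (fun m => inv32 (V + h ^ 2 * IZR m ^ 2))).
  { assert (hz : is_lim_seq (fun N => 2 / V - h * inv32 V - 2 * / h ^ 2 * / (V / h ^ 2 + INR N)) (2 / V - h * inv32 V)).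
    { replace (Finite (2 / V - h * inv32 V)) with (Finite (2 / V - h * inv32 V - 2 * / h ^ 2 * 0)) by (f_equal; ring).
      apply is_lim_seq_minus'; [apply is_lim_seq_const|].
      apply (is_lim_seq_scal_l _ (2 * / h ^ 2) (Finite 0)). apply is_lim_seq_inv_shift.
      now apply Rdiv_lt_0_compat. }
    refine (is_lim_seq_le _ _ _ _ _ hz hl).
    intros N. destruct (inv32_riemann_sum V h N hV hh) as [e _].
    pose proof (pos_INR N) as hN.
    destruct (inv32_primitive_bound V (h * INR N) hV ltac:(nra)) as [e2 _].
    assert (e3 : / (V + (h * INR N) ^ 2) <= / h ^ 2 * / (V / h ^ 2 + INR N)).
    { rewrite <- Rinv_mult. apply Rinv_le_contravar.
      - apply Rmult_lt_0_compat; [assumption|]. assert (0 < V / h ^ 2) by now apply Rdiv_lt_0_compat. lra.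
      - replace (h ^ 2 * (V / h ^ 2 + INR N)) with (V + h ^ 2 * INR N) by (field; lra).
        rewrite Rpow_mult_distr. apply Rplus_le_compat_l, Rmult_le_compat_l; [lra|].
        destruct N as [|N]; [simpl; lra|]. rewrite S_INR in *. pose proof (pos_INR N). nra. }
    unfold Rdiv in *. lra. }
  apply Rabs_le. lra.
Qed.

Lemma rsum1_upper x : 0 < x -> rsum 1 x <= PI / sqrt x + 2 / x.
Proof.
  intros hx. pose proof (sqrt_lt_R0 x hx) as hs. pose proof PI_RGT_0 as hpi.
  rewrite rsum1_coth by assumption.
  pose proof (coth_upper (PI * sqrt x) ltac:(nra)) as h.
  replace (PI / sqrt x + 2 / x) with (PI * (1 + 2 / (PI * sqrt x)) / sqrt x).
  - unfold Rdiv. apply Rmult_le_compat_r; [left; now apply Rinv_0_lt_compat|].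
    apply Rmult_le_compat_l; [lra|exact h].
  - replace x with (sqrt x ^ 2) at 4 by (apply pow2_sqrt; lra). field. lra.
Qed.

Lemma scaled_error_sum V c (k : nat) : 0 < V -> 0 < c -> exists C, 0 <= C /\
  (forall m, Rabs (rsum2_error (V + c * IZR m ^ 2)) <= C * pw 2 m).
Proof.
  intros hV hc. destruct (rsum2_error_bound k) as (C & hC & hb).
  assert (hVc : 0 < V / c) by now apply Rdiv_lt_0_compat.
  exists (C * (/ V ^ S k * (/ c * (1 + / (V / c))))).
  split.
  { apply Rmult_le_pos; [assumption|]. apply Rmult_le_pos; [left; now apply Rinv_0_lt_compat, pow_lt|].
    apply Rmult_le_pos; [left; now apply Rinv_0_lt_compat|]. pose proof (Rinv_0_lt_compat _ hVc). lra. }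
  intros m. 
  assert (hx : 0 < V + c * IZR m ^ 2) by nra.
  destruct (hb _ hx) as [e1 e2]. rewrite Rabs_pos_eq by assumption.
  eapply Rle_trans; [exact e2|]. rewrite !Rmult_assoc. apply Rmult_le_compat_l; [assumption|].
  change ((V + c * IZR m ^ 2) ^ S (S k)) with ((V + c * IZR m ^ 2) * (V + c * IZR m ^ 2) ^ S k).
  rewrite Rinv_mult, Rmult_comm.
  pose proof (shifted_square_inv_bound (V / c) m hVc) as [_ h].
  apply Rmult_le_compat.
  - left. now apply Rinv_0_lt_compat, pow_lt.
  - left. now apply Rinv_0_lt_compat.
  - apply Rinv_le_contravar; [now apply pow_lt|]. apply pow_incr. nra.
  - replace (V + c * IZR m ^ 2) with (c * (IZR m ^ 2 + V / c)) by (field; lra).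
    rewrite Rinv_mult. apply Rmult_le_compat_l; [left; now apply Rinv_0_lt_compat|]. exact h.
Qed.

Lemma error_sum_bound C k V c : 0 <= C -> 0 < V -> 0 < c ->
  (forall x, 0 < x -> 0 <= rsum2_error x <= C * / x ^ (S (S k))) ->
  0 <= ZS (fun m => rsum2_error (V + c * IZR m ^ 2)) <= C * / V ^ S k * (/ c * rsum 1 (V / c)).
Proof.
  intros hC hV hc hb.
  assert (hVc : 0 < V / c) by now apply Rdiv_lt_0_compat.
  assert (hpos : forall m, 0 < V + c * IZR m ^ 2).
  { intros m. nra. }
  assert (hdom : forall m, Rabs (rsum2_error (V + c * IZR m ^ 2)) <=
    C * / V ^ S k * / c * / (IZR m ^ 2 + V / c)).
  { intros m. destruct (hb _ (hpos m)) as [e1 e2].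
    rewrite Rabs_pos_eq by assumption. eapply Rle_trans; [exact e2|].
    rewrite !Rmult_assoc. apply Rmult_le_compat_l; [assumption|].
    rewrite <- Rinv_mult. replace (c * (IZR m ^ 2 + V / c)) with (V + c * IZR m ^ 2) by (field; lra).
    rewrite <- Rinv_mult. apply Rinv_le_contravar.
    - apply Rmult_lt_0_compat; [now apply pow_lt|apply hpos].
    - change ((V + c * IZR m ^ 2) ^ S (S k)) with ((V + c * IZR m ^ 2) * (V + c * IZR m ^ 2) ^ S k).
      rewrite Rmult_comm. apply Rmult_le_compat_l; [left; apply hpos|].
      apply pow_incr. nra. }
  pose proof (rsum1_summable _ hVc) as hw.
  split.
  - apply ZS_nonneg. apply (summable_le _ _ (C * / V ^ S k * / c) hw).
    intros m. split; [apply hb, hpos|]. eapply Rle_trans; [apply Rle_abs|apply hdom].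
  - eapply Rle_trans; [apply Rle_abs|]. eapply Rle_trans; [apply (ZS_abs_le _ _ _ hw hdom)|].
    rewrite rsum1_eq. lra.
Qed.

(** Both sides of the symmetric double sum over the lattice Z x hZ are evaluated
    row by row; letting h tend to 0 replaces the inner sum by an integral. *)
Lemma inv32_sum C k V : 0 <= C ->
  (forall x, 0 < x -> 0 <= rsum2_error x <= C * / x ^ (S (S k))) -> 0 < V ->
  Rabs (PI / 2 * ZS (fun n => inv32 (V + IZR n ^ 2)) - PI / V) <=
  C * / V ^ S k * (PI / sqrt V + 2 / V).
Proof.
  intros hC hb hV. pose proof PI_RGT_0 as hpi.
  destruct (rsum2_error_bound 0) as (C0 & hC0 & hb0).
  set (P := ZS (fun n => inv32 (V + IZR n ^ 2))).
  assert (key : forall h, 0 < h <= 1 ->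
    Rabs (PI / 2 * P - PI / V) <= h * (C0 * / V ^ 1 * rsum 1 V + PI / 2 * inv32 V) +
      C * / V ^ S k * (PI / sqrt V + 2 / V)).
  { intros h [hh hh1]. assert (hh2 : 0 < h ^ 2) by now apply pow_lt.
    assert (hsym := lat_term_swap V 1 (h ^ 2)).
    rewrite !lat_term_rows in hsym by lra.
    assert (e1 : ZS (fun n => / (h ^ 2) ^ 2 * rsum 2 ((V + 1 * IZR n ^ 2) / h ^ 2)) =
      / h * (PI / 2) * P + / h ^ 4 * ZS (fun n => rsum2_error (V / h ^ 2 + / h ^ 2 * IZR n ^ 2))).
    { destruct (scaled_error_sum (V / h ^ 2) (/ h ^ 2) 0) as (D & hD & hDb);
        [now apply Rdiv_lt_0_compat|now apply Rinv_0_lt_compat|].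
      unfold P.
      rewrite <- (ZS_lin _ _ (pw 2) (/ sqrt V * / 1 * (1 + / (V / 1))) D _ _ pw2_summable).
      - apply ZS_ext. intros n. pose proof (pow2_ge_0 (IZR n)).
        replace ((V + 1 * IZR n ^ 2) / h ^ 2) with (V / h ^ 2 + / h ^ 2 * IZR n ^ 2) by (field; lra).
        unfold rsum2_error.
        change (/ ((V / h ^ 2 + / h ^ 2 * IZR n ^ 2) * sqrt (V / h ^ 2 + / h ^ 2 * IZR n ^ 2))) with
          (inv32 (V / h ^ 2 + / h ^ 2 * IZR n ^ 2)).
        replace (V / h ^ 2 + / h ^ 2 * IZR n ^ 2) with ((/ h) ^ 2 * (V + IZR n ^ 2)) at 3 by (field; lra).
        rewrite inv32_scale by (try apply Rinv_0_lt_compat; lra).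
        rewrite !pow_inv, Rinv_inv. field. lra.
      - intros n. replace (V + IZR n ^ 2) with (V + 1 * IZR n ^ 2) by ring. apply inv32_dominated; lra.
      - exact hDb. }
    assert (e2 : ZS (fun n => / 1 ^ 2 * rsum 2 ((V + h ^ 2 * IZR n ^ 2) / 1)) =
      PI / 2 * ZS (fun m => inv32 (V + h ^ 2 * IZR m ^ 2)) + 1 * ZS (fun m => rsum2_error (V + h ^ 2 * IZR m ^ 2))).
    { destruct (scaled_error_sum V (h ^ 2) 0 hV hh2) as (D & hD & hDb).
      rewrite <- (ZS_lin _ _ (pw 2) _ D _ _ pw2_summable (fun m => inv32_dominated V (h ^ 2) m hV hh2) hDb).
      apply ZS_ext. intros n. rewrite Rdiv_1_r. unfold rsum2_error, inv32.
      replace (/ 1 ^ 2) with 1 by field. ring. }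
    rewrite e1, e2 in hsym.
    destruct (error_sum_bound C0 0 (V / h ^ 2) (/ h ^ 2) hC0) as [_ b1];
      [now apply Rdiv_lt_0_compat|now apply Rinv_0_lt_compat|assumption|].
    replace (V / h ^ 2 / / h ^ 2) with V in b1 by (field; lra). rewrite Rinv_inv in b1.
    destruct (error_sum_bound C0 0 (V / h ^ 2) (/ h ^ 2) hC0) as [b0 _];
      [now apply Rdiv_lt_0_compat|now apply Rinv_0_lt_compat|assumption|].
    destruct (error_sum_bound C k V (h ^ 2) hC hV hh2 hb) as [b2 b3].
    pose proof (inv32_mesh_sum V h hV hh) as b4.
    set (E1 := ZS (fun m => rsum2_error (V / h ^ 2 + / h ^ 2 * IZR m ^ 2))) in *.
    set (E2 := ZS (fun m => rsum2_error (V + h ^ 2 * IZR m ^ 2))) in *.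
    set (Q := ZS (fun m => inv32 (V + h ^ 2 * IZR m ^ 2))) in *.
    assert (hmain : PI / 2 * P - PI / V = PI / 2 * (h * Q - 2 / V) + h * E2 - / h ^ 3 * E1).
    { assert (h * (/ h * (PI / 2) * P + / h ^ 4 * E1) = h * (PI / 2 * Q + 1 * E2)) by now rewrite hsym.
      replace (h * (/ h * (PI / 2) * P + / h ^ 4 * E1)) with (PI / 2 * P + / h ^ 3 * E1) in H by (field; lra).
      unfold Rdiv in *. lra. }
    (* In this direction the rows have arguments of size at least [V / h^2], so already the bound
       with exponent 0 makes [E1] of order [h^4]. *)
    assert (b5 : 0 <= / h ^ 3 * E1 <= h * (C0 * / V ^ 1 * rsum 1 V)).
    { assert (hi : 0 < / h ^ 3) by (apply Rinv_0_lt_compat, pow_lt; lra).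
      split; [apply Rmult_le_pos; lra|].
      apply Rle_trans with (/ h ^ 3 * (C0 * / (V / h ^ 2) ^ 1 * (h ^ 2 * rsum 1 V))).
      - apply Rmult_le_compat_l; lra.
      - right. field. lra. }
    (* This bound does not improve as [h] tends to 0; it is the error that survives in the
       statement. *)
    assert (b6 : 0 <= h * E2 <= C * / V ^ S k * (PI / sqrt V + 2 / V)).
    { split; [apply Rmult_le_pos; lra|].
      assert (hVk : 0 < / V ^ S k) by now apply Rinv_0_lt_compat, pow_lt.
      apply Rle_trans with (C * / V ^ S k * (h * (/ h ^ 2 * rsum 1 (V / h ^ 2)))).
      - replace (C * / V ^ S k * (h * (/ h ^ 2 * rsum 1 (V / h ^ 2)))) with
          (h * (C * / V ^ S k * (/ h ^ 2 * rsum 1 (V / h ^ 2)))) by ring.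
        apply Rmult_le_compat_l; lra.
      - apply Rmult_le_compat_l; [apply Rmult_le_pos; lra|].
        assert (hVh : 0 < V / h ^ 2) by now apply Rdiv_lt_0_compat.
        pose proof (rsum1_upper (V / h ^ 2) hVh) as hr.
        assert (hsq : sqrt (V / h ^ 2) = sqrt V / h).
        { rewrite sqrt_div_alt by assumption. now rewrite sqrt_pow2 by lra. }
        rewrite hsq in hr. pose proof (sqrt_lt_R0 V hV) as hs.
        apply Rle_trans with (h * (/ h ^ 2 * (PI / (sqrt V / h) + 2 / (V / h ^ 2)))).
        + apply Rmult_le_compat_l; [lra|]. apply Rmult_le_compat_l; [left; now apply Rinv_0_lt_compat|exact hr].
        + replace (h * (/ h ^ 2 * (PI / (sqrt V / h) + 2 / (V / h ^ 2)))) with (PI / sqrt V + h * (2 / V))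
            by (field; lra).
          assert (0 < 2 / V) by (apply Rdiv_lt_0_compat; lra). nra. }
    rewrite hmain. apply Rabs_le_between in b4.
    apply Rabs_le. nra. }
  set (A := C0 * / V ^ 1 * rsum 1 V + PI / 2 * inv32 V) in *.
  apply le_epsilon. intros eps heps.
  set (h := Rmin 1 (eps / (Rabs A + 1))).
  pose proof (Rabs_pos A) as hA.
  assert (hh : 0 < h) by (apply Rmin_glb_lt; [lra|apply Rdiv_lt_0_compat; lra]).
  assert (h1 : h <= 1) by apply Rmin_l.
  assert (h2 : h <= eps / (Rabs A + 1)) by apply Rmin_r.
  eapply Rle_trans; [apply (key h); lra|].
  assert (h * A <= eps).
  { apply Rle_trans with (h * (Rabs A + 1)); [apply Rmult_le_compat_l; [lra|]; pose proof (Rle_abs A); lra|].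
    apply Rmult_le_reg_r with (/ (Rabs A + 1)); [apply Rinv_0_lt_compat; lra|].
    replace (h * (Rabs A + 1) * / (Rabs A + 1)) with h by (field; lra). exact h2. }
  lra.
Qed.

Definition green_reg (a u : R) : R := green a u + / u ^ 2 - PI / u.

(** Each row is its integral plus an exponentially small error. The errors add up to something below
    every power, and so does the deviation of the sum of the row integrals from the integral over
    the plane, [pi / u]. *)
Lemma green_reg_decay a k : 0 < a -> exists C, 0 <= C /\ forall u, 1 <= u ->
  Rabs (green_reg a u) <= C * / u ^ S k.
Proof.
  intros ha. destruct (rsum2_error_bound k) as (C & hC & hb).
  pose proof PI_RGT_0 as hpi.
  set (B := PI / sqrt (/ a) + 2 / / a).
  assert (hia : 0 < / a) by now apply Rinv_0_lt_compat.
  assert (hB : 0 <= B).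
  { pose proof (sqrt_lt_R0 _ hia). unfold B. apply Rplus_le_le_0_compat; apply Rdiv_le_0_compat; lra. }
  assert (hbound : forall u, 1 <= u -> PI / sqrt (u / a) + 2 / (u / a) <= B).
  { intros u hu. assert (hua : / a <= u / a) by (unfold Rdiv; nra).
    pose proof (sqrt_lt_R0 _ hia) as hs.
    assert (sqrt (/ a) <= sqrt (u / a)) by now apply sqrt_le_1_alt.
    unfold B, Rdiv. apply Rplus_le_compat; (apply Rmult_le_compat_l; [lra|]);
      apply Rinv_le_contravar; auto; unfold Rdiv in hua; lra. }
  set (K := / a * (C * / (/ a) ^ S k * B) + a ^ 2 * (C * / a ^ S k * (/ a ^ 2 * B))).
  exists K. split.
  { assert (0 <= C * / (/ a) ^ S k * B).
    { apply Rmult_le_pos; [|assumption]. apply Rmult_le_pos; [assumption|].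
      left. now apply Rinv_0_lt_compat, pow_lt. }
    assert (0 <= C * / a ^ S k * (/ a ^ 2 * B)).
    { apply Rmult_le_pos; [apply Rmult_le_pos; [assumption|left; now apply Rinv_0_lt_compat, pow_lt]|].
      apply Rmult_le_pos; [left; now apply Rinv_0_lt_compat, pow_lt|assumption]. }
    unfold K. nra. }
  intros u hu. unfold green_reg. rewrite green_rows by lra.
  assert (hV : 0 < u / a) by (apply Rdiv_lt_0_compat; lra).
  assert (ha2 : 0 < a ^ 2) by now apply pow_lt.
  assert (hau : 0 < a * u) by nra.
  destruct (scaled_error_sum (a * u) (a ^ 2) 0 hau ha2) as (D & hD & hDb).
  assert (hi : forall n, Rabs (inv32 (u / a + IZR n ^ 2)) <= / sqrt (u / a) * / 1 * (1 + / (u / a / 1)) * pw 2 n).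
  { intros n. replace (u / a + IZR n ^ 2) with (u / a + 1 * IZR n ^ 2) by ring. apply inv32_dominated; lra. }
  assert (e : ZS (fun n => a ^ 2 * rsum 2 (a * u + a ^ 2 * IZR n ^ 2)) =
    / a * (PI / 2) * ZS (fun n => inv32 (u / a + IZR n ^ 2)) +
    a ^ 2 * ZS (fun n => rsum2_error (a * u + a ^ 2 * IZR n ^ 2))).
  { rewrite <- (ZS_lin _ _ (pw 2) _ D _ _ pw2_summable hi hDb).
    apply ZS_ext. intros n. pose proof (pow2_ge_0 (IZR n)). unfold rsum2_error.
    change (/ ((a * u + a ^ 2 * IZR n ^ 2) * sqrt (a * u + a ^ 2 * IZR n ^ 2))) with
      (inv32 (a * u + a ^ 2 * IZR n ^ 2)).
    replace (a * u + a ^ 2 * IZR n ^ 2) with (a ^ 2 * (u / a + IZR n ^ 2)) at 3 by (field; lra).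
    rewrite inv32_scale by lra. field. lra. }
  rewrite e.
  pose proof (inv32_sum C k (u / a) hC hb hV) as b1.
  destruct (error_sum_bound C k (a * u) (a ^ 2) hC hau ha2 hb) as [b2 b3].
  replace (a * u / a ^ 2) with (u / a) in b3 by (field; lra).
  set (E := ZS (fun n => rsum2_error (a * u + a ^ 2 * IZR n ^ 2))) in *.
  set (P := ZS (fun n => inv32 (u / a + IZR n ^ 2))) in *.
  replace (/ a * (PI / 2) * P + a ^ 2 * E - PI / u) with (/ a * (PI / 2 * P - PI / (u / a)) + a ^ 2 * E)
    by (field; lra).
  eapply Rle_trans; [apply Rabs_triang|].
  rewrite !Rabs_mult, (Rabs_pos_eq (/ a)), (Rabs_pos_eq (a ^ 2)), (Rabs_pos_eq E) by lra.
  pose proof (hbound u hu) as hB2.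
  assert (hupow : / (u / a) ^ S k = / (/ a) ^ S k * / u ^ S k).
  { unfold Rdiv. rewrite Rpow_mult_distr, Rinv_mult. ring. }
  assert (haupow : / (a * u) ^ S k = / a ^ S k * / u ^ S k).
  { rewrite Rpow_mult_distr, Rinv_mult. ring. }
  unfold K. rewrite Rmult_plus_distr_r. apply Rplus_le_compat.
  - rewrite Rmult_assoc. apply Rmult_le_compat_l; [lra|]. eapply Rle_trans; [exact b1|].
    rewrite hupow. replace (C * / (/ a) ^ S k * B * / u ^ S k) with (C * (/ (/ a) ^ S k * / u ^ S k) * B) by ring.
    apply Rmult_le_compat_l; [|exact hB2].
    apply Rmult_le_pos; [assumption|]. rewrite <- hupow. left. now apply Rinv_0_lt_compat, pow_lt.
  - rewrite Rmult_assoc. apply Rmult_le_compat_l; [lra|]. eapply Rle_trans; [exact b3|].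
    rewrite haupow. replace (C * / a ^ S k * (/ a ^ 2 * B) * / u ^ S k) with
      (C * (/ a ^ S k * / u ^ S k) * (/ a ^ 2 * B)) by ring.
    apply Rmult_le_compat_l.
    + apply Rmult_le_pos; [assumption|]. rewrite <- haupow. left. now apply Rinv_0_lt_compat, pow_lt.
    + apply Rmult_le_compat_l; [left; now apply Rinv_0_lt_compat|].
      eapply Rle_trans; [apply rsum1_upper; assumption|exact hB2].
Qed.

(** * Analytic continuation *)

Notation is_Cderive := (is_derive (K := C_AbsRing) (V := C_NormedModule)).

(** The complex numbers carry two normed module structures over themselves: the product rule lives
    in the one from the ring, [C_derive] in [C_NormedModule]. *)
Lemma is_Cderive_AbsRing (f : C -> C) z l :
  is_derive (K := C_AbsRing) (V := AbsRing_NormedModule C_AbsRing) f z l <-> is_Cderive f z l.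
Proof.
  split; intros [_ h]; (split; [apply is_linear_scal_l|exact h]).
Qed.

Lemma is_Cderive_mult (f g : C -> C) z l m : is_Cderive f z l -> is_Cderive g z m ->
  is_Cderive (fun s => f s * g s)%C z (l * g z + f z * m)%C.
Proof.
  rewrite <- !is_Cderive_AbsRing. intros hf hg.
  exact (is_derive_mult (K := C_AbsRing) f g z l m hf hg Cmult_comm).
Qed.

Lemma is_Cderive_plus (f g : C -> C) z l m : is_Cderive f z l -> is_Cderive g z m ->
  is_Cderive (fun s => f s + g s)%C z (l + m)%C.
Proof. intros hf hg. exact (is_derive_plus (V := C_NormedModule) f g z l m hf hg). Qed.

Lemma is_Cderive_const (c z : C) : is_Cderive (fun _ => c) z (RtoC 0).
Proof. exact (is_derive_const (V := C_NormedModule) c z). Qed.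

Lemma is_Cderive_id (z : C) : is_Cderive (fun s => s) z (RtoC 1).
Proof. apply is_Cderive_AbsRing. exact (is_derive_id (K := C_AbsRing) z). Qed.

Lemma is_Cderive_unique (f : C -> C) z l m : is_Cderive f z l -> is_Cderive f z m -> l = m.
Proof. intros h1 h2. apply is_C_derive_unique in h1. apply is_C_derive_unique in h2. congruence. Qed.

Lemma Cexp_quadratic (w : C) : Cmod (Cexp w - 1 - w)%C <= 4 * exp (Cmod w) * Cmod w ^ 2.
Proof.
  pose proof (Cexp_taylor w 2) as h. cbn [cpoly] in h.
  replace (Cexp w - 1 - w)%C with
    (Cexp w - (0 + exp_coeff 0 * w ^ 0 + exp_coeff 1 * w ^ 1))%C.
  - eapply Rle_trans; [exact h|]. right. simpl. field.
  - unfold exp_coeff. simpl. rewrite Rinv_1. ring.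
Qed.

Lemma Cexp_cubic (w : C) :
  Cmod (Cexp w - 1 - w - w * w * RtoC (/ 2))%C <= 8 / 3 * exp (Cmod w) * Cmod w ^ 3.
Proof.
  pose proof (Cexp_taylor w 3) as h. cbn [cpoly] in h.
  replace (Cexp w - 1 - w - w * w * RtoC (/ 2))%C with
    (Cexp w - (0 + exp_coeff 0 * w ^ 0 + exp_coeff 1 * w ^ 1 + exp_coeff 2 * w ^ 2))%C.
  - eapply Rle_trans; [exact h|]. right. simpl. field.
  - unfold exp_coeff. simpl. replace (1 + 1) with 2 by ring. rewrite Rinv_1. ring.
Qed.

Lemma is_Cderive_Cexp (l : C) : is_Cderive (fun s => Cexp (l * s))%C (RtoC 0) l.
Proof.
  apply is_derive_of_quadratic with 1 (4 * exp (Cmod l) * Cmod l ^ 2); [lra| |].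
  - apply Rmult_le_pos; [|apply pow2_ge_0]. pose proof (exp_pos (Cmod l)). lra.
  - intros z hz. rewrite Cmult_0_r, Cexp_R, exp_0, Cplus_0_l.
    eapply Rle_trans; [apply Cexp_quadratic|].
    rewrite Cmod_mult. pose proof (Cmod_ge_0 l). 
    assert (exp (Cmod l * Cmod z) <= exp (Cmod l)) by (apply exp_le_compat; nra).
    rewrite Rpow_mult_distr.
    replace (4 * exp (Cmod l) * Cmod l ^ 2 * Cmod z ^ 2) with (4 * exp (Cmod l) * (Cmod l ^ 2 * Cmod z ^ 2)) by ring.
    apply Rmult_le_compat_r; [apply Rmult_le_pos; apply pow2_ge_0|]. lra.
Qed.

Definition ipi : C := (PI * Ci)%C.
(** This is [2 i sin (pi s)]; accordingly [sinc s] below is [sin (pi s) / (pi s)], with its value 1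
    at 0. *)
Definition csin2 (s : C) : C := (Cexp (ipi * s) - Cexp (- ipi * s))%C.
Definition sinc (s : C) : C :=
  if Ceq_dec s (RtoC 0) then RtoC 1 else (csin2 s / (2 * ipi * s))%C.

Lemma ipi_neq_0 : (2 * ipi)%C <> RtoC 0.
Proof.
  intros h. apply (f_equal Im) in h. unfold ipi, Ci in h. simpl in h. pose proof PI_RGT_0. lra.
Qed.

Lemma expandable_csin2 s0 : expandable csin2 s0.
Proof.
  apply expandable_ext with (fun s => Cexp (ipi * s) + Copp (RtoC 1) * Cexp (- ipi * s))%C 1; [lra| |].
  - intros s _. unfold csin2. ring.
  - apply expandable_plus; [apply expandable_Cexp|].
    apply (expandable_mult (fun _ => Copp (RtoC 1))); [apply expandable_const|apply expandable_Cexp].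
Qed.

Lemma ipi_nz : ipi <> RtoC 0.
Proof. intros h. apply ipi_neq_0. rewrite h. ring. Qed.

Lemma two_nz : RtoC 2 <> RtoC 0.
Proof. intros h. apply ipi_neq_0. rewrite h. ring. Qed.

Lemma expandable_sinc s0 : expandable sinc s0.
Proof.
  set (g := fun s => if Ceq_dec s (RtoC 0) then (2 * ipi)%C else (csin2 s / s)%C).
  assert (hg : forall s, sinc s = (/ (2 * ipi) * g s)%C).
  { intros s. unfold sinc, g. destruct (Ceq_dec s 0) as [_|hs].
    - rewrite Cinv_l; [reflexivity|apply ipi_neq_0].
    - field. repeat split; auto using ipi_nz, two_nz. }
  apply expandable_ext with (fun s => / (2 * ipi) * g s)%C 1; [lra|intros s _; now rewrite hg|].
  apply (expandable_mult (fun _ => / (2 * ipi))%C); [apply expandable_const|].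
  destruct (Ceq_dec s0 0) as [->|hs0].
  - assert (h0 : csin2 0 = 0%C) by (unfold csin2; rewrite !Cmult_0_r; ring).
    destruct (expandable_divide csin2 (RtoC 0) (expandable_csin2 (RtoC 0)) h0) as (v & hv & hdiv).
    assert (ev : v = (2 * ipi)%C).
    { apply (is_Cderive_unique csin2 (RtoC 0)); [exact hv|].
      replace (2 * ipi)%C with (ipi + (0 * Cexp (- ipi * 0) + Copp (RtoC 1) * - ipi))%C
        by ring.
      apply (is_derive_ext (V := C_NormedModule) (fun s => Cexp (ipi * s) + Copp (RtoC 1) * Cexp (- ipi * s))%C).
      - intros s. unfold csin2.
        change ((Cexp (ipi * s) + Copp 1 * Cexp (- ipi * s) = Cexp (ipi * s) - Cexp (- ipi * s))%C). ring.
      - apply is_Cderive_plus; [apply is_Cderive_Cexp|].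
        apply (is_Cderive_mult (fun _ => Copp (RtoC 1)) (fun s => Cexp (- ipi * s))%C);
          [apply is_Cderive_const|apply is_Cderive_Cexp]. }
    apply hdiv.
    + unfold g. destruct (Ceq_dec 0 0) as [_|h]; [now symmetry|now contradiction h].
    + intros s hs. unfold g. destruct (Ceq_dec s 0) as [h|_]; [contradiction|].
      f_equal. ring.
  - assert (hp : 0 < Cmod s0) by now apply Cmod_gt_0.
    apply expandable_ext with (fun s => csin2 s * / (s - 0))%C (Cmod s0); [assumption| |].
    + intros s hs. unfold g. destruct (Ceq_dec s 0) as [->|h].
      * exfalso. replace (0 - s0)%C with (- s0)%C in hs by ring. rewrite Cmod_opp in hs. lra.
      * unfold Cdiv. do 2 f_equal. ring.
    + apply expandable_mult; [apply expandable_csin2|now apply expandable_inv_linear].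
Qed.

(** The function is even: in the difference of the two exponentials the quadratic terms cancel, and
    the cubic remainder leaves a quadratic one after division by [s]. *)
Lemma sinc_derive_0 : is_Cderive sinc (RtoC 0) (RtoC 0).
Proof.
  pose proof PI_RGT_0 as hpi.
  assert (hm : Cmod ipi = PI) by (unfold ipi; rewrite Cmod_mult, Cmod_R, Cmod_Ci, Rabs_pos_eq; lra).
  apply is_derive_of_quadratic with 1 (8 / 3 * exp PI * PI ^ 2); [lra| |].
  - apply Rmult_le_pos; [|apply pow2_ge_0]. pose proof (exp_pos PI). lra.
  - intros z hz. rewrite Cplus_0_l.
    assert (h1 : sinc 0 = 1%C) by (unfold sinc; destruct (Ceq_dec 0 0) as [_|h]; [reflexivity|now contradiction h]).
    rewrite h1, Cmult_0_l. unfold sinc. destruct (Ceq_dec z 0) as [->|hz0].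
    + replace (1 - 1 - 0)%C with (RtoC 0) by ring. rewrite Cmod_0. simpl. lra.
    + pose proof ipi_neq_0 as hi.
      assert (hden : (2 * ipi * z)%C <> 0%C) by now apply Cmult_neq_0.
      replace (csin2 z / (2 * ipi * z) - 1 - 0)%C with ((csin2 z - 2 * ipi * z) / (2 * ipi * z))%C
        by (field; repeat split; auto using ipi_nz, two_nz).
      rewrite Cmod_div by assumption.
      set (w := (ipi * z)%C).
      assert (hw : Cmod w = PI * Cmod z) by (unfold w; now rewrite Cmod_mult, hm).
      replace (csin2 z - 2 * ipi * z)%C with
        ((Cexp w - 1 - w - w * w * RtoC (/ 2)) - (Cexp (- w) - 1 - - w - (- w) * (- w) * RtoC (/ 2)))%C.
      2:{ unfold csin2, w. replace (- ipi * z)%C with (- (ipi * z))%C by ring. ring. }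
      replace (2 * ipi * z)%C with (2 * w)%C by (unfold w; ring).
      rewrite Cmod_mult, hw, Cmod_R, (Rabs_pos_eq 2) by lra.
      assert (hz1 : 0 < Cmod z) by now apply Cmod_gt_0.
      apply Rmult_le_reg_r with (2 * (PI * Cmod z)); [nra|].
      replace (Cmod (Cexp w - 1 - w - w * w * RtoC (/ 2) - (Cexp (- w) - 1 - - w - - w * - w * RtoC (/ 2)))%C
         / (2 * (PI * Cmod z)) * (2 * (PI * Cmod z))) with
        (Cmod (Cexp w - 1 - w - w * w * RtoC (/ 2) - (Cexp (- w) - 1 - - w - - w * - w * RtoC (/ 2)))%C)
        by (field; nra).
      unfold Cminus at 1. eapply Rle_trans; [apply Cmod_triangle|]. rewrite Cmod_opp.
      pose proof (Cexp_cubic w) as c1. pose proof (Cexp_cubic (- w)%C) as c2.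
      rewrite Cmod_opp in c2. rewrite hw in c1, c2.
      assert (he : exp (PI * Cmod z) <= exp PI) by (apply exp_le_compat; nra).
      assert (hc : 0 <= (PI * Cmod z) ^ 3) by (apply pow_le; nra).
      assert (hfin : 8 / 3 * exp (PI * Cmod z) * (PI * Cmod z) ^ 3 <= 8 / 3 * exp PI * (PI * Cmod z) ^ 3).
      { apply Rmult_le_compat_r; [assumption|]. lra. }
      replace (8 / 3 * exp PI * PI ^ 2 * Cmod z ^ 2 * (2 * (PI * Cmod z))) with
        (2 * (8 / 3 * exp PI * (PI * Cmod z) ^ 3)) by ring.
      lra.
Qed.

Lemma sinc_real (x : R) : x <> 0 -> sinc (RtoC x) = RtoC (sin (PI * x) / (PI * x)).
Proof.
  intros hx. pose proof PI_RGT_0 as hpi. unfold sinc.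
  destruct (Ceq_dec (RtoC x) 0) as [h|_]; [now apply RtoC_inj in h|].
  assert (h1 : Cexp (ipi * RtoC x) = (cos (PI * x), sin (PI * x))).
  { unfold Cexp, ipi, Ci. simpl. f_equal.
    - replace ((PI * 0 - 0 * 1) * x - (PI * 1 + 0 * 0) * 0) with 0 by ring. rewrite exp_0, Rmult_1_l. f_equal. ring.
    - replace ((PI * 0 - 0 * 1) * x - (PI * 1 + 0 * 0) * 0) with 0 by ring. rewrite exp_0, Rmult_1_l. f_equal. ring. }
  assert (h2 : Cexp (- ipi * RtoC x) = (cos (PI * x), - sin (PI * x))).
  { unfold Cexp, ipi, Ci. simpl. rewrite <- sin_neg, <- (cos_neg (PI * x)). f_equal.
    - replace (- (PI * 0 - 0 * 1) * x - - (PI * 1 + 0 * 0) * 0) with 0 by ring. rewrite exp_0, Rmult_1_l. f_equal. ring.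
    - replace (- (PI * 0 - 0 * 1) * x - - (PI * 1 + 0 * 0) * 0) with 0 by ring. rewrite exp_0, Rmult_1_l. f_equal. ring. }
  unfold csin2. rewrite h1, h2.
  assert (e : Cminus (cos (PI * x), sin (PI * x)) (cos (PI * x), - sin (PI * x)) =
    (2 * Ci * RtoC (sin (PI * x)))%C).
  { unfold Cminus, Cplus, Copp, Cmult, Ci, RtoC. simpl. f_equal; ring. }
  rewrite e. unfold ipi. rewrite RtoC_div, RtoC_mult by nra. field.
  assert (hpiC : RtoC PI <> 0%C) by (intros h; apply RtoC_inj in h; lra).
  assert (hxC : RtoC x <> 0%C) by (intros h; apply RtoC_inj in h; lra).
  repeat split; try assumption. 
  intros h. apply (f_equal Im) in h. simpl in h. lra.
Qed.

(** * Analyticity of the two halves of the Mellin transform *)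

Lemma expandable_laplace (phi : R -> R) (sg beta K : R) (s0 : C) : sg = 1 \/ sg = - 1 ->
  (forall x, continuous phi x) -> exp_dominated beta phi K -> sg * Re s0 < beta ->
  expandable (superposition LInt phi (fun x => sg * x)) s0.
Proof.
  intros hsg hphi hK hs.
  (* Of the available decay [6 r], half is spent on the weight [exp (3 r |mu|)] and half remains for
     integrability. *)
  set (r := (beta - sg * Re s0) / 6). assert (hr : 0 < r) by (unfold r; lra).
  assert (hK0 : 0 <= K) by now apply exp_dominated_pos in hK.
  assert (hab : forall x, 0 <= x -> Rabs (sg * x) = x).
  { intros x hx. destruct hsg as [->| ->]; [rewrite Rabs_pos_eq|rewrite Rabs_left1]; lra. }
  assert (hb : forall x, 0 <= x ->
    Rabs (phi x) * (exp (Re s0 * (sg * x)) * exp (3 * r * Rabs (sg * x))) <= K * exp (- (3 * r) * x)).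
  { intros x hx. rewrite hab by assumption. rewrite <- exp_plus.
    apply Rle_trans with (K * exp (- beta * x) * exp (Re s0 * (sg * x) + 3 * r * x)).
    - apply Rmult_le_compat_r; [left; apply exp_pos|now apply hK].
    - rewrite Rmult_assoc, <- exp_plus. apply Rmult_le_compat_l; [assumption|].
      apply exp_le_compat. right. unfold r. field. }
  apply (expandable_superposition (exp_dom (3 * r)) LInt (fun x => 0 <= x)
    (fun x => K * exp (- (3 * r) * x)) (K * / (3 * r))) with r.
  - apply bounded_functional_scale; [assumption|]. apply LInt_bounded_functional. lra.
  - assumption.
  - apply Rmult_le_pos; [assumption|]. left. apply Rinv_0_lt_compat. lra.
  - intros x hx. rewrite Rmult_assoc. now apply hb.
  - intros s k hsr. apply Rabs_re_sub_le in hsr.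
    assert (hfk : 0 <= INR (fact k) / r ^ k).
    { apply Rdiv_le_0_compat; [left; apply INR_fact_lt_0|now apply pow_lt]. }
    assert (key : forall x, 0 <= x -> Rabs (phi x * (sg * x) ^ k) * exp (Re s * (sg * x)) <=
      INR (fact k) / r ^ k * K * exp (- (3 * r) * x)).
    { intros x hx. rewrite Rabs_mult.
      pose proof (moment_bound (sg * x) (Re s) r (Re s0) k hr hsr) as h.
      apply Rle_trans with (INR (fact k) / r ^ k * (Rabs (phi x) * (exp (Re s0 * (sg * x)) * exp (3 * r * Rabs (sg * x))))).
      - replace (Rabs (phi x) * Rabs ((sg * x) ^ k) * exp (Re s * (sg * x))) with
          (Rabs (phi x) * (Rabs ((sg * x) ^ k) * exp (Re s * (sg * x)))) by ring.
        replace (INR (fact k) / r ^ k * (Rabs (phi x) * (exp (Re s0 * (sg * x)) * exp (3 * r * Rabs (sg * x))))) with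
          (Rabs (phi x) * (INR (fact k) / r ^ k * (exp (Re s0 * (sg * x)) * exp (3 * r * Rabs (sg * x))))) by ring.
        apply Rmult_le_compat_l; [apply Rabs_pos|exact h].
      - rewrite (Rmult_assoc _ K). apply Rmult_le_compat_l; [assumption|]. now apply hb. }
    split; split.
    + intros x. apply continuous_ext with (fun y => phi y * ((sg * y) ^ k * (exp (Re s * (sg * y)) * cos (Im s * (sg * y))))).
      * intros y. unfold Cexp, Re, Im. simpl.
        replace (fst s * (sg * y) - snd s * 0) with (fst s * (sg * y)) by ring.
        replace (fst s * 0 + snd s * (sg * y)) with (snd s * (sg * y)) by ring. real_eq. ring.
      * apply continuous_Rmult; [apply hphi|]. apply continuous_ex_derive. auto_derive. auto.
    + exists (INR (fact k) / r ^ k * K). intros x hx.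
      eapply Rle_trans; [apply Re_Im_scaled_Cexp_bound|now apply key].
    + intros x. apply continuous_ext with (fun y => phi y * ((sg * y) ^ k * (exp (Re s * (sg * y)) * sin (Im s * (sg * y))))).
      * intros y. unfold Cexp, Re, Im. simpl.
        replace (fst s * (sg * y) - snd s * 0) with (fst s * (sg * y)) by ring.
        replace (fst s * 0 + snd s * (sg * y)) with (snd s * (sg * y)) by ring. real_eq. ring.
      * apply continuous_Rmult; [apply hphi|]. apply continuous_ex_derive. auto_derive. auto.
    + exists (INR (fact k) / r ^ k * K). intros x hx.
      eapply Rle_trans; [apply Re_Im_scaled_Cexp_bound|now apply key].
Qed.

Lemma LInt_zero : LInt (fun _ => 0) = 0.
Proof.
  unfold LInt. rewrite (Lim_seq_ext _ (fun _ => 0)).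
  - now rewrite Lim_seq_const.
  - intros n. rewrite RInt_const. unfold scal; simpl; unfold mult; simpl. ring.
Qed.

Lemma laplace_real (phi mu : R -> R) (t : R) :
  superposition LInt phi mu (RtoC t) = RtoC (LInt (fun x => phi x * exp (t * mu x))).
Proof.
  unfold superposition, cfun.
  assert (e1 : (fun x => Re (RtoC (phi x) * Cexp (RtoC t * RtoC (mu x)))%C) = (fun x => phi x * exp (t * mu x))).
  { apply functional_extensionality. intros x. now rewrite <- RtoC_mult, Cexp_R, <- RtoC_mult. }
  assert (e2 : (fun x => Im (RtoC (phi x) * Cexp (RtoC t * RtoC (mu x)))%C) = (fun _ => 0)).
  { apply functional_extensionality. intros x. now rewrite <- RtoC_mult, Cexp_R, <- RtoC_mult. }
  now rewrite e1, e2, LInt_zero.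
Qed.

Lemma green_term_dominated a u : 0 < a -> 0 <= u ->
  lat_dominated (pw 2) (Rpower (quad_const a) (- (2))) (lat_restrict (fun p => / (u + quad a p) ^ 2)).
Proof.
  intros ha hu. apply quad_power_dominated; [assumption|lra|].
  intros p hp. pose proof (quad_pos a p ha hp) as hq.
  rewrite Rpower_Ropp. replace (Rpower (quad a p) 2) with (quad a p ^ 2)
    by (rewrite <- Rpower_pow by assumption; reflexivity).
  rewrite Rabs_pos_eq by (left; apply Rinv_0_lt_compat, pow_lt; lra).
  apply Rinv_le_contravar; [now apply pow_lt|]. apply pow_incr. lra.
Qed.

Lemma green_exp_continuous a x : 0 < a -> continuous (fun y => green a (exp y)) x.
Proof.
  intros ha. unfold green.
  apply (LS_continuous (fun y => lat_restrict (fun p => / (exp y + quad a p) ^ 2)) (pw 2) x 1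
    (Rpower (quad_const a) (- (2)))); [apply pw2_summable|lra| |].
  - intros p. destruct (classic (p = (0, 0)%Z)) as [->|hp]; [apply continuous_const|].
    apply continuous_ext with (fun y => / (exp y + quad a p) ^ 2).
    + intros y. now rewrite lat_restrict_neq.
    + apply continuous_ex_derive. auto_derive. pose proof (exp_pos x). pose proof (quad_pos a p ha hp).
      apply Rgt_not_eq. apply Rmult_lt_0_compat; nra.
  - intros y _. apply green_term_dominated; [assumption|left; apply exp_pos].
Qed.

(** The measure [u G(u) du] in the variable [x], namely [u^2 G(u)] at [u = e^(-x)], where [u^(-s)]
    is [e^(s x)]. The outer density is its analogue at [u = e^x], with the terms [pi / u] and
    [-1 / u^2] taken out of [G]. *)
Definition inner_density (a x : R) : R := exp (- (2) * x) * green a (exp (- x)).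
Definition outer_density (a x : R) : R := exp (2 * x) * green_reg a (exp x).

Lemma inner_density_spec a : 0 < a ->
  (forall x, continuous (inner_density a) x) /\ exists K, exp_dominated 2 (inner_density a) K.
Proof.
  intros ha. split.
  - intros x. apply continuous_Rmult; [apply continuous_exp_opp|].
    apply (continuous_comp (fun y => - y) (fun y => green a (exp y))); [|now apply green_exp_continuous].
    apply continuous_ex_derive. auto_derive. auto.
  - exists (Rpower (quad_const a) (- (2)) * ZS (pw 2) ^ 2). intros x hx. unfold inner_density.
    rewrite Rabs_mult, (Rabs_pos_eq (exp _)), Rmult_comm by (left; apply exp_pos).
    apply Rmult_le_compat_r; [left; apply exp_pos|].
    apply LS_abs_le; [apply pw2_summable|]. apply green_term_dominated; [assumption|left; apply exp_pos].
Qed.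

(** The factor [u^2] uses up two of the [k + 1] powers, which leaves the rate [k - 1]. *)
Lemma outer_density_spec a (k : nat) : 0 < a ->
  (forall x, continuous (outer_density a) x) /\ exists K, exp_dominated (INR k - 1) (outer_density a) K.
Proof.
  intros ha. split.
  - intros x. apply continuous_Rmult.
    + apply continuous_ex_derive. auto_derive. auto.
    + apply continuous_ext with (fun y => green a (exp y) + (/ exp y ^ 2 + - (PI / exp y))).
      * intros y. unfold green_reg. real_eq. ring.
      * apply continuous_Rplus; [now apply green_exp_continuous|].
        apply continuous_ex_derive. auto_derive. pose proof (exp_pos x).
        repeat split; try lra. apply Rgt_not_eq. nra.
  - destruct (green_reg_decay a k ha) as (K & hK & hb). exists K. intros x hx.
    unfold outer_density. rewrite Rabs_mult, (Rabs_pos_eq (exp (2 * x))) by (left; apply exp_pos).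
    assert (h1 : 1 <= exp x) by (rewrite <- exp_0; now apply exp_le_compat).
    apply Rle_trans with (exp (2 * x) * (K * / exp x ^ S k)).
    + apply Rmult_le_compat_l; [left; apply exp_pos|now apply hb].
    + assert (hpow : forall n, exp x ^ n = exp (INR n * x)).
      { induction n as [|n IH]; [simpl; now rewrite Rmult_0_l, exp_0|].
        rewrite S_INR, Rmult_plus_distr_r, Rmult_1_l, exp_plus. simpl. rewrite IH. ring. }
      rewrite hpow, <- exp_Ropp, S_INR.
      replace (exp (2 * x) * (K * exp (- ((INR k + 1) * x)))) with
        (K * (exp (2 * x) * exp (- ((INR k + 1) * x)))) by ring.
      rewrite <- exp_plus. right. do 2 f_equal. ring.
Qed.

Definition mellin_part (a : R) (s : C) : C :=
  Cplus (superposition LInt (inner_density a) (fun x => 1 * x) s)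
    (superposition LInt (outer_density a) (fun x => - (1) * x) s).

Lemma expandable_mellin_part a s0 : 0 < a -> Re s0 < 2 -> expandable (mellin_part a) s0.
Proof.
  intros ha hs. apply expandable_plus.
  - destruct (inner_density_spec a ha) as [h1 [K hK]].
    apply expandable_laplace with 2 K; auto. lra.
  - destruct (nfloor_ex (Rabs (Re s0) + 2)) as [k hk]; [pose proof (Rabs_pos (Re s0)); lra|].
    destruct (outer_density_spec a k ha) as [h1 [K hK]].
    apply expandable_laplace with (INR k - 1) K; auto.
    pose proof (Rle_abs (- Re s0)) as h. rewrite Rabs_Ropp in h. lra.
Qed.

(** Over [u > 1] the removed terms [pi / u] and [-1 / u^2] integrate against [u^(1-s)] to
    [pi / (s - 1)] and [-1 / s]. The prefactor [sin (pi s) / (pi (1 - s))] is [s sinc(s) / (1 - s)];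
    its [s] is moved into the last factor, where it cancels the pole of [-1 / s] and leaves the
    constant -1. *)
Definition continuation (a : R) (s : C) : C :=
  (Cexp (RtoC (- (2) * ln (2 * PI)) * s) * sinc s * (Copp 1 * / (s - 1)) *
   (s * (mellin_part a s + RtoC PI * / (s - 1)) + Copp 1))%C.

Lemma expandable_continuation a s0 : 0 < a -> Re s0 < 2 -> s0 <> RtoC 1 ->
  expandable (continuation a) s0.
Proof.
  intros ha hs h1. unfold continuation.
  apply (expandable_mult (fun s => Cexp (RtoC (- (2) * ln (2 * PI)) * s) * sinc s * (Copp 1 * / (s - 1)))%C
    (fun s => s * (mellin_part a s + RtoC PI * / (s - 1)) + Copp 1)%C).
  - apply (expandable_mult (fun s => Cexp (RtoC (- (2) * ln (2 * PI)) * s) * sinc s)%C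
      (fun s => Copp 1 * / (s - 1))%C).
    + apply (expandable_mult (fun s => Cexp (RtoC (- (2) * ln (2 * PI)) * s))%C sinc);
        [apply expandable_Cexp|apply expandable_sinc].
    + apply (expandable_mult (fun _ => Copp 1)); [apply expandable_const|now apply expandable_inv_linear].
  - apply (expandable_plus (fun s => s * (mellin_part a s + RtoC PI * / (s - 1)))%C); [|apply expandable_const].
    apply (expandable_mult (fun s => s)); [apply expandable_id|].
    apply expandable_plus; [now apply expandable_mellin_part|].
    apply (expandable_mult (fun _ => RtoC PI)); [apply expandable_const|now apply expandable_inv_linear].
Qed.

Lemma continuation_real a s : 0 < a -> 1 < s < 2 ->
  continuation a (RtoC s) = dirichlet a (RtoC s).
Proof.
  intros ha hs. pose proof PI_RGT_0 as hpi.
  rewrite dirichlet_real by lra.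
  destruct (green_mellin a s ha hs) as (hc & hd1 & hd2 & hm).
  set (LSQ := LS (lat_restrict (fun p => Rpower (quad a p) (- s)))) in *.
  set (A := LInt (fun x => inner_density a x * exp (s * (1 * x)))).
  set (E := LInt (fun x => outer_density a x * exp (s * (- (1) * x)))).
  assert (eA : LInt (fun x => exp ((2 - s) * - x) * green a (exp (- x))) = A).
  { unfold A. f_equal. apply functional_extensionality. intros x. unfold inner_density.
    replace ((2 - s) * - x) with (- (2) * x + s * (1 * x)) by ring. rewrite exp_plus. ring. }
  assert (eE : LInt (fun x => exp ((2 - s) * x) * green a (exp x)) = E + PI / (s - 1) - / s).
  { destruct (outer_density_spec a 1 ha) as [h1 [K hK]]. simpl INR in hK.
    assert (d1 : exp_dom (s - 1) (fun x => outer_density a x * exp (s * (- (1) * x)))).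
    { split.
      - intros x. apply continuous_Rmult; [apply h1|]. apply continuous_ex_derive. auto_derive. auto.
      - exists K. intros x hx. rewrite Rabs_mult, (Rabs_pos_eq (exp _)) by (left; apply exp_pos).
        specialize (hK x hx). replace (- (1 - 1) * x) with 0 in hK by ring. rewrite exp_0, Rmult_1_r in hK.
        apply Rmult_le_compat; [apply Rabs_pos|left; apply exp_pos|assumption|].
        apply exp_le_compat. nra. }
    assert (d2 := exp_dom_exp (s - 1)).
    assert (d3 : exp_dom (s - 1) (fun x => exp (- s * x))).
    { split; [intros x; apply continuous_exp_opp|]. exists 1. intros x hx.
      rewrite Rabs_pos_eq, Rmult_1_l by (left; apply exp_pos). apply exp_le_compat. nra. }
    assert (e : (fun x => exp ((2 - s) * x) * green a (exp x)) =
      (fun x => 1 * (1 * (outer_density a x * exp (s * (- (1) * x))) + PI * exp (- (s - 1) * x)) + - (1) * exp (- s * x))).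
    { apply functional_extensionality. intros x. unfold outer_density, green_reg.
      replace (s * (- (1) * x)) with (- s * x) by ring.
      replace ((2 - s) * x) with (2 * x + - s * x) by ring.
      replace (- (s - 1) * x) with (x + - s * x) by ring. rewrite !exp_plus.
      replace (2 * x) with (x + x) by ring. rewrite exp_plus. pose proof (exp_pos x). field. lra. }
    rewrite e, (LInt_lin (s - 1)), (LInt_lin (s - 1)), !LInt_exp by (auto; try lra; apply exp_dom_lin; assumption).
    fold E. unfold Rdiv. ring. }
  rewrite eA, eE in hm.
  assert (hsz : sin (PI * (s - 1)) <> 0) by (apply Rgt_not_eq, sin_gt_0; nra).
  assert (hss : sin (PI * (s - 1)) = - sin (PI * s)).
  { replace (PI * (s - 1)) with (- (PI - PI * s)) by ring. rewrite sin_neg. 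
    now rewrite <- (sin_PI_x (PI * s)). }
  unfold continuation, mellin_part. rewrite !laplace_real. fold A. fold E.
  rewrite sinc_real by lra. rewrite <- RtoC_mult, Cexp_R.
  assert (hsC : (RtoC s - 1)%C = RtoC (s - 1)) by now rewrite RtoC_minus.
  rewrite hsC, <- RtoC_inv, <- RtoC_opp, <- !RtoC_mult, <- !RtoC_plus, <- !RtoC_mult, <- RtoC_plus, <- RtoC_mult by lra.
  f_equal. unfold Rpower.
  replace (- (2) * ln (2 * PI) * s) with (- (2 * s) * ln (2 * PI)) by ring.
  rewrite !Rmult_assoc. f_equal.
  assert (hL : LSQ = (A + E + PI / (s - 1) - / s) * (sin (PI * (s - 1)) / (PI * (s - 1)))).
  { replace (A + E + PI / (s - 1) - / s) with (LSQ * (PI * (s - 1) / sin (PI * (s - 1)))) by lra.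
    field. repeat split; lra. }
  rewrite hL, hss. field. lra.
Qed.

(** The two sides agree on the real interval (1, 2), whose points accumulate at 3/2. The strip is
    convex, so the segment from 3/2 to [s] carries the identity along. *)
Lemma continuation_dirichlet a s : 0 < a -> 1 < Re s < 2 -> continuation a s = dirichlet a s.
Proof.
  intros ha hs.
  set (D := fun s => (continuation a s + Copp 1 * dirichlet a s)%C).
  assert (hne : forall z : C, 1 < Re z -> z <> RtoC 1) by (intros z hz h; rewrite h in hz; simpl in hz; lra).
  assert (hexp : forall z, 1 < Re z < 2 -> expandable D z).
  { intros z hz. apply expandable_plus.
    - apply expandable_continuation; [assumption|lra|apply hne; lra].
    - apply (expandable_mult (fun _ => Copp 1)); [apply expandable_const|].
      apply dirichlet_expandable; [assumption|lra]. }
  assert (hreal : forall t, 1 < t < 2 -> D (RtoC t) = RtoC 0).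
  { intros t ht. unfold D. rewrite continuation_real by assumption. ring. }
  assert (hloc : exists d, 0 < d /\ forall z, Cmod (z - RtoC (3 / 2))%C < d -> D z = RtoC 0).
  { apply expandable_zero_locally.
    - apply hexp. simpl. lra.
    - intros d hd. exists (RtoC (Rmin (1 / 4) (d / 2))).
      assert (h1 : 0 < Rmin (1 / 4) (d / 2)) by (apply Rmin_glb_lt; lra).
      assert (h2 := Rmin_l (1 / 4) (d / 2)). assert (h3 := Rmin_r (1 / 4) (d / 2)).
      split; [|split].
      + intros h. apply RtoC_inj in h. lra.
      + rewrite Cmod_R, Rabs_pos_eq; lra.
      + rewrite <- RtoC_plus. apply hreal. lra. }
  assert (hz : D s = RtoC 0).
  { destruct (Ceq_dec (RtoC (3 / 2)) s) as [<-|hn]; [apply hreal; lra|].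
    destruct (identity_on_segment D (RtoC (3 / 2)) s hn) as (d & hd & h); [|exact hloc|].
    - intros t ht. apply hexp. unfold Re in *. simpl. nra.
    - apply h. replace (s - s)%C with (RtoC 0) by ring. now rewrite Cmod_0. }
  unfold D in hz. replace (continuation a s) with
    (continuation a s + Copp 1 * dirichlet a s + dirichlet a s)%C by ring.
  rewrite hz. ring.
Qed.

(** Neither formula covers the plane: [continuation] is available for [Re s < 2], the series for
    [Re s > 1]. They are glued inside the common strip. *)
Definition zeta_extension (a : R) (s : C) : C :=
  if Rlt_dec (Re s) (3 / 2) then continuation a s else dirichlet a s.

Lemma zeta_extension_spectral a : 0 < a -> is_spectral_zeta (rect_lattice a) (zeta_extension a).
Proof.
  intros ha. split.
  - intros s hs. replace (zeta_extension a s) with (dirichlet a s); [now apply zeta_has_sum|].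
    unfold zeta_extension. destruct (Rlt_dec (Re s) (3 / 2)); [|reflexivity].
    symmetry. apply continuation_dirichlet; [assumption|lra].
  - intros s hs. apply expandable_analytic.
    assert (hre : forall z d, Cmod (z - s)%C < d -> Rabs (Re z - Re s) < d).
    { intros z d h. eapply Rle_lt_trans; [|exact h].
      replace (Re z - Re s) with (Re (z - s)%C) by (unfold Re; simpl; ring). apply re_le_Cmod. }
    destruct (Rlt_le_dec 1 (Re s)) as [h1|h1].
    + apply expandable_ext with (dirichlet a) (Re s - 1); [lra| |now apply dirichlet_expandable].
      intros z hz. apply hre, Rabs_def2 in hz. unfold zeta_extension.
      destruct (Rlt_dec (Re z) (3 / 2)); [|reflexivity].
      symmetry. apply continuation_dirichlet; [assumption|lra].
    + apply expandable_ext with (continuation a) (/ 2); [lra| |apply expandable_continuation; auto; lra].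
      intros z hz. apply hre, Rabs_def2 in hz. unfold zeta_extension.
      destruct (Rlt_dec (Re z) (3 / 2)); [reflexivity|lra].
Qed.

(** * Uniqueness of the zeta function and its derivative at 0 *)

Lemma has_sum_unique A f S T : has_sum A f S -> has_sum A f T -> S = T.
Proof.
  intros hS hT. apply NNPP. intros hne.
  assert (hd : 0 < Cmod (S - T)%C).
  { apply Cmod_gt_0. intros h. apply hne. replace S with (S - T + T)%C by ring. rewrite h. ring. }
  destruct (hS (Cmod (S - T)%C / 2)) as (l1 & n1 & i1 & h1); [lra|].
  destruct (hT (Cmod (S - T)%C / 2)) as (l2 & n2 & i2 & h2); [lra|].
  set (l := nodup Ceq_dec (l1 ++ l2)).
  assert (hl : NoDup l) by apply NoDup_nodup.
  assert (hA : forall w, In w l -> A w).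
  { intros w hw. apply nodup_In, in_app_iff in hw. destruct hw; auto. }
  specialize (h1 l hl hA ltac:(intros w hw; apply nodup_In, in_app_iff; now left)).
  specialize (h2 l hl hA ltac:(intros w hw; apply nodup_In, in_app_iff; now right)).
  assert (h3 : Cmod (S - T)%C <= Cmod (Csum_list f l - S)%C + Cmod (Csum_list f l - T)%C).
  { replace (S - T)%C with (- (Csum_list f l - S) + (Csum_list f l - T))%C by ring.
    eapply Rle_trans; [apply Cmod_triangle|]. rewrite Cmod_opp. lra. }
  lra.
Qed.

(** The segment from [2 + i] to [0] avoids the pole at [1]. *)
Lemma spectral_zeta_unique (L : C -> Prop) Z W : is_spectral_zeta L Z -> is_spectral_zeta L W ->
  exists d, 0 < d /\ forall s, Cmod s < d -> Z s = W s.
Proof.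
  intros [hZ1 hZ2] [hW1 hW2].
  set (D := fun s => (Z s + Copp 1 * W s)%C).
  assert (hexp : forall z, z <> RtoC 1 -> expandable D z).
  { intros z hz. apply expandable_plus; [now apply analytic_expandable, hZ2|].
    apply (expandable_mult (fun _ => Copp 1)); [apply expandable_const|].
    now apply analytic_expandable, hW2. }
  assert (hpq : (2, 1) <> RtoC 0) by (intros h; injection h; lra).
  destruct (identity_on_segment D (2, 1) (RtoC 0) hpq) as (d & hd & h).
  - intros t ht. apply hexp. intros h.
    assert (h1 := f_equal Re h). assert (h2 := f_equal Im h). simpl in h1, h2. lra.
  - exists 1. split; [lra|]. intros s hs.
    assert (hre : Rabs (Re s - 2) < 1).
    { eapply Rle_lt_trans; [|exact hs]. replace (Re s - 2) with (Re (s - (2, 1))%C) by (unfold Re; simpl; ring).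
      apply re_le_Cmod. }
    apply Rabs_def2 in hre.
    unfold D. rewrite (has_sum_unique _ _ _ _ (hZ1 s ltac:(lra)) (hW1 s ltac:(lra))). ring.
  - exists d. split; [assumption|]. intros s hs.
    assert (hs0 : Cmod (s - 0)%C < d) by now replace (s - 0)%C with s by ring.
    specialize (h s hs0). unfold D in h.
    replace (Z s) with (Z s + Copp 1 * W s + W s)%C by ring. rewrite h. ring.
Qed.

(** Minus the derivative of [continuation] at 0. There the last factor is -1, the value of zeta at
    0; it multiplies the derivatives [- 2 ln (2 pi)] and 1 of the first factor and of [1 / (1 - s)],
    while that of [sinc] is 0. The last factor adds its own derivative, the two integrals minus
    [pi]. *)
Definition log_det_value (a : R) : R :=
  1 - 2 * ln (2 * PI) + PI - LInt (inner_density a) - LInt (outer_density a).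

Lemma continuation_derive_0 a : 0 < a ->
  is_Cderive (continuation a) (RtoC 0) (RtoC (- log_det_value a)).
Proof.
  intros ha.
  set (h := fun s => (mellin_part a s + RtoC PI * / (s - 1))%C).
  assert (hh : expandable h (RtoC 0)).
  { apply expandable_plus; [apply expandable_mellin_part; [assumption|simpl; lra]|].
    apply (expandable_mult (fun _ => RtoC PI)); [apply expandable_const|].
    apply expandable_inv_linear. intros e. apply RtoC_inj in e. lra. }
  (* The product rule asks for some derivative of [h]; that of [s * h s] at 0 is just [h 0]. *)
  destruct (expandable_ex_derive h _ hh) as [dh hdh].
  assert (hi : is_Cderive (fun s => Copp 1 * / (s - 1))%C (RtoC 0) (RtoC 1)).
  { apply is_derive_of_quadratic with (1 / 2) 2; [lra|lra|].
    intros z hz. rewrite Cplus_0_l.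
    assert (hz1 : / 2 <= Cmod (1 - z)%C).
    { assert (hh1 : Cmod 1 <= Cmod (1 - z)%C + Cmod z).
      { replace (RtoC 1) with (1 - z + z)%C at 1 by ring. apply Cmod_triangle. }
      rewrite Cmod_1 in hh1. lra. }
    assert (hz0 : (1 - z)%C <> 0%C) by (apply Cmod_gt_0; lra).
    assert (hz2 : (z - 1)%C <> 0%C) by (intros e; apply hz0; replace (1 - z)%C with (- (z - 1))%C by ring; rewrite e; ring).
    assert (h01 : (0 - 1)%C <> 0%C) by (intros e; apply (f_equal Re) in e; simpl in e; lra).
    replace (Copp 1 * / (z - 1) - Copp 1 * / (0 - 1) - 1 * z)%C with (z * z * / (1 - z))%C
      by (field; repeat split; assumption).
    rewrite !Cmod_mult, Cmod_inv by assumption.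
    assert (hinv : / Cmod (1 - z)%C <= 2).
    { replace 2 with (/ / 2) by field. apply Rinv_le_contravar; lra. }
    simpl. nra. }
  assert (h1 := is_Cderive_mult _ _ _ _ _ (is_Cderive_Cexp (RtoC (- (2) * ln (2 * PI)))) sinc_derive_0).
  assert (h2 := is_Cderive_mult _ _ _ _ _ h1 hi).
  assert (h3 := is_Cderive_plus _ _ _ _ _ (is_Cderive_mult _ _ _ _ _ (is_Cderive_id (RtoC 0)) hdh)
    (is_Cderive_const (Copp 1) (RtoC 0))).
  assert (h4 := is_Cderive_mult _ _ _ _ _ h2 h3).
  cbv beta in h4.
  assert (e0 : sinc 0 = 1%C) by (unfold sinc; destruct (Ceq_dec 0 0) as [_|e]; [reflexivity|now contradiction e]).
  assert (eh : h (RtoC 0) = RtoC (LInt (inner_density a) + LInt (outer_density a) - PI)).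
  { unfold h, mellin_part. rewrite !laplace_real.
    assert (ea : (fun x => inner_density a x * exp (0 * (1 * x))) = inner_density a).
    { apply functional_extensionality. intros x. rewrite Rmult_0_l, exp_0. ring. }
    assert (eb : (fun x => outer_density a x * exp (0 * (- (1) * x))) = outer_density a).
    { apply functional_extensionality. intros x. rewrite Rmult_0_l, exp_0. ring. }
    rewrite ea, eb, <- RtoC_minus, <- RtoC_inv, <- RtoC_mult, <- !RtoC_plus by lra.
    f_equal. field. }
  replace (RtoC (- (2) * ln (2 * PI)) * 0)%C with (RtoC 0) in h4 by ring.
  rewrite e0, eh, Cexp_R, exp_0 in h4.
  match type of h4 with is_derive ?f _ ?l => replace (RtoC (- log_det_value a)) with l end.
  - exact h4.
  - assert (e1 : (Copp 1 * / (0 - 1))%C = RtoC 1).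
    { 
      field. }
    rewrite e1. unfold log_det_value.
    rewrite RtoC_opp, !RtoC_minus, !RtoC_plus, !RtoC_minus, !RtoC_mult, RtoC_opp. ring.
Qed.

(** The function selected by [epsilon] is known through its specification only; by uniqueness it
    agrees with [continuation] near 0, and that is all the derivative depends on. *)
Lemma det_laplacian_eq a : 0 < a ->
  det_laplacian (rect_lattice a) = RtoC (exp (log_det_value a)).
Proof.
  intros ha. unfold det_laplacian.
  assert (hspec : is_spectral_zeta (rect_lattice a) (spectral_zeta (rect_lattice a))).
  { unfold spectral_zeta. apply epsilon_spec. exists (zeta_extension a). now apply zeta_extension_spectral. }
  destruct (spectral_zeta_unique _ _ _ (zeta_extension_spectral a ha) hspec) as (d & hd & h).
  assert (hder : is_Cderive (spectral_zeta (rect_lattice a)) (RtoC 0) (RtoC (- log_det_value a))).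
  { apply (is_derive_ext_loc (V := C_NormedModule) (continuation a)); [|now apply continuation_derive_0].
    assert (hm : 0 < Rmin d 1) by (apply Rmin_glb_lt; lra).
    apply (@locally_le_locally_norm C_AbsRing (AbsRing_NormedModule C_AbsRing)).
    exists (mkposreal _ hm).
    cut (forall s : C, Cmod (s - 0)%C < Rmin d 1 -> continuation a s = spectral_zeta (rect_lattice a) s).
    { intros key s hs. exact (key s hs). }
    intros s hs. replace (s - 0)%C with s in hs by ring.
    rewrite <- h by (eapply Rlt_le_trans; [exact hs|apply Rmin_l]).
    unfold zeta_extension. destruct (Rlt_dec (Re s) (3 / 2)) as [_|hn]; [reflexivity|].
    exfalso. apply hn. pose proof (re_le_Cmod s) as hre. pose proof (Rle_abs (Re s)).
    assert (Cmod s < 1) by (eapply Rlt_le_trans; [exact hs|apply Rmin_r]). lra. }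
  rewrite (is_C_derive_unique _ _ _ hder), <- RtoC_opp, Ropp_involutive. apply Cexp_R.
Qed.

(** For [x >= 0] this equals [2 r - 2 x - V / r] with [r = sqrt (V + x^2)], the non-exponential part
    of a row at the upper end. The form without cancellation shows its sign and decay; likewise
    [trap_int] is a primitive, vanishing at 0, from which the limit [V / 2] can be read off. *)
Definition trap (V x : R) : R := V ^ 2 / (sqrt (V + x ^ 2) * (sqrt (V + x ^ 2) + x) ^ 2).
Definition trap1 (V x : R) : R :=
  2 * (x / sqrt (V + x ^ 2)) - 2 + V * x / sqrt (V + x ^ 2) ^ 3.
Definition trap2 (V x : R) : R := 3 * V ^ 2 / sqrt (V + x ^ 2) ^ 5.
Definition trap_int (V x : R) : R := x * V / (sqrt (V + x ^ 2) + x).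

(** * Evaluation of the regularised integral *)

Section Trapezoid.
Context (V : R) (hV : 0 < V).

Lemma trap_sqrt x : 0 <= x ->
  exists s, sqrt (V + x ^ 2) = s /\ 0 < s /\ s ^ 2 = V + x ^ 2 /\ x < s.
Proof.
  intros hx. pose proof (pow2_ge_0 x). exists (sqrt (V + x ^ 2)).
  pose proof (sqrt_lt_R0 (V + x ^ 2) ltac:(lra)) as hs.
  assert (e : sqrt (V + x ^ 2) ^ 2 = V + x ^ 2) by (rewrite pow2_sqrt; lra).
  repeat split; auto. nra.
Qed.

Lemma trap_alt x : 0 <= x -> trap V x = 2 * sqrt (V + x ^ 2) - 2 * x - V / sqrt (V + x ^ 2).
Proof.
  intros hx. unfold trap. destruct (trap_sqrt x hx) as (s & -> & h1 & h2 & h3).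
  replace V with (s ^ 2 - x ^ 2) by lra. field. lra.
Qed.

Definition trap_raw (x : R) : R := 2 * sqrt (V + x ^ 2) - 2 * x - V / sqrt (V + x ^ 2).

Lemma trap_raw_derive x : is_derive trap_raw x (trap1 V x).
Proof.
  pose proof (pow2_ge_0 x). pose proof (sqrt_lt_R0 (V + x ^ 2) ltac:(lra)) as hs.
  unfold trap_raw, trap1. auto_derive; replace (x * (x * 1)) with (x ^ 2) by ring.
  - repeat split; lra.
  - set (s := sqrt (V + x ^ 2)) in *. field. lra.
Qed.

Lemma trap1_derive x : is_derive (trap1 V) x (trap2 V x).
Proof.
  pose proof (pow2_ge_0 x). pose proof (sqrt_lt_R0 (V + x ^ 2) ltac:(lra)) as hs.
  unfold trap1, trap2. auto_derive; replace (x * (x * 1)) with (x ^ 2) by ring.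
  - set (s := sqrt (V + x ^ 2)) in *. repeat split; try lra.
    apply Rgt_not_eq. repeat apply Rmult_lt_0_compat; lra.
  - set (s := sqrt (V + x ^ 2)) in *.
    assert (e : s ^ 2 = V + x ^ 2) by (unfold s; rewrite pow2_sqrt; lra).
    replace V with (s ^ 2 - x ^ 2) by lra. field. lra.
Qed.

Definition trap_int_raw (x : R) : R := x * sqrt (V + x ^ 2) - x ^ 2.

Lemma trap_int_raw_derive x : is_derive trap_int_raw x (trap_raw x).
Proof.
  pose proof (pow2_ge_0 x). pose proof (sqrt_lt_R0 (V + x ^ 2) ltac:(lra)) as hs.
  unfold trap_int_raw, trap_raw. auto_derive; replace (x * (x * 1)) with (x ^ 2) by ring.
  - repeat split; lra.
  - set (s := sqrt (V + x ^ 2)) in *.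
    assert (e : s ^ 2 = V + x ^ 2) by (unfold s; rewrite pow2_sqrt; lra).
    replace V with (s ^ 2 - x ^ 2) by lra. field. lra.
Qed.

Lemma trap_int_alt x : 0 <= x -> trap_int V x = trap_int_raw x.
Proof.
  intros hx. unfold trap_int, trap_int_raw. destruct (trap_sqrt x hx) as (s & -> & h1 & h2 & h3).
  replace V with (s ^ 2 - x ^ 2) by lra. field. lra.
Qed.

Lemma trap2_anti x y : 0 <= x <= y -> trap2 V y <= trap2 V x.
Proof.
  intros hxy. unfold trap2, Rdiv. apply Rmult_le_compat_l.
  - pose proof (pow2_ge_0 V). lra.
  - pose proof (pow2_ge_0 x). apply Rinv_le_contravar.
    + apply pow_lt, sqrt_lt_R0. lra.
    + apply pow_incr. split; [apply sqrt_pos|]. apply sqrt_le_1_alt.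
      apply Rplus_le_compat_l, pow_incr. lra.
Qed.

Lemma trap2_nonneg x : 0 <= x -> 0 <= trap2 V x.
Proof.
  intros hx. unfold trap2. pose proof (pow2_ge_0 x). apply Rdiv_le_0_compat.
  - pose proof (pow2_ge_0 V). lra.
  - apply pow_lt, sqrt_lt_R0. lra.
Qed.

(** Here [phi t] is twice the trapezoidal error on [k, k + t]. One has [phi' = psi] and
    [psi' = t f''(k + t)], and both vanish at 0; bounding the decreasing [f''] by its end values and
    integrating twice gives the factor 1/6. *)
Lemma trapezoid_error k : 0 <= k ->
  trap2 V (k + 1) / 6 <=
  trap_raw k + trap_raw (k + 1) - 2 * (trap_int_raw (k + 1) - trap_int_raw k) <=
  trap2 V k / 6.
Proof.
  intros hk.
  set (phi := fun t => t * (trap_raw k + trap_raw (k + t)) - 2 * (trap_int_raw (k + t) - trap_int_raw k)).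
  set (psi := fun t => trap_raw k - trap_raw (k + t) + t * trap1 V (k + t)).
  assert (shift : forall (f df : R -> R), (forall x, is_derive f x (df x)) ->
    forall t, is_derive (fun t => f (k + t)) t (df (k + t))).
  { intros f df h t. evar_last.
    - apply (is_derive_comp f (fun t => k + t)); [apply h|].
      instantiate (1 := 1). auto_derive; [auto|ring].
    - unfold scal; simpl; unfold mult; simpl. ring. }
  assert (hphi : forall t, is_derive phi t (psi t)).
  { intros t. unfold phi, psi. evar_last.
    - apply (is_derive_minus (fun t => t * (trap_raw k + trap_raw (k + t)))
        (fun t => 2 * (trap_int_raw (k + t) - trap_int_raw k))).
      + apply (is_derive_Rmul (fun t => t) (fun t => trap_raw k + trap_raw (k + t))).
        * apply (is_derive_id (K := R_AbsRing)).
        * apply (is_derive_plus (fun _ => trap_raw k) (fun t => trap_raw (k + t)));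
            [apply (is_derive_const (K := R_AbsRing))|apply (shift trap_raw (trap1 V)), trap_raw_derive].
      + apply is_derive_scal. apply (is_derive_minus (fun t => trap_int_raw (k + t)) (fun _ => trap_int_raw k));
          [apply (shift trap_int_raw trap_raw), trap_int_raw_derive|apply (is_derive_const (K := R_AbsRing))].
    - unfold minus, plus, opp, zero, one; simpl. ring. }
  assert (hpsi : forall t, is_derive psi t (t * trap2 V (k + t))).
  { intros t. unfold psi. evar_last.
    - apply (is_derive_plus (fun t => trap_raw k - trap_raw (k + t)) (fun t => t * trap1 V (k + t))).
      + apply (is_derive_minus (fun _ => trap_raw k) (fun t => trap_raw (k + t)));
          [apply (is_derive_const (K := R_AbsRing))|apply (shift trap_raw (trap1 V)), trap_raw_derive].
      + apply (is_derive_Rmul (fun t => t) (fun t => trap1 V (k + t)));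
          [apply (is_derive_id (K := R_AbsRing))|apply (shift (trap1 V) (trap2 V)), trap1_derive].
    - unfold minus, plus, opp, zero, one; simpl. ring. }
  assert (hphi0 : phi 0 = 0) by (unfold phi; rewrite Rplus_0_r; ring).
  assert (hpsi0 : psi 0 = 0) by (unfold psi; rewrite Rplus_0_r; ring).
  assert (hphi1 : phi 1 = trap_raw k + trap_raw (k + 1) - 2 * (trap_int_raw (k + 1) - trap_int_raw k))
    by (unfold phi; ring).
  rewrite <- hphi1.
  set (A := trap2 V (k + 1)). set (B := trap2 V k).
  assert (hAB : forall t, 0 <= t <= 1 -> A <= trap2 V (k + t) <= B).
  { intros t ht. split; apply trap2_anti; lra. }
  assert (dsq : forall c t, is_derive (fun t => c * t ^ 2 / 2) t (c * t)).
  { intros c t. auto_derive; [auto|]. field. }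
  assert (dcb : forall c t, is_derive (fun t => c * t ^ 3 / 6) t (c * t ^ 2 / 2)).
  { intros c t. auto_derive; [auto|]. field. }
  assert (bpsi : forall t, 0 <= t <= 1 -> A * t ^ 2 / 2 <= psi t <= B * t ^ 2 / 2).
  { intros t ht. split.
    - assert (h : psi 0 - A * 0 ^ 2 / 2 <= psi t - A * t ^ 2 / 2).
      { apply (derive_nonneg_le (fun t => psi t - A * t ^ 2 / 2) (fun t => t * trap2 V (k + t) - A * t)); [lra| |].
        - intros x hx. apply (is_derive_minus psi (fun t => A * t ^ 2 / 2)); [apply hpsi|apply dsq].
        - intros x hx. pose proof (hAB x ltac:(lra)). nra. }
      lra.
    - assert (h : B * 0 ^ 2 / 2 - psi 0 <= B * t ^ 2 / 2 - psi t).
      { apply (derive_nonneg_le (fun t => B * t ^ 2 / 2 - psi t) (fun t => B * t - t * trap2 V (k + t))); [lra| |].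
        - intros x hx. apply (is_derive_minus (fun t => B * t ^ 2 / 2) psi); [apply dsq|apply hpsi].
        - intros x hx. pose proof (hAB x ltac:(lra)). nra. }
      lra. }
  split.
  - assert (h : phi 0 - A * 0 ^ 3 / 6 <= phi 1 - A * 1 ^ 3 / 6).
    { apply (derive_nonneg_le (fun t => phi t - A * t ^ 3 / 6) (fun t => psi t - A * t ^ 2 / 2)); [lra| |].
      - intros x hx. apply (is_derive_minus phi (fun t => A * t ^ 3 / 6)); [apply hphi|apply dcb].
      - intros x hx. pose proof (bpsi x hx). lra. }
    lra.
  - assert (h : B * 0 ^ 3 / 6 - phi 0 <= B * 1 ^ 3 / 6 - phi 1).
    { apply (derive_nonneg_le (fun t => B * t ^ 3 / 6 - phi t) (fun t => B * t ^ 2 / 2 - psi t)); [lra| |].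
      - intros x hx. apply (is_derive_minus (fun t => B * t ^ 3 / 6) phi); [apply dcb|apply hphi].
      - intros x hx. pose proof (bpsi x hx). lra. }
    lra.
Qed.

Lemma trap1_step k : 0 <= k -> trap2 V (k + 1) <= trap1 V (k + 1) - trap1 V k <= trap2 V k.
Proof.
  intros hk. destruct (mean_value (trap1 V) (trap2 V) k (k + 1)) as (c & hc & he); [lra| |].
  - intros x _. apply trap1_derive.
  - rewrite he. replace (k + 1 - k) with 1 by ring. rewrite Rmult_1_r.
    split; apply trap2_anti; lra.
Qed.

(** The second derivatives that bound the errors are compared with increments of the first
    derivative, which telescope; the constant 2 is minus the slope [trap1 V 0]. Monotonicity of
    [trap2] limits the loss to its values at the two ends. *)
Lemma trap_zsum N :
  (trap1 V (INR N) + 2 - trap2 V 0) / 6 + trap2 V (INR N) / 6 <=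
  zsum N (fun n => trap V (Rabs (IZR n))) - 2 * trap_int_raw (INR N) - trap_raw (INR N) <=
  (trap1 V (INR N) + 2 + trap2 V 0) / 6 - trap2 V (INR N) / 6.
Proof.
  induction N as [|N IH].
  - cbn [zsum]. rewrite Rabs_R0, trap_alt by lra. fold (trap_raw 0). simpl INR.
    assert (e1 : trap1 V 0 = - 2) by (unfold trap1, Rdiv; ring).
    assert (e2 : trap_int_raw 0 = 0) by (unfold trap_int_raw; ring).
    rewrite e1, e2. lra.
  - cbn [zsum]. rewrite opp_IZR, <- INR_IZR_INZ, Rabs_Ropp, !(Rabs_pos_eq (INR (S N))) by apply pos_INR.
    rewrite !(trap_alt (INR (S N))) by apply pos_INR. fold (trap_raw (INR (S N))).
    rewrite S_INR. pose proof (pos_INR N) as hN.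
    pose proof (trapezoid_error (INR N) hN). pose proof (trap1_step (INR N) hN). lra.
Qed.

Lemma trap_dominated n : Rabs (trap V (Rabs (IZR n))) <= V ^ 2 / sqrt V * / (IZR n ^ 2 + V).
Proof.
  pose proof (Rabs_pos (IZR n)) as hx. unfold trap.
  assert (hsq : sqrt V <= sqrt (V + Rabs (IZR n) ^ 2)).
  { apply sqrt_le_1_alt. pose proof (pow2_ge_0 (Rabs (IZR n))). lra. }
  destruct (trap_sqrt _ hx) as (s & e & h1 & h2 & h3). rewrite e in *.
  rewrite pow2_abs in h2. pose proof (sqrt_lt_R0 V hV).
  pose proof (pow2_ge_0 V) as hV2.
  rewrite Rabs_pos_eq.
  - unfold Rdiv. rewrite Rmult_assoc. apply Rmult_le_compat_l; [assumption|].
    rewrite <- Rinv_mult. apply Rinv_le_contravar.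
    + apply Rmult_lt_0_compat; [assumption|]. pose proof (pow2_ge_0 (IZR n)). lra.
    + rewrite (Rplus_comm (IZR n ^ 2)), <- h2. apply Rmult_le_compat; try lra; [apply pow2_ge_0|].
      apply pow_incr. lra.
  - apply Rdiv_le_0_compat; [assumption|]. apply Rmult_lt_0_compat; [assumption|]. apply pow_lt. lra.
Qed.

(** The constant 1/3 is -f'(0)/6 in the trapezoidal rule for the summand f. *)
Lemma trap_ZS : Rabs (ZS (fun n => trap V (Rabs (IZR n))) - V - 1 / 3) <= / (2 * sqrt V).
Proof.
  destruct (ZS_dominated _ _ _ (rsum1_summable V hV) trap_dominated) as [hl _].
  pose proof (sqrt_lt_R0 V hV) as hsV.
  assert (e2 : trap2 V 0 / 6 = / (2 * sqrt V)).
  { unfold trap2. replace (V + 0 ^ 2) with V by ring. set (s := sqrt V) in *.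
    replace V with (s ^ 2) by (apply pow2_sqrt; lra). field. lra. }
  assert (hinv := is_lim_seq_inv_shift V hV).
  assert (hbound : forall N, 
    - (V ^ 2 * / (V + INR N)) - 2 * V * / (V + INR N) <=
      zsum N (fun n => trap V (Rabs (IZR n))) - V - 1 / 3 + / (2 * sqrt V) /\
    zsum N (fun n => trap V (Rabs (IZR n))) - V - 1 / 3 - / (2 * sqrt V) <= V ^ 2 / sqrt V * / (V + INR N)).
  { intros N. pose proof (pos_INR N) as hN. pose proof (trap_zsum N) as [b1 b2].
    pose proof (trap2_nonneg (INR N) hN) as b3.
    pose proof (trap_dominated (Z.of_nat N)) as b4.
    rewrite <- INR_IZR_INZ, (Rabs_pos_eq (INR N)) in b4 by assumption.
    assert (hNN : INR N <= INR N ^ 2).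
    { destruct N as [|N']; [simpl; lra|]. rewrite S_INR in *. pose proof (pos_INR N'). nra. }
    assert (b5 : trap V (INR N) <= V ^ 2 / sqrt V * / (V + INR N)).
    { eapply Rle_trans; [apply Rle_abs|]. eapply Rle_trans; [exact b4|].
      apply Rmult_le_compat_l; [apply Rdiv_le_0_compat; [apply pow2_ge_0|assumption]|].
      apply Rinv_le_contravar; lra. }
    assert (b6 : 0 <= trap V (INR N)).
    { unfold trap. destruct (trap_sqrt _ hN) as (s & -> & h1 & _). apply Rdiv_le_0_compat; [apply pow2_ge_0|].
      apply Rmult_lt_0_compat; [assumption|]. apply pow_lt. lra. }
    rewrite trap_alt in b5, b6 by assumption. fold (trap_raw (INR N)) in b5, b6.
    rewrite <- trap_int_alt in b1, b2 by assumption.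
    (* The integral over both half-lines is [V], with an exactly computable defect at the cutoff. *)
    assert (b7 : - (V ^ 2 * / (V + INR N)) <= 2 * trap_int V (INR N) - V <= 0).
    { unfold trap_int. destruct (trap_sqrt _ hN) as (s & -> & h1 & h2 & h3).
      replace (2 * (INR N * V / (s + INR N)) - V) with (- (V * (s - INR N) / (s + INR N))) by (field; lra).
      assert (h4 : V * (s - INR N) / (s + INR N) = V ^ 2 * / (s + INR N) ^ 2).
      { replace V with (s ^ 2 - INR N ^ 2) by lra. field. lra. }
      rewrite h4. assert (h5 : / (s + INR N) ^ 2 <= / (V + INR N)) by (apply Rinv_le_contravar; nra).
      assert (h6 : 0 < / (s + INR N) ^ 2) by (apply Rinv_0_lt_compat, pow_lt; lra).
      nra. }
    assert (b8 : - (2 * V * / (V + INR N)) <= trap1 V (INR N) <= 0).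
    { unfold trap1. destruct (trap_sqrt _ hN) as (s & -> & h1 & h2 & h3).
      assert (h4 : 2 * (INR N / s) - 2 = - (2 * V * / (s * (s + INR N)))).
      { replace V with (s ^ 2 - INR N ^ 2) by lra. field. lra. }
      split.
      - rewrite h4. assert (h5 : / (s * (s + INR N)) <= / (V + INR N)) by (apply Rinv_le_contravar; nra).
        assert (0 <= V * INR N / s ^ 3) by (apply Rdiv_le_0_compat; [nra|now apply pow_lt]). nra.
      - replace (2 * (INR N / s) - 2 + V * INR N / s ^ 3) with
          ((2 * INR N * s ^ 2 + V * INR N - 2 * s ^ 3) / s ^ 3) by (field; lra).
        apply Rmult_le_reg_r with (s ^ 3); [now apply pow_lt|]. rewrite Rmult_0_l.
        replace ((2 * INR N * s ^ 2 + V * INR N - 2 * s ^ 3) / s ^ 3 * s ^ 3) with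
          (- ((s - INR N) * (2 * s ^ 2) - V * INR N)) by (field; lra).
        assert (h7 : V * INR N <= (s - INR N) * (2 * s ^ 2)).
        { replace V with ((s - INR N) * (s + INR N)) by lra. rewrite Rmult_assoc.
          apply Rmult_le_compat_l; [lra|nra]. }
        lra. }
    rewrite <- e2. split; lra. }
  apply Rabs_le. split.
  - assert (h : - / (2 * sqrt V) <= ZS (fun n => trap V (Rabs (IZR n))) - V - 1 / 3); [|lra].
    assert (hlo : is_lim_seq (fun N => - (V ^ 2 * / (V + INR N)) - 2 * V * / (V + INR N)) (- (V ^ 2 * 0) - 2 * V * 0)).
    { apply is_lim_seq_minus'.
      - apply (is_lim_seq_opp _ (Finite (V ^ 2 * 0))). now apply (is_lim_seq_scal_l _ (V ^ 2) (Finite 0)).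
      - now apply (is_lim_seq_scal_l _ (2 * V) (Finite 0)). }
    assert (hup : is_lim_seq (fun N => zsum N (fun n => trap V (Rabs (IZR n))) - V - 1 / 3 + / (2 * sqrt V))
      (ZS (fun n => trap V (Rabs (IZR n))) - V - 1 / 3 + / (2 * sqrt V))).
    { repeat first [apply is_lim_seq_plus' | apply is_lim_seq_minus' | apply is_lim_seq_const]. exact hl. }
    assert (h := is_lim_seq_le _ _ _ _ (fun N => proj1 (hbound N)) hlo hup). simpl in h. lra.
  - assert (hlo : is_lim_seq (fun N => V ^ 2 / sqrt V * / (V + INR N)) (V ^ 2 / sqrt V * 0)).
    { now apply (is_lim_seq_scal_l _ (V ^ 2 / sqrt V) (Finite 0)). }
    assert (hup : is_lim_seq (fun N => zsum N (fun n => trap V (Rabs (IZR n))) - V - 1 / 3 - / (2 * sqrt V))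
      (ZS (fun n => trap V (Rabs (IZR n))) - V - 1 / 3 - / (2 * sqrt V))).
    { repeat first [apply is_lim_seq_plus' | apply is_lim_seq_minus' | apply is_lim_seq_const]. exact hl. }
    assert (h := is_lim_seq_le _ _ _ _ (fun N => proj2 (hbound N)) hup hlo). simpl in h. lra.
Qed.
End Trapezoid.

(** * Integration of the rows *)

Lemma rsum2_bounds y : 0 < y -> 0 <= rsum 2 y <= / y * (PI / sqrt y + 2 / y).
Proof.
  intros hy. pose proof (rsum1_summable y hy) as hw.
  assert (hd : forall m, Rabs (/ (IZR m ^ 2 + y) ^ 2) <= / y * / (IZR m ^ 2 + y)).
  { intros m. pose proof (rsum_dominated y 1 m hy) as h. now rewrite pow_1 in h. }
  split.
  - apply ZS_nonneg. apply summable_le with (1 := hw) (K := / y). intros m.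
    pose proof (pow2_ge_0 (IZR m)). split; [left; apply Rinv_0_lt_compat, pow_lt; lra|].
    eapply Rle_trans; [apply Rle_abs|apply hd].
  - eapply Rle_trans; [apply Rle_abs|]. eapply Rle_trans; [apply (ZS_abs_le _ _ _ hw hd)|].
    rewrite <- rsum1_eq. apply Rmult_le_compat_l; [left; now apply Rinv_0_lt_compat|].
    now apply rsum1_upper.
Qed.

Lemma rsum2_continuous y : 0 < y -> continuous (rsum 2) y.
Proof.
  intros hy.
  apply continuous_ext_loc with (fun x => PI * (cosh (PI * sqrt x) / sinh (PI * sqrt x)) / (2 * x * sqrt x) +
    PI ^ 2 / (2 * x * sinh (PI * sqrt x) ^ 2)).
  - exists (mkposreal y hy). intros x hx. change (Rabs (x - y) < y) in hx. apply Rabs_def2 in hx.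
    symmetry. apply rsum2_coth. lra.
  - apply continuous_ex_derive. pose proof (sqrt_lt_R0 y hy) as hs. pose proof PI_RGT_0.
    assert (0 < sinh (PI * sqrt y)) by (apply sinh_pos; nra).
    assert (0 < 2 * y * sqrt y) by (apply Rmult_lt_0_compat; lra).
    assert (0 < 2 * y * (sinh (PI * sqrt y) * (sinh (PI * sqrt y) * 1))) by (apply Rmult_lt_0_compat; nra).
    auto_derive. repeat split; lra.
Qed.

(** A primitive of [U rsum 2 (U + b2)] in [U], by parts: [rsum 1] is a primitive of [- rsum 2], and
    [2 ln sinh (pi sqrt x)] is a primitive of [rsum 1]. In the row [n] one has [b2 = a^2 n^2]. *)
Definition rowlog (b2 U : R) : R := 2 * ln (sinh (PI * sqrt (U + b2))) - U * rsum 1 (U + b2).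

Lemma rowlog_derive b2 U : 0 < U + b2 -> is_derive (rowlog b2) U (U * rsum 2 (U + b2)).
Proof.
  intros h. pose proof (sqrt_lt_R0 _ h) as hs. pose proof PI_RGT_0 as hpi.
  assert (hsh : 0 < sinh (PI * sqrt (U + b2))) by (apply sinh_pos; nra).
  assert (h1 : is_derive (fun x => 2 * ln (sinh (PI * sqrt (x + b2)))) U (rsum 1 (U + b2))).
  { rewrite rsum1_coth by assumption. unfold coth. auto_derive; [repeat split; lra|]. field. lra. }
  assert (h2 : is_derive (fun x => rsum 1 (x + b2)) U (- rsum 2 (U + b2))).
  { evar_last.
    - apply (is_derive_comp (rsum 1) (fun x => x + b2)); [now apply rsum1_derive|].
      instantiate (1 := 1). auto_derive; [auto|ring].
    - unfold scal; simpl; unfold mult; simpl. ring. }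
  unfold rowlog. evar_last.
  - apply (is_derive_minus (fun x => 2 * ln (sinh (PI * sqrt (x + b2)))) (fun x => x * rsum 1 (x + b2))).
    + exact h1.
    + apply (is_derive_Rmul (fun x => x)); [apply (is_derive_id (K := R_AbsRing))|exact h2].
  - unfold minus, plus, opp, one; simpl. ring.
Qed.

Lemma RInt_ZS (f : Z -> R -> R) w K al be : summable w -> al <= be ->
  (forall m x, continuous (f m) x) -> (forall x, continuous (fun y => ZS (fun m => f m y)) x) ->
  (forall m x, al <= x <= be -> Rabs (f m x) <= K * w m) ->
  RInt (fun x => ZS (fun m => f m x)) al be = ZS (fun m => RInt (f m) al be) :> R.
Proof.
  intros hw hab hf hF hK.
  symmetry. apply ZS_unique.
  set (F := fun x => ZS (fun m => f m x)) in *.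
  apply is_lim_seq_ext with (fun N => RInt F al be - (RInt F al be - zsum N (fun m => RInt (f m) al be)));
    [intros; real_eq; ring|].
  replace (Finite (RInt F al be)) with (Finite (RInt F al be - 0)) by (f_equal; real_eq; ring).
  apply is_lim_seq_minus'; [apply is_lim_seq_const|].
  apply is_lim_seq_abs_0.
  apply is_lim_seq_le_le with (fun _ => 0) (fun N => (be - al) * K * (ZS w - zsum N w)).
  - intros N. split; [apply Rabs_pos|]. rewrite zsum_RInt by assumption.
    assert (hc : forall x, continuous (fun y => - 1 * zsum N (fun m => f m y)) x).
    { intros x. apply continuous_Rmult; [apply continuous_const|].
      apply (zsum_continuous N f). intros m. apply hf. }
    assert (e : RInt F al be - RInt (fun x => zsum N (fun m => f m x)) al be =
      RInt (fun x => F x + - 1 * zsum N (fun m => f m x)) al be :> R).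
    { rewrite RInt_Rplus, RInt_Rscal; auto.
      - real_eq. ring.
      - intros x. apply (zsum_continuous N f). intros m. apply hf. }
    rewrite e, Rmult_assoc. apply abs_RInt_le_const; [assumption| |].
    + apply ex_RInt_cont. intros x. apply continuous_Rplus; [apply hF|apply hc].
    + intros t ht. destruct (ZS_dominated (fun m => f m t) w K hw (fun m => hK m t ht)) as [_ h].
      specialize (h N). fold (F t) in h.
      replace (F t + - 1 * zsum N (fun m => f m t)) with (F t - zsum N (fun m => f m t)) by ring.
      exact h.
  - apply is_lim_seq_const.
  - replace (Finite 0) with (Rbar_mult ((be - al) * K) 0) by (simpl; f_equal; ring).
    apply is_lim_seq_scal_l. now apply ZS_tail_lim.
Qed.

Lemma rsum2_row_bound a d U n : 0 < a -> 0 < d <= U ->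
  0 <= rsum 2 (U + a ^ 2 * IZR n ^ 2) <=
  (PI / sqrt d + 2 / d) * / a ^ 2 * / (IZR n ^ 2 + d / a ^ 2).
Proof.
  intros ha [hd hU]. pose proof (pow2_ge_0 (IZR n)) as hn. assert (ha2 : 0 < a ^ 2) by now apply pow_lt.
  assert (hy : d + a ^ 2 * IZR n ^ 2 <= U + a ^ 2 * IZR n ^ 2) by lra.
  assert (hy0 : d <= U + a ^ 2 * IZR n ^ 2) by nra.
  set (y := U + a ^ 2 * IZR n ^ 2) in *.
  destruct (rsum2_bounds y) as [h1 h2]; [lra|]. split; [exact h1|].
  eapply Rle_trans; [exact h2|].
  rewrite Rmult_comm, Rmult_assoc.
  assert (hy1 : 0 < / y) by (apply Rinv_0_lt_compat; lra).
  pose proof (sqrt_lt_R0 d hd) as hsd. pose proof PI_RGT_0 as hpi.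
  assert (hsy : sqrt d <= sqrt y) by now apply sqrt_le_1_alt.
  apply Rmult_le_compat.
  - apply Rplus_le_le_0_compat; apply Rdiv_le_0_compat; lra.
  - lra.
  - unfold Rdiv. apply Rplus_le_compat; (apply Rmult_le_compat_l; [lra|]); apply Rinv_le_contravar; lra.
  - rewrite <- Rinv_mult. apply Rinv_le_contravar.
    + apply Rmult_lt_0_compat; [assumption|]. assert (0 < d / a ^ 2) by now apply Rdiv_lt_0_compat. lra.
    + replace (a ^ 2 * (IZR n ^ 2 + d / a ^ 2)) with (d + a ^ 2 * IZR n ^ 2) by (field; lra). exact hy.
Qed.

(** The integral is cut at [u = e^X] and at [u = e^(-X)], and in the row variable [U = a u] each row
    integrates exactly. The terms after the sum come from the contributions of [1 / u^2] and
    [pi / u]. *)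
Lemma rowlog_sum a X : 0 < a -> 0 <= X ->
  RInt (inner_density a) 0 X + RInt (outer_density a) 0 X =
  ZS (fun n => rowlog (a ^ 2 * IZR n ^ 2) (a * exp X) - rowlog (a ^ 2 * IZR n ^ 2) (a * exp (- X)))
    - X - PI * exp X + PI.
Proof.
  intros ha hX. 
  set (K := fun x => exp (2 * x) * green a (exp x)).
  assert (hK : forall x, continuous K x).
  { intros x. apply continuous_Rmult; [|now apply green_exp_continuous].
    apply continuous_ex_derive. auto_derive. auto. }
  assert (e1 : RInt (inner_density a) 0 X = RInt K (- X) 0 :> R).
  { rewrite <- (RInt_reflect K) by assumption. apply (RInt_ext (V := R_CompleteNormedModule)).
    intros x _. unfold inner_density, K. replace (2 * - x) with (- (2) * x) by ring. reflexivity. }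
  assert (hcx : forall x, continuous (fun x => 1 + - PI * exp x) x).
  { intros x. apply continuous_ex_derive. auto_derive. auto. }
  assert (e2 : RInt (outer_density a) 0 X = RInt K 0 X + (X - PI * (exp X - 1)) :> R).
  { rewrite (RInt_ext (V := R_CompleteNormedModule) (outer_density a) (fun x => K x + (1 + - PI * exp x))).
    - rewrite RInt_Rplus by assumption. apply f_equal.
      rewrite (RInt_FTC (fun x => x - PI * exp x)); [|intros x; auto_derive; [auto|ring]|assumption].
      rewrite exp_0. ring.
    - intros x _. unfold outer_density, green_reg, K. replace (2 * x) with (x + x) by ring.
      rewrite exp_plus. pose proof (exp_pos x). real_eq. field. lra. }
  set (k := fun n x => a ^ 2 * exp (2 * x) * rsum 2 (a * exp x + a ^ 2 * IZR n ^ 2)).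
  assert (hpos : forall n x, 0 < a * exp x + a ^ 2 * IZR n ^ 2).
  { intros n x. pose proof (exp_pos x). nra. }
  assert (hkc : forall n x, continuous (k n) x).
  { intros n x. apply continuous_Rmult.
    - apply continuous_ex_derive. auto_derive. auto.
    - apply (continuous_comp (fun x => a * exp x + a ^ 2 * IZR n ^ 2) (rsum 2)).
      + apply continuous_ex_derive. auto_derive. auto.
      + apply rsum2_continuous, hpos. }
  assert (hrow : forall n x, is_derive (fun x => rowlog (a ^ 2 * IZR n ^ 2) (a * exp x)) x (k n x)).
  { intros n x. evar_last.
    - apply (is_derive_comp (rowlog (a ^ 2 * IZR n ^ 2)) (fun x => a * exp x));
        [apply rowlog_derive, hpos|].
      instantiate (1 := a * exp x). auto_derive; [auto|ring].
    - unfold scal; simpl; unfold mult; simpl. unfold k. replace (2 * x) with (x + x) by ring.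
      rewrite exp_plus. simpl. ring. }
  (* Complete rows contain the origin, whose term is [u^2 / u^2 = 1]. It adds [2 X] over the whole
     range, of which the regularised outer density already accounts for [X]. *)
  assert (hKk : forall x, K x + 1 = ZS (fun n => k n x)).
  { intros x. pose proof (exp_pos x) as hx.
    assert (e : K x + 1 = exp (2 * x) * (green a (exp x) + / exp x ^ 2)).
    { unfold K. replace (2 * x) with (x + x) by ring. rewrite exp_plus. field. lra. }
    rewrite e, green_rows by assumption.
    assert (hd0 : 0 < a * exp x) by nra.
    rewrite <- (ZS_scal _ (fun m => / (IZR m ^ 2 + a * exp x / a ^ 2))
      (a ^ 2 * ((PI / sqrt (a * exp x) + 2 / (a * exp x)) * / a ^ 2))).
    - apply ZS_ext. intros n. unfold k. ring.
    - apply rsum1_summable. apply Rdiv_lt_0_compat; [assumption|now apply pow_lt].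
    - intros n. destruct (rsum2_row_bound a (a * exp x) (a * exp x) n ha ltac:(lra)) as [b1 b2].
      rewrite Rabs_mult, (Rabs_pos_eq (a ^ 2)), Rabs_pos_eq by (assumption || apply pow2_ge_0).
      rewrite (Rmult_assoc (a ^ 2)). apply Rmult_le_compat_l; [apply pow2_ge_0|]. lra. }
  set (d := a * exp (- X)).
  assert (hd : 0 < d) by (apply Rmult_lt_0_compat; [assumption|apply exp_pos]).
  assert (hda : 0 < d / a ^ 2) by (apply Rdiv_lt_0_compat; [assumption|now apply pow_lt]).
  assert (e3 : RInt (fun x => ZS (fun n => k n x)) (- X) X = ZS (fun n => RInt (k n) (- X) X) :> R).
  { apply (RInt_ZS k (fun m => / (IZR m ^ 2 + d / a ^ 2))
      (a ^ 2 * exp (2 * X) * ((PI / sqrt d + 2 / d) * / a ^ 2))); [now apply rsum1_summable|lra|assumption| |].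
    - intros x. apply continuous_ext with (fun y => K y + 1); [exact hKk|].
      apply continuous_Rplus; [apply hK|apply continuous_const].
    - intros n x hx. unfold k.
      destruct (rsum2_row_bound a d (a * exp x) n ha) as [b1 b2].
      { split; [assumption|]. unfold d. apply Rmult_le_compat_l; [lra|]. apply exp_le_compat. lra. }
      pose proof (exp_pos (2 * x)) as hx2. pose proof (pow2_ge_0 a) as ha2.
      rewrite Rabs_pos_eq by (apply Rmult_le_pos; [apply Rmult_le_pos; lra|assumption]).
      rewrite (Rmult_assoc (a ^ 2 * exp (2 * X))).
      apply Rmult_le_compat; [apply Rmult_le_pos; lra|assumption| |lra].
      apply Rmult_le_compat_l; [assumption|]. apply exp_le_compat. lra. }
  assert (e4 : RInt (fun x => ZS (fun n => k n x)) (- X) X = RInt K (- X) X + 2 * X :> R).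
  { rewrite (RInt_ext (V := R_CompleteNormedModule) _ (fun x => K x + 1)) by (intros x _; symmetry; apply hKk).
    rewrite (RInt_Rplus K (fun _ => 1)) by (auto; intros; apply continuous_const).
    apply f_equal. rewrite RInt_const. unfold scal; simpl; unfold mult; simpl. ring. }
  assert (e5 : ZS (fun n => RInt (k n) (- X) X) =
    ZS (fun n => rowlog (a ^ 2 * IZR n ^ 2) (a * exp X) - rowlog (a ^ 2 * IZR n ^ 2) (a * exp (- X)))).
  { apply ZS_ext. intros n.
    apply (RInt_FTC (fun x => rowlog (a ^ 2 * IZR n ^ 2) (a * exp x))); auto. }
  fold d in e5. rewrite <- e5, <- e3, e4, e1, e2, (RInt_split K (- X) 0 X) by assumption. ring.
Qed.

(** What is lost in a row when [ln (sinh y)] is replaced by [y - ln 2] and the hyperbolic cotangent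
    by 1. *)
Definition row_error (U v : R) : R :=
  2 * ln (1 - exp (- (2 * (PI * v)))) - PI * U * ((coth (PI * v) - 1) / v).

Lemma ln_sinh y : 0 < y -> ln (sinh y) = y - ln 2 + ln (1 - exp (- (2 * y))).
Proof.
  intros hy. assert (he : exp (- (2 * y)) < 1) by (rewrite <- exp_0; apply exp_increasing; lra).
  pose proof (exp_pos y) as hp.
  assert (e : sinh y = exp y * / 2 * (1 - exp (- (2 * y)))).
  { unfold sinh. replace (- (2 * y)) with (- y + - y) by ring. rewrite exp_plus, exp_Ropp. field. lra. }
  rewrite e, !ln_mult, ln_exp, ln_Rinv by lra. ring.
Qed.

(** From [- ln (1 - e^(-z)) <= 1 / (e^z - 1)] and [e^z - 1 >= z^4 / 4!]. The fourth power suffices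
    for sums over rows that tend to 0 at the upper end. *)
Lemma ln_1_minus_exp_bound z : 0 < z -> - (24 / z ^ 4) <= ln (1 - exp (- z)) <= 0.
Proof.
  intros hz. assert (he : exp (- z) < 1) by (rewrite <- exp_0; apply exp_increasing; lra).
  pose proof (exp_pos (- z)) as hp.
  split.
  - assert (h : - ln (1 - exp (- z)) <= / (exp z - 1)).
    { rewrite <- ln_Rinv by lra.
      pose proof (exp_ineq1_le (ln (/ (1 - exp (- z))))) as h1.
      rewrite exp_ln in h1 by (apply Rinv_0_lt_compat; lra).
      assert (h2 : / (1 - exp (- z)) - 1 = / (exp z - 1)).
      { rewrite exp_Ropp in *. assert (1 < exp z) by (rewrite <- exp_0; now apply exp_increasing).
        field. split; lra. }
      lra. }
    assert (hz4 : 0 < z ^ 4) by now apply pow_lt.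
    pose proof (exp_ge_one_term z 3 ltac:(lra)) as h3.
    assert (h4 : INR (fact 4) = 24) by (simpl; ring). rewrite h4 in h3.
    assert (h5 : / (exp z - 1) <= / (z ^ 4 / 24)) by (apply Rinv_le_contravar; [apply Rdiv_lt_0_compat|]; lra).
    replace (24 / z ^ 4) with (/ (z ^ 4 / 24)) by (field; lra). lra.
  - rewrite <- ln_1. left. apply ln_increasing; lra.
Qed.

(** Here 48 is twice 4!, from the logarithm, and 240 is twice 5!, from bounding the hyperbolic sine
    below by its term of order 5. *)
Definition row_error_const : R := 48 / (2 * PI) ^ 4 + 240 * PI / PI ^ 5.

Lemma row_error_bound U v : 0 < v -> 0 <= U <= v ^ 2 ->
  Rabs (row_error U v) <= row_error_const * / (v ^ 2) ^ 2.
Proof.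
  intros hv hU. pose proof PI_RGT_0 as hpi. assert (hy : 0 < PI * v) by nra.
  pose proof (ln_1_minus_exp_bound (2 * (PI * v)) ltac:(lra)) as [h1 h2].
  destruct (coth_minus_1 _ hy) as [h3 h4].
  pose proof (sinh_ge_term (PI * v) 4 ltac:(lra)) as h5.
  assert (h6 : INR (fact 5) = 120) by (simpl; ring). rewrite h6 in h5.
  assert (hy5 : 0 < (PI * v) ^ 5) by now apply pow_lt.
  assert (h7 : / sinh (PI * v) <= / ((PI * v) ^ 5 / (2 * 120))).
  { apply Rinv_le_contravar; [apply Rdiv_lt_0_compat; lra|exact h5]. }
  assert (h8 : 0 <= PI * U * ((coth (PI * v) - 1) / v) <= 240 * PI / PI ^ 5 * / (v ^ 2) ^ 2).
  { assert (hq : 0 <= (coth (PI * v) - 1) / v) by (apply Rdiv_le_0_compat; lra).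
    split; [apply Rmult_le_pos; [nra|assumption]|].
    apply Rle_trans with (PI * v ^ 2 * (/ ((PI * v) ^ 5 / (2 * 120)) / v)).
    - apply Rmult_le_compat; [nra|assumption|nra|].
      unfold Rdiv at 1 2. apply Rmult_le_compat_r; [left; now apply Rinv_0_lt_compat|lra].
    - right. field. lra. }
  assert (h9 : 24 / (2 * (PI * v)) ^ 4 = 24 / (2 * PI) ^ 4 * / (v ^ 2) ^ 2) by (field; lra).
  rewrite h9 in h1. unfold row_error_const. rewrite Rmult_plus_distr_r.
  replace (48 / (2 * PI) ^ 4) with (2 * (24 / (2 * PI) ^ 4)) by (field; lra).
  unfold row_error. apply Rabs_le. split; lra.
Qed.

(** The part [2 pi a |n| - 2 ln 2] does not depend on [U] and cancels against the lower end of the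
    same row. Only after this cancellation can the rows be summed separately at the two ends. *)
Lemma rowlog_decompose a U n : 0 < a -> 0 < U ->
  rowlog (a ^ 2 * IZR n ^ 2) U =
  PI * a * trap (U / a ^ 2) (Rabs (IZR n)) + 2 * PI * (a * Rabs (IZR n)) - 2 * ln 2 +
  row_error U (sqrt (U + a ^ 2 * IZR n ^ 2)).
Proof.
  intros ha hU. pose proof PI_RGT_0 as hpi. 
  assert (ha2 : 0 < a ^ 2) by now apply pow_lt.
  assert (hy : 0 < U + a ^ 2 * IZR n ^ 2) by nra.
  assert (hV : 0 < U / a ^ 2) by now apply Rdiv_lt_0_compat.
  unfold rowlog. rewrite rsum1_coth by assumption.
  pose proof (sqrt_lt_R0 _ hy) as hs.
  rewrite (trap_alt _ hV) by apply Rabs_pos. rewrite pow2_abs.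
  assert (hsq : sqrt (U + a ^ 2 * IZR n ^ 2) = a * sqrt (U / a ^ 2 + IZR n ^ 2)).
  { replace (U + a ^ 2 * IZR n ^ 2) with (a ^ 2 * (U / a ^ 2 + IZR n ^ 2)) by (field; lra).
    rewrite sqrt_mult_alt by lra. now rewrite sqrt_pow2 by lra. }
  set (v := sqrt (U + a ^ 2 * IZR n ^ 2)) in *.
  set (t := sqrt (U / a ^ 2 + IZR n ^ 2)) in *.
  rewrite ln_sinh by nra. unfold row_error. rewrite hsq.
  assert (ht : 0 < t) by nra. field. lra.
Qed.

(** The limit of the row [n] at the lower end after that cancellation; the row 0 diverges there and
    is kept apart. With [q = e^(-2 pi a)], the sum over all [n] is four times the logarithm of the
    product of the factors [1 - q^k]. *)
Definition qlog (a : R) (n : Z) : R :=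
  if Z.eq_dec n 0 then 0 else 2 * ln (1 - exp (- (2 * (PI * (a * Rabs (IZR n)))))).

Lemma Rabs_IZR_ge_1 n : n <> 0%Z -> 1 <= Rabs (IZR n).
Proof. intros hn. rewrite <- abs_IZR. apply IZR_le. lia. Qed.

Lemma inv_sqr_pw2 n : n <> 0%Z -> / IZR n ^ 2 <= 2 * pw 2 n.
Proof.
  intros hn. rewrite pw2_eq. pose proof (IZR_sqr_ge_1 n hn) as h.
  replace (2 * / (1 + IZR n ^ 2)) with (/ ((1 + IZR n ^ 2) / 2)) by (field; lra).
  apply Rinv_le_contravar; lra.
Qed.

Lemma qlog_dominated a n : 0 < a -> Rabs (qlog a n) <= 96 / (2 * PI * a) ^ 4 * pw 2 n.
Proof.
  intros ha. pose proof PI_RGT_0 as hpi.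
  assert (hc : 0 < (2 * PI * a) ^ 4) by (apply pow_lt; nra).
  unfold qlog. destruct (Z.eq_dec n 0) as [->|hn].
  - rewrite Rabs_R0. apply Rmult_le_pos; [apply Rdiv_le_0_compat; lra|left; apply Rpower_pos].
  - pose proof (Rabs_IZR_ge_1 n hn) as h1.
    assert (ha1 : 0 < a * Rabs (IZR n)) by nra.
    assert (hz : 0 < 2 * (PI * (a * Rabs (IZR n)))) by nra.
    destruct (ln_1_minus_exp_bound _ hz) as [h2 h3].
    pose proof (inv_sqr_pw2 n hn) as h4. pose proof (IZR_sqr_ge_1 n hn) as h5.
    assert (h6 : 24 / (2 * (PI * (a * Rabs (IZR n)))) ^ 4 <= 24 / (2 * PI * a) ^ 4 * / IZR n ^ 2).
    { replace (2 * (PI * (a * Rabs (IZR n)))) with (2 * PI * a * Rabs (IZR n)) by ring.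
      rewrite Rpow_mult_distr. replace (Rabs (IZR n) ^ 4) with (IZR n ^ 2 * IZR n ^ 2)
        by (rewrite <- !(pow2_abs (IZR n)); ring).
      set (x := IZR n ^ 2) in *. set (c := (2 * PI * a) ^ 4) in *.
      unfold Rdiv. rewrite Rmult_assoc. apply Rmult_le_compat_l; [lra|].
      rewrite <- Rinv_mult. apply Rinv_le_contravar; [nra|].
      apply Rmult_le_compat_l; nra. }
    assert (h9 : 0 < 24 / (2 * PI * a) ^ 4) by (apply Rdiv_lt_0_compat; lra).
    replace (96 / (2 * PI * a) ^ 4) with (4 * (24 / (2 * PI * a) ^ 4)) by (field; lra).
    apply Rabs_le. split; nra.
Qed.

(** The row at its lower end [d], without the part that it shares with the upper end. *)
Definition row_start (a d : R) (n : Z) : R :=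
  rowlog (a ^ 2 * IZR n ^ 2) d - 2 * PI * (a * Rabs (IZR n)) + 2 * ln 2.

(** At [U = 0] the row equals [qlog] exactly, and its derivative [U rsum 2] is of order [U / n^2];
    the mean value theorem on [0, d] gives a summable error of order [d^2]. *)
Lemma row_start_nonzero a d n : 0 < a -> 0 < d -> n <> 0%Z ->
  0 <= row_start a d n - qlog a n <= d ^ 2 * (2 * (/ a ^ 2 * (PI / a + 2 / a ^ 2))) * pw 2 n.
Proof.
  intros ha hd hn. pose proof PI_RGT_0 as hpi.
  pose proof (Rabs_IZR_ge_1 n hn) as hn1. pose proof (IZR_sqr_ge_1 n hn) as hn2.
  assert (ha2 : 0 < a ^ 2) by now apply pow_lt.
  set (b2 := a ^ 2 * IZR n ^ 2).
  assert (hb2 : a ^ 2 <= b2) by (unfold b2; nra).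
  assert (e : qlog a n = rowlog b2 0 - 2 * PI * (a * Rabs (IZR n)) + 2 * ln 2).
  { unfold qlog. destruct (Z.eq_dec n 0) as [|_]; [contradiction|].
    unfold rowlog. rewrite Rplus_0_l, Rmult_0_l.
    assert (hsq : sqrt b2 = a * Rabs (IZR n)).
    { unfold b2. rewrite sqrt_mult_alt, sqrt_pow2 by lra. f_equal. rewrite <- pow2_abs. now rewrite sqrt_pow2 by lra. }
    assert (ha1 : 0 < a * Rabs (IZR n)) by nra.
    rewrite hsq, ln_sinh by nra. ring. }
  unfold row_start. fold b2. rewrite e.
  destruct (mean_value (rowlog b2) (fun U => U * rsum 2 (U + b2)) 0 d hd) as (c & hc & he).
  { intros x hx. apply rowlog_derive. lra. }
  replace (rowlog b2 d - 2 * PI * (a * Rabs (IZR n)) + 2 * ln 2 -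
    (rowlog b2 0 - 2 * PI * (a * Rabs (IZR n)) + 2 * ln 2)) with (rowlog b2 d - rowlog b2 0) by ring.
  rewrite he, Rminus_0_r.
  destruct (rsum2_bounds (c + b2)) as [h1 h2]; [lra|].
  assert (hB : rsum 2 (c + b2) <= / a ^ 2 * / IZR n ^ 2 * (PI / a + 2 / a ^ 2)).
  { eapply Rle_trans; [exact h2|].
    assert (hsa : a <= sqrt (c + b2)).
    { rewrite <- (sqrt_pow2 a) by lra. apply sqrt_le_1_alt. lra. }
    apply Rmult_le_compat.
    - left. apply Rinv_0_lt_compat. lra.
    - apply Rplus_le_le_0_compat; apply Rdiv_le_0_compat; lra.
    - rewrite <- Rinv_mult. apply Rinv_le_contravar; [nra|]. unfold b2. lra.
    - unfold Rdiv. apply Rplus_le_compat; (apply Rmult_le_compat_l; [lra|]); apply Rinv_le_contravar; lra. }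
  split; [apply Rmult_le_pos; [apply Rmult_le_pos; lra|lra]|].
  set (M := / a ^ 2 * (PI / a + 2 / a ^ 2)) in *.
  assert (hM : 0 <= M).
  { apply Rmult_le_pos; [left; now apply Rinv_0_lt_compat|].
    apply Rplus_le_le_0_compat; apply Rdiv_le_0_compat; lra. }
  pose proof (inv_sqr_pw2 n hn) as h4.
  assert (hB2 : rsum 2 (c + b2) <= 2 * M * pw 2 n).
  { eapply Rle_trans; [exact hB|].
    replace (/ a ^ 2 * / IZR n ^ 2 * (PI / a + 2 / a ^ 2)) with (M * / IZR n ^ 2) by (unfold M; ring).
    replace (2 * M * pw 2 n) with (M * (2 * pw 2 n)) by ring. now apply Rmult_le_compat_l. }
  replace (d ^ 2 * (2 * M) * pw 2 n) with (d * (2 * M * pw 2 n) * d) by ring.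
  apply Rmult_le_compat_r; [lra|]. apply Rmult_le_compat; lra.
Qed.

Lemma cosh_ge_1 y : 1 <= cosh y.
Proof.
  unfold cosh. pose proof (exp_pos (- y)) as hq.
  assert (e : exp y * exp (- y) = 1) by (rewrite <- exp_plus, Rplus_opp_r; apply exp_0).
  pose proof (Rmult_le_pos _ _ (Rlt_le _ _ hq) (pow2_ge_0 (exp y - 1))) as h. nra.
Qed.

Lemma sinh_bounds y : 0 < y -> y <= sinh y <= y * cosh y.
Proof.
  intros hy. split.
  - assert (h : sinh 0 - 0 <= sinh y - y).
    { apply (derive_nonneg_le (fun x => sinh x - x) (fun x => cosh x - 1)); [lra| |].
      - intros x _. auto_derive; [auto|ring].
      - intros x hx. pose proof (cosh_ge_1 x). lra. }
    rewrite sinh_0 in h. lra.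
  - assert (h : 0 * cosh 0 - sinh 0 <= y * cosh y - sinh y).
    { apply (derive_nonneg_le (fun x => x * cosh x - sinh x) (fun x => x * sinh x)); [lra| |].
      - intros x _. auto_derive; [auto|ring].
      - intros x hx. destruct (Rle_lt_or_eq_dec 0 x ltac:(lra)) as [h|<-]; [|lra].
        pose proof (sinh_pos x h). nra. }
    rewrite sinh_0 in h. lra.
Qed.

(** For [n = 0] the argument [y = pi sqrt d] tends to 0, where [sinh y] behaves like [y]: the
    logarithm yields [2 ln y + 2 ln 2 = ln d + 2 ln (2 pi)], and [d rsum 1 d = y coth y] yields the
    -1. The term [ln d] later produces the factor [a] of the determinant. *)
Lemma row_start_zero a d : 0 < d ->
  let y := PI * sqrt d in
  - (cosh y - 1) <= row_start a d 0 - (ln d + 2 * ln (2 * PI) - 1) <= 2 * ln (cosh y).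
Proof.
  intros hd y. pose proof PI_RGT_0 as hpi. pose proof (sqrt_lt_R0 d hd) as hs.
  assert (hy : 0 < y) by (unfold y; nra).
  destruct (sinh_bounds y hy) as [h1 h2]. 
  assert (hlnd : ln d = 2 * ln (sqrt d)).
  { replace d with (sqrt d * sqrt d) at 1 by (apply sqrt_sqrt; lra). rewrite ln_mult by assumption. ring. }
  assert (hlny : ln y = ln PI + ln (sqrt d)) by (unfold y; now rewrite ln_mult by lra).
  assert (h4 : d * rsum 1 d = y * cosh y / sinh y).
  { rewrite rsum1_coth by assumption. fold y. unfold coth. replace d with (sqrt d * sqrt d) at 1 by (apply sqrt_sqrt; lra).
    unfold y at 3. field. lra. }
  assert (e : row_start a d 0 - (ln d + 2 * ln (2 * PI) - 1) = 2 * (ln (sinh y) - ln y) - (y * cosh y / sinh y - 1)).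
  { unfold row_start, rowlog. rewrite Rabs_R0. replace (a ^ 2 * 0 ^ 2) with 0 by ring. rewrite !Rplus_0_r.
    rewrite h4. fold y. rewrite hlnd, hlny, ln_mult by lra. ring. }
  rewrite e.
  assert (h5 : ln y <= ln (sinh y)) by (destruct h1 as [h|<-]; [left; now apply ln_increasing|lra]).
  pose proof (cosh_ge_1 y) as hch.
  assert (h6 : ln (sinh y) <= ln y + ln (cosh y)).
  { rewrite <- ln_mult by lra. destruct h2 as [h| ->]; [left; apply ln_increasing; lra|lra]. }
  assert (h7 : 1 <= y * cosh y / sinh y <= cosh y).
  { split; apply Rmult_le_reg_r with (sinh y); try assumption; field_simplify; nra. }
  split; lra.
Qed.

Lemma ZS_origin x : ZS (fun n => if Z.eq_dec n 0 then x else 0) = x.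
Proof.
  apply ZS_unique. apply is_lim_seq_ext with (fun _ => x); [|apply is_lim_seq_const].
  intros N. symmetry. apply zsum_delta; [|reflexivity].
  intros m hm. now destruct (Z.eq_dec m 0).
Qed.

Lemma row_start_sum a d : 0 < a -> 0 < d ->
  (exists K, forall n, Rabs (row_start a d n) <= K * pw 2 n) /\
  Rabs (ZS (row_start a d) - row_start a d 0 - ZS (qlog a)) <=
  d ^ 2 * (2 * (/ a ^ 2 * (PI / a + 2 / a ^ 2))) * ZS (pw 2).
Proof.
  intros ha hd. set (M := d ^ 2 * (2 * (/ a ^ 2 * (PI / a + 2 / a ^ 2)))).
  assert (hM : 0 <= M).
  { pose proof PI_RGT_0. unfold M. apply Rmult_le_pos; [apply pow2_ge_0|].
    apply Rmult_le_pos; [lra|]. apply Rmult_le_pos; [left; apply Rinv_0_lt_compat, pow_lt; lra|].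
    apply Rplus_le_le_0_compat; apply Rdiv_le_0_compat; try lra. now apply pow_lt. }
  (* Three summable pieces: the errors of the rows [n <> 0], the row 0 alone, and the limits
     [qlog]. *)
  set (e := fun n => if Z.eq_dec n 0 then 0 else row_start a d n - qlog a n).
  set (o := fun n : Z => if Z.eq_dec n 0 then row_start a d 0 else 0).
  assert (hp : forall n, 0 < pw 2 n) by (intros n; apply Rpower_pos).
  assert (he : forall n, Rabs (e n) <= M * pw 2 n).
  { intros n. unfold e. destruct (Z.eq_dec n 0) as [|hn].
    - rewrite Rabs_R0. apply Rmult_le_pos; [assumption|left; apply hp].
    - pose proof (row_start_nonzero a d n ha hd hn) as h. fold M in h. rewrite Rabs_pos_eq; lra. }
  assert (ho : forall n, Rabs (o n) <= Rabs (row_start a d 0) * pw 2 n).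
  { intros n. unfold o. destruct (Z.eq_dec n 0) as [->|hn].
    - rewrite pw2_eq. replace (/ (1 + 0 ^ 2)) with 1 by field. lra.
    - rewrite Rabs_R0. apply Rmult_le_pos; [apply Rabs_pos|left; apply hp]. }
  assert (hq := fun n => qlog_dominated a n ha).
  assert (hsum : forall n, row_start a d n = 1 * (1 * e n + 1 * o n) + 1 * qlog a n).
  { intros n. unfold e, o, qlog. destruct (Z.eq_dec n 0) as [->|hn]; ring. }
  assert (heo : forall n, Rabs (1 * e n + 1 * o n) <= (M + Rabs (row_start a d 0)) * pw 2 n).
  { intros n. rewrite !Rmult_1_l. eapply Rle_trans; [apply Rabs_triang|].
    specialize (he n). specialize (ho n). lra. }
  split.
  - exists (M + Rabs (row_start a d 0) + 96 / (2 * PI * a) ^ 4). intros n. rewrite hsum, !Rmult_1_l.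
    eapply Rle_trans; [apply Rabs_triang|]. specialize (heo n). rewrite !Rmult_1_l in heo.
    specialize (hq n). lra.
  - replace (ZS (row_start a d)) with (ZS (fun n => 1 * (1 * e n + 1 * o n) + 1 * qlog a n))
      by (apply ZS_ext; intros n; now rewrite hsum).
    rewrite (ZS_lin _ _ _ _ _ 1 1 pw2_summable heo hq), (ZS_lin _ _ _ _ _ 1 1 pw2_summable he ho).
    unfold o. rewrite ZS_origin.
    replace (1 * (1 * ZS e + 1 * row_start a d 0) + 1 * ZS (qlog a) - row_start a d 0 - ZS (qlog a)) with (ZS e) by ring.
    apply ZS_abs_le; [apply pw2_summable|exact he].
Qed.

Lemma row_error_sum a U : 0 < a -> 0 < U ->
  (exists K, forall n, Rabs (row_error U (sqrt (U + a ^ 2 * IZR n ^ 2))) <= K * pw 2 n) /\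
  Rabs (ZS (fun n => row_error U (sqrt (U + a ^ 2 * IZR n ^ 2)))) <=
  row_error_const * / U * / a ^ 2 * (PI / sqrt (U / a ^ 2) + 2 / (U / a ^ 2)).
Proof.
  intros ha hU. assert (ha2 : 0 < a ^ 2) by now apply pow_lt.
  assert (hV : 0 < U / a ^ 2) by now apply Rdiv_lt_0_compat.
  pose proof PI_RGT_0 as hpi.
  assert (hc : 0 <= row_error_const).
  { unfold row_error_const. apply Rplus_le_le_0_compat; apply Rdiv_le_0_compat; try lra; apply pow_lt; lra. }
  assert (hb : forall n, Rabs (row_error U (sqrt (U + a ^ 2 * IZR n ^ 2))) <=
    row_error_const * / U * / a ^ 2 * / (IZR n ^ 2 + U / a ^ 2)).
  { intros n. 
    assert (hy : 0 < U + a ^ 2 * IZR n ^ 2) by nra.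
    assert (hsq : sqrt (U + a ^ 2 * IZR n ^ 2) ^ 2 = U + a ^ 2 * IZR n ^ 2) by (apply pow2_sqrt; lra).
    eapply Rle_trans.
    - apply row_error_bound; [now apply sqrt_lt_R0|]. rewrite hsq. nra.
    - rewrite hsq, !Rmult_assoc. apply Rmult_le_compat_l; [assumption|].
      rewrite <- Rinv_mult. replace (a ^ 2 * (IZR n ^ 2 + U / a ^ 2)) with (U + a ^ 2 * IZR n ^ 2) by (field; lra).
      rewrite <- Rinv_mult. apply Rinv_le_contravar; [now apply Rmult_lt_0_compat|]. nra. }
  assert (hK : 0 <= row_error_const * / U * / a ^ 2).
  { apply Rmult_le_pos; [apply Rmult_le_pos|]; try assumption; left; now apply Rinv_0_lt_compat. }
  split.
  - exists (row_error_const * / U * / a ^ 2 * (1 + / (U / a ^ 2))). intros n.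
    eapply Rle_trans; [apply hb|]. rewrite (Rmult_assoc (row_error_const * / U * / a ^ 2)).
    apply Rmult_le_compat_l; [assumption|]. apply shifted_square_inv_bound. assumption.
  - eapply Rle_trans; [apply (ZS_abs_le _ _ _ (rsum1_summable _ hV) hb)|].
    apply Rmult_le_compat_l; [assumption|]. rewrite <- rsum1_eq. now apply rsum1_upper.
Qed.

Lemma rowlog_difference_sum a U d : 0 < a -> 0 < U -> 0 < d ->
  ZS (fun n => rowlog (a ^ 2 * IZR n ^ 2) U - rowlog (a ^ 2 * IZR n ^ 2) d) =
  PI * a * ZS (fun n => trap (U / a ^ 2) (Rabs (IZR n))) +
  ZS (fun n => row_error U (sqrt (U + a ^ 2 * IZR n ^ 2))) - ZS (row_start a d).
Proof.
  intros ha hU hd. assert (ha2 : 0 < a ^ 2) by now apply pow_lt.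
  assert (hV : 0 < U / a ^ 2) by now apply Rdiv_lt_0_compat.
  destruct (row_error_sum a U ha hU) as [[K1 h1] _].
  destruct (row_start_sum a d ha hd) as [[K2 h2] _].
  assert (h3 : forall n, Rabs (trap (U / a ^ 2) (Rabs (IZR n))) <=
    (U / a ^ 2) ^ 2 / sqrt (U / a ^ 2) * (1 + / (U / a ^ 2)) * pw 2 n).
  { intros n. eapply Rle_trans; [now apply trap_dominated|]. rewrite (Rmult_assoc _ _ (pw 2 n)).
    apply Rmult_le_compat_l.
    - apply Rdiv_le_0_compat; [apply pow2_ge_0|now apply sqrt_lt_R0].
    - now apply shifted_square_inv_bound. }
  set (K3 := (U / a ^ 2) ^ 2 / sqrt (U / a ^ 2) * (1 + / (U / a ^ 2))) in *.
  assert (h4 : forall n, Rabs (PI * a * trap (U / a ^ 2) (Rabs (IZR n)) +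
     1 * row_error U (sqrt (U + a ^ 2 * IZR n ^ 2))) <= (Rabs (PI * a) * K3 + K1) * pw 2 n).
  { intros n. rewrite Rmult_1_l. eapply Rle_trans; [apply Rabs_triang|]. rewrite Rabs_mult.
    specialize (h1 n). specialize (h3 n). pose proof (Rabs_pos (PI * a)). nra. }
  transitivity (ZS (fun n => 1 * (PI * a * trap (U / a ^ 2) (Rabs (IZR n)) +
     1 * row_error U (sqrt (U + a ^ 2 * IZR n ^ 2))) + - (1) * row_start a d n)).
  - apply ZS_ext. intros n. rewrite rowlog_decompose by assumption. unfold row_start. ring.
  - rewrite (ZS_lin _ _ _ _ _ 1 (- (1)) pw2_summable h4 h2), (ZS_lin _ _ _ _ _ (PI * a) 1 pw2_summable h3 h1).
    ring.
Qed.

(** In the truncated formula with [X = n] the divergent terms cancel: [pi a V], from the trapezoidal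
    sum, against [pi e^n], and the [n] in [ln d = ln a - n] against [X]. *)
Lemma log_det_value_eq a : 0 < a -> log_det_value a = ln a - PI * a / 3 + ZS (qlog a).
Proof.
  intros ha. pose proof PI_RGT_0 as hpi. assert (ha2 : 0 < a ^ 2) by now apply pow_lt.
  destruct (inner_density_spec a ha) as [c1 [K1 hK1]].
  destruct (outer_density_spec a 2 ha) as [c2 [K2 hK2]].
  replace (INR 2 - 1) with 1 in hK2 by (simpl; ring).
  assert (l1 : is_lim_seq (fun n => RInt (inner_density a) 0 (INR n)) (LInt (inner_density a))).
  { apply LInt_correct with 2; [lra|]. split; [assumption|now exists K1]. }
  assert (l2 : is_lim_seq (fun n => RInt (outer_density a) 0 (INR n)) (LInt (outer_density a))).
  { apply LInt_correct with 1; [lra|]. split; [assumption|now exists K2]. }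
  pose proof (is_lim_seq_plus' _ _ _ _ l1 l2) as l3.
  set (target := PI * a / 3 - ln a - 2 * ln (2 * PI) + 1 - ZS (qlog a) + PI).
  enough (h : is_lim_seq (fun n => RInt (inner_density a) 0 (INR n) + RInt (outer_density a) 0 (INR n)) target).
  { pose proof (is_lim_seq_unique_R _ _ _ l3 h) as e. unfold log_det_value, target in *. lra. }
  set (U := fun n => a * exp (INR n)). set (d := fun n => a * exp (- INR n)).
  assert (hU : forall n, 0 < U n) by (intros n; apply Rmult_lt_0_compat; [assumption|apply exp_pos]).
  assert (hd : forall n, 0 < d n) by (intros n; apply Rmult_lt_0_compat; [assumption|apply exp_pos]).
  assert (ld : is_lim_seq d 0).
  { replace (Finite 0) with (Rbar_mult a 0) by (simpl; f_equal; ring). unfold d.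
    apply is_lim_seq_scal_l. apply is_lim_seq_ext with (fun n => exp (- (1) * INR n)).
    - intros n. f_equal. ring.
    - apply is_lim_seq_exp_opp. lra. }
  set (V := fun n => U n / a ^ 2).
  assert (hV : forall n, 0 < V n) by (intros n; apply Rdiv_lt_0_compat; [apply hU|assumption]).
  assert (hVd : forall n, / V n = d n).
  { intros n. unfold V, U, d. rewrite exp_Ropp. pose proof (exp_pos (INR n)). field. lra. }
  assert (hUd : forall n, / U n = d n / a ^ 2).
  { intros n. unfold U, d. rewrite exp_Ropp. pose proof (exp_pos (INR n)). field. lra. }
  assert (lsd : is_lim_seq (fun n => sqrt (d n)) 0).
  { rewrite <- sqrt_0. apply is_lim_seq_continuous; [|exact ld].
    apply continuity_pt_sqrt. lra. }
  assert (hsd : forall n, / sqrt (V n) = sqrt (d n)).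
  { intros n. rewrite <- hVd, sqrt_inv. reflexivity. }
  (* The four errors: trapezoidal rule at the upper end, exponentially small parts there, nonzero
     rows at the lower end, and the row 0 at the lower end. *)
  set (E1 := fun n => PI * a * (ZS (fun m => trap (V n) (Rabs (IZR m))) - V n - 1 / 3)).
  set (E2 := fun n => ZS (fun m => row_error (U n) (sqrt (U n + a ^ 2 * IZR m ^ 2)))).
  set (E3 := fun n => ZS (row_start a (d n)) - row_start a (d n) 0 - ZS (qlog a)).
  set (E4 := fun n => row_start a (d n) 0 - (ln (d n) + 2 * ln (2 * PI) - 1)).
  assert (hmain : forall n, RInt (inner_density a) 0 (INR n) + RInt (outer_density a) 0 (INR n) =
    target + (E1 n + E2 n - E3 n - E4 n)).
  { intros n. rewrite rowlog_sum by (try assumption; apply pos_INR). fold (U n). fold (d n).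
    rewrite rowlog_difference_sum by auto. fold (V n).
    assert (hln : ln (d n) = ln a - INR n).
    { unfold d. rewrite ln_mult by (try assumption; apply exp_pos). rewrite ln_exp. ring. }
    assert (hpv : PI * a * V n = PI * exp (INR n)) by (unfold V, U; field; lra).
    unfold E1, E2, E3, E4, target. rewrite hln. 
    set (T := ZS (fun m => trap (V n) (Rabs (IZR m)))).
    replace (PI * a * (T - V n - 1 / 3)) with (PI * a * T - PI * a * V n - PI * a / 3) by field.
    rewrite hpv. ring. }
  apply is_lim_seq_ext with (fun n => target + (E1 n + E2 n - E3 n - E4 n)); [intros n; now rewrite hmain|].
  replace (Finite target) with (Finite (target + (0 + 0 - 0 - 0))) by (f_equal; ring).
  assert (squeeze : forall u b : nat -> R, (forall n, Rabs (u n) <= b n) -> is_lim_seq b 0 -> is_lim_seq u 0).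
  { intros u b hub hb. apply is_lim_seq_abs_0. apply is_lim_seq_le_le with (fun _ => 0) b; auto.
    - intros n. split; [apply Rabs_pos|apply hub].
    - apply is_lim_seq_const. }
  apply is_lim_seq_plus'; [apply is_lim_seq_const|].
  apply is_lim_seq_minus'; [apply is_lim_seq_minus'; [apply is_lim_seq_plus'|]|].
  - apply squeeze with (fun n => PI * a / 2 * sqrt (d n)).
    + intros n. unfold E1. rewrite Rabs_mult, (Rabs_pos_eq (PI * a)) by nra.
      pose proof (trap_ZS (V n) (hV n)) as h.
      replace (PI * a / 2 * sqrt (d n)) with (PI * a * / (2 * sqrt (V n))).
      * apply Rmult_le_compat_l; [nra|exact h].
      * rewrite Rinv_mult, hsd. field.
    + replace (Finite 0) with (Rbar_mult (PI * a / 2) 0) by (simpl; f_equal; ring).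
      now apply is_lim_seq_scal_l.
  - apply squeeze with (fun n => row_error_const * (d n / a ^ 2) * / a ^ 2 * (PI * sqrt (d n) + 2 * d n)).
    + intros n. destruct (row_error_sum a (U n) ha (hU n)) as [_ h]. fold (V n) in h.
      unfold Rdiv in h at 1 2. rewrite hsd, hVd, hUd in h. exact h.
    + replace (Finite 0) with (Finite (row_error_const * (0 / a ^ 2) * / a ^ 2 * (PI * 0 + 2 * 0)))
        by (f_equal; field; lra).
      apply is_lim_seq_mult'; [|apply is_lim_seq_plus'].
      * apply is_lim_seq_mult'; [|apply is_lim_seq_const].
        apply is_lim_seq_mult'; [apply is_lim_seq_const|]. apply is_lim_seq_mult'; [exact ld|apply is_lim_seq_const].
      * apply is_lim_seq_mult'; [apply is_lim_seq_const|exact lsd].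
      * apply is_lim_seq_mult'; [apply is_lim_seq_const|exact ld].
  - set (M := 2 * (/ a ^ 2 * (PI / a + 2 / a ^ 2))).
    apply squeeze with (fun n => d n ^ 2 * M * ZS (pw 2)).
    + intros n. now apply row_start_sum.
    + replace (Finite 0) with (Finite (0 * (0 * 1) * M * ZS (pw 2))) by (f_equal; ring).
      apply is_lim_seq_mult'; [|apply is_lim_seq_const]. apply is_lim_seq_mult'; [|apply is_lim_seq_const].
      simpl. apply is_lim_seq_mult'; [exact ld|]. apply is_lim_seq_mult'; [exact ld|apply is_lim_seq_const].
  - assert (ly : is_lim_seq (fun n => cosh (PI * sqrt (d n))) 1).
    { rewrite <- cosh_0. apply (is_lim_seq_continuous cosh).
      - apply continuity_pt_filterlim. apply continuous_ex_derive. auto_derive. auto.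
      - replace (Finite 0) with (Rbar_mult PI 0) by (simpl; f_equal; ring). now apply is_lim_seq_scal_l. }
    apply is_lim_seq_le_le with (fun n => - (cosh (PI * sqrt (d n)) - 1)) (fun n => 2 * ln (cosh (PI * sqrt (d n)))).
    + intros n. apply (row_start_zero a (d n) (hd n)).
    + replace (Finite 0) with (Finite (- (1 - 1))) by (f_equal; ring).
      apply (is_lim_seq_opp _ (Finite (1 - 1))). apply is_lim_seq_minus'; [exact ly|apply is_lim_seq_const].
    + replace (Finite 0) with (Rbar_mult 2 (ln 1)) by (simpl; f_equal; rewrite ln_1; ring).
      apply is_lim_seq_scal_l. apply is_lim_seq_continuous; [|exact ly].
      apply continuity_pt_filterlim. apply continuous_ex_derive. auto_derive. lra.
Qed.

(** * The eta function and the maximum *)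

Fixpoint qprod (a : R) (n : nat) : R :=
  match n with
  | O => 1
  | S m => qprod a m * (1 - exp (- (2 * (PI * (a * INR (S m))))))
  end.

Lemma qfactor_pos a n : 0 < a -> 0 < 1 - exp (- (2 * (PI * (a * INR (S n))))).
Proof.
  intros ha. pose proof PI_RGT_0. rewrite S_INR. pose proof (pos_INR n).
  assert (h1 : 0 < a * (INR n + 1)) by nra.
  assert (h : exp (- (2 * (PI * (a * (INR n + 1))))) < 1); [|lra].
  assert (0 < PI * (a * (INR n + 1))) by (apply Rmult_lt_0_compat; assumption).
  apply Rlt_le_trans with (exp 0); [apply exp_increasing; lra|right; apply exp_0].
Qed.

(** The divisor 4 reflects that each factor occurs at [n] and [- n], each time with the coefficient
    2 in [qlog]. *)
Lemma qprod_exp a n : 0 < a -> qprod a n = exp (zsum n (qlog a) / 4).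
Proof.
  intros ha. induction n as [|n IH].
  - simpl. unfold qlog. simpl. rewrite Rdiv_0_l. now rewrite exp_0.
  - cbn [qprod zsum]. rewrite IH. pose proof (qfactor_pos a n ha) as hf.
    assert (e : forall m, m <> 0%Z -> Rabs (IZR m) = INR (S n) ->
      qlog a m = 2 * ln (1 - exp (- (2 * (PI * (a * INR (S n))))))).
    { intros m hm hr. unfold qlog. destruct (Z.eq_dec m 0); [contradiction|]. now rewrite hr. }
    rewrite !e; try lia.
    + rewrite <- (exp_ln _ hf) at 1. rewrite <- exp_plus. f_equal. field.
    + rewrite opp_IZR, Rabs_Ropp, <- INR_IZR_INZ. apply Rabs_pos_eq, pos_INR.
    + rewrite <- INR_IZR_INZ. apply Rabs_pos_eq, pos_INR.
Qed.

Lemma qprod_lim a : 0 < a -> is_lim_seq (qprod a) (exp (ZS (qlog a) / 4)).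
Proof.
  intros ha.
  apply is_lim_seq_ext with (fun n => exp (zsum n (qlog a) / 4)).
  - intros n. symmetry. now apply qprod_exp.
  - apply (is_lim_seq_continuous exp).
    + apply derivable_continuous_pt, derivable_pt_exp.
    + apply (is_lim_seq_scal_r _ (/ 4) (ZS (qlog a))).
      apply (ZS_dominated _ _ _ pw2_summable (fun n => qlog_dominated a n ha)).
Qed.

Lemma Cprod_qprod a n :
  Cprod (fun k => RtoC 1 - Cexp (RtoC 2 * RtoC PI * Ci * RtoC (INR (S k)) * (RtoC a * Ci)))%C n =
  RtoC (qprod a n).
Proof.
  induction n as [|n IH]; [reflexivity|]. cbn [Cprod qprod]. rewrite IH, RtoC_mult. f_equal.
  replace (RtoC 2 * RtoC PI * Ci * RtoC (INR (S n)) * (RtoC a * Ci))%C with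
    (RtoC (- (2 * (PI * (a * INR (S n)))))).
  - now rewrite Cexp_R, RtoC_minus.
  - generalize (INR (S n)). intros x. unfold Cmult, Ci, RtoC. simpl fst. simpl snd. f_equal; ring.
Qed.

Lemma Cmod_eta a : 0 < a ->
  Cmod (eta (RtoC a * Ci)%C) ^ 4 = exp (- (PI * a / 3) + ZS (qlog a)).
Proof.
  intros ha. unfold eta.
  assert (e1 : (RtoC PI * Ci * (RtoC a * Ci) / RtoC 12)%C = RtoC (- (PI * a / 12))).
  { unfold Cdiv. rewrite <- RtoC_inv by lra. unfold Cmult, Ci, RtoC. simpl fst. simpl snd. f_equal; field. }
  rewrite e1, Cexp_R.
  assert (e2 : Clim_seq (Cprod (fun k => RtoC 1 -
     Cexp (RtoC 2 * RtoC PI * Ci * RtoC (INR (S k)) * (RtoC a * Ci)))%C) = RtoC (exp (ZS (qlog a) / 4))).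
  { unfold Clim_seq.
    rewrite (Lim_seq_ext (fun n => Re (Cprod _ n)) (qprod a)) by (intros n; now rewrite Cprod_qprod).
    rewrite (Lim_seq_ext (fun n => Im (Cprod _ n)) (fun _ => 0)) by (intros n; now rewrite Cprod_qprod).
    rewrite (is_lim_seq_unique _ _ (qprod_lim a ha)), Lim_seq_const. reflexivity. }
  rewrite e2, <- RtoC_mult, <- exp_plus, Cmod_R, Rabs_pos_eq by (left; apply exp_pos).
  simpl. rewrite Rmult_1_r, <- !exp_plus. f_equal. field.
Qed.

Lemma eta_value a : 0 < a ->
  a * Cmod (eta (RtoC a * Ci)%C) ^ 4 = exp (log_det_value a).
Proof.
  intros ha. rewrite Cmod_eta, log_det_value_eq by assumption.
  replace (ln a - PI * a / 3 + ZS (qlog a)) with (ln a + (- (PI * a / 3) + ZS (qlog a))) by ring.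
  now rewrite (exp_plus (ln a)), exp_ln.
Qed.

(** * Symmetry and the maximum *)

Lemma green_inv a u : 0 < a -> green (/ a) u = green a u.
Proof.
  intros ha. unfold green. rewrite <- LS_swap. f_equal.
  apply functional_extensionality. intros [n m]. unfold lat_restrict, swap, quad. simpl fst. simpl snd.
  rewrite Bool.andb_comm. destruct (Z.eqb n 0 && Z.eqb m 0)%bool; [reflexivity|].
  do 2 f_equal. field. lra.
Qed.

(** Exchanging the two generators of the lattice. *)
Lemma log_det_value_inv a : 0 < a -> log_det_value (/ a) = log_det_value a.
Proof.
  intros ha. unfold log_det_value, inner_density, outer_density, green_reg.
  assert (e : green (/ a) = green a).
  { apply functional_extensionality. intros u. now apply green_inv. }
  now rewrite e.
Qed.

(** By convexity of the exponential, its secant slope [(e^y - 1) / y] at 0 increases. *)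
Lemma planck_decreasing y1 y2 : 0 < y1 <= y2 -> y2 / (exp y2 - 1) <= y1 / (exp y1 - 1).
Proof.
  intros hy.
  assert (hx1 : 1 < exp y1) by (rewrite <- exp_0; apply exp_increasing; lra).
  assert (hx2 : 1 < exp y2) by (rewrite <- exp_0; apply exp_increasing; lra).
  assert (h : y1 * (exp y1 - 1) - y1 * (exp y1 - 1) <= y1 * (exp y2 - 1) - y2 * (exp y1 - 1)).
  { apply (derive_nonneg_le (fun y => y1 * (exp y - 1) - y * (exp y1 - 1))
      (fun y => y1 * exp y - (exp y1 - 1))); [lra| |].
    - intros x _. auto_derive; [auto|ring].
    - intros x hx. assert (exp y1 <= exp x) by (apply exp_le_compat; lra).
      assert (h1 : 1 - y1 <= exp (- y1)) by (pose proof (exp_ineq1_le (- y1)); lra).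
      assert (h2 : exp y1 * exp (- y1) = 1) by (rewrite <- exp_plus, Rplus_opp_r; apply exp_0).
      nra. }
  apply Rmult_le_reg_r with ((exp y1 - 1) * (exp y2 - 1)); [apply Rmult_lt_0_compat; lra|].
  replace (y2 / (exp y2 - 1) * ((exp y1 - 1) * (exp y2 - 1))) with (y2 * (exp y1 - 1)) by (field; lra).
  replace (y1 / (exp y1 - 1) * ((exp y1 - 1) * (exp y2 - 1))) with (y1 * (exp y2 - 1)) by (field; lra).
  lra.
Qed.

(** [x |-> ln (1 - exp (- c e^x))] has the decreasing derivative y / (e^y - 1) at
    y = c e^x, so its even part is largest at 0. *)
Lemma qterm_symmetric_le c a : 0 < c -> 0 < a ->
  ln (1 - exp (- (c * a))) + ln (1 - exp (- (c * / a))) <= 2 * ln (1 - exp (- c)).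
Proof.
  intros hc ha.
  assert (key : forall x, 0 <= x ->
    ln (1 - exp (- (c * exp x))) + ln (1 - exp (- (c * exp (- x)))) <= 2 * ln (1 - exp (- c))).
  { intros x hx.
    set (g := fun x => ln (1 - exp (- (c * exp x))) + ln (1 - exp (- (c * exp (- x))))).
    set (r := fun y => y / (exp y - 1)).
    assert (hlt : forall y, 0 < exp y -> exp (- (c * exp y)) < 1).
    { intros y hy. rewrite <- exp_0. apply exp_increasing. nra. }
    assert (hd : forall y, is_derive g y (r (c * exp y) - r (c * exp (- y)))).
    { intros y. pose proof (exp_pos y) as h1. pose proof (exp_pos (- y)) as h2.
      pose proof (hlt y h1) as h3. pose proof (hlt (- y) h2) as h4.
      unfold g, r. auto_derive; [repeat split; lra|].
      assert (h5 : 1 < exp (c * exp y)) by (rewrite <- exp_0; apply exp_increasing; nra).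
      assert (h6 : 1 < exp (c * exp (- y))) by (rewrite <- exp_0; apply exp_increasing; nra).
      rewrite !(exp_Ropp (c * _)). field. repeat split; lra. }
    assert (h : - g 0 <= - g x).
    { apply (derive_nonneg_le (fun y => - g y) (fun y => - (r (c * exp y) - r (c * exp (- y))))); [lra| |].
      - intros y _. apply (is_derive_opp g). apply hd.
      - intros y hy. assert (exp (- y) <= exp y) by (apply exp_le_compat; lra).
        pose proof (exp_pos (- y)).
        pose proof (planck_decreasing (c * exp (- y)) (c * exp y)) as hp. unfold r.
        assert (c * exp (- y) <= c * exp y) by (apply Rmult_le_compat_l; lra).
        assert (0 < c * exp (- y)) by (apply Rmult_lt_0_compat; lra). lra. }
    assert (e0 : g 0 = 2 * ln (1 - exp (- c))).
    { unfold g. rewrite Ropp_0, exp_0, Rmult_1_r. ring. }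
    fold (g x). lra. }
  assert (hexp : a = exp (ln a)) by now rewrite exp_ln.
  assert (hexp2 : / a = exp (- ln a)) by now rewrite exp_Ropp, exp_ln.
  destruct (Rle_lt_dec 0 (ln a)) as [h|h].
  - specialize (key (ln a) h). now rewrite <- hexp, <- hexp2 in key.
  - specialize (key (- ln a) ltac:(lra)). rewrite Ropp_involutive, <- hexp, <- hexp2 in key. lra.
Qed.

Lemma qlog_symmetric_le a n : 0 < a -> qlog a n + qlog (/ a) n <= 2 * qlog 1 n.
Proof.
  intros ha. pose proof PI_RGT_0. unfold qlog. destruct (Z.eq_dec n 0) as [|hn]; [lra|].
  pose proof (Rabs_IZR_ge_1 n hn) as h1.
  pose proof (qterm_symmetric_le (2 * (PI * Rabs (IZR n))) a ltac:(nra) ha) as h.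
  replace (2 * (PI * (a * Rabs (IZR n)))) with (2 * (PI * Rabs (IZR n)) * a) by ring.
  replace (2 * (PI * (/ a * Rabs (IZR n)))) with (2 * (PI * Rabs (IZR n)) * / a) by ring.
  rewrite Rmult_1_l. lra.
Qed.

(** Averaging the formulas at [a] and [1/a] cancels the logarithms. The eta products are compared
    only weakly; the strict gap comes from the exponents, whose average is [- pi (a + 1/a) / 6]
    against [- pi / 3] at 1. *)
Lemma log_det_value_max a : 0 < a ->
  log_det_value a <= log_det_value 1 - PI / 6 * (a + / a - 2).
Proof.
  intros ha. assert (hia : 0 < / a) by now apply Rinv_0_lt_compat.
  pose proof (log_det_value_inv a ha) as hs.
  pose proof (log_det_value_eq a ha) as e1. pose proof (log_det_value_eq (/ a) hia) as e2.
  pose proof (log_det_value_eq 1 Rlt_0_1) as e3.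
  rewrite ln_Rinv in e2 by assumption. rewrite ln_1 in e3.
  assert (h : ZS (qlog a) + ZS (qlog (/ a)) <= 2 * ZS (qlog 1)).
  { assert (l : forall b, 0 < b -> is_lim_seq (fun N => zsum N (qlog b)) (ZS (qlog b))).
    { intros b hb. apply (ZS_dominated _ _ _ pw2_summable (fun n => qlog_dominated b n hb)). }
    pose proof (is_lim_seq_plus' _ _ _ _ (l a ha) (l (/ a) hia)) as l1.
    pose proof (is_lim_seq_scal_l _ 2 _ (l 1 Rlt_0_1)) as l2.
    refine (is_lim_seq_le _ _ _ _ _ l1 l2). intros N.
    rewrite <- zsum_scal. replace (zsum N (qlog a) + zsum N (qlog (/ a))) with
      (zsum N (fun n => 1 * qlog a n + 1 * qlog (/ a) n)) by (rewrite zsum_lin; ring).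
    apply zsum_le. intros n. rewrite !Rmult_1_l. now apply qlog_symmetric_le. }
  rewrite hs in e2. unfold Rdiv in *. nra.
Qed.

Lemma sum_inv_ge_2 a : 0 < a -> 0 <= a + / a - 2 /\ (a + / a - 2 = 0 -> a = 1).
Proof.
  intros ha. assert (e : a + / a - 2 = (a - 1) ^ 2 / a) by (field; lra).
  rewrite e. split.
  - apply Rdiv_le_0_compat; [apply pow2_ge_0|assumption].
  - intros h. assert (h1 : (a - 1) ^ 2 = 0).
    { replace ((a - 1) ^ 2) with ((a - 1) ^ 2 / a * a) by (field; lra). rewrite h. ring. }
    nra.
Qed.

(** The factors from [k = 3] on are bounded below by 1 minus the sum of the [q^k], a geometric
    series. The induction carries the finite geometric sum, which the infinite one replaces only at
    the end. *)
Lemma qprod_one_bounds n (q := exp (- (2 * PI))) :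
  (1 - q) * (1 - q ^ 2) * (1 - q ^ 3 / (1 - q)) <= qprod 1 (S (S n)) <= 1 - q.
Proof.
  assert (hq0 : 0 < q) by apply exp_pos.
  assert (hq1 : q < 1) by (unfold q; rewrite <- exp_0; apply exp_increasing; pose proof PI_RGT_0; lra).
  assert (hf : forall k, exp (- (2 * (PI * (1 * INR k)))) = q ^ k).
  { induction k as [|k IH]; [simpl; rewrite !Rmult_0_r, Ropp_0; apply exp_0|].
    rewrite S_INR. replace (- (2 * (PI * (1 * (INR k + 1))))) with (- (2 * PI) + - (2 * (PI * (1 * INR k)))) by ring.
    rewrite exp_plus, IH. reflexivity. }
  assert (hpow : forall k, 0 < q ^ k <= 1).
  { intros k. split; [now apply pow_lt|]. rewrite <- (pow1 k). apply pow_incr. lra. }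
  set (A := 1 - q ^ 3 / (1 - q)).
  assert (hA : A <= 1).
  { unfold A. assert (0 < q ^ 3 / (1 - q)) by (apply Rdiv_lt_0_compat; [apply hpow|lra]). lra. }
  set (B := (1 - q) * (1 - q ^ 2)).
  assert (hB : 0 < B).
  { assert (q ^ 2 < 1) by nra. apply Rmult_lt_0_compat; lra. }
  assert (hlow : B * (A + q ^ (n + 3) / (1 - q)) <= qprod 1 (S (S n))).
  { induction n as [|n IH].
    - cbn [qprod]. rewrite !hf. unfold A, B. simpl. right. field. lra.
    - cbn [qprod] in *. rewrite !hf in *. replace (S n + 3)%nat with (S (n + 3)) by lia.
      replace (S (S (S n))) with (n + 3)%nat by lia.
      set (u := q ^ (n + 3)) in *.
      assert (hu : 0 < u <= q ^ 3).
      { unfold u. rewrite pow_add. pose proof (hpow n). pose proof (hpow 3%nat). split; nra. }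
      assert (hu1 : u <= 1) by (pose proof (hpow 3%nat); lra).
      eapply Rle_trans; [|apply Rmult_le_compat_r; [lra|exact IH]].
      rewrite Rmult_assoc. apply Rmult_le_compat_l; [lra|].
      change (q ^ S (n + 3)) with (q * u).
      assert (e : (A + u / (1 - q)) * (1 - u) - (A + q * u / (1 - q)) = u * ((q ^ 3 - u) / (1 - q)))
        by (unfold A; field; lra).
      assert (0 <= u * ((q ^ 3 - u) / (1 - q))).
      { apply Rmult_le_pos; [lra|]. apply Rdiv_le_0_compat; lra. }
      lra. }
  split.
  - eapply Rle_trans; [|exact hlow]. fold B. apply Rmult_le_compat_l; [lra|]. fold A.
    assert (0 < q ^ (n + 3) / (1 - q)) by (apply Rdiv_lt_0_compat; [apply hpow|lra]). lra.
  - assert (h : forall m, 0 <= qprod 1 (S m) <= 1 - q).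
    { induction m as [|m IH].
      - cbn [qprod]. rewrite hf. simpl. lra.
      - change (qprod 1 (S (S m))) with (qprod 1 (S m) * (1 - exp (- (2 * (PI * (1 * INR (S (S m)))))))).
        rewrite hf. pose proof (hpow (S (S m))). split; nra. }
    apply h.
Qed.

(** * Numerical value at the square torus *)

Fixpoint exp_taylor (n : nat) (x : R) : R :=
  match n with
  | O => 0
  | S m => exp_taylor m x + x ^ m / INR (fact m)
  end.

Lemma exp_term_succ n x : x ^ S n / INR (fact (S n)) = x ^ n / INR (fact n) * (x / INR (S n)).
Proof.
  rewrite fact_simpl, mult_INR. simpl pow. field. split; [now apply not_0_INR|apply INR_fact_neq_0].
Qed.

Lemma exp_taylor_derive n x : is_derive (exp_taylor (S n)) x (exp_taylor n x).
Proof.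
  induction n as [|n IH].
  - apply is_derive_ext with (fun _ => 1).
    + intros t. simpl. real_eq. field.
    + exact (is_derive_const (K := R_AbsRing) (V := R_NormedModule) 1 x).
  - assert (hc : / INR (fact n) = INR (S n) * / INR (fact (S n))).
    { rewrite fact_simpl, mult_INR. field. split; [apply INR_fact_neq_0|now apply not_0_INR]. }
    apply (is_derive_plus (exp_taylor (S n)) (fun y => y ^ S n / INR (fact (S n)))); [exact IH|].
    unfold Rdiv. rewrite hc. generalize (/ INR (fact (S n))). intros c.
    auto_derive; [auto|].
    change (match n with O => 1 | S _ => INR n + 1 end) with (INR (S n)). ring.
Qed.

(** Taylor's formula with the remainder bounded through [e^2 <= 9], obtained by repeated integration
    from the case [n = 0]. *)
Lemma exp_taylor_bounds n x : 0 <= x <= 2 ->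
  exp_taylor n x <= exp x <= exp_taylor n x + 9 * (x ^ n / INR (fact n)).
Proof.
  assert (h0 : forall m, exp_taylor (S m) 0 = 1).
  { induction m as [|m IH]; [simpl; field|].
    change (exp_taylor (S m) 0 + 0 ^ S m / INR (fact (S m)) = 1). rewrite IH, pow_i by lia.
    unfold Rdiv. ring. }
  revert x. induction n as [|n IH]; intros x hx.
  - simpl. pose proof (exp_pos x). split; [lra|].
    assert (exp x <= exp (1 + 1)) by (apply exp_le_compat; lra).
    rewrite exp_plus in H0. pose proof exp_le_3. pose proof (exp_pos 1). nra.
  - split.
    + assert (h : exp 0 - exp_taylor (S n) 0 <= exp x - exp_taylor (S n) x).
      { apply (derive_nonneg_le (fun y => exp y - exp_taylor (S n) y) (fun y => exp y - exp_taylor n y)); [lra| |].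
        - intros y _. apply (is_derive_minus exp (exp_taylor (S n))); [|apply exp_taylor_derive].
          auto_derive; [auto|ring].
        - intros y hy. specialize (IH y ltac:(lra)). lra. }
      rewrite h0, exp_0 in h. lra.
    + set (F := fun y => exp_taylor (S n) y + 9 * (y ^ S n / INR (fact (S n)))).
      assert (hF : forall y, is_derive F y (exp_taylor n y + 9 * (y ^ n / INR (fact n)))).
      { intros y. apply (is_derive_plus (exp_taylor (S n)) (fun y => 9 * (y ^ S n / INR (fact (S n)))));
          [apply exp_taylor_derive|].
        assert (hc : / INR (fact n) = INR (S n) * / INR (fact (S n))).
        { rewrite fact_simpl, mult_INR. field. split; [apply INR_fact_neq_0|now apply not_0_INR]. }
        unfold Rdiv. rewrite hc. generalize (/ INR (fact (S n))). intros c.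
        auto_derive; [auto|].
        change (match n with O => 1 | S _ => INR n + 1 end) with (INR (S n)). ring. }
      assert (h : F 0 - exp 0 <= F x - exp x).
      { apply (derive_nonneg_le (fun y => F y - exp y) (fun y => exp_taylor n y + 9 * (y ^ n / INR (fact n)) - exp y)); [lra| |].
        - intros y _. apply (is_derive_minus F exp); [apply hF|]. auto_derive; [auto|ring].
        - intros y hy. specialize (IH y ltac:(lra)). lra. }
      unfold F in h. rewrite h0, pow_i, exp_0 in h by lia. unfold Rdiv in h at 1. lra.
Qed.

(** Alternating arctangent series for pi/4 = 2 arctan (1/3) + arctan (1/7), stopped at index 4. *)
Lemma PI_bounds : 3.14159 < PI < 3.141593.
Proof.
  destruct (PI_2_3_7_ineq 4) as [h1 h2].
  unfold tg_alt, PI_2_3_7_tg, Ratan_seq in *. simpl in h1, h2. lra.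
Qed.

(** The only exponential to be evaluated: [e^(-pi/3)] is the prefactor of the fourth power of eta at
    [i], and its sixth power is [q = e^(-2 pi)]. *)
Lemma exp_PI_3_bounds : 2.84965 < exp (PI / 3) < 2.849655.
Proof.
  pose proof PI_bounds as hpi. split.
  - apply Rlt_le_trans with (exp 1.0471966).
    + eapply Rlt_le_trans; [|apply (exp_taylor_bounds 12); lra].
      cbn [exp_taylor]. rewrite !exp_term_succ. simpl. lra.
    + apply exp_le_compat. lra.
  - apply Rle_lt_trans with (exp 1.0471977).
    + apply exp_le_compat. lra.
    + eapply Rle_lt_trans; [apply (exp_taylor_bounds 12); lra|].
      cbn [exp_taylor]. rewrite !exp_term_succ. simpl. lra.
Qed.

Lemma eta_i_numeric : 34830 / 100000 <= exp (log_det_value 1) < 34831 / 100000.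
Proof.
  set (q := exp (- (2 * PI))). set (t := exp (- (PI / 3))). set (P := exp (ZS (qlog 1) / 4)).
  assert (e : exp (log_det_value 1) = t * P ^ 4).
  { rewrite log_det_value_eq, ln_1 by lra. unfold t, P.
    replace (exp (ZS (qlog 1) / 4) ^ 4) with (exp (ZS (qlog 1) / 4 + ZS (qlog 1) / 4 + ZS (qlog 1) / 4 + ZS (qlog 1) / 4))
      by (rewrite !exp_plus; ring).
    rewrite <- exp_plus. f_equal. field. }
  assert (hqt : q = t ^ 6).
  { unfold q, t. replace (- (2 * PI)) with (- (PI / 3) + - (PI / 3) + - (PI / 3) + - (PI / 3) + - (PI / 3) + - (PI / 3)) by field.
    rewrite !exp_plus. ring. }
  assert (ht : / 2.849655 <= t <= / 2.84965).
  { unfold t. rewrite exp_Ropp. pose proof exp_PI_3_bounds. split; apply Rinv_le_contravar; lra. }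
  assert (hP : (1 - q) * (1 - q ^ 2) * (1 - q ^ 3 / (1 - q)) <= P <= 1 - q).
  { pose proof (qprod_lim 1 Rlt_0_1) as hl. apply (is_lim_seq_incr_n _ 2) in hl. fold P in hl.
    assert (hb : forall n, (1 - q) * (1 - q ^ 2) * (1 - q ^ 3 / (1 - q)) <= qprod 1 (n + 2) <= 1 - q).
    { intros n. replace (n + 2)%nat with (S (S n)) by lia. apply qprod_one_bounds. }
    split.
    - exact (is_lim_seq_le _ _ _ _ (fun n => proj1 (hb n)) (is_lim_seq_const _) hl).
    - exact (is_lim_seq_le _ _ _ _ (fun n => proj2 (hb n)) hl (is_lim_seq_const _)). }
  assert (hq : 0.001867 <= q <= 0.0018675).
  { rewrite hqt. split.
    - apply Rle_trans with ((/ 2.849655) ^ 6); [lra|]. apply pow_incr. lra.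
    - apply Rle_trans with ((/ 2.84965) ^ 6); [apply pow_incr; lra|lra]. }
  assert (hlow : 0.998129 <= P).
  { eapply Rle_trans; [|apply hP].
    assert (h3 : q ^ 3 / (1 - q) <= 0.00000001).
    { apply Rmult_le_reg_r with (1 - q); [lra|].
      replace (q ^ 3 / (1 - q) * (1 - q)) with (q ^ 3) by (field; lra).
      assert (q ^ 3 <= 0.0018675 ^ 3) by (apply pow_incr; lra). lra. }
    assert (h2 : q ^ 2 <= 0.0018675 ^ 2) by (apply pow_incr; lra).
    assert (h4 : 0.998129015 <= (1 - q) * (1 - q ^ 2)).
    { apply Rle_trans with ((1 - 0.0018675) * (1 - 0.0018675 ^ 2)); [lra|].
      apply Rmult_le_compat; lra. }
    apply Rle_trans with (0.998129015 * (1 - 0.00000001)); [lra|].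
    apply Rmult_le_compat; lra. }
  (* The upper bound keeps only the first factor [1 - q] of the product; the next ones differ from 1
     by about [q^2], which does not affect the five digits. *)
  assert (hP4 : 0.998129 ^ 4 <= P ^ 4 <= (1 - 0.001867) ^ 4).
  { split; apply pow_incr; lra. }
  rewrite e. split.
  - apply Rle_trans with (/ 2.849655 * 0.998129 ^ 4); [lra|]. apply Rmult_le_compat; lra.
  - apply Rle_lt_trans with (/ 2.84965 * (1 - 0.001867) ^ 4); [|lra]. apply Rmult_le_compat; lra.
Qed.

Theorem theorem1p1 :
  (forall alpha : R, 0 < alpha ->
     det_laplacian (rect_lattice alpha)
       = RtoC (alpha * Cmod (eta (RtoC alpha * Ci)%C) ^ 4)
     /\ alpha * Cmod (eta (RtoC alpha * Ci)%C) ^ 4 <= Cmod (eta Ci) ^ 4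
     /\ (alpha * Cmod (eta (RtoC alpha * Ci)%C) ^ 4 = Cmod (eta Ci) ^ 4
           <-> alpha = 1))
  /\ 34830 / 100000 <= Cmod (eta Ci) ^ 4 < 34831 / 100000.
Proof.
  assert (e1 : Cmod (eta Ci) ^ 4 = exp (log_det_value 1)).
  { rewrite <- eta_value by lra. replace (RtoC 1 * Ci)%C with Ci by ring. ring. }
  rewrite e1. split; [|exact eta_i_numeric].
  intros alpha ha. rewrite eta_value by assumption.
  pose proof (log_det_value_max alpha ha) as hmax. destruct (sum_inv_ge_2 alpha ha) as [h1 h2].
  pose proof PI_RGT_0 as hpi.
  split; [now apply det_laplacian_eq|]. split; [|split].
  - apply exp_le_compat. nra.
  (* Equality closes the gap [pi (a + 1/a - 2) / 6], hence [a = 1]. *)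
  - intros h. apply exp_inv in h. apply h2. nra.
  - now intros ->.
Qed.
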